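(* For every integer $n \geq 3$ there exists an $n$-oid of genus $1$ in $\mathbb{R}^3$ that has all the symmetries of the genus-$0$ $n$-oid. That is, there exists a complete immersed minimal surface $X : \bar{M} \setminus \{p_1,\dots,p_n\} \to \mathbb{R}^3$ of finite total curvature, where $\bar{M}$ is a compact Riemann surface of genus $1$, such that: (i) each of the $n$ ends $p_1,\dots,p_n$ is an embedded catenoid end, and the limiting normals at the ends span a plane $\mathcal{P}$ through the origin; (ii) the surface is invariant under the reflection in $\mathcal{P}$, under the rotation by angle $2\pi/n$ about the axis through the origin perpendicular to $\mathcal{P}$, and under the reflection in a plane perpendicular to $\mathcal{P}$ and containing that axis (so that it is invariant under the group $D_n \times \mathbb{Z}_2$, of order $4n$, generated by these isometries).
   Context: An end of a complete minimal surface of finite total curvature is an embedded catenoid end if a sufficiently small punctured neighbourhood of the puncture is embedded in $\mathbb{R}^3$ by $X$ and is asymptotic to an end of a catenoid (nonzero logarithmic growth). Each end is required to be embedded individually; different ends may intersect each other, and the surface is only immersed. The limiting normal at an end is the value of the (extended) Gauss map at the corresponding puncture. The surface $X : M \to \mathbb{R}^3$ is invariant under an isometry $\sigma$ of $\mathbb{R}^3$ (equivalently, $\sigma$ is a symmetry of the surface) if there is a diffeomorphism $\varphi : M \to M$ with $X \circ \varphi = \sigma \circ X$. The (genus-$0$) $n$-oid of Jorge and Meeks is a complete immersed minimal surface of genus $0$ and finite total curvature with $n$ catenoid ends whose limiting normals span a plane $\mathcal{P}$ that is a plane of reflective symmetry. It also has an order-$n$ rotational symmetry about an axis perpendicular to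 $\mathcal{P}$ and a plane of reflective symmetry perpendicular to $\mathcal{P}$; its symmetry group is $D_n \times \mathbb{Z}_2$, where $D_n$ is the dihedral group of order $2n$. An $n$-oid of genus $k$ is a minimal surface obtained by adding $k$ handles to the $n$-oid while preserving minimality, i.e. the underlying compact Riemann surface has genus $k$ and there are $n$ catenoid ends. *)

(* Defs.v *)
From HB Require Import structures.
From mathcomp Require Import all_boot all_order all_algebra all_fingroup.
From mathcomp Require Import complex.
From mathcomp Require Import all_classical all_reals all_analysis.
From mathcomp Require extremal.

Set Implicit Arguments.
Unset Strict Implicit.
Unset Printing Implicit Defensive.

Import Order.TTheory GRing.Theory Num.Theory.
Import numFieldNormedType.Exports.

Local Open Scope classical_set_scope.
Local Open Scope ring_scope.
Local Open Scope complex_scope.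

(* Points of R^3 are row vectors. The norm that the library puts on matrices
   is the sup norm, so the Euclidean structure is defined here; the topology
   and the derivatives are the same for both norms. *)
Section Euclid.
Variable R : realType.
Implicit Types x y : 'rV[R]_3.

Definition dot x y : R := (x *m y^T) 0 0.

Definition enorm x : R := Num.sqrt (dot x x).

Definition cross x y : 'rV[R]_3 := \row_(k < 3)
  (* indices are added modulo 3 *)
  (x 0 (k + 1) * y 0 (k + 2) - x 0 (k + 2) * y 0 (k + 1)).

Definition isometry (T : 'rV[R]_3 -> 'rV[R]_3) : Prop :=
  forall x y, enorm (T x - T y) = enorm (x - y).

(* Linear isometries are matrices acting on row vectors by x |-> x *m A. *)

(* The reflection in the plane through the origin with unit normal e:
   x |-> x - 2 <x, e> e. *)
Definition reflection_mx (e : 'rV[R]_3) : 'M[R]_3 := 1%:M - 2 *: (e^T *m e).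

(* The rotation by angle t about the oriented axis R e, with e a unit vector
   (Rodrigues' formula):
   x |-> cos t x + sin t (e x x) + (1 - cos t) <x, e> e. *)
Definition rotation_mx (e : 'rV[R]_3) (t : R) : 'M[R]_3 :=
  cos t *: 1%:M + sin t *: lin1_mx (cross e) + (1 - cos t) *: (e^T *m e).

Definition is_matrix_group (G : set 'M[R]_3) : Prop :=
  [/\ G 1%:M, forall A B, G A -> G B -> G (A *m B)
    & forall A, G A -> A \in unitmx /\ G (invmx A)].

Definition matrix_group_generated (A : set 'M[R]_3) : set 'M[R]_3 :=
  smallest is_matrix_group A.

Definition cosh (t : R) : R := (expR t + expR (- t)) / 2.

(* The upper half of the catenoid of neck radius a about the third axis. *)
Definition half_catenoid (a : R) : set 'rV[R]_3 :=
  [set x | Num.sqrt (x 0 0 ^+ 2 + x 0 1 ^+ 2) = a * cosh (x 0 2 / a)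
           /\ 0 <= x 0 2].

Definition is_catenoid_end (E : set 'rV[R]_3) : Prop :=
  exists (a : R) (T : 'rV[R]_3 -> 'rV[R]_3),
    [/\ 0 < a, isometry T & E = T @` half_catenoid a].

(* The distance between the two sets tends to zero at infinity. *)
Definition asymptotic (A B : set 'rV[R]_3) : Prop :=
  forall eps : R, 0 < eps -> exists r : R,
    (forall x, A x -> r < enorm x -> exists2 y, B y & enorm (x - y) < eps) /\
    (forall y, B y -> r < enorm y -> exists2 x, A x & enorm (x - y) < eps).

End Euclid.

Section Smooth.
Variables (R : realType) (W : normedModType R).
Implicit Types (F : R[i]^o -> W) (D : set R[i]^o).

(* Real derivatives of functions of z = u + i v; partial 1 is d/du and
   partial 'i is d/dv. *)
Definition has_partial (w : R[i]) F (z : R[i]^o) : Prop :=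
  derivable (fun t : R^o => F (z + t%:C * w)) 0 1.

Definition partial (w : R[i]) F (z : R[i]^o) : W :=
  'D_1 (fun t : R^o => F (z + t%:C * w)) 0.

(* F is of class C^k on the open set D. *)
Fixpoint class_C (k : nat) D F : Prop :=
  (forall z, D z -> {for z, continuous F}) /\
  if k is k'.+1 then
    forall w : R[i], w = 1 \/ w = 'i ->
      (forall z, D z -> has_partial w F z) /\ class_C k' D (partial w F)
  else True.

Definition smooth D F : Prop := forall k, class_C k D F.

End Smooth.

(* Classical local theory of a parametrized surface F. *)
Section Surface.
Variable R : realType.
Implicit Types (F : R[i]^o -> 'rV[R]_3) (z : R[i]^o).

Definition Fu F := partial 1 F.
Definition Fv F := partial 'i F.

Definition ffE F z := dot (Fu F z) (Fu F z).
Definition ffF F z := dot (Fu F z) (Fv F z).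
Definition ffG F z := dot (Fv F z) (Fv F z).

Definition unit_normal F z : 'rV[R]_3 :=
  let m := cross (Fu F z) (Fv F z) in (enorm m)^-1 *: m.

Definition sfL F z := dot (Fu (Fu F) z) (unit_normal F z).
Definition sfM F z := dot (Fu (Fv F) z) (unit_normal F z).
Definition sfN F z := dot (Fv (Fv F) z) (unit_normal F z).

Definition mean_curvature F z : R :=
  (sfL F z * ffG F z - 2 * sfM F z * ffF F z + sfN F z * ffE F z)
  / (2 * (ffE F z * ffG F z - ffF F z ^+ 2)).

Definition gauss_curvature F z : R :=
  (sfL F z * sfN F z - sfM F z ^+ 2) / (ffE F z * ffG F z - ffF F z ^+ 2).

Definition area_density F z : R :=
  Num.sqrt (ffE F z * ffG F z - ffF F z ^+ 2).

Definition immersed_at F z : Prop := row_free (col_mx (Fu F z) (Fv F z)).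

Definition conformal_at F z : Prop := ffE F z = ffG F z /\ ffF F z = 0.

End Surface.

(* A chart is a homeomorphism coord between the open sets dom of M and
   coord @` dom of the complex plane; param is its inverse. Both maps are total
   functions whose values elsewhere are irrelevant. *)
Record chart (R : realType) (M : topologicalType) := Chart {
  dom : set M;
  coord : M -> R[i]^o;
  param : R[i]^o -> M;
  dom_open : open dom;
  codom_open : open (coord @` dom);
  coordK : forall x, dom x -> param (coord x) = x;
  coord_continuous : forall x, dom x -> {for x, continuous coord};
  param_continuous : forall z, (coord @` dom) z -> {for z, continuous param}
}.

Record riemannSurface (R : realType) := RiemannSurface {
  rs_space :> topologicalType;
  rs_hausdorff : hausdorff_space rs_space;
  rs_connected : connected [set: rs_space];
  rs_atlas : set (chart R rs_space);
  rs_cover : forall x : rs_space, exists2 c, rs_atlas c & dom c x;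
  (* changes of charts are holomorphic: derivable over the field R[i] *)
  rs_holomorphic : forall c d, rs_atlas c -> rs_atlas d ->
    forall z : R[i]^o, (coord c @` (dom c `&` dom d)) z ->
    derivable (coord d \o param c : R[i]^o -> R[i]^o) z 1
}.

Definition torus (R : realType) : set (R[i]^o * R[i]^o) :=
  [set w | `|w.1| = 1 /\ `|w.2| = 1].
Arguments torus : clear implicits.

(* A compact surface has genus 1 when it is homeomorphic to S^1 x S^1. *)
Definition genus_one (R : realType) (M : topologicalType) : Prop :=
  exists (f : M -> R[i]^o * R[i]^o) (g : R[i]^o * R[i]^o -> M),
    [/\ continuous f, {within torus R, continuous g}, f @` [set: M] = torus R,
        cancel f g & {in torus R, cancel g f}].

(* In all that follows X is a map defined on the complement of the set P of
   punctures; as a Rocq function it is total, with irrelevant values on P. *)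
Section PuncturedSurface.
Variables (R : realType) (S : riemannSurface R) (P : set S).
Implicit Types (X N : S -> 'rV[R]_3).

Local Notation atlas := (@rs_atlas R S).

(* As S carries a complex structure, the minimal immersion is required to be
   conformal for it. *)
Definition minimal_immersion X : Prop :=
  forall c, atlas c ->
  let D := coord c @` (dom c `\` P) in let F := X \o param c in
  smooth D F /\
  forall z, D z ->
    [/\ immersed_at F z, conformal_at F z & mean_curvature F z = 0].

(* Every divergent C^1 path has infinite length. Since X is an immersion, a
   continuous curve g is C^1 in S as soon as X \o g is, and its length for the
   induced metric is the Euclidean length of X \o g. *)
Definition complete_immersion X : Prop :=
  forall g : R^o -> S,
    continuous g -> (forall t, ~ P (g t)) ->
    (forall t, derivable (X \o g) t 1) -> continuous (derive1 (X \o g)) ->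
    (forall K : set S, compact K -> K `<=` ~` P ->
       \forall t \near +oo, ~ K (g t)) ->
    (\int[@lebesgue_measure R]_(t in `[0%R, +oo[)
       (enorm (derive1 (X \o g) t))%:E = +oo)%E.

Definition plane_point (w : R * R) : R[i]^o := w.1 +i* w.2.

(* The integral of |K| dA over S minus P, as the supremum over finite families
   of pairwise disjoint Borel pieces, each lying in one chart. *)
Definition total_abs_curvature X : \bar R :=
  ereal_sup [set s | exists (m : nat) (c : 'I_m -> chart R S)
                            (A : 'I_m -> set (R * R)),
    [/\ forall k, atlas (c k),
        forall k, measurable (A k),
        forall k, plane_point @` A k `<=` coord (c k) @` (dom (c k) `\` P),
        trivIset setT (fun k => (param (c k) \o plane_point) @` A k)
      & s = (\sum_(k < m)
               \int[@lebesgue_measure R \x @lebesgue_measure R]_(w in A k)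
                 (`| gauss_curvature (X \o param (c k)) (plane_point w) |
                  * area_density (X \o param (c k)) (plane_point w))%:E)%E]].

Definition finite_total_curvature X : Prop := (total_abs_curvature X < +oo)%E.

(* X restricted to V is a homeomorphism onto its image. *)
Definition embeds X (V : set S) : Prop :=
  [/\ {in V &, injective X}, {in V, continuous X}
    & forall O, open O -> O `<=` V ->
        exists2 O', open O' & X @` O = O' `&` X @` V].

Definition embedded_catenoid_end X (q : S) : Prop :=
  exists U : set S,
    [/\ open U, U q, U `&` P `<=` [set q], embeds X (U `\ q)
      & exists2 E, is_catenoid_end E & asymptotic (X @` (U `\ q)) E].

Definition is_gauss_map X N : Prop :=
  forall c x, atlas c -> dom c x -> ~ P x ->
    N x = unit_normal (X \o param c) (coord c x).

Definition limiting_normal X (q : S) (v : 'rV[R]_3) : Prop :=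
  exists2 N, is_gauss_map X N & N x @[x --> q^'] --> v.

Definition smooth_map (phi : S -> S) : Prop :=
  (forall x, ~ P x -> {for x, continuous phi}) /\
  forall c d, atlas c -> atlas d ->
    let D := coord c @` [set x | [/\ dom c x, ~ P x & dom d (phi x)]] in
    let f := coord d \o phi \o param c in
    smooth (W := R^o) D (fun z => complex.Re (f z)) /\
    smooth (W := R^o) D (fun z => complex.Im (f z)).

Definition diffeomorphism (phi : S -> S) : Prop :=
  exists psi : S -> S,
    [/\ forall x, ~ P x -> ~ P (phi x) /\ psi (phi x) = x,
        forall x, ~ P x -> ~ P (psi x) /\ phi (psi x) = x,
        smooth_map phi & smooth_map psi].

Definition invariant_under X (A : 'M[R]_3) : Prop :=
  exists2 phi, diffeomorphism phi & forall x, ~ P x -> X (phi x) = X x *m A.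

End PuncturedSurface.

(* Main.v *)
(** On the rectangular torus C / (2nL Z + 2 pi i Z), with coordinate z, take the
    ends at the points 2jL and the Weierstrass forms (A, B, C) = (s1^2, s2^2,
    s1 s2) e^z / theta^2, where theta vanishes simply on 2L Z + 2 pi i Z and
    s1, s2 are theta functions with zeros shifted by i pi/n.  A translation by
    2L multiplies A and B by conjugate n-th roots of unity and fixes C, and
    X is the real part of the integral of (i (B - A)/2, - (A + B)/2, i C).

    By the reflections of the torus the only period condition left is a single
    real equation, the vanishing of the sum over j of Re (w_j / (1 - w_j)^2)
    with w_j = Q^(2j+1) e^(i pi/n) and Q = e^(-L).  The sum is nonnegative
    at Q = 1/4 and nonpositive for Q close to 1, so the intermediate value
    theorem provides the nome Q.

    The symmetries follow from the uniqueness of a potential up to a constant.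
    At an end the forms have double poles, and their Laurent expansions give a
    horizontal part k / z + O(z) and a vertical logarithm, which is a graph
    asymptotic to a catenoid end.  The surface is complete because X is proper,
    and its total curvature is finite because the curvature density is bounded
    by a continuous function on the closed torus. *)

From HB Require Import structures.
From mathcomp Require Import all_boot all_order all_algebra all_fingroup.
From mathcomp Require Import complex.
From mathcomp Require Import all_classical all_reals all_analysis.
From mathcomp Require extremal.
From mathcomp Require Import zify ring lra.
Require Import Defs.

Import Order.TTheory GRing.Theory Num.Theory.
Import numFieldNormedType.Exports.

Local Open Scope classical_set_scope.
Local Open Scope ring_scope.

Set Implicit Arguments.
Unset Strict Implicit.
Unset Printing Implicit Defensive.

(** Homotopy is avoided: the complement of the punctures is covered by convex strips, potentials are
    integrals along segments, and a period is the change of a potential under translation by [tpi].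
    Conjugation makes that period vanish for the two horizontal forms but acts with the opposite
    sign on i C. The last period is turned into a residue: [wf], built with the derivative of the
    theta function [t], satisfies wf(z - 2L) = wf(z) - C(z), so the period of C is the difference of
    the periods of [wf] on the two sides of the puncture 0, a multiple of (log t)'' at i pi/n. There
    log t is a sum of two conjugate values, so one real equation remains, and expanding the
    logarithm of the product gives the Lambert series. The horizontal translation by 2L acts as a
    rotation by 2 pi/n, which has a fixed axis, so it creates no further horizontal period, and
    conjugation removes the vertical one. The factor e^z / theta^2 cancels from the Gauss map and
    from |K| dA, which is why both extend through the ends. *)

Notation Re := (@complex.Re _).
Notation Im := (@complex.Im _).
Notation cabs := (@Normc.normc _).
Notation "x %:C" := (real_complex _ x) : ring_scope.
Notation "a +i* b" := (Complex a b) : ring_scope.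
Notation I := (Complex 0 1).

(** * Complex numbers and holomorphic functions *)

Section ComplexPlane.
Variable R : realType.
Local Notation C := (R[i]^o).
Implicit Types (x y : R) (z w : R[i]).

Lemma normE z : `|z| = (cabs z)%:C.
Proof. by rewrite normc_def; case: z. Qed.

Lemma cabsM z w : cabs (z * w) = cabs z * cabs w.
Proof. exact: Normc.normcM. Qed.

Lemma cabsV z : cabs z^-1 = (cabs z)^-1.
Proof. exact: Normc.normcV. Qed.

Lemma cabsX z n : cabs (z ^+ n) = cabs z ^+ n.
Proof.
elim: n => [|n IH]; first by rewrite !expr0 Normc.normc1.
by rewrite !exprS cabsM IH.
Qed.

Lemma cabsD z w : cabs (z + w) <= cabs z + cabs w.
Proof. exact: le_normcD. Qed.

Lemma cabsN z : cabs (- z) = cabs z.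
Proof. exact: normcN. Qed.

Lemma cabsC z w : cabs (z - w) = cabs (w - z).
Proof. by rewrite -cabsN opprB. Qed.

Lemma cabs_ge0 z : 0 <= cabs z.
Proof. by case: z => a b; exact: sqrtr_ge0. Qed.

Lemma cabs0 : cabs (0 : R[i]) = 0.
Proof. exact: Normc.normc0. Qed.

Lemma cabs1 : cabs (1 : R[i]) = 1.
Proof. exact: Normc.normc1. Qed.

Lemma cabs_eq0 z : (cabs z == 0) = (z == 0).
Proof.
apply/eqP/eqP => [|->]; [exact: Normc.eq0_normc|exact: cabs0].
Qed.

Lemma cabs_gt0 z : (0 < cabs z) = (z != 0).
Proof. by rewrite lt_def cabs_ge0 andbT cabs_eq0. Qed.

Lemma cabs_real x : cabs (x%:C) = `|x|.
Proof. by rewrite /= expr0n addr0 sqrtr_sqr. Qed.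

Lemma cabs_I : cabs (I : R[i]) = 1.
Proof. by rewrite /= expr0n expr1n add0r sqrtr1. Qed.

Lemma cabs_conj z : cabs (conjc z) = cabs z.
Proof. by case: z => a b /=; rewrite sqrrN. Qed.

Lemma cabs_sqr z : cabs z ^+ 2 = Re z ^+ 2 + Im z ^+ 2.
Proof. by case: z => a b /=; rewrite sqr_sqrtr // addr_ge0 ?sqr_ge0. Qed.

Lemma Re_le_cabs z : `|Re z| <= cabs z.
Proof.
by case: z => a b /=; rewrite -sqrtr_sqr ler_wsqrtr // lerDl sqr_ge0.
Qed.

Lemma Im_le_cabs z : `|Im z| <= cabs z.
Proof.
by case: z => a b /=; rewrite -sqrtr_sqr ler_wsqrtr // lerDr sqr_ge0.
Qed.

Lemma cabs_le_ReIm z : cabs z <= `|Re z| + `|Im z|.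
Proof.
have {1}-> : z = (Re z)%:C + I * (Im z)%:C by exact: complexE.
by rewrite (le_trans (cabsD _ _)) // cabsM cabs_I mul1r !cabs_real.
Qed.

Lemma ler_cabsB z w : cabs z - cabs w <= cabs (z - w).
Proof. by rewrite lerBlDr (le_trans _ (cabsD _ _)) // subrK. Qed.

Lemma ReD z w : Re (z + w) = Re z + Re w. Proof. by case: z w => [a b] [c d]. Qed.
Lemma ImD z w : Im (z + w) = Im z + Im w. Proof. by case: z w => [a b] [c d]. Qed.
Lemma ReN z : Re (- z) = - Re z. Proof. by case: z => [a b]. Qed.
Lemma ImN z : Im (- z) = - Im z. Proof. by case: z => [a b]. Qed.
Lemma ReM z w : Re (z * w) = Re z * Re w - Im z * Im w.
Proof. by case: z w => [a b] [c d]. Qed.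
Lemma ImM z w : Im (z * w) = Re z * Im w + Im z * Re w.
Proof. by case: z w => [a b] [c d]. Qed.
Lemma ReI z : Re (I * z) = - Im z.
Proof. by rewrite ReM /= mul0r mul1r sub0r. Qed.
Lemma ReZ x z : Re (x%:C * z) = x * Re z.
Proof. by rewrite ReM /= mul0r subr0. Qed.
Lemma ImZ x z : Im (x%:C * z) = x * Im z.
Proof. by rewrite ImM /= mul0r addr0. Qed.
Lemma Re_conj z : Re (conjc z) = Re z. Proof. by case: z. Qed.
Lemma Im_conj z : Im (conjc z) = - Im z. Proof. by case: z. Qed.

Lemma eqC z w : Re z = Re w -> Im z = Im w -> z = w.
Proof. by case: z w => [a b] [c d] /= -> ->. Qed.

Lemma conjM z w : conjc (z * w) = conjc z * conjc w.
Proof. exact: rmorphM. Qed.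
Lemma conjD z w : conjc (z + w) = conjc z + conjc w.
Proof. exact: rmorphD. Qed.
Lemma conjB z w : conjc (z - w) = conjc z - conjc w.
Proof. exact: rmorphB. Qed.
Lemma conjN z : conjc (- z) = - conjc z.
Proof. exact: rmorphN. Qed.
Lemma conjX z n : conjc (z ^+ n) = conjc z ^+ n.
Proof. exact: rmorphXn. Qed.
Lemma conjV z : conjc (z^-1) = (conjc z)^-1.
Proof. exact: conjc_inv. Qed.

Lemma realCV x : (x^-1)%:C = (x%:C)^-1 :> R[i].
Proof. exact: fmorphV. Qed.
Lemma realCM x y : (x * y)%:C = x%:C * y%:C :> R[i].
Proof. exact: rmorphM. Qed.
Lemma realCD x y : (x + y)%:C = x%:C + y%:C :> R[i].
Proof. exact: rmorphD. Qed.
Lemma realCN x : (- x)%:C = - x%:C :> R[i].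
Proof. exact: rmorphN. Qed.
Lemma realCX x n : (x ^+ n)%:C = x%:C ^+ n :> R[i].
Proof. exact: rmorphXn. Qed.
Lemma realC1 : (1 : R)%:C = 1 :> R[i].
Proof. by []. Qed.

(* The norm of R[i] is itself complex-valued, hence the reformulation with
   real radii. *)
Lemma nbhsCP z (A : set C) :
  nbhs (z : C) A <-> exists2 e, 0 < e & forall w, cabs (w - z) < e -> A w.
Proof.
split.
- move/nbhs_ballP => [e /= e0 sA].
  have eR : (Re e)%:C = e by apply: RRe_real; exact: gtr0_real.
  exists (Re e); first by rewrite -ltcR eR.
  by move=> w zw; apply: sA; rewrite -ball_normE /= normE cabsC -eR ltcR.
- move=> [e e0 sA]; apply/nbhs_ballP; exists e%:C; first by rewrite /= ltcR.
  by move=> w; rewrite -ball_normE /= normE ltcR cabsC; exact: sA.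
Qed.

Lemma cvgCP (T : Type) (F : set_system T) (FF : Filter F) (f : T -> R[i]) z :
  (f : T -> C) @ F --> (z : C) <-> forall e : R, 0 < e -> \forall t \near F, cabs (f t - z) < e.
Proof.
split.
- move=> fz e e0; have : nbhs (z : C) [set w : C | cabs ((w : R[i]) - z) < e].
    by apply/nbhsCP; exists e.
  exact: fz.
- move=> H A /nbhsCP[e e0 sA]; have := H e e0.
  by apply: filterS => t /sA.
Qed.

Lemma continuousCP (T : topologicalType) (f : T -> R[i]) (x : T) :
  {for x, continuous (f : T -> C)} <->
  forall e : R, 0 < e -> \forall t \near x, cabs (f t - f x) < e.
Proof. exact: cvgCP. Qed.

Lemma continuousRP (T : topologicalType) (f : T -> R) (x : T) :
  {for x, continuous f} <->
  forall e : R, 0 < e -> \forall t \near x, `|f t - f x| < e.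
Proof.
split=> [H e e0|H].
- move/cvgrPdist_lt : H => /(_ e e0).
  by apply: filterS => t; rewrite distrC.
- apply/cvgrPdist_lt => e /H.
  by apply: filterS => t; rewrite distrC.
Qed.

Lemma near_ball_C z (e : R) : 0 < e -> \forall w \near (z : C), cabs (w - z) < e.
Proof. by move=> e0; apply/nbhsCP; exists e. Qed.

Lemma near_ball_R (x e : R) : 0 < e -> \forall y \near x, `|y - x| < e.
Proof.
move=> e0; apply/nbhs_ballP; exists e => //= y.
by rewrite -ball_normE /= distrC.
Qed.

Lemma continuous_Re : continuous (Re : C -> R).
Proof.
move=> z; apply/continuousRP => e e0.
apply: filterS (near_ball_C z e0) => w; apply: le_lt_trans.
by rewrite -ReN -ReD Re_le_cabs.
Qed.

Lemma continuous_Im : continuous (Im : C -> R).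
Proof.
move=> z; apply/continuousRP => e e0.
apply: filterS (near_ball_C z e0) => w; apply: le_lt_trans.
by rewrite -ImN -ImD Im_le_cabs.
Qed.

Lemma continuous_conj : continuous (conjc : C -> C).
Proof.
move=> z; apply/continuousCP => e e0.
apply: filterS (near_ball_C z e0) => w.
by rewrite -(cabs_conj (_ - _)) rmorphB.
Qed.

Lemma continuous_cabs : continuous (cabs : C -> R).
Proof.
move=> z; apply/continuousRP => e e0.
apply: filterS (near_ball_C z e0) => w; apply: le_lt_trans.
by rewrite ler_norml ler_cabsB lerNl opprB cabsC ler_cabsB.
Qed.

Lemma cvg_C (T : Type) (F : set_system T) (FF : Filter F) (f g : T -> R) a b :
  f @ F --> a -> g @ F --> b -> (fun t => f t +i* g t : C) @ F --> (a +i* b : C).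
Proof.
move=> /cvgrPdist_lt fa /cvgrPdist_lt gb; apply/cvgCP => e e0.
have e2 : 0 < e / 2 by rewrite divr_gt0.
near=> t; rewrite (le_lt_trans (cabs_le_ReIm _)) //= (splitr e) ltrD //.
- by rewrite distrC; near: t; exact: fa.
- by rewrite distrC; near: t; exact: gb.
Unshelve. all: by end_near. Qed.

Lemma continuous_realC : continuous (fun x : R => x%:C : C).
Proof. by move=> x; apply: cvg_C; [exact: cvg_id|exact: cvg_cst]. Qed.

End ComplexPlane.

Arguments continuous_Re {R}.
Arguments continuous_Im {R}.
Arguments continuous_conj {R}.
Arguments continuous_cabs {R}.
Arguments continuous_realC {R}.

(** The division-free form of differentiability, used over the real and over the complex field
    alike; at h = 0 both sides vanish, so that case can be included. *)
Lemma is_deriveP (K : numFieldType) (f : K -> K) (x d : K) :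
  is_derive x 1 f d <->
  forall e : K, 0 < e -> \forall h \near (0 : K),
    `|f (x + h) - f x - h * d| <= e * `|h|.
Proof.
have E (h : K) : h != 0 ->
    `|d - h^-1 *: (f (h *: 1 + x) - f x)| = `|h|^-1 * `|f (x + h) - f x - h * d|.
  move=> h0; rewrite -normfV -normrM distrC /GRing.scale /= mulr1 [h + x]addrC.
  by rewrite [in RHS]mulrBr mulKf.
split.
- move=> [df Df] e e0.
  have /cvgrPdist_le := df; move/(_ e e0).
  rewrite -[lim _]/('D_1 f x) Df => /nbhs_ballP[r /= r0 H].
  apply/nbhs_ballP; exists r => //= h hr.
  have [->|h0] := eqVneq h 0; first by rewrite addr0 subrr mul0r subr0 normr0 mulr0.
  have := H h hr h0; rewrite /= E // => K1.
  by rewrite -ler_pdivrMr ?normr_gt0 // [_ / _]mulrC.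
- move=> H.
  have cv : (fun h : K => h^-1 *: (f (h *: 1 + x) - f x)) h @[h --> 0^'] --> d.
    apply/cvgrPdist_le => e e0; have := H e e0.
    move=> /nbhs_ballP[r /= r0 {}H]; apply/nbhs_ballP; exists r => //= h hr h0.
    have {}H := H h hr; rewrite E //.
    by rewrite [_^-1 * _]mulrC ler_pdivrMr ?normr_gt0.
  have df : derivable f x 1 by apply/cvg_ex; exists d.
  by apply: DeriveDef => //; exact/cvg_lim.
Qed.

(** * Complex derivatives and k-fold holomorphic functions *)

Section Holomorphic.
Variable R : realType.
Local Notation C := R[i].
Local Notation Ct := (R[i]^o).
Implicit Types (x y e : R) (z w d : C) (f g : C -> C) (D : set C).

Definition hder f z d := is_derive (z : Ct) (1 : Ct) (f : Ct -> Ct) d.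

Definition cont f z := {for (z : Ct), continuous (f : Ct -> Ct)}.

Lemma hderP f z d : hder f z d <->
  forall e, 0 < e -> exists2 r, 0 < r & forall h : C, cabs h < r ->
    cabs (f (z + h) - f z - h * d) <= e * cabs h.
Proof.
split=> [/(is_deriveP (K := R[i])) H e e0|H].
  have /nbhsCP[r r0 Hr] := H e%:C ltac:(by rewrite ltcR).
  exists r => // h hr; have := Hr h; rewrite subr0 => /(_ hr) /=.
  by rewrite !normE -rmorphM lecR.
apply/(is_deriveP (K := R[i])) => e e0.
have eR : e = (Re e)%:C by apply/esym/RRe_real; exact: gtr0_real.
rewrite eR ltcR in e0; have [r r0 Hr] := H _ e0.
apply/nbhsCP; exists r => // h; rewrite subr0 => hr.
by rewrite eR !normE -rmorphM lecR; exact: Hr.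
Qed.

Lemma rderP (f : R -> R) x (d : R) : is_derive x (1 : R) f d <->
  forall e, 0 < e -> exists2 r, 0 < r & forall h, `|h| < r ->
    `|f (x + h) - f x - h * d| <= e * `|h|.
Proof.
split=> [/is_deriveP H e e0|H].
  have /nbhs_ballP[r /= r0 Hr] := H e e0.
  exists r => // h hr; apply: Hr; by rewrite -ball_normE /= sub0r normrN.
apply/is_deriveP => e e0; have [r r0 Hr] := H _ e0.
apply/nbhs_ballP; exists r => //= h; rewrite -ball_normE /= sub0r normrN.
exact: Hr.
Qed.

Lemma hder_bound f z d : hder f z d ->
  exists2 r, 0 < r & forall h : C, cabs h < r ->
    cabs (f (z + h) - f z) <= (1 + cabs d) * cabs h.
Proof.
move=> /hderP /(_ 1 ltr01)[r r0 H]; exists r => // h hr.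
have -> : f (z + h) - f z = (f (z + h) - f z - h * d) + h * d
  by ring.
rewrite (le_trans (cabsD _ _)) // cabsM mulrDl mul1r [cabs h * _]mulrC lerD2r.
by have := H h hr; rewrite mul1r.
Qed.

Lemma hder_continuous f z d : hder f z d -> cont f z.
Proof.
move=> /hder_bound[r r0 H]; apply/continuousCP => e e0.
set k := 1 + cabs d in H.
have k0 : 0 < k by rewrite ltr_pwDl // cabs_ge0.
have m0 : 0 < Num.min r (e / k) by rewrite lt_min r0 divr_gt0.
apply: filterS (near_ball_C z m0) => w; rewrite lt_min => /andP[wr we].
have := H _ wr; rewrite (_ : z + (w - z) = w :> R[i]); last by ring.
move=> /le_lt_trans; apply.
by rewrite mulrC -ltr_pdivlMr.
Qed.

Lemma hder_eq f z d d' : hder f z d -> d = d' -> hder f z d'.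
Proof. by move=> ? <-. Qed.

Lemma hder_cst (a : C) z : hder (fun=> a) z 0.
Proof. exact: is_derive_cst. Qed.

Lemma hder_id z : hder id z 1.
Proof. exact: is_derive_id. Qed.

Lemma hderD f g z d d' : hder f z d -> hder g z d' ->
  hder (fun w => f w + g w) z (d + d').
Proof. by move=> ? ?; exact: is_deriveD. Qed.

Lemma hderN f z d : hder f z d -> hder (fun w => - f w) z (- d).
Proof. by move=> ?; exact: is_deriveN. Qed.

Lemma hderM f g z d d' : hder f z d -> hder g z d' ->
  hder (fun w => f w * g w) z (d * g z + f z * d').
Proof.
move=> hf hg; apply: hder_eq; first exact: (@is_deriveM R[i] Ct f g z 1 d d').
by rewrite /GRing.scale /= addrC; congr (_ + _); rewrite mulrC.
Qed.

Lemma hder_comp f g z d d' : hder f (g z) d -> hder g z d' ->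
  hder (fun w => f (g w)) z (d * d').
Proof.
move=> hf hg; have [r1 r10 H1] := hder_bound hg; set k := 1 + cabs d' in H1.
have k0 : 0 < k by rewrite ltr_pwDl // cabs_ge0.
move: hf hg => /hderP hf /hderP hg; apply/hderP => e e0.
have kd : 0 < cabs d + 1 by rewrite ltr_wpDl // cabs_ge0.
have [r2 r20 H2] := hf (e / 2 / k) ltac:(by rewrite !divr_gt0).
have [r3 r30 H3] := hg (e / 2 / (cabs d + 1)) ltac:(by rewrite !divr_gt0).
exists (Num.min r1 (Num.min r3 (r2 / k))); first by rewrite !lt_min r10 r30 divr_gt0.
move=> h; rewrite !lt_min => /and3P[h1 h3 h2].
have gb := H1 h h1; set v := g (z + h) - g z in gb *.
have vr : cabs v < r2 by rewrite (le_lt_trans gb) // mulrC -ltr_pdivlMr.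
have := H2 v vr; have -> : g z + v = g (z + h) by rewrite /v; ring.
move=> K2; have K3 := H3 h h3; rewrite -/v in K3.
have -> : f (g (z + h)) - f (g z) - h * (d * d') =
   (f (g (z + h)) - f (g z) - v * d) + d * (v - h * d') by ring.
rewrite (le_trans (cabsD _ _)) // cabsM.
have -> : e * cabs h = e / 2 * cabs h + e / 2 * cabs h by field.
apply: lerD.
  rewrite (le_trans K2) //.
  have -> : e / 2 * cabs h = e / 2 / k * (k * cabs h) by field; rewrite gt_eqF.
  by rewrite ler_wpM2l // !divr_ge0 // ltW.
have -> : e / 2 * cabs h = (cabs d + 1) * (e / 2 / (cabs d + 1) * cabs h).
  by field; rewrite gt_eqF.
rewrite (le_trans (ler_wpM2l (cabs_ge0 _) K3)) // ler_wpM2r ?lerDl //.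
by rewrite mulr_ge0 ?cabs_ge0 // !divr_ge0 // ltW.
Qed.

Lemma hderV f z d : f z != 0 -> hder f z d ->
  hder (fun w => (f w)^-1) z (- d / f z ^+ 2).
Proof.
move=> f0 [df Df].
apply: (@DeriveDef R[i] Ct Ct); first exact: (@derivableV R[i] Ct f z 1 f0 df).
rewrite (@deriveV R[i] Ct f z 1 f0 df) Df /GRing.scale /=.
by rewrite mulNr mulNr mulrC.
Qed.

(** The bridge from complex to real calculus: the remainder bound of [hderP] is restricted to a real
    line. The potentials below are defined by the property obtained here. *)
Lemma hder_real f z d w : hder f z d ->
  is_derive (0 : R) (1 : R) (fun t => Re (f (z + t%:C * w))) (Re (w * d)).
Proof.
move=> /hderP H; apply/rderP => e e0.
have k0 : 0 < cabs w + 1 by rewrite ltr_wpDl // cabs_ge0.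
have [r r0 Hr] := H (e / (cabs w + 1)) ltac:(by rewrite divr_gt0).
exists (r / (cabs w + 1)); first by rewrite divr_gt0.
move=> h hr; rewrite add0r mul0r addr0 -ReZ -!ReN -!ReD.
rewrite (le_trans (Re_le_cabs _)) // mulrA.
have hw : cabs (h%:C * w) <= `|h| * (cabs w + 1).
  by rewrite cabsM cabs_real ler_wpM2l // lerDl.
rewrite (le_trans (Hr _ _)) //.
  by rewrite (le_lt_trans hw) // -ltr_pdivlMr.
have -> : e * `|h| = e / (cabs w + 1) * (`|h| * (cabs w + 1)).
  by field; rewrite gt_eqF.
by rewrite ler_wpM2l // divr_ge0 // ltW.
Qed.

(** The order is explicit because higher derivatives are never deduced from the first one; for an
    entire function the property is established for all [k]. *)
Fixpoint hol (k : nat) D f : Prop :=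
  (forall z, D z -> cont f z) /\
  if k is k'.+1 then
    exists2 f', (forall z, D z -> hder f z (f' z)) & hol k' D f'
  else True.

Lemma hol0 D f : (forall z, D z -> cont f z) -> hol 0 D f.
Proof. by []. Qed.

Lemma hol_continuous k D f : hol k D f -> forall z, D z -> cont f z.
Proof. by case: k => [|k] []. Qed.

Lemma holS k D f : hol k.+1 D f -> hol k D f.
Proof.
elim: k f => [|k IH] f [cf [f' hf Hf]]; first by split.
by split=> //; exists f' => //; exact: IH.
Qed.

Lemma hol_sub k D D' f : D' `<=` D -> hol k D f -> hol k D' f.
Proof.
move=> DD; elim: k f => [|k IH] f [cf Hf]; split.
- by move=> z /DD; exact: cf.
- by [].
- by move=> z /DD; exact: cf.
- by case: Hf => f' hf Hf; exists f'; [move=> z /DD; exact: hf|exact: IH].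
Qed.

Lemma hol_intro k D f f' : (forall z, D z -> hder f z (f' z)) -> hol k D f' ->
  hol k.+1 D f.
Proof.
by move=> hf Hf; split; [move=> z Dz; exact: hder_continuous (hf z Dz)|exists f'].
Qed.

Lemma hol_cst k D (a : C) : hol k D (fun=> a).
Proof.
elim: k a => [|k IH] a; first by apply: hol0 => z _; exact: (@cst_continuous Ct Ct a z).
by apply: (hol_intro (f' := fun=> 0)) => // z _; exact: hder_cst.
Qed.

Lemma hol_id k D : hol k D id.
Proof.
case: k => [|k]; first by apply: hol0 => z _; exact: (@cvg_id Ct).
apply: (hol_intro (f' := fun=> 1)); last exact: hol_cst.
by move=> z _; exact: hder_id.
Qed.

Lemma holD k D f g : hol k D f -> hol k D g -> hol k D (fun w => f w + g w).
Proof.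
elim: k f g => [|k IH] f g [cf Hf] [cg Hg].
  by apply: hol0 => z Dz; exact: (@continuousD _ Ct Ct f g z (cf z Dz) (cg z Dz)).
case: Hf Hg => f' hf Hf [g' hg Hg].
apply: (@hol_intro _ _ _ (fun w => f' w + g' w)); last exact: IH.
by move=> z Dz; apply: hderD; [exact: hf|exact: hg].
Qed.

Lemma holN k D f : hol k D f -> hol k D (fun w => - f w).
Proof.
elim: k f => [|k IH] f [cf Hf].
  by apply: hol0 => z Dz; exact: (@continuousN _ Ct Ct f z (cf z Dz)).
case: Hf => f' hf Hf; apply: (@hol_intro _ _ _ (fun w => - f' w)); last exact: IH.
by move=> z Dz; apply: hderN; exact: hf.
Qed.

Lemma holM k D f g : hol k D f -> hol k D g -> hol k D (fun w => f w * g w).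
Proof.
elim: k f g => [|k IH] f g.
  move=> [cf _] [cg _]; apply: hol0 => z Dz.
  exact: (@continuousM R[i] Ct f g z (cf z Dz) (cg z Dz)).
move=> Ff Gg; have F1 := holS Ff; have G1 := holS Gg.
case: Ff Gg => cf [f' hf Hf] [cg [g' hg Hg]].
apply: (@hol_intro _ _ _ (fun w => f' w * g w + f w * g' w)).
  by move=> z Dz; apply: hderM; [exact: hf|exact: hg].
by apply: holD; exact: IH.
Qed.

Lemma holX k D f n : hol k D f -> hol k D (fun w => f w ^+ n).
Proof.
move=> Hf; elim: n => [|n IH]; first exact: hol_cst.
rewrite (_ : (fun w => f w ^+ n.+1) = fun w => f w * f w ^+ n); last first.
  by apply/funext => w; rewrite exprS.
exact: holM.
Qed.

Lemma holV k D f : (forall z, D z -> f z != 0) -> hol k D f ->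
  hol k D (fun w => (f w)^-1).
Proof.
move=> f0; elim: k f f0 => [|k IH] f f0.
  by move=> [cf _]; apply: hol0 => z Dz; exact: (@continuousV R[i] Ct f z (f0 z Dz) (cf z Dz)).
move=> Ff; have F1 := holS Ff; case: Ff => cf [f' hf Hf].
apply: (@hol_intro _ _ _ (fun w => - f' w * (f w ^+ 2)^-1)).
  by move=> z Dz; apply: hderV; [exact: f0|exact: hf].
apply: holM; first exact: holN.
apply: IH; last exact: holX.
by move=> z Dz; rewrite expf_neq0 // f0.
Qed.

Lemma hol_comp k D D' f g : (forall z, D z -> D' (g z)) ->
  hol k D' f -> hol k D g -> hol k D (fun w => f (g w)).
Proof.
move=> DD; elim: k f g DD => [|k IH] f g DD.
  move=> [cf _] [cg _]; apply: hol0 => z Dz.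
  apply: (@continuous_comp Ct Ct Ct g f); [exact: cg|apply: cf; exact: DD].
move=> Ff Gg; have G1 := holS Gg; case: Ff Gg => cf [f' hf Hf] [cg [g' hg Hg]].
apply: (@hol_intro _ _ _ (fun w => f' (g w) * g' w)).
  by move=> z Dz; apply: hder_comp; [apply: hf; exact: DD|exact: hg].
by apply: holM => //; exact: IH.
Qed.

End Holomorphic.

(** * Everywhere convergent power series and the complex exponential *)

Section Series.
Variable R : realType.
Local Notation C := R[i].
Local Notation Ct := (R[i]^o).
Implicit Types (u v : nat -> C) (c : nat -> C) (M : R) (z h : C).

(** Summing real and imaginary parts separately reduces every convergence question to real
    series. *)
Definition csum u : C :=
  limn (series (fun k => Re (u k))) +i* limn (series (fun k => Im (u k))).

(** The fixed ratio 1/2 is a normalisation: testing the coefficients of a series at radius 2r yields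
    this domination on the disc of radius r. *)
Definition gdom u M := forall k, cabs (u k) <= M * (2^-1) ^+ k.

Lemma gdom_ge0 u M : gdom u M -> 0 <= M.
Proof. by move=> /(_ 0%N); rewrite expr0 mulr1; apply: le_trans; exact: cabs_ge0. Qed.

Lemma half_lt1 : `|2^-1 : R| < 1.
Proof. by rewrite ger0_norm ?invr_ge0 // invf_lt1 // ltr1n. Qed.

Lemma is_cvg_half M : cvgn (series (geometric M (2^-1 : R))).
Proof. exact: is_cvg_geometric_series half_lt1. Qed.

Lemma lim_half M : limn (series (geometric M (2^-1 : R))) = 2 * M.
Proof.
have -> : 2 * M = M / (1 - 2^-1) by field.
by apply/cvg_lim => //; exact: cvg_geometric_series half_lt1.
Qed.

Lemma gdom_real (f : nat -> R) M : (forall k, `|f k| <= M * (2^-1) ^+ k) ->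
  cvgn (series f) /\ `|limn (series f)| <= 2 * M.
Proof.
move=> H; have c1 : cvgn [normed series f].
  apply: (@series_le_cvg _ _ (geometric M 2^-1)) => [n|n|n|].
  - exact: normr_ge0.
  - exact: le_trans (H n).
  - exact: H.
  - exact: is_cvg_half.
split; first exact: normed_cvg.
rewrite (le_trans (lim_series_norm c1)) // -lim_half.
by apply: lim_series_le => // ; exact: is_cvg_half.
Qed.

Lemma gdom_Re u M : gdom u M -> cvgn (series (fun k => Re (u k))).
Proof. by move=> H; apply: (@gdom_real _ M _).1 => k; exact: le_trans (Re_le_cabs _) (H k). Qed.

Lemma gdom_Im u M : gdom u M -> cvgn (series (fun k => Im (u k))).
Proof. by move=> H; apply: (@gdom_real _ M _).1 => k; exact: le_trans (Im_le_cabs _) (H k). Qed.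

Lemma csum_bound u M : gdom u M -> cabs (csum u) <= 4 * M.
Proof.
move=> H; rewrite (le_trans (cabs_le_ReIm _)) //=.
have -> : 4 * M = 2 * M + 2 * M by ring.
apply: lerD; apply: (@gdom_real _ M _).2 => k.
- exact: le_trans (Re_le_cabs _) (H k).
- exact: le_trans (Im_le_cabs _) (H k).
Qed.

Lemma csumD u v M N : gdom u M -> gdom v N ->
  csum (fun k => u k + v k) = csum u + csum v.
Proof.
move=> Hu Hv; apply: eqC => /=.
- rewrite -(lim_seriesD (gdom_Re Hu) (gdom_Re Hv)).
  by congr (limn (series _)); apply/funext => k; rewrite ReD.
- rewrite -(lim_seriesD (gdom_Im Hu) (gdom_Im Hv)).
  by congr (limn (series _)); apply/funext => k; rewrite ImD.
Qed.

Lemma csumZ u M (a : C) : gdom u M -> csum (fun k => a * u k) = a * csum u.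
Proof.
move=> Hu; have cR := gdom_Re Hu; have cI := gdom_Im Hu.
have Z (t : R) f : cvgn (series f) -> t * limn (series f) = limn (series (t *: f)).
  by move=> cf; rewrite lim_seriesZ.
apply: eqC; rewrite ?ReM ?ImM /= !Z //.
- rewrite -lim_seriesB; [|exact: is_cvg_seriesZ..].
  by congr (limn (series _)); apply/funext => k; rewrite ReM.
- rewrite -lim_seriesD; [|exact: is_cvg_seriesZ..].
  by congr (limn (series _)); apply/funext => k; rewrite ImM.
Qed.

Lemma csum_conj u M : gdom u M -> csum (fun k => conjc (u k)) = conjc (csum u).
Proof.
move=> Hu; apply: eqC; rewrite /= ?Re_conj ?Im_conj /=.
- by congr (limn (series _)); apply/funext => k; rewrite Re_conj.
- rewrite -(lim_seriesN (gdom_Im Hu)).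
  by congr (limn (series _)); apply/funext => k; rewrite Im_conj.
Qed.

Lemma lim_series_recl (f : nat -> R) : cvgn (series f) ->
  limn (series f) = f 0%N + limn (series (fun k => f k.+1)).
Proof.
move=> cf; have E n : series f n.+1 = f 0%N + series (fun k => f k.+1) n.
  by rewrite /series /= big_nat_recl.
have c1 : series (fun k => f k.+1) @ \oo --> limn (series f) - f 0%N.
  rewrite (_ : series _ = fun n => series f n.+1 - f 0%N); last first.
    by apply/funext => n; rewrite E addrC addKr.
  by apply: cvgB; [rewrite (cvg_shiftS (series f))|exact: cvg_cst].
by rewrite (cvg_lim _ c1) // addrC subrK.
Qed.

Lemma csum_recl u M : gdom u M -> csum u = u 0%N + csum (fun k => u k.+1).
Proof.
move=> Hu; apply: eqC; rewrite ?ReD ?ImD /=.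
- exact/(@lim_series_recl (fun k => Re (u k)))/(gdom_Re Hu).
- exact/(@lim_series_recl (fun k => Im (u k)))/(gdom_Im Hu).
Qed.

Lemma eq_csum u v : u =1 v -> csum u = csum v.
Proof. by move=> /funext ->. Qed.

Lemma csum0 : csum (fun=> 0) = 0.
Proof.
have H : gdom (fun=> 0 : C) 0 by move=> k; rewrite cabs0 mul0r.
by apply/eqP; rewrite -cabs_eq0 eq_le cabs_ge0 (le_trans (csum_bound H)) ?mulr0.
Qed.

(** Infinite radius of convergence, in a form stable under formal differentiation. *)
Definition rapid c := forall r : R, 0 <= r ->
  exists M, forall k, cabs (c k) * r ^+ k <= M.

Lemma le_half (a b : R) k : a * 2 ^+ k <= b -> a <= b * 2^-1 ^+ k.
Proof. by rewrite exprVn ler_pdivlMr // exprn_gt0. Qed.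

Lemma rapid_gdom c (r : R) : rapid c -> 0 <= r -> exists M, forall z,
  cabs z <= r -> gdom (fun k => c k * z ^+ k) M.
Proof.
move=> Hc r0; have [M HM] := Hc (2 * r) (mulr_ge0 (ler0n _ _) r0).
exists M => z zr k; rewrite cabsM cabsX; apply: le_half.
rewrite -mulrA -exprMn (le_trans _ (HM k)) // ler_wpM2l ?cabs_ge0 //.
rewrite lerXn2r // ?nnegrE ?mulr_ge0 ?cabs_ge0 //.
by rewrite mulrC ler_wpM2l.
Qed.

Definition pder c : nat -> C := fun k => k.+1%:R * c k.+1.

Lemma cabs_natr k : cabs (k%:R : C) = k%:R.
Proof. by rewrite -(rmorph_nat (real_complex R)) cabs_real ger0_norm. Qed.

Lemma natr_le_exp2 k : k%:R <= 2 ^+ k :> R.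
Proof. by rewrite -natrX ler_nat ltnW // ltn_expl. Qed.

(** The bound is taken at radius 2(r + 1): the powers of 2 absorb the factor k + 1, and r + 1 >= 1
    absorbs the shift of the exponent. *)
Lemma rapid_pder c : rapid c -> rapid (pder c).
Proof.
move=> Hc r r0; have [M HM] := Hc (2 * (r + 1)) ltac:(by rewrite mulr_ge0 // addr_ge0).
exists M => k; rewrite /pder cabsM cabs_natr.
rewrite (le_trans _ (HM k.+1)) // mulrAC [leRHS]mulrC ler_wpM2r ?cabs_ge0 //.
rewrite exprMn ler_pM // ?exprn_ge0 //; first exact: natr_le_exp2.
rewrite (@le_trans _ _ ((r + 1) ^+ k)) //.
  by rewrite lerXn2r // ?nnegrE ?addr_ge0 // lerDl.
by rewrite ler_weXn2l // lerDr.
Qed.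

Definition ps c z : C := csum (fun k => c k * z ^+ k).

Lemma psE c z : ps c z = csum (fun k => c k * z ^+ k).
Proof. by []. Qed.

(** Termwise differentiation. The second order remainder [D k] of the k-th power is at most |h|^2
    (2r)^k, by an induction on k, so the remainder of the whole series is O(|h|^2). *)
Lemma hder_ps c z : rapid c -> hder (ps c) z (ps (pder c) z).
Proof.
move=> Hc; apply/hderP => e e0.
pose r := cabs z + 1.
(* With r = |z| + 1 the disc of radius r contains z + h for |h| < 1. The coefficients are then
   tested at 4r: one factor 2 pays for (2r)^k in the remainders, the other for the geometric
   domination. *)
have r1 : 1 <= r by rewrite lerDr cabs_ge0.
have r0 : 0 <= r by exact: le_trans r1.
have [M HM] := Hc (2 * (2 * r)) ltac:(by rewrite !mulr_ge0).
have M0 : 0 <= M.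
  by rewrite (le_trans _ (HM 0%N)) // mulr_ge0 ?cabs_ge0 // exprn_ge0 // !mulr_ge0.
exists (Num.min 1 (e / (4 * M + 1))).
  by rewrite lt_min ltr01 divr_gt0 // ltr_wpDl // mulr_ge0.
move=> h; rewrite lt_min => /andP[h1 he].
have zr : cabs z <= r by rewrite lerDl.
have zhr : cabs (z + h) <= r by rewrite (le_trans (cabsD _ _)) // lerD2l ltW.
have [M1 H1] := rapid_gdom Hc r0; have [M2 H2] := rapid_gdom (rapid_pder Hc) r0.
pose D k : C := (z + h) ^+ k - z ^+ k - h * (k%:R * z ^+ k.-1).
have HD k : cabs (D k) <= cabs h ^+ 2 * (2 * r) ^+ k.
  elim: k => [|k IH].
    by rewrite /D mul0r mulr0 subr0 subrr cabs0 mulr_ge0 ?exprn_ge0 ?cabs_ge0 // mulr_ge0.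
  have -> : D k.+1 = (z + h) * D k + h ^+ 2 * (k%:R * z ^+ k.-1).
    rewrite /D /=; case: k {IH} => [|k] /=; first by rewrite !expr1; ring.
    by rewrite -![k.+1%:R]natr1 -natr1 !exprS; ring.
  rewrite (le_trans (cabsD _ _)) // [cabs (_ * D k)]cabsM.
  rewrite [cabs (h ^+ 2 * _)]cabsM [cabs (k%:R * _)]cabsM !cabsX cabs_natr.
  have -> : cabs h ^+ 2 * (2 * r) ^+ k.+1 =
     r * (cabs h ^+ 2 * (2 * r) ^+ k) + cabs h ^+ 2 * (r * (2 * r) ^+ k).
    by rewrite [(2 * r) ^+ k.+1]exprS; ring.
  apply: lerD; first by apply: ler_pM => //; exact: cabs_ge0.
  rewrite ler_wpM2l ?exprn_ge0 ?cabs_ge0 // exprMn mulrCA ler_pM ?exprn_ge0 ?cabs_ge0 //.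
    exact: natr_le_exp2.
  case: k {IH} => [|k] /=; first by rewrite !expr0 mulr1.
  rewrite (@le_trans _ _ (r ^+ k)) //; first by rewrite lerXn2r ?nnegrE ?cabs_ge0.
  by rewrite -exprS ler_weXn2l // !leqW.
have E : ps c (z + h) - ps c z - h * ps (pder c) z = csum (fun k => c k * D k).
  have G0 : gdom (fun k => c k * (k%:R * z ^+ k.-1)) (Num.max M2 M2 * 2).
    case=> [|k] /=; first by rewrite mul0r mulr0 cabs0 expr0 mulr1 maxxx mulr_ge0 //; exact: gdom_ge0 (H2 z zr).
    have := H2 z zr k; rewrite maxxx /pder [_ * c _]mulrC -mulrA => /le_trans; apply.
    by rewrite exprS -mulrA mulVKf.
  have -> : ps (pder c) z = csum (fun k => c k * (k%:R * z ^+ k.-1)).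
    rewrite (csum_recl G0) mul0r mulr0 add0r; apply: eq_csum => k /=.
    by rewrite /pder mulrAC mulrC mulrA.
  rewrite -mulN1r -(csumZ _ (H1 z zr)) -mulNr -(csumZ _ G0).
  have Gz : gdom (fun k => -1 * (c k * z ^+ k)) M1.
    by move=> k; rewrite mulN1r cabsN; exact: H1.
  rewrite -(csumD (H1 _ zhr) Gz).
  have Gs : gdom (fun k => c k * (z + h) ^+ k + -1 * (c k * z ^+ k)) (M1 + M1).
    by move=> k; rewrite (le_trans (cabsD _ _)) // mulrDl lerD //; exact: H1.
  have Gh : gdom (fun k => - h * (c k * (k%:R * z ^+ k.-1))) (cabs h * (Num.max M2 M2 * 2)).
    by move=> k; rewrite cabsM cabsN -mulrA ler_wpM2l ?cabs_ge0.
  rewrite -(csumD Gs Gh); apply: eq_csum => k; rewrite /D; ring.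
rewrite E.
have GD : gdom (fun k => c k * D k) (cabs h ^+ 2 * M).
  move=> k; rewrite cabsM -mulrA.
  rewrite (le_trans (ler_wpM2l (cabs_ge0 _) (HD k))) // mulrCA.
  rewrite ler_wpM2l ?exprn_ge0 ?cabs_ge0 //; apply: le_half.
  by rewrite -mulrA -exprMn [_ * 2]mulrC.
rewrite (le_trans (csum_bound GD)) //.
have -> : 4 * (cabs h ^+ 2 * M) = (4 * M * cabs h) * cabs h by ring.
rewrite ler_wpM2r ?cabs_ge0 // (@le_trans _ _ ((4 * M + 1) * cabs h)) //.
  by rewrite ler_wpM2r ?cabs_ge0 // lerDl.
rewrite mulrC -ler_pdivlMr ?ltW //.
by rewrite ltr_wpDl // mulr_ge0.
Qed.

Lemma hol_ps k c D : rapid c -> hol k D (ps c).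
Proof.
elim: k c => [|k IH] c Hc.
  by apply: hol0 => z _; exact: hder_continuous (hder_ps z Hc).
apply: (hol_intro (f' := ps (pder c))); first by move=> z _; exact: hder_ps.
exact/IH/rapid_pder.
Qed.

(* Locked, because the unfolding of values of the exponential during unification is very slow. *)
Fact cexp_key : unit. Proof. by []. Qed.
Definition cexp : C -> C := locked_with cexp_key
  (fun z => (expR (Re z))%:C * (cos (Im z) +i* sin (Im z))).

Lemma cexpE z : cexp z = (expR (Re z))%:C * (cos (Im z) +i* sin (Im z)).
Proof. by rewrite /cexp unlock. Qed.

Lemma cabs_cis (t : R) : cabs (cos t +i* sin t) = 1.
Proof. by rewrite /= cos2Dsin2 sqrtr1. Qed.

Lemma Re_cexp z : Re (cexp z) = expR (Re z) * cos (Im z).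
Proof. by rewrite cexpE ReZ. Qed.

Lemma Im_cexp z : Im (cexp z) = expR (Re z) * sin (Im z).
Proof. by rewrite cexpE ImZ. Qed.

Lemma cabs_cexp z : cabs (cexp z) = expR (Re z).
Proof. by rewrite cexpE cabsM cabs_cis mulr1 cabs_real ger0_norm // expR_ge0. Qed.

Lemma cexp_neq0 z : cexp z != 0.
Proof. by rewrite -cabs_gt0 cabs_cexp expR_gt0. Qed.

Lemma cexpD z h : cexp (z + h) = cexp z * cexp h.
Proof.
rewrite !cexpE ReD ImD expRD cosD sinD rmorphM.
by apply: eqC; rewrite !(ReM, ImM) /=; ring.
Qed.

Lemma cexp0 : cexp 0 = 1.
Proof. by rewrite cexpE /= expR0 cos0 sin0; apply: eqC; rewrite !(ReM, ImM) /=; ring. Qed.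

Lemma cexpN z : cexp (- z) = (cexp z)^-1.
Proof.
apply: (mulfI (cexp_neq0 z)); rewrite divff ?cexp_neq0 //.
by rewrite -cexpD subrr cexp0.
Qed.

Lemma cexp_conj z : cexp (conjc z) = conjc (cexp z).
Proof.
rewrite !cexpE Re_conj Im_conj cosN sinN.
by apply: eqC; rewrite !(ReM, ImM, Re_conj, Im_conj) /=; ring.
Qed.

(** By the functional equation only the point 0 matters; there cexp h - 1 - h is split into pieces
    controlled by the derivatives at 0 of the real exponential, sine and cosine. *)
Lemma hder_cexp z : hder cexp z (cexp z).
Proof.
have /rderP He := is_derive_expR (0 : R).
have /rderP Hs := is_derive_sin (0 : R).
have /rderP Hc := is_derive_cos (0 : R).
apply/hderP => e e0; set k := cabs (cexp z).
have k0 : 0 < k by rewrite cabs_gt0 cexp_neq0.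
(* The three pieces are at most [d], 2[d] and [d] times |h|, so the factor 5 leaves room. *)
pose d := e / (5 * k); have d0 : 0 < d by rewrite divr_gt0 // mulr_gt0.
have [r1 r10 H1] := He d d0; have [r2 r20 H2] := Hs d d0.
have [r3 r30 H3] := Hc d d0; have [r4 r40 H4] := Hc 1 ltr01.
have [r5 r50 H5] := Hs 1 ltr01.
exists (Num.min (Num.min r1 (Num.min r2 r3)) (Num.min (Num.min r4 r5) (d / 4))).
  by rewrite !lt_min r10 r20 r30 r40 r50 divr_gt0.
move=> h; rewrite !lt_min => /andP[/and3P[h1 h2 h3]] /andP[/andP[h4 h5] h6].
have -> : cexp (z + h) - cexp z - h * cexp z = cexp z * (cexp h - 1 - h).
  by rewrite cexpD; ring.
rewrite cabsM -/k; set a := Re h; set b := Im h.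
have ha : `|a| <= cabs h by exact: Re_le_cabs.
have hb : `|b| <= cabs h by exact: Im_le_cabs.
pose E := expR a - 1 - a; pose S := sin b - b; pose K := cos b - 1.
have bE : `|E| <= d * cabs h.
  have := H1 a (le_lt_trans ha h1); rewrite add0r expR0 mulr1 => /le_trans; apply.
  by rewrite ler_wpM2l // ltW.
have bS : `|S| <= d * cabs h.
  have := H2 b (le_lt_trans hb h2); rewrite add0r sin0 subr0 cos0 mulr1 => /le_trans; apply.
  by rewrite ler_wpM2l // ltW.
have bK : `|K| <= d * cabs h.
  have := H3 b (le_lt_trans hb h3); rewrite add0r cos0 sin0 oppr0 mulr0 subr0 => /le_trans; apply.
  by rewrite ler_wpM2l // ltW.
have bK1 : `|K| <= cabs h.
  have := H4 b (le_lt_trans hb h4); rewrite add0r cos0 sin0 oppr0 mulr0 subr0 mul1r => /le_trans.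
  exact.
have bS1 : `|S| <= cabs h.
  have := H5 b (le_lt_trans hb h5); rewrite add0r sin0 subr0 cos0 mulr1 mul1r => /le_trans.
  exact.
have -> : cexp h - 1 - h = E%:C * (cos b +i* sin b) + (K +i* S)
    + a%:C * (K +i* (S + b)).
  by rewrite /E /K /S cexpE -/a -/b; apply: eqC; rewrite !(ReD,ImD,ReN,ImN,ReM,ImM) /=; rewrite /a /b; ring.
have b1 : cabs (E%:C * (cos b +i* sin b)) <= d * cabs h.
  by rewrite cabsM cabs_cis mulr1 cabs_real.
have b2 : cabs (K +i* S) <= 2 * (d * cabs h).
  by rewrite (le_trans (cabs_le_ReIm _)) //= mulr2n mulrDl !mul1r lerD.
have b3 : cabs (a%:C * (K +i* (S + b))) <= cabs h * (3 * cabs h).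
  rewrite cabsM cabs_real ler_pM ?cabs_ge0 //.
  rewrite (le_trans (cabs_le_ReIm _)) //=.
  have := ler_normD S b => hS; lra.
have b4 : cabs h * (3 * cabs h) <= d * cabs h.
  rewrite mulrC ler_wpM2r ?cabs_ge0 //.
  have := cabs_ge0 h; lra.
have b5 := cabsD (E%:C * (cos b +i* sin b) + (K +i* S)) (a%:C * (K +i* (S + b))).
have b6 := cabsD (E%:C * (cos b +i* sin b)) (K +i* S).
have -> : e * cabs h = k * (5 * (d * cabs h)).
  by rewrite /d; field; rewrite gt_eqF.
rewrite ler_wpM2l ?(ltW k0) //.
have := mulr_ge0 (ltW d0) (cabs_ge0 h); lra.
Qed.

Lemma hol_cexp k D : hol k D cexp.
Proof.
elim: k => [|k IH].
  by apply: hol0 => z _; exact: hder_continuous (hder_cexp z).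
by apply: (hol_intro (f' := cexp)) => // z _; exact: hder_cexp.
Qed.

End Series.

Opaque csum ps.

(** * Theta functions and the Lambert series *)

Section QPochhammer.
Variable R : realType.
Local Notation C := R[i].
Local Notation Ct := (R[i]^o).
Implicit Types (z w v : C) (r : R).

Lemma hder_unique (f : C -> C) z d d' : hder f z d -> hder f z d' -> d = d'.
Proof. by move=> [_ <-] [_ <-]. Qed.

Lemma hder_ext (f g : C -> C) z d : f =1 g -> hder f z d -> hder g z d.
Proof. by move=> /funext ->. Qed.

Lemma ps_at0 (c : nat -> C) : rapid c -> ps c 0 = c 0%N.
Proof.
move=> Hc; have [M HM] := rapid_gdom Hc (lexx 0).
have H0 : cabs (0 : C) <= 0 by rewrite cabs0.
rewrite psE (csum_recl (HM 0 H0)) expr0 mulr1.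
have -> : csum (fun k => c k.+1 * 0 ^+ k.+1) = csum (fun=> 0 : C).
  by apply: eq_csum => k; rewrite exprS mul0r mulr0.
by rewrite csum0 addr0.
Qed.

Variable q : R.
Hypothesis q01 : 0 < q < 1.

Let q0 : 0 < q. Proof. by case/andP: q01. Qed.
Let q1 : q < 1. Proof. by case/andP: q01. Qed.

(** Euler's expansion of the product of the 1 - q^j v, j >= 1: the coefficient of v^k is (-1)^k
    q^(k(k+1)/2) / ((1 - q) ... (1 - q^k)). *)
Fixpoint qpc (k : nat) : R :=
  if k is k'.+1 then - (q ^+ k / (1 - q ^+ k)) * qpc k' else 1.

Definition qc k : C := (qpc k)%:C.

Let qk1 k : 0 < 1 - q ^+ k.+1.
Proof. by rewrite subr_gt0 exprn_ilt1 // ltW. Qed.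

Lemma qpcS k : qpc k.+1 = - (q ^+ k.+1 / (1 - q ^+ k.+1)) * qpc k.
Proof. by []. Qed.

(** The ratio of consecutive weighted coefficients is at most q^(k+1) r/(1 - q), which tends to 0.
    Beyond some K the sequence is nonincreasing, so the sum of its first terms bounds it. *)
Lemma rapid_qc : rapid qc.
Proof.
move=> r r0; pose b k := cabs (qc k) * r ^+ k.
have b0 k : 0 <= b k by rewrite mulr_ge0 ?cabs_ge0 ?exprn_ge0.
have bS k : b k.+1 <= q ^+ k.+1 * (r / (1 - q)) * b k.
  have A : `|qpc k.+1| = q ^+ k.+1 / (1 - q ^+ k.+1) * `|qpc k|.
    rewrite qpcS normrM normrN; congr (_ * _).
    by rewrite ger0_norm // divr_ge0 ?exprn_ge0 // ltW.
  rewrite /b /qc !cabs_real A.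
  have -> : q ^+ k.+1 / (1 - q ^+ k.+1) * `|qpc k| * r ^+ k.+1 =
     (q ^+ k.+1 * (r * (`|qpc k| * r ^+ k))) * (1 - q ^+ k.+1)^-1.
    by rewrite [r ^+ k.+1]exprS; ring.
  have -> : q ^+ k.+1 * (r / (1 - q)) * (`|qpc k| * r ^+ k) =
     (q ^+ k.+1 * (r * (`|qpc k| * r ^+ k))) * (1 - q)^-1 by ring.
  rewrite ler_wpM2l //; first by rewrite !mulr_ge0 // exprn_ge0 // ltW.
  have qq : 0 < 1 - q by rewrite subr_gt0.
  rewrite lef_pV2 ?posrE // lerD2l lerN2.
  by rewrite exprS ler_piMr ?exprn_ile1 // ltW.
have [K HK] : exists K, forall k, (K <= k)%N -> q ^+ k.+1 * (r / (1 - q)) <= 1.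
  have c0 : (fun k => q ^+ k) @ \oo --> (0 : R) by apply: cvg_expr; rewrite gtr0_norm.
  have k0 : 0 < r / (1 - q) + 1 by rewrite ltr_wpDl // divr_ge0 // subr_ge0 ltW.
  have := c0; move/cvgrPdist_lt => /(_ (r / (1 - q) + 1)^-1).
  rewrite invr_gt0 => /(_ k0) [K _ H]; exists K => k Kk.
  have := H k.+1 (leqW Kk); rewrite sub0r normrN ger0_norm; last by rewrite exprn_ge0 // ltW.
  move=> H1.
  rewrite (@le_trans _ _ (q ^+ k.+1 * (r / (1 - q) + 1))) //.
    by rewrite ler_wpM2l ?lerDl // exprn_ge0 // ltW.
  by rewrite -ler_pdivlMr // mul1r ltW.
exists (\sum_(i < K.+1) b i) => k; rewrite -/(b k).
have bM i : (i <= K)%N -> b i <= \sum_(i < K.+1) b i.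
  move=> iK; rewrite (bigD1 (Ordinal (iK : (i < K.+1)%N))) //= lerDl.
  by apply: sumr_ge0 => j _; exact: b0.
have [kK|kK] := leqP k K; first exact: bM.
have dec i : (K <= i)%N -> b i.+1 <= b i.
  by move=> /HK Ki; rewrite (le_trans (bS _)) // ler_piMl.
rewrite (@le_trans _ _ (b K)) ?bM //.
elim: k kK => [//|k IH]; rewrite ltnS leq_eqVlt => /predU1P[<-|Kk]; first exact: dec.
by rewrite (le_trans (dec _ _)) ?IH // ltnW.
Qed.

Definition qP v : C := ps qc v.

Lemma hol_qP k D : hol k D qP.
Proof. exact: hol_ps rapid_qc. Qed.

Lemma qP0 : qP 0 = 1.
Proof. by rewrite /qP (ps_at0 rapid_qc). Qed.

Lemma qP_conj v : qP (conjc v) = conjc (qP v).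
Proof.
have [M HM] := rapid_gdom rapid_qc (cabs_ge0 v).
rewrite /qP !psE -(csum_conj (HM v (lexx _))); apply: eq_csum => k.
by rewrite conjM rmorphXn /= oppr0.
Qed.

(* The q-difference equation of the product of the 1 - q^j v, j >= 1. *)
Lemma qP_step v : qP v = (1 - q%:C * v) * qP (q%:C * v).
Proof.
have r0 := cabs_ge0 v; have [M HM] := rapid_gdom rapid_qc r0.
have qv : cabs (q%:C * v) <= cabs v.
  by rewrite cabsM cabs_real gtr0_norm // ler_piMl ?cabs_ge0 // ltW.
have G1 := HM v (lexx _); have G2 := HM _ qv.
have E : qP (q%:C * v) - qP v = q%:C * v * qP (q%:C * v).
  rewrite /qP !psE -(csumZ _ G2) (csum_recl G1) (csum_recl G2) !expr0.
  have S u : gdom u M -> gdom (fun k => u k.+1) M.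
    move=> Gu k; rewrite (le_trans (Gu _)) // exprS ler_wpM2l ?(gdom_ge0 Gu) //.
    by rewrite ler_piMl ?exprn_ge0 ?invr_ge0 // invf_le1 // ler1n.
  rewrite opprD addrACA subrr add0r -mulN1r -(csumZ _ (S _ G1)).
  have GN : gdom (fun k => -1 * (qc k.+1 * v ^+ k.+1)) M.
    by move=> k; rewrite mulN1r cabsN; exact: (S _ G1 k).
  rewrite -(csumD (S _ G2) GN); apply: eq_csum => k.
  have E1 : qc k.+1 * (1 - q%:C ^+ k.+1) = - q%:C ^+ k.+1 * qc k.
    rewrite /qc -rmorphXn -(rmorph1 (real_complex R)) -rmorphB -rmorphN -!rmorphM; congr (_%:C).
    by rewrite qpcS; field; rewrite gt_eqF.
  transitivity (- (qc k.+1 * (1 - q%:C ^+ k.+1)) * v ^+ k.+1).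
    by rewrite exprMn; ring.
  by rewrite E1 exprMn !exprS; ring.
have -> : qP v = qP (q%:C * v) - (qP (q%:C * v) - qP v) by ring.
by rewrite E; ring.
Qed.

Lemma qP_iter n v :
  qP v = \prod_(j < n) (1 - q%:C ^+ j.+1 * v) * qP (q%:C ^+ n * v).
Proof.
elim: n => [|n IH]; first by rewrite big_ord0 expr0 !mul1r.
by rewrite big_ord_recr /= {1}IH qP_step !exprS -!mulrA.
Qed.

Lemma cvg_qpow v : (fun n => q%:C ^+ n * v : Ct) @ \oo --> (0 : Ct).
Proof.
apply/cvgCP => e e0.
have c0 : (fun k => q ^+ k) @ \oo --> (0 : R).
  by apply: cvg_expr; rewrite gtr0_norm.
have k0 : 0 < cabs v + 1 by rewrite ltr_wpDl // cabs_ge0.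
move/cvgrPdist_lt : c0 => /(_ (e / (cabs v + 1))); rewrite divr_gt0 // => /(_ isT).
apply: filterS => n; rewrite sub0r normrN gtr0_norm ?exprn_gt0 // => H.
rewrite subr0 cabsM cabsX cabs_real gtr0_norm //.
rewrite (@le_lt_trans _ _ (q ^+ n * (cabs v + 1))) //.
  by rewrite ler_wpM2l ?lerDl // exprn_ge0 // ltW.
by rewrite -ltr_pdivlMr.
Qed.

Lemma cvg_qpow_cont (f : C -> C) v : cont f 0 ->
  (fun n => f (q%:C ^+ n * v) : Ct) @ \oo --> (f 0 : Ct).
Proof. by move=> cf; apply: cvg_comp (@cvg_qpow v) _; exact: cf. Qed.

(** Iterating the q-difference equation moves the argument to q^N v, near 0, where the value is near
    1; the remaining finite product is nonzero by hypothesis. The infinite product itself never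
    appears. *)
Lemma qP_neq0 v : (forall j, 1 - q%:C ^+ j.+1 * v != 0) -> qP v != 0.
Proof.
move=> H.
have c1 : (fun n => qP (q%:C ^+ n * v) : Ct) @ \oo --> (qP 0 : Ct).
  by apply: cvg_qpow_cont; exact: (hol_continuous (@hol_qP 0 setT)).
move/cvgCP : c1 => /(_ 1 ltr01) [N _ /(_ N (leqnn N)) HN].
rewrite (qP_iter N) mulf_neq0 //; first by apply/prodf_neq0 => j _; exact: H.
have {}HN : cabs (qP (q%:C ^+ N * v) - qP 0) < 1 := HN.
by apply/eqP => E; move: HN; rewrite E qP0 sub0r cabsN cabs1 ltxx.
Qed.

(** Composition with the exponential turns the scaling v -> q v into a translation by log q. [qp1]
    and [qp2] are the first two derivatives in z, which act on the power series as v d/dv. *)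
Definition qp z : C := qP (cexp z).
Definition qp1 z : C := cexp z * ps (pder qc) (cexp z).
Definition qp2 z : C :=
  cexp z * ps (pder qc) (cexp z) + cexp z ^+ 2 * ps (pder (pder qc)) (cexp z).

Lemma qp_conj z : qp (conjc z) = conjc (qp z).
Proof. by rewrite /qp cexp_conj qP_conj. Qed.

Lemma ps_conj (c : nat -> C) v : rapid c -> (forall k, conjc (c k) = c k) ->
  ps c (conjc v) = conjc (ps c v).
Proof.
move=> Hc cc; have [M HM] := rapid_gdom Hc (cabs_ge0 v).
rewrite !psE -(csum_conj (HM _ (lexx _))); apply: eq_csum => k.
by rewrite [RHS]conjM conjX cc.
Qed.

Lemma pder_conj (c : nat -> C) k : (forall k, conjc (c k) = c k) ->
  conjc (pder c k) = pder c k.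
Proof. by move=> cc; rewrite /pder conjM cc conjc_nat. Qed.

Lemma qc_conj k : conjc (qc k) = qc k.
Proof. exact: conjc_real. Qed.

Lemma qp1_conj z : qp1 (conjc z) = conjc (qp1 z).
Proof.
rewrite /qp1 cexp_conj [RHS]conjM ps_conj //; first exact: rapid_pder rapid_qc.
by move=> k; apply: pder_conj; exact: qc_conj.
Qed.

Lemma qp2_conj z : qp2 (conjc z) = conjc (qp2 z).
Proof.
have r1 := rapid_pder rapid_qc; have r2 := rapid_pder r1.
have c1 k : conjc (pder qc k) = pder qc k by apply: pder_conj; exact: qc_conj.
have c2 k : conjc (pder (pder qc) k) = pder (pder qc) k by exact: pder_conj.
rewrite /qp2 cexp_conj !ps_conj // [RHS]conjD; congr (_ + _).
  by rewrite [RHS]conjM.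
by rewrite [RHS]conjM conjX.
Qed.

Lemma qp_per z w : cexp z = cexp w -> qp z = qp w.
Proof. by rewrite /qp => ->. Qed.

Lemma hder_qp z : hder qp z (qp1 z).
Proof.
rewrite /qp1 mulrC; apply: (hder_comp (f := qP)) (hder_cexp z).
exact: hder_ps rapid_qc.
Qed.

Lemma hder_qp1 z : hder qp1 z (qp2 z).
Proof.
rewrite (_ : qp2 z = cexp z * ps (pder qc) (cexp z) +
   cexp z * (ps (pder (pder qc)) (cexp z) * cexp z)); last by rewrite /qp2; ring.
apply: hderM; first exact: hder_cexp.
apply: (hder_comp (f := ps (pder qc))) (hder_cexp z).
exact: hder_ps (rapid_pder rapid_qc).
Qed.

Lemma hol_qp k D : hol k D qp.
Proof. by apply: (@hol_comp R k D setT) => //; [exact: hol_qP|exact: hol_cexp]. Qed.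

Variable a : R.
Hypothesis qa : q = expR a.

Lemma cexp_shift z : cexp (z + a%:C) = q%:C * cexp z.
Proof.
rewrite cexpD mulrC; congr (_ * _).
apply: eqC; rewrite ?Re_cexp ?Im_cexp /= ?qa ?cos0 ?sin0 ?mulr1 ?mulr0 //.
Qed.

Lemma qp_step z : qp z = (1 - cexp (z + a%:C)) * qp (z + a%:C).
Proof. by rewrite /qp cexp_shift; exact: qP_step. Qed.

Lemma hder_shift (f : C -> C) (b : C) z d : hder f (z + b) d -> hder (fun w => f (w + b)) z d.
Proof.
move=> hf; have := hderD (hder_id z) (hder_cst b z); rewrite addr0 => hg.
by have := hder_comp (f := f) (g := fun w => w + b) hf hg; rewrite mulr1.
Qed.

Let e1 z : hder (fun w => 1 - cexp (w + a%:C)) z (- cexp (z + a%:C)).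
Proof.
rewrite -[- cexp _]add0r; apply: hderD; first exact: hder_cst.
by apply: hderN; apply: hder_shift; exact: hder_cexp.
Qed.

Lemma qp1_step z : qp1 z = - cexp (z + a%:C) * qp (z + a%:C)
  + (1 - cexp (z + a%:C)) * qp1 (z + a%:C).
Proof.
apply: (hder_unique (hder_qp z)); apply: hder_ext (fun w => esym (qp_step w)) _.
by apply: hderM; [exact: e1|apply: hder_shift; exact: hder_qp].
Qed.

Lemma qp2_step z : qp2 z = - cexp (z + a%:C) * qp (z + a%:C)
  - 2 * cexp (z + a%:C) * qp1 (z + a%:C) + (1 - cexp (z + a%:C)) * qp2 (z + a%:C).
Proof.
set w := z + a%:C.
rewrite (_ : _ + _ = (- cexp w * qp w + - cexp w * qp1 w) +
  (- cexp w * qp1 w + (1 - cexp w) * qp2 w)); last by ring.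
apply: (hder_unique (hder_qp1 z)); apply: hder_ext (fun w => esym (qp1_step w)) _.
apply: hderD.
  apply: hderM; first by apply: hderN; apply: hder_shift; exact: hder_cexp.
  by apply: hder_shift; exact: hder_qp.
by apply: hderM; [exact: e1|apply: hder_shift; exact: hder_qp1].
Qed.

(** [ql1] and [ql2] are the first two derivatives of log [qp], written without a logarithm. *)
Definition ql1 z : C := qp1 z / qp z.
Definition ql2 z : C := (qp2 z * qp z - qp1 z ^+ 2) / qp z ^+ 2.

Lemma cexp_shifts z n : cexp (z + (a *+ n)%:C) = q%:C ^+ n * cexp z.
Proof.
elim: n => [|n IH]; first by rewrite mulr0n addr0 expr0 mul1r.
by rewrite mulrSr rmorphD addrA cexp_shift IH exprS mulrA.
Qed.

Definition regular z := forall j : nat, 1 - q%:C ^+ j.+1 * cexp z != 0.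

Lemma regular_qp z : regular z -> qp z != 0.
Proof. exact: qP_neq0. Qed.

Lemma regular_shift z : regular z -> regular (z + a%:C).
Proof. by move=> Hz j; rewrite cexp_shift mulrA -exprSr. Qed.

Lemma ql1_step z : regular z ->
  ql1 z = - (cexp (z + a%:C) / (1 - cexp (z + a%:C))) + ql1 (z + a%:C).
Proof.
move=> Hz; have := regular_qp (regular_shift Hz); have := Hz 0%N.
rewrite expr1 -cexp_shift /ql1 (qp1_step z) (qp_step z) => n1 n2.
by field; rewrite n1 n2.
Qed.

Lemma ql2_step z : regular z ->
  ql2 z = - (cexp (z + a%:C) / (1 - cexp (z + a%:C)) ^+ 2) + ql2 (z + a%:C).
Proof.
move=> Hz; have := regular_qp (regular_shift Hz); have := Hz 0%N.
rewrite expr1 -cexp_shift /ql2 (qp2_step z) (qp1_step z) (qp_step z) => n1 n2.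
by field; rewrite n1 n2.
Qed.

Lemma regular_shifts z n : regular z -> regular (z + (a *+ n)%:C).
Proof. by move=> Hz j; rewrite cexp_shifts mulrA -exprD addSn. Qed.

(** Each translation by [a] splits off one term of a Lambert series. As e^z is multiplied by q^n,
    the remainder tends to the value at v = 0, which is 0 ([cvg_ql1]); the same holds for [ql2]. *)
Lemma ql1_iter z n : regular z -> ql1 z =
  - (\sum_(j < n) q%:C ^+ j.+1 * cexp z / (1 - q%:C ^+ j.+1 * cexp z))
  + ql1 (z + (a *+ n)%:C).
Proof.
move=> Hz; elim: n => [|n IH]; first by rewrite big_ord0 oppr0 add0r mulr0n addr0.
rewrite IH (ql1_step (regular_shifts n Hz)) big_ord_recr /=.
have -> : z + (a *+ n)%:C + a%:C = z + (a *+ n.+1)%:C by rewrite mulrSr rmorphD addrA.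
by rewrite cexp_shifts; ring.
Qed.

Lemma ql2_iter z n : regular z -> ql2 z =
  - (\sum_(j < n) q%:C ^+ j.+1 * cexp z / (1 - q%:C ^+ j.+1 * cexp z) ^+ 2)
  + ql2 (z + (a *+ n)%:C).
Proof.
move=> Hz; elim: n => [|n IH]; first by rewrite big_ord0 oppr0 add0r mulr0n addr0.
rewrite IH (ql2_step (regular_shifts n Hz)) big_ord_recr /=.
have -> : z + (a *+ n)%:C + a%:C = z + (a *+ n.+1)%:C by rewrite mulrSr rmorphD addrA.
by rewrite cexp_shifts; ring.
Qed.

Let L1 v : C := v * ps (pder qc) v.
Let L2 v : C := v * ps (pder qc) v + v ^+ 2 * ps (pder (pder qc)) v.

Let holL1 k D : hol k D L1.
Proof.
by apply: holM; [exact: hol_id|exact: hol_ps (rapid_pder rapid_qc)].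
Qed.

Let holL2 k D : hol k D L2.
Proof.
apply: holD; first exact: holL1.
by apply: holM; [apply: holX; exact: hol_id|exact: hol_ps (rapid_pder (rapid_pder rapid_qc))].
Qed.

Lemma cvg_ql1 z : (fun n => ql1 (z + (a *+ n)%:C) : Ct) @ \oo --> (0 : Ct).
Proof.
have -> : (fun n => ql1 (z + (a *+ n)%:C) : Ct) =
    fun n => (fun v => L1 v * (qP v)^-1) (q%:C ^+ n * cexp z).
  by apply/funext => n; rewrite /ql1 /qp1 /qp cexp_shifts.
rewrite (_ : 0 = (fun v => L1 v * (qP v)^-1) 0); last by rewrite /L1 !mul0r.
apply: (@cvg_qpow_cont (fun v => L1 v * (qP v)^-1) (cexp z)); apply: (hol_continuous (k := 0) (D := [set 0])) => //.
apply: holM; first exact: holL1.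
by apply: holV; [move=> w ->; rewrite qP0 oner_neq0|exact: hol_qP].
Qed.

Lemma cvg_ql2 z : (fun n => ql2 (z + (a *+ n)%:C) : Ct) @ \oo --> (0 : Ct).
Proof.
have -> : (fun n => ql2 (z + (a *+ n)%:C) : Ct) =
    fun n => (fun v => (L2 v * qP v + - (L1 v ^+ 2)) * (qP v ^+ 2)^-1) (q%:C ^+ n * cexp z).
  by apply/funext => n; rewrite /ql2 /qp2 /qp1 /qp cexp_shifts.
rewrite (_ : 0 = (fun v => (L2 v * qP v + - (L1 v ^+ 2)) * (qP v ^+ 2)^-1) 0); last first.
  by rewrite /L1 /L2 !mul0r expr0n !mul0r addr0 mul0r oppr0 addr0 mul0r.
apply: (@cvg_qpow_cont (fun v => (L2 v * qP v + - (L1 v ^+ 2)) * (qP v ^+ 2)^-1) (cexp z)); apply: (hol_continuous (k := 0) (D := [set 0])) => //.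
apply: holM.
  apply: holD; first by apply: holM; [exact: holL2|exact: hol_qP].
  by apply: holN; apply: holX; exact: holL1.
apply: holV; first by move=> w ->; rewrite qP0 expr1n oner_neq0.
by apply: holX; exact: hol_qP.
Qed.

End QPochhammer.

Opaque qP qp1 qp2 qp.

(** * The Lambert series and the choice of the nome *)

Section Lambert.
Variable R : realType.
Local Notation C := R[i].
Variables (u : C).
Hypothesis u1 : cabs u = 1.
Local Notation k := (Re u).
Hypothesis k0 : 1 / 2 <= k.
Hypothesis k1 : k < 1.
Implicit Types (x y Q : R).

(** The squared sine of the argument of [u]. Since |1 - x u|^2 = (x - k)^2 + s2, it bounds all
    denominators from below, uniformly in x. *)
Let s2 : R := 1 - k ^+ 2.

Let s20 : 0 < s2.
Proof.
have -> : s2 = (1 - k) * (1 + k) by rewrite /s2; ring.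
by rewrite mulr_gt0 //; move: k0 k1 => h0 h1; lra.
Qed.

Let s2le : s2 <= 3 / 4.
Proof.
have -> : s2 = 3 / 4 - (k - 1 / 2) * (k + 1 / 2) by rewrite /s2; field.
by rewrite gerBl mulr_ge0 //; move: k0 => h0; lra.
Qed.

Let uu : k ^+ 2 + Im u ^+ 2 = 1.
Proof. by rewrite -cabs_sqr u1 expr1n. Qed.

Definition den x : R := 1 - 2 * k * x + x ^+ 2.

Lemma den_ge x : s2 <= den x.
Proof. by rewrite /s2 /den; have := sqr_ge0 (x - k); rewrite !expr2; lra. Qed.

Lemma den_gt0 x : 0 < den x.
Proof. exact: lt_le_trans (den_ge x). Qed.

Lemma den_abs x : cabs (1 - x%:C * u) ^+ 2 = den x.
Proof.
rewrite cabs_sqr !(ReD, ImD, ReN, ImN, ReZ, ImZ) /= /den.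
have -> : (0 - x * Im u) ^+ 2 = x ^+ 2 * (1 - k ^+ 2).
  by rewrite -uu; ring.
ring.
Qed.

Lemma one_sub_neq0 x : 1 - x%:C * u != 0.
Proof.
rewrite -cabs_eq0; apply/eqP => E; have := den_abs x; rewrite E expr0n /= => F.
by have := den_gt0 x; rewrite -F ltxx.
Qed.

Lemma den_conj x : (den x)%:C = (1 - x%:C * u) * conjc (1 - x%:C * u).
Proof.
have E : x ^+ 2 = x ^+ 2 * (k ^+ 2 + Im u ^+ 2) by rewrite uu mulr1.
rewrite /den; apply: eqC; last first.
  by rewrite !(ReM, ImM, ReD, ImD, ReN, ImN, Re_conj, Im_conj) /=; ring.
by rewrite E !(ReM, ImM, ReD, ImD, ReN, ImN, Re_conj, Im_conj) /=; ring.
Qed.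

Definition eta x : R := Re (x%:C * u / (1 - x%:C * u) ^+ 2).

(** Obtained by multiplying with the conjugate denominators. For x > 0 the sign is that of k(1 +
    x^2) - 2x: positive for small x, negative near x = 1 because k < 1. This is the source of the
    sign change of the sum. *)
Lemma etaE x : eta x = x * (k * (1 + x ^+ 2) - 2 * x) / den x ^+ 2.
Proof.
have n0 := one_sub_neq0 x.
have E : x%:C * u / (1 - x%:C * u) ^+ 2 =
   ((den x)^-1 ^+ 2)%:C * (x%:C * u * (conjc (1 - x%:C * u)) ^+ 2).
  have D := den_conj x.
  have c0 : conjc (1 - x%:C * u) != 0 by rewrite conjc_eq0.
  rewrite realCX realCV D; move: c0 n0.
  generalize (conjc (1 - x%:C * u)) (1 - x%:C * u) => c w c0 n0.
  by field; rewrite c0 n0.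
rewrite /eta E ReZ.
have -> : Re (x%:C * u * conjc (1 - x%:C * u) ^+ 2) = x * (k * (1 + x ^+ 2) - 2 * x).
  rewrite expr2 !(ReM, ImM, ReD, ImD, ReN, ImN, Re_conj, Im_conj) /=.
  have -> : k * (1 + x ^+ 2) = k + k * x ^+ 2 * (k ^+ 2 + Im u ^+ 2) by rewrite uu; ring.
  have -> : 2 * x = 2 * x * (k ^+ 2 + Im u ^+ 2) by rewrite uu; ring.
  by rewrite !expr2; ring.
by rewrite exprVn mulrC.
Qed.

Lemma eta_continuous : continuous eta.
Proof.
rewrite (_ : eta = fun x => x * (k * (1 + x ^+ 2) - 2 * x) / den x ^+ 2); last exact/funext/etaE.
move=> x; apply: cvgM.
  apply: cvgM; first exact: cvg_id.
  apply: cvgB; last by apply: cvgM; [exact: cvg_cst|exact: cvg_id].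
  apply: cvgM; first exact: cvg_cst.
  by apply: cvgD; [exact: cvg_cst|exact: exprn_continuous].
apply: cvgV; first by rewrite expf_neq0 // gt_eqF // den_gt0.
apply: (@continuous_comp _ _ _ den (fun y => y ^+ 2)); last exact: exprn_continuous.
apply: cvgD; last exact: exprn_continuous.
by apply: cvgB; [exact: cvg_cst|apply: cvgM; [exact: cvg_cst|exact: cvg_id]].
Qed.

Lemma eta_bound x : 0 <= x <= 1 -> `|eta x| <= 4 / s2 ^+ 2 * x.
Proof.
move=> /andP[x0 x1]; rewrite etaE normrM normrM (ger0_norm x0) normfV.
rewrite (ger0_norm (exprn_ge0 _ (ltW (den_gt0 _)))).
rewrite -mulrA mulrC ler_wpM2r // ler_pM ?invr_ge0 ?exprn_ge0 //.
- by rewrite ltW // den_gt0.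
- by move: k0 k1 => h0 h1; rewrite ler_norml; apply/andP; split; nra.
- rewrite lef_pV2 ?posrE ?exprn_gt0 ?den_gt0 //.
  by rewrite lerXn2r ?nnegrE ?den_ge // ltW // den_gt0.
Qed.

(** From k >= 1/2 one gets k(1 + x^2) > 1/2 >= 2x. Hence the bound 1/4, which makes every term of
    the sum at Q = 1/4 positive. *)
Lemma eta_gt0 x : 0 < x -> x <= 1 / 4 -> 0 < eta x.
Proof.
move=> x0 x4; rewrite etaE divr_gt0 ?exprn_gt0 ?den_gt0 // mulr_gt0 //.
move: k0 k1 => h0 h1; nra.
Qed.

Definition Hpart (N : nat) Q : R := \sum_(j < N) eta (Q ^+ (2 * j + 1)).
Definition Hsum Q : R := limn (series (fun j => eta (Q ^+ (2 * j + 1)))).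

Lemma HpartE Q : series (fun j => eta (Q ^+ (2 * j + 1))) = Hpart^~ Q.
Proof. by apply/funext => N; rewrite /series /= big_mkord. Qed.

Let M : R := 4 / s2 ^+ 2.

Let M0 : 0 < M. Proof. by rewrite divr_gt0 // exprn_gt0. Qed.

Lemma eta_term b Q j : 0 <= Q <= b -> b < 1 ->
  `|eta (Q ^+ (2 * j + 1))| <= M * b ^+ j.
Proof.
move=> /andP[Q0 Qb] b1; have Q1 : Q <= 1 by rewrite (le_trans Qb) // ltW.
rewrite (le_trans (eta_bound _)) ?exprn_ge0 ?exprn_ile1 //.
rewrite ler_wpM2l ?(ltW M0) // (@le_trans _ _ (Q ^+ j)) //.
  by rewrite ler_wiXn2l // mul2n -addnn -addnA leq_addr.
by rewrite lerXn2r // nnegrE // (le_trans Q0).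
Qed.

Lemma Hcvg Q : 0 <= Q < 1 -> Hpart^~ Q @ \oo --> Hsum Q.
Proof.
move=> /andP[Q0 Q1]; rewrite /Hsum -HpartE.
apply: normed_cvg.
apply: (@series_le_cvg _ _ (geometric M Q)) => [n|n|n|].
- exact: normr_ge0.
- by rewrite /= mulr_ge0 ?exprn_ge0 // ltW.
- by rewrite /= (eta_term n (b := Q)) // Q0 lexx.
- by apply: is_cvg_geometric_series; rewrite ger0_norm.
Qed.

(** The terms are dominated by those of a geometric series of ratio b, uniformly in Q <= b. This
    uniformity gives the continuity of [Hsum] by an e/3 argument. *)
Lemma Htail b Q N : 0 <= Q <= b -> b < 1 ->
  `|Hsum Q - Hpart N Q| <= M * b ^+ N / (1 - b).
Proof.
move=> Qb b1; have /andP[Q0 Qb'] := Qb.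
have b0 : 0 <= b by exact: le_trans Qb'.
have bb : 0 < 1 - b by rewrite subr_gt0.
have cH : Hpart^~ Q @ \oo --> Hsum Q by apply: Hcvg; rewrite Q0 (le_lt_trans Qb').
have c1 : (fun n => `|Hpart n Q - Hpart N Q|) @ \oo --> `|Hsum Q - Hpart N Q|.
  by apply: cvg_norm; apply: cvgB => //; exact: cvg_cst.
apply: (cvgr_to_le c1).
exists N => // n /= Nn; rewrite -(subnKC Nn).
have T m : `|Hpart (N + m) Q - Hpart N Q| <= M * b ^+ N * (1 - b ^+ m) / (1 - b).
  elim: m => [|m IH]; first by rewrite addn0 subrr normr0 expr0 subrr mulr0 mul0r.
  have -> : Hpart (N + m.+1) Q - Hpart N Q =
     (Hpart (N + m) Q - Hpart N Q) + eta (Q ^+ (2 * (N + m) + 1)).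
    by rewrite addnS /Hpart big_ord_recr /=; ring.
  have -> : M * b ^+ N * (1 - b ^+ m.+1) / (1 - b) =
     M * b ^+ N * (1 - b ^+ m) / (1 - b) + M * b ^+ (N + m).
    by rewrite exprD exprS; field; rewrite gt_eqF.
  by rewrite (le_trans (ler_normD _ _)) // lerD //; exact: eta_term.
rewrite (le_trans (T _)) // ler_wpM2r ?invr_ge0 ?(ltW bb) //.
have MN : 0 <= M * b ^+ N by rewrite mulr_ge0 ?exprn_ge0 // ltW.
by apply: ler_piMr => //; rewrite gerBl exprn_ge0.
Qed.

Lemma Hpart_continuous N : continuous (Hpart N).
Proof.
elim: N => [|N IH].
  rewrite (_ : Hpart 0 = fun=> 0); first exact: cst_continuous.
  by apply/funext => Q; rewrite /Hpart big_ord0.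
rewrite (_ : Hpart N.+1 = fun Q => Hpart N Q + eta (Q ^+ (2 * N + 1))); last first.
  by apply/funext => Q; rewrite /Hpart big_ord_recr.
move=> Q; apply: cvgD; first exact: IH.
apply: (@continuous_comp _ _ _ (fun Q => Q ^+ (2 * N + 1)) eta); first exact: exprn_continuous.
exact: eta_continuous.
Qed.

Lemma Hsum_continuous a b : 0 <= a -> b < 1 -> {within `[a, b], continuous Hsum}.
Proof.
move=> a0 b1; apply/subspace_continuousP => Q /=; rewrite in_itv /= => /andP[aQ Qb].
have b0 : 0 <= b by rewrite (le_trans a0) // (le_trans aQ).
have bb : 0 < 1 - b by rewrite subr_gt0.
apply/cvgrPdist_lt => e e0.
have [N HN] : exists N, M * b ^+ N / (1 - b) < e / 3.
  have c0 : (fun k => b ^+ k) @ \oo --> (0 : R) by apply: cvg_expr; rewrite ger0_norm.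
  move/cvgrPdist_lt : c0 => /(_ (e / 3 * (1 - b) / M)).
  rewrite !divr_gt0 ?mulr_gt0 ?invr_gt0 // => /(_ isT)[N _ /(_ N (leqnn N)) /=].
  rewrite sub0r normrN ger0_norm ?exprn_ge0 // => H; exists N.
  by rewrite ltr_pdivrMr // mulrC -ltr_pdivlMr.
have := @Hpart_continuous N Q; move/cvgrPdist_lt => /(_ (e / 3)).
rewrite divr_gt0 // => /(_ isT) HQ.
rewrite /within /=; apply: filterS HQ => y /= Hy.
rewrite in_itv /= => /andP[ay yb].
have T1 := Htail N (_ : 0 <= Q <= b) b1; have T2 := Htail N (_ : 0 <= y <= b) b1.
have {}T1 := le_lt_trans (T1 ltac:(by rewrite (le_trans a0 aQ) Qb)) HN.
have {}T2 := le_lt_trans (T2 ltac:(by rewrite (le_trans a0 ay) yb)) HN.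
have -> : Hsum Q - Hsum y =
  (Hsum Q - Hpart N Q) + (Hpart N Q - Hpart N y) - (Hsum y - Hpart N y) by ring.
have -> : e = e / 3 + e / 3 + e / 3 by field.
rewrite (le_lt_trans (ler_normB _ _)) // ltrD //.
by rewrite (le_lt_trans (ler_normD _ _)) // ltrD.
Qed.

Lemma Hsum_pos : 0 <= Hsum (1 / 4).
Proof.
have c : Hpart^~ (1 / 4) @ \oo --> Hsum (1 / 4) by apply: Hcvg; apply/andP; split; lra.
apply: (cvgr_to_ge c); near=> N; apply: sumr_ge0 => j _.
apply: ltW; apply: eta_gt0; first by rewrite exprn_gt0 //; lra.
by rewrite addn1 exprS ler_piMr // exprn_ile1 //; lra.
Unshelve. all: by end_near. Qed.

(** The boundary term of the telescoping sum. Its value 1/2 at x = 1 and the lower bound 1 - x near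
    0 make the telescoped total about 1/2 - 1 = -1/2. *)
Definition rr x : R := Re (1 - x%:C * u)^-1.

Lemma rrE x : rr x = (1 - x * k) / den x.
Proof.
rewrite /rr (_ : (1 - x%:C * u)^-1 = ((den x)^-1)%:C * conjc (1 - x%:C * u)).
  by rewrite ReZ Re_conj ReD ReN ReZ /= mulrC.
have n0 := one_sub_neq0 x.
have D := den_conj x.
have c0 : conjc (1 - x%:C * u) != 0 by rewrite conjc_eq0.
rewrite realCV D; move: c0 n0.
generalize (conjc (1 - x%:C * u)) (1 - x%:C * u) => c w c0 n0.
by field; rewrite c0 n0.
Qed.

Lemma rr_ge x : 0 <= x <= 1 -> 1 - x <= rr x.
Proof.
move=> /andP[x0 x1]; rewrite rrE ler_pdivlMr ?den_gt0 // /den -subr_ge0.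
have -> : 1 - x * k - (1 - x) * (1 - 2 * k * x + x ^+ 2) =
  x * ((1 - x) ^+ 2 + x * (1 - k) + k * (1 - x)) by ring.
by rewrite mulr_ge0 // !addr_ge0 ?sqr_ge0 // mulr_ge0 //; move: k0 k1 => h0 h1; lra.
Qed.

Lemma rr1 : rr 1 = 1 / 2.
Proof.
have H : 1 - k != 0 by rewrite gt_eqF // subr_gt0.
rewrite rrE /den (_ : 1 - 2 * k * 1 + 1 ^+ 2 = 2 * (1 - k)); last by ring.
by rewrite mul1r; field.
Qed.

(* Replacing 1/(1-w)^2 by 1/((1-w/Q)(1-Qw)) makes the sum telescope. *)
Lemma eta_telescope Q j : 0 < Q < 1 ->
  (Q^-1 - Q) * eta (Q ^+ (2 * j + 1)) <= rr (Q ^+ (2 * j)) - rr (Q ^+ (2 * j.+1))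
    + (Q^-1 - Q) * (1 - Q) ^+ 2 / (Q * s2 ^+ 2) * Q ^+ (4 * j + 2).
Proof.
move=> /andP[Q0 Q1].
pose x := Q ^+ (2 * j + 1); pose y := Q ^+ (2 * j); pose z := Q ^+ (2 * j.+1).
have xy : x = Q * y by rewrite /x addn1 exprS.
have zy : z = Q ^+ 2 * y by rewrite /z mulnS exprD.
have Qn : (Q%:C : C) != 0 by rewrite -cabs_eq0 cabs_real normr_eq0 gt_eqF.
have c0 : 0 < Q^-1 - Q by rewrite subr_gt0 (lt_trans Q1) // invf_gt1.
rewrite -lerBlDl -/x -/y -/z.
pose wx := 1 - x%:C * u; pose wy := 1 - y%:C * u; pose wz := 1 - z%:C * u.
have nx : wx != 0 by exact: one_sub_neq0.
have ny : wy != 0 by exact: one_sub_neq0.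
have nz : wz != 0 by exact: one_sub_neq0.
have E : (Q^-1 - Q) * eta x - (rr y - rr z) =
  Re (- ((Q^-1 - Q)%:C * (x%:C * u) ^+ 2 * ((1 - Q) ^+ 2 / Q)%:C / (wx ^+ 2 * wy * wz))).
  rewrite /eta /rr -ReZ -!(ReN, ReD); congr (Re _).
  rewrite -/wx -/wy -/wz.
  move: nx ny nz; rewrite /wx /wy /wz xy zy.
  rewrite !(realCD, realCM, realCN, realCX, realCV, realC1).
  by move=> nx ny nz; field; rewrite nx ny nz Qn.
rewrite E (le_trans (ler_norm _)) // (le_trans (Re_le_cabs _)) // cabsN.
have N2 (t : R) : s2 <= cabs (1 - t%:C * u) ^+ 2 by rewrite den_abs den_ge.
have Ny := N2 y; have Nz := N2 z; have Nx := N2 x.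
have P : s2 <= cabs wy * cabs wz.
  rewrite -(@ler_pXn2r _ 2) ?nnegrE ?mulr_ge0 ?cabs_ge0 //; last by rewrite ltW.
  by rewrite exprMn [s2 ^+ 2]expr2 ler_pM // ltW.
have W : s2 ^+ 2 <= cabs (wx ^+ 2 * wy * wz).
  by rewrite -mulrA [cabs (wx ^+ 2 * _)]cabsM cabsX cabsM expr2 ler_pM // ltW.
have x0 : 0 < x by rewrite exprn_gt0.
rewrite [cabs (_ / _)]cabsM cabsV [cabs (_ * ((1 - Q) ^+ 2 / Q)%:C)]cabsM.
rewrite [cabs (_ * _ ^+ 2)]cabsM cabsX [cabs (x%:C * u)]cabsM u1 mulr1 !cabs_real (gtr0_norm c0) (gtr0_norm x0).
rewrite ger0_norm ?divr_ge0 ?sqr_ge0 ?(ltW Q0) //.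
have -> : (Q^-1 - Q) * (1 - Q) ^+ 2 / (Q * s2 ^+ 2) * Q ^+ (4 * j + 2) =
  (Q^-1 - Q) * x ^+ 2 * ((1 - Q) ^+ 2 / Q) * (s2 ^+ 2)^-1.
  have -> : Q ^+ (4 * j + 2) = x ^+ 2.
    by rewrite /x -exprM; congr (_ ^+ _); rewrite mulnDl mulnAC.
  by field; rewrite !gt_eqF.
have PP : 0 <= (Q^-1 - Q) * x ^+ 2 * ((1 - Q) ^+ 2 / Q).
  apply: mulr_ge0; last by rewrite divr_ge0 ?sqr_ge0 // ltW.
  by apply: mulr_ge0; [exact: ltW|exact: sqr_ge0].
by apply: ler_wpM2l => //; rewrite lef_pV2 ?posrE ?exprn_gt0 // (lt_le_trans _ W) ?exprn_gt0.
Qed.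

(** After multiplication by Q^-1 - Q > 0 the sum telescopes to about -1/2, up to the error of
    [eta_telescope]. The choice 1 - Q = s2/2 makes (1 - Q)^2/s2^2 = 1/4, so the total error is at
    most 1/4. *)
Lemma Hsum_neg : Hsum (1 - s2 / 2) <= 0.
Proof.
pose Q : R := 1 - s2 / 2; rewrite -/Q.
have Q01 : 0 < Q < 1 by move: s20 s2le => h0 h1; rewrite /Q; apply/andP; split; lra.
have /andP[Q0 Q1] := Q01.
have c0 : 0 < Q^-1 - Q by rewrite subr_gt0 (lt_trans Q1) // invf_gt1.
have cH : Hpart^~ Q @ \oo --> Hsum Q by apply: Hcvg; rewrite (ltW Q0).
pose K := (Q^-1 - Q) * (1 - Q) ^+ 2 / (Q * s2 ^+ 2).
have K0 : 0 <= K.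
  apply: divr_ge0; first by apply: mulr_ge0; [exact: ltW|exact: sqr_ge0].
  by apply: mulr_ge0; [exact: ltW|exact: sqr_ge0].
have Q4 : 0 < 1 - Q ^+ 4 by rewrite subr_gt0 exprn_ilt1 // ltW.
have B N : (Q^-1 - Q) * Hpart N Q <= rr 1 - rr (Q ^+ (2 * N)) +
    K * (Q ^+ 2 * (1 - Q ^+ (4 * N)) / (1 - Q ^+ 4)).
  elim: N => [|N IH].
    by rewrite /Hpart big_ord0 !muln0 !expr0 !subrr !mulr0 mul0r mulr0 addr0.
  rewrite /Hpart big_ord_recr /= mulrDr -/(Hpart N Q).
  rewrite (le_trans (lerD IH (eta_telescope N Q01))) // -/K.
  have -> : Q ^+ (4 * N.+1) = Q ^+ 4 * Q ^+ (4 * N) by rewrite mulnS exprD.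
  rewrite exprD le_eqVlt; apply/orP; left; apply/eqP.
  by field; rewrite gt_eqF.
have KB : K * (Q ^+ 2 / (1 - Q ^+ 4)) <= 1 / 4.
  have -> : K * (Q ^+ 2 / (1 - Q ^+ 4)) = (1 - Q) ^+ 2 / s2 ^+ 2 * (1 + Q ^+ 2)^-1.
    rewrite /K; field.
    rewrite !gt_eqF // ltr_wpDr // ?sqr_ge0 //.
  have -> : (1 - Q) ^+ 2 / s2 ^+ 2 = 1 / 4 by rewrite /Q; field; rewrite gt_eqF.
  rewrite ler_piMr // invf_le1 ?lerDl ?sqr_ge0 //.
  by rewrite ltr_wpDr ?sqr_ge0.
(* 1/2 from [rr1], at most -1 + Q^(2N) from [rr_ge], and 1/4 from the error terms. *)
have B2 N : (Q^-1 - Q) * Hpart N Q <= - (1 / 4) + Q ^+ N.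
  rewrite (le_trans (B N)) // rr1.
  have r1 : 1 - Q ^+ (2 * N) <= rr (Q ^+ (2 * N)).
    by apply: rr_ge; rewrite exprn_ge0 ?exprn_ile1 ?(ltW Q0) ?(ltW Q1).
  have QN : Q ^+ (2 * N) <= Q ^+ N.
    by rewrite ler_wiXn2l ?(ltW Q0) ?(ltW Q1) // mul2n -addnn leq_addr.
  have : K * (Q ^+ 2 * (1 - Q ^+ (4 * N)) / (1 - Q ^+ 4)) <= K * (Q ^+ 2 / (1 - Q ^+ 4)).
    apply: ler_wpM2l => //; apply: ler_wpM2r; first by rewrite invr_ge0 ltW.
    by apply: ler_piMr; rewrite ?sqr_ge0 // gerBl exprn_ge0 // ltW.
  lra.
have cQ : (fun N => Q ^+ N) @ \oo --> (0 : R) by apply: cvg_expr; rewrite gtr0_norm.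
rewrite -(pmulr_rle0 _ c0).
have c1 : (fun N => (Q^-1 - Q) * Hpart N Q) @ \oo --> (Q^-1 - Q) * Hsum Q.
  by apply: cvgM => //; exact: cvg_cst.
apply: (cvgr_to_le c1).
move/cvgrPdist_lt : cQ => /(_ (1 / 4)).
rewrite divr_gt0 // => /(_ isT); apply: filterS => N.
rewrite sub0r normrN gtr0_norm ?exprn_gt0 // => HN.
by rewrite (le_trans (B2 N)) //; lra.
Qed.

Lemma Hsum_zero : exists2 Q, 0 < Q < 1 & Hpart^~ Q @ \oo --> (0 : R).
Proof.
have [h0 h1] := (s20, s2le); have ab : 1 / 4 <= 1 - s2 / 2 by lra.
have c : {within `[1 / 4, 1 - s2 / 2], continuous Hsum} by apply: Hsum_continuous; lra.
have m : Num.min (Hsum (1 / 4)) (Hsum (1 - s2 / 2)) <= 0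
    <= Num.max (Hsum (1 / 4)) (Hsum (1 - s2 / 2)).
  by rewrite ge_min le_max Hsum_neg Hsum_pos orbT.
have [Q] := IVT ab c m.
rewrite in_itv /= => /andP[Q0 Q1] HQ.
have Q01 : 0 < Q < 1 by apply/andP; split; lra.
exists Q => //; rewrite -HQ; apply: Hcvg; lra.
Qed.

End Lambert.

(** * Potentials of holomorphic differentials *)

Section Potential.
Variable R : realType.
Local Notation C := R[i].
Local Notation Ct := (R[i]^o).
Implicit Types (z w h : C) (r t s : R) (F G : C -> R) (f g : C -> C) (D : set C).

Lemma is_derive_at0 (f : R -> R) t0 d :
  is_derive (0 : R) (1 : R) (fun s => f (t0 + s)) d -> is_derive t0 (1 : R) f d.
Proof.
move=> /rderP H; apply/rderP => e /H [r r0 Hr]; exists r => // k /Hr.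
by rewrite add0r addr0.
Qed.

(* F is a potential of the 1-form Re (f dz) on D. *)
Definition pot D F f := forall z, D z -> forall w,
  is_derive (0 : R) (1 : R) (fun t => F (z + t%:C * w)) (Re (w * f z)).

Lemma pot_hder D f g : (forall z, D z -> hder f z (g z)) -> pot D (fun z => Re (f z)) g.
Proof. by move=> H z Dz w; exact/hder_real/H. Qed.

Lemma pot_sub D D' F f : D' `<=` D -> pot D F f -> pot D' F f.
Proof. by move=> DD H z /DD; exact: H. Qed.

Lemma pot_eq D F f g : (forall z, D z -> f z = g z) -> pot D F f -> pot D F g.
Proof. by move=> E H z Dz w; rewrite -E //; exact: H. Qed.

Lemma potD D F G f g : pot D F f -> pot D G g ->
  pot D (fun z => F z + G z) (fun z => f z + g z).
Proof.
move=> hF hG z Dz w; rewrite mulrDr ReD.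
by apply: is_deriveD; [exact: hF|exact: hG].
Qed.

Lemma potN D F f : pot D F f -> pot D (fun z => - F z) (fun z => - f z).
Proof. by move=> hF z Dz w; rewrite mulrN ReN; apply: is_deriveN; exact: hF. Qed.

Lemma potB D F G f g : pot D F f -> pot D G g ->
  pot D (fun z => F z - G z) (fun z => f z - g z).
Proof. by move=> hF hG; apply: potD => //; exact: potN. Qed.

Lemma pot_cst D (c : R) : pot D (fun=> c) (fun=> 0).
Proof. by move=> z Dz w; rewrite mulr0; exact: is_derive_cst. Qed.

Lemma potZ D (k : R) F f : pot D F f -> pot D (fun z => k * F z) (fun z => k%:C * f z).
Proof.
move=> hF z Dz w; have := hF z Dz w => hd.
have := @is_deriveZ _ _ _ _ k _ _ _ hd.
by rewrite mulrCA ReZ.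
Qed.

Lemma pot_shift D F f h : pot D F f ->
  pot [set z | D (z + h)] (fun z => F (z + h)) (fun z => f (z + h)).
Proof.
move=> hF z Dz w; have := hF _ Dz w.
by congr (is_derive _ _ _ _); apply/funext => t; congr F; ring.
Qed.

Lemma pot_neg D F f : pot D F f ->
  pot [set z | D (- z)] (fun z => F (- z)) (fun z => - f (- z)).
Proof.
move=> hF z Dz w; have := hF _ Dz (- w).
have -> : - w * f (- z) = w * - f (- z) by ring.
by congr (is_derive _ _ _ _); apply/funext => t; congr F; ring.
Qed.

Lemma pot_conj D F f : pot D F f ->
  pot [set z | D (conjc z)] (fun z => F (conjc z)) (fun z => conjc (f (conjc z))).
Proof.
move=> hF z Dz w; have := hF _ Dz (conjc w).
have -> : Re (conjc w * f (conjc z)) = Re (w * conjc (f (conjc z))).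
  by rewrite !ReM Re_conj Im_conj Re_conj Im_conj; ring.
congr (is_derive _ _ _ _); apply/funext => t; congr F.
by rewrite conjD conjM conjc_real.
Qed.

Lemma pot_line D F f z w t : D (z + t%:C * w) -> pot D F f ->
  is_derive t (1 : R) (fun s => F (z + s%:C * w)) (Re (w * f (z + t%:C * w))).
Proof.
move=> Dz hF; apply: is_derive_at0; have := hF _ Dz w.
by congr (is_derive _ _ _ _); apply/funext => s; congr F; rewrite realCD; ring.
Qed.

Lemma rder_continuous (f : R -> R) t d : is_derive t (1 : R) f d -> {for t, continuous f}.
Proof. by move=> H; apply/differentiable_continuous/derivable1_diffP. Qed.

Lemma pot_MVT D F f z w : (forall t, 0 <= t <= 1 -> D (z + t%:C * (w - z))) ->
  pot D F f -> exists2 t, 0 < t < 1 & F w - F z = Re ((w - z) * f (z + t%:C * (w - z))).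
Proof.
move=> seg hF; pose g t := F (z + t%:C * (w - z)).
have dg t : 0 <= t <= 1 -> is_derive t (1 : R) g (Re ((w - z) * f (z + t%:C * (w - z)))).
  by move=> /seg Dt; exact: pot_line hF.
have [||t] := @MVT R g (fun t => Re ((w - z) * f (z + t%:C * (w - z)))) 0 1 ltr01.
- by move=> t; rewrite in_itv /= => /andP[? ?]; apply: dg; rewrite !ltW.
- apply: derivable_within_continuous => t; rewrite in_itv /= => tt.
  by have [] := dg t tt.
- rewrite in_itv /= => tt E; exists t => //; move: E.
  rewrite /g subr0 mulr1 mul0r addr0 mul1r => <-.
  by congr (F _ - _); ring.
Qed.

Lemma pot_lip D F f z w (K : R) :
  (forall t, 0 <= t <= 1 -> D (z + t%:C * (w - z))) -> pot D F f ->
  (forall t, 0 <= t <= 1 -> cabs (f (z + t%:C * (w - z))) <= K) ->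
  `|F w - F z| <= K * cabs (w - z).
Proof.
move=> seg hF bK; have [t /andP[t0 t1] ->] := pot_MVT seg hF.
rewrite (le_trans (Re_le_cabs _)) // cabsM mulrC ler_wpM2r ?cabs_ge0 //.
by apply: bK; rewrite !ltW.
Qed.

Lemma pot_const_seg D F z w :
  (forall t, 0 <= t <= 1 -> D (z + t%:C * (w - z))) -> pot D F (fun=> 0) -> F w = F z.
Proof.
move=> seg hF; have [t _ E] := pot_MVT seg hF.
by apply/eqP; rewrite -subr_eq0 E mulr0.
Qed.

Definition convexC D := forall z w t, D z -> D w -> 0 <= t <= 1 -> D (z + t%:C * (w - z)).

Lemma pot_const D F z w : convexC D -> D z -> D w -> pot D F (fun=> 0) -> F w = F z.
Proof. by move=> cD Dz Dw; apply: pot_const_seg => t t01; exact: cD. Qed.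

Lemma pot_unique D F G f z w : convexC D -> D z -> D w -> pot D F f -> pot D G f ->
  F w - G w = F z - G z.
Proof.
move=> cD Dz Dw hF hG; apply: (@pot_const D (fun z => F z - G z) z w) => //.
by apply: (pot_eq _ (potB hF hG)) => x _; rewrite subrr.
Qed.

Lemma convex_ball z r : convexC [set w | cabs (w - z) < r].
Proof.
move=> u v t /= ur vr /andP[t0 t1].
have -> : u + t%:C * (v - u) - z = (1 - t)%:C * (u - z) + t%:C * (v - z).
  by rewrite realCD realCN realC1; ring.
have s0 : 0 <= 1 - t by rewrite subr_ge0.
rewrite (le_lt_trans (cabsD _ _)) // !cabsM !cabs_real !ger0_norm //.
have [->|tp] := eqVneq t 0; first by rewrite mul0r addr0 subr0 mul1r.
have -> : r = (1 - t) * r + t * r by ring.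
rewrite ler_ltD ?ler_wpM2l ?(ltW ur) // ltr_pM2l //.
by rewrite lt_def tp.
Qed.

Lemma nbhs_ball_sub z (D : set Ct) : open D -> D z ->
  exists2 r, 0 < r & forall w, cabs (w - z) < r -> D w.
Proof.
move=> oD Dz; have : nbhs (z : Ct) D by exact: open_nbhs_nbhs.
by move/nbhsCP.
Qed.

Lemma pot_continuous (D : set Ct) F f z : open D -> D z -> pot D F f ->
  cont f z -> {for (z : Ct), continuous (F : Ct -> R)}.
Proof.
move=> oD Dz hF /continuousCP /(_ 1 ltr01) cf.
have [r1 r10 Hr1] := nbhs_ball_sub oD Dz.
have /nbhsCP[r2 r20 Hr2] : nbhs (z : Ct) [set w : Ct | cabs (f w - f z) < 1] by exact: cf.
pose r := Num.min r1 r2; have r0 : 0 < r by rewrite lt_min r10.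
have Hr w : cabs (w - z) < r -> cabs (f w - f z) < 1 /\ D w.
  by rewrite lt_min => /andP[/Hr1 ? /Hr2].
apply/continuousRP => e e0; pose K := cabs (f z) + 1.
have K0 : 0 < K by rewrite ltr_wpDl // cabs_ge0.
have m0 : 0 < Num.min r (e / K) by rewrite lt_min r0 divr_gt0.
apply: filterS (near_ball_C z m0) => w; rewrite lt_min => /andP[wr we].
have zz : cabs (z - z) < r by rewrite subrr cabs0.
have seg t : 0 <= t <= 1 -> cabs (z + t%:C * (w - z) - z) < r.
  by move=> t01; exact: (@convex_ball z r z w t zz wr).
have seg' t : 0 <= t <= 1 -> D (z + t%:C * (w - z)) by move=> /seg/Hr[].
have B t : 0 <= t <= 1 -> cabs (f (z + t%:C * (w - z))) <= K.
  move=> /seg/Hr[/= H _].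
  have -> : f (z + t%:C * (w - z)) = f z + (f (z + t%:C * (w - z)) - f z) by ring.
  by rewrite (le_trans (cabsD _ _)) // lerD2l ltW.
rewrite (le_lt_trans (pot_lip seg' hF B)) // mulrC -ltr_pdivlMr //.
Qed.

Section Existence.
Variables (D : set Ct) (f f' : C -> C) (z0 : C).
Hypotheses (oD : open D) (cD : convexC D) (Dz0 : D z0).
Hypotheses (df : forall z, D z -> hder f z (f' z)) (cf' : forall z, D z -> cont f' z).

Let path z t : C := z0 + t%:C * (z - z0).

Let Dpath z t : D z -> 0 <= t <= 1 -> D (path z t).
Proof. by move=> Dz tt; exact: cD. Qed.

Let K z t : R := Re ((z - z0) * f (path z t)).
Let K' z t w : R := Re (w * (f (path z t) + (z - z0) * f' (path z t) * t%:C)).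

Definition potential z : R := \int[lebesgue_measure]_(t in `[0, 1]) K z t.

Let dK z w t : D z -> 0 <= t <= 1 ->
  is_derive (0 : R) (1 : R) (fun s => K (z + s%:C * w) t) (K' z t w).
Proof.
move=> Dz tt; rewrite /K /K'.
apply: (@hder_real _ (fun z => (z - z0) * f (path z t))).
have h1 : hder (fun z => z - z0) z 1.
  by have := hderD (hder_id z) (hder_cst (- z0) z); rewrite addr0.
have h2 : hder (fun z => path z t) z (t%:C * 1).
  have := hderD (hder_cst z0 z) (hderM (hder_cst t%:C z) h1).
  by rewrite mul0r !add0r.
have := hderM h1 (hder_comp (f := f) (g := fun z => path z t) (df (Dpath Dz tt)) h2).
by rewrite mul1r mulr1 mulrA.
Qed.

Let creal_comp (T : topologicalType) (k : T -> R) x : {for x, continuous k} ->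
  {for x, continuous (fun y => (k y)%:C : Ct)}.
Proof. by move=> ck; apply: (@continuous_comp _ _ Ct k (fun x : R => x%:C)) => //; exact: continuous_realC. Qed.

Let cpath z w : continuous (fun p : R * R => path (z + p.1%:C * w) p.2 : Ct).
Proof.
move=> p; rewrite /path.
apply: (@continuousD _ Ct); first exact: cst_continuous.
apply: (@continuousM R[i]).
  by apply: (@creal_comp _ (fun p : R * R => p.2)); exact: cvg_snd.
apply: (@continuousD _ Ct); last exact: cst_continuous.
apply: (@continuousD _ Ct); first exact: cst_continuous.
apply: (@continuousM R[i]); last exact: cst_continuous.
by apply: (@creal_comp _ (fun p : R * R => p.1)); exact: cvg_fst.
Qed.

Let cK' z w p : D (path (z + p.1%:C * w) p.2) ->
  {for p, continuous (fun p : R * R => K' (z + p.1%:C * w) p.2 w)}.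
Proof.
move=> Dp; rewrite /K'.
have c2 : {for p, continuous (fun p : R * R => p.2%:C : Ct)}.
  by apply: (@creal_comp _ (fun p : R * R => p.2)); exact: cvg_snd.
have c1 : {for p, continuous (fun p : R * R => p.1%:C : Ct)}.
  by apply: (@creal_comp _ (fun p : R * R => p.1)); exact: cvg_fst.
apply: (@continuous_comp _ Ct _ _ (Re : Ct -> R)); last exact: continuous_Re.
apply: (@continuousM R[i]); first exact: cst_continuous.
apply: (@continuousD _ Ct).
  apply: (@continuous_comp _ Ct Ct (fun p : R * R => path (z + p.1%:C * w) p.2) f); first exact: cpath.
  by have := hder_continuous (df Dp).
apply: (@continuousM R[i]) c2.
apply: (@continuousM R[i]).
  apply: (@continuousD _ Ct); last exact: cst_continuous.
  apply: (@continuousD _ Ct); first exact: cst_continuous.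
  by apply: (@continuousM R[i]) c1 _; exact: cst_continuous.
apply: (@continuous_comp _ Ct Ct (fun p : R * R => path (z + p.1%:C * w) p.2) f'); first exact: cpath.
exact: cf'.
Qed.

Let cK z t : D (path z t) -> {for t, continuous (K z)}.
Proof.
move=> Dp; apply: (@continuous_comp _ Ct _ _ (Re : Ct -> R)); last exact: continuous_Re.
apply: (@continuousM R[i]); first exact: cst_continuous.
apply: (@continuous_comp _ Ct Ct (path z) f); last by have := hder_continuous (df Dp).
apply: (@continuousD _ Ct); first exact: cst_continuous.
apply: (@continuousM R[i]); last exact: cst_continuous.
exact: continuous_realC.
Qed.

Let within_for (T U : topologicalType) (A : set T) (k : T -> U) :
  (forall x, A x -> {for x, continuous k}) -> {within A, continuous k}.
Proof.
move=> H; apply/subspace_continuousP => x Ax.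
by apply: cvg_within_filter; exact: H.
Qed.

(** Differentiation under the integral sign gives the integral of [K'] over [0, 1]. Its integrand is
    the t-derivative of t Re(w f(path z t)), so the fundamental theorem evaluates it to Re(w f(z)).
    Convexity keeps all segments inside [D]. *)
Lemma pot_potential : pot D potential f.
Proof.
move=> z Dz w; have [r r0 Hr] := nbhs_ball_sub oD Dz.
pose d := r / (cabs w + 1) / 2.
have w0 : 0 < cabs w + 1 by rewrite ltr_wpDl // cabs_ge0.
have d0 : 0 < d by rewrite !divr_gt0.
have Dd s : - d <= s <= d -> D (z + s%:C * w).
  rewrite -ler_norml => sd; apply: Hr.
  rewrite (_ : z + s%:C * w - z = s%:C * w); last by ring.
  rewrite cabsM cabs_real (@le_lt_trans _ _ (d * (cabs w + 1))) //.
    by rewrite ler_pM ?cabs_ge0 // lerDl.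
  have -> : d * (cabs w + 1) = r / 2 by rewrite /d; field; rewrite gt_eqF.
  by rewrite ltr_pdivrMr // ltr_pMr // ltr1n.
pose g (s t : R) := K (z + s%:C * w) t.
have dg s t : - d <= s <= d -> 0 <= t <= 1 -> is_derive s (1 : R) (g^~ t) (K' (z + s%:C * w) t w).
  move=> sd tt; apply: is_derive_at0; have := dK w (Dd s sd) tt.
  by congr (is_derive _ _ _ _); apply/funext => s'; rewrite /g; congr K; rewrite realCD; ring.
pose A := `[- d, d] `*` `[0, 1] : set (R * R).
have cA : compact A by apply: compact_setX; exact: segment_compact.
have A0 : A !=set0.
  by exists (0, 0); split => /=; rewrite in_itv /= ?lexx ?ler01 // oppr_le0 !ltW.
have contA : {within A, continuous (fun p : R * R => `|K' (z + p.1%:C * w) p.2 w|)}.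
  apply: within_for => p [] /=; rewrite !in_itv /= => p1 p2.
  apply: (@continuous_comp _ _ _ _ (fun x : R => `|x|)); last exact: norm_continuous.
  by apply: cK'; apply: Dpath => //; exact: Dd.
(* The maximum over a compact rectangle provides the constant that dominates the parameter
   derivative. *)
have [c _ Hc] := compact_EVT_max A0 cA contA.
pose M := `|K' (z + c.1%:C * w) c.2 w|.
have itv s : `]- d, d[%classic s -> - d <= s <= d.
  by rewrite /= in_itv /= => /andP[? ?]; rewrite !ltW.
have z00 : `]- d, d[%classic (0 : R) by rewrite /= in_itv /= oppr_lt0 d0.
have intg s : `]- d, d[%classic s ->
    (@lebesgue_measure R).-integrable `[0, 1] (EFin \o g s).
  move=> /itv sd; apply: continuous_compact_integrable; first exact: segment_compact.
  apply: within_for => t; rewrite /= in_itv /= => tt.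
  by apply: cK; apply: Dpath => //; exact: Dd.
have dgv s t : `]- d, d[%classic s -> `[0, 1]%classic t -> derivable (g^~ t) s 1.
  by move=> /itv sd; rewrite /= in_itv /= => tt; have [] := dg s t sd tt.
have intM : (@lebesgue_measure R).-integrable `[0, 1] (EFin \o fun=> M).
  apply: continuous_compact_integrable; first exact: segment_compact.
  by apply: within_for => t _; exact: cst_continuous.
have M0 (t : R) : 0 <= M by exact: normr_ge0.
have p1 s t : - d <= s <= d -> 0 <= t <= 1 ->
    partial1of2 g s t = K' (z + s%:C * w) t w.
  by move=> sd tt; rewrite /partial1of2 derive1E; have [_ ->] := dg s t sd tt.
have bnd s t : `]- d, d[%classic s -> `[0, 1]%classic t -> `|partial1of2 g s t| <= M.
  move=> /itv sd; rewrite /= in_itv /= => tt; rewrite p1 //.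
  by apply: (Hc (s, t)); rewrite inE; split; rewrite /= in_itv.
have cv := @cvg_differentiation_under_integral R _ _ (@lebesgue_measure R) g
  `[0, 1]%classic (measurable_itv _) 0 (- d) d z00 intg dgv (fun=> M) M0 intM bnd.
have E : \int[lebesgue_measure]_(t in `[0, 1]) partial1of2 g 0 t = Re (w * f z).
  pose U t := t * Re (w * f (path z t)).
  have dU t : 0 <= t <= 1 -> is_derive t (1 : R) U (K' z t w).
    move=> tt; have Dt := Dpath Dz tt.
    have h : is_derive t (1 : R) (fun t => Re (w * f (path z t)))
        (Re ((z - z0) * (w * f' (path z t)))).
      apply: is_derive_at0.
      have hw : hder (fun v => w * f v) (path z t) (w * f' (path z t)).
        by have := hderM (hder_cst w _) (df Dt); rewrite mul0r add0r.
      have := hder_real (z - z0) hw.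
      by congr (is_derive _ _ _ _); apply/funext => s; rewrite /path realCD; congr (Re (_ * f _)); ring.
    have [dM EM] := @is_deriveM R R id (fun t => Re (w * f (path z t))) t 1 _ _ (is_derive_id _ _) h.
    apply: DeriveDef; first exact: dM.
    rewrite [LHS]EM /K' /GRing.scale /= mulr1 mulrDr ReD addrC; congr (_ + _).
    by rewrite -ReZ; congr Re; ring.
  have cU t : 0 <= t <= 1 -> {for t, continuous U}.
    by move=> /dU; exact: rder_continuous.
  transitivity (fine (\int[lebesgue_measure]_(t in `[0%R, 1%R]) (K' z t w)%:E)%E).
    congr fine; apply: eq_integral => t; rewrite inE /= in_itv /= => tt.
    by rewrite p1 //; [rewrite mul0r addr0|rewrite oppr_le0 !ltW].
  rewrite (@continuous_FTC2 R (fun t => K' z t w) U 0 1 ltr01).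
  - by rewrite /= /U mul0r subr0 mul1r /path mul1r; congr (Re (_ * f _)); ring.
  - apply: within_for => t; rewrite /= in_itv /= => tt.
    have E0 : z + (0 : R)%:C * w = z by rewrite mul0r addr0.
    have H : D (path (z + (0 : R, t).1%:C * w) (0 : R, t).2).
      by rewrite [X in path X _]E0; exact: Dpath.
    have := cK' H => H'.
    have cp : {for t, continuous (fun t : R => (0 : R, t))}.
      apply: (@cvg_pair _ _ _ _ (nbhs (0 : R)) (nbhs t) _ _ _ (fun=> 0) id).
        exact: cvg_cst.
      exact: cvg_id.
    have := @continuous_comp _ _ _ (fun t : R => (0 : R, t)) _ t cp H'.
    rewrite (_ : _ \o _ = (fun t => K' z t w)) //.
    by apply/funext => s; congr (K' _ s w); exact: E0.
  - split.
    + by move=> t; rewrite in_itv /= => /andP[? ?]; have [] := dU t ltac:(by rewrite !ltW).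
    + by apply: cvg_at_right_filter; apply: cU; rewrite lexx ler01.
    + by apply: cvg_at_left_filter; apply: cU; rewrite lexx ler01.
  - move=> t; rewrite in_itv /= => /andP[? ?].
    by rewrite derive1E; have [_ ->] := dU t ltac:(by rewrite !ltW).
have D1 : derivable (fun s : R => potential (z + s%:C * w)) 0 1.
  apply/cvg_ex; exists (Re (w * f z)); rewrite -E.
  apply: cvg_trans cv; apply: near_eq_cvg; near=> h => /=.
  by rewrite /g /potential [h *: 1]mulr1.
apply: DeriveDef => //; apply/cvg_lim => //; rewrite -E.
apply: cvg_trans cv; apply: near_eq_cvg; near=> h => /=.
by rewrite /g /potential [h *: 1]mulr1.
Unshelve. all: by end_near. Qed.

End Existence.
End Potential.

(** * Laurent expansions at a double pole *)

Section Expansion.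
Variable R : realType.
Local Notation C := R[i].
Local Notation Ct := (R[i]^o).
Implicit Types (z w h d : C) (r M : R) (f g : C -> C).

(** The real mean value estimate is applied to Re f and to Im f, the latter being the real part of
    -i f; this accounts for the factor 2. *)
Lemma hder_growth f f' r M n : 0 <= M ->
  (forall z, cabs z < r -> hder f z (f' z)) ->
  (forall z, cabs z < r -> cabs (f' z) <= M * cabs z ^+ n) ->
  forall z, cabs z < r -> cabs (f z - f 0) <= 2 * M * cabs z ^+ n.+1.
Proof.
move=> M0 df bf z zr.
have seg t : 0 <= t <= 1 -> cabs (0 + t%:C * (z - 0)) <= cabs z.
  move=> /andP[t0 t1]; rewrite add0r subr0 cabsM cabs_real ger0_norm //.
  by rewrite ler_piMl ?cabs_ge0.
have seg' t : 0 <= t <= 1 -> [set z | cabs z < r] (0 + t%:C * (z - 0)).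
  by move=> /seg H; rewrite /= (le_lt_trans H).
have bnd t : 0 <= t <= 1 -> cabs (f' (0 + t%:C * (z - 0))) <= M * cabs z ^+ n.
  move=> tt; rewrite (le_trans (bf _ (seg' _ tt))) // ler_wpM2l // lerXn2r ?nnegrE ?cabs_ge0 //.
  exact: seg.
have h1 := pot_lip seg' (pot_hder df) bnd.
have df2 v : cabs v < r -> hder (fun w => - I * f w) v (- I * f' v).
  by move=> vr; have := hderM (hder_cst (- I) v) (df v vr); rewrite mul0r add0r.
have bnd2 t : 0 <= t <= 1 -> cabs (- I * f' (0 + t%:C * (z - 0))) <= M * cabs z ^+ n.
  by move=> tt; rewrite cabsM cabsN cabs_I mul1r; exact: bnd.
have h2 := pot_lip seg' (pot_hder df2) bnd2.
rewrite (le_trans (cabs_le_ReIm _)) //.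
have -> : 2 * M * cabs z ^+ n.+1 = M * cabs z ^+ n * cabs (z - 0) + M * cabs z ^+ n * cabs (z - 0).
  by rewrite subr0 exprS; ring.
apply: lerD; first by move: h1; rewrite ReD ReN.
move: h2; rewrite !mulNr !ReN !ReI !opprK ImD ImN; exact.
Qed.

Let half : C := 2^-1.

Let hc (c : C) z : hder (fun w => cexp (c * w)) z (c * cexp (c * z)).
Proof.
have h1 : hder (fun w => c * w) z c.
  by have := hderM (hder_cst c z) (hder_id z); rewrite mul0r add0r mulr1.
by have := hder_comp (f := @cexp R) (g := fun w => c * w) (hder_cexp _) h1; rewrite mulrC.
Qed.

(** [D0] is 2 sinh(z/2) - z, and [D1], [D2], [D3] are its derivatives. As [D0], [D1], [D2] vanish at
    0, three integrations of a bound on [D3] give D0 = O(z^3). *)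
Let D0 z : C := cexp (half * z) - cexp (- half * z) - z.
Let D1 z : C := half * (cexp (half * z) + cexp (- half * z)) - 1.
Let D2 z : C := half * half * (cexp (half * z) - cexp (- half * z)).
Let D3 z : C := half * half * half * (cexp (half * z) + cexp (- half * z)).

Let hZ c f z d : hder f z d -> hder (fun w => c * f w) z (c * d).
Proof. by move=> hf; have := hderM (hder_cst c z) hf; rewrite mul0r add0r. Qed.

Let hD0 z : hder D0 z (D1 z).
Proof.
by apply: (hder_eq (hderD (hderD (hc half z) (hderN (hc (- half) z))) (hderN (hder_id z)))); rewrite /D1; ring.
Qed.

Let hD1 z : hder D1 z (D2 z).
Proof.
by apply: (hder_eq (hderD (hZ half (hderD (hc half z) (hc (- half) z))) (hder_cst (- 1) z))); rewrite /D2; ring.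
Qed.

Let hD2 z : hder D2 z (D3 z).
Proof.
by apply: (hder_eq (hZ (half * half) (hderD (hc half z) (hderN (hc (- half) z))))); rewrite /D3; ring.
Qed.

Let K : R := expR 1.

Let cabs_half : cabs half = 2^-1.
Proof. by rewrite /half cabsV -(rmorph_nat (real_complex R)) cabs_real ger0_norm. Qed.

Let bhalf (c : C) z : cabs c = 2^-1 -> cabs z < 1 -> cabs (cexp (c * z)) <= K.
Proof.
move=> c2 z1; rewrite cabs_cexp ler_expR (le_trans (ler_norm _)) //.
rewrite (le_trans (Re_le_cabs _)) // cabsM c2; have := cabs_ge0 z; lra.
Qed.

Let bD3 z : cabs z < 1 -> cabs (D3 z) <= K * cabs z ^+ 0.
Proof.
move=> z1; rewrite /D3 expr0 mulr1 !cabsM cabs_half.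
have H : cabs (cexp (half * z) + cexp (- half * z)) <= K + K.
  rewrite (le_trans (cabsD _ _)) // lerD // bhalf // ?cabsN //.
have K0 : 0 < K by exact: expR_gt0.
have := cabs_ge0 (cexp (half * z) + cexp (- half * z)); lra.
Qed.

Let bD0 z : cabs z < 1 -> cabs (D0 z) <= 8 * K * cabs z ^+ 3.
Proof.
have K0 : 0 <= K by exact: expR_ge0.
have e0 : D0 0 = 0 by rewrite /D0 !mulr0 !subrr.
have e1 : D1 0 = 0 by rewrite /D1 !mulr0 cexp0 /half; field.
have e2 : D2 0 = 0 by rewrite /D2 !mulr0 subrr mulr0.
have b2 w : cabs w < 1 -> cabs (D2 w) <= 2 * K * cabs w ^+ 1.
  move=> w1; have := hder_growth K0 (fun v _ => hD2 v) bD3 w1.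
  by rewrite e2 subr0.
have K2 : 0 <= 2 * K by rewrite mulr_ge0.
have b1 w : cabs w < 1 -> cabs (D1 w) <= 2 * (2 * K) * cabs w ^+ 2.
  move=> w1; have := hder_growth K2 (fun v _ => hD1 v) b2 w1.
  by rewrite e1 subr0.
have K4 : 0 <= 2 * (2 * K) by rewrite mulr_ge0.
move=> z1; have := hder_growth K4 (fun v _ => hD0 v) b1 z1.
rewrite e0 subr0 => /le_trans; apply.
by rewrite le_eqVlt; apply/orP; left; apply/eqP; ring.
Qed.

(** Equal to 1/(4 sinh^2(z/2)): the model double pole with period 2 pi i, without residue at 0. *)
Definition pole2 z : C := cexp z / (1 - cexp z) ^+ 2.

Let pole2E z : pole2 z = ((D0 z + z) ^+ 2)^-1.
Proof.
have e : D0 z + z = cexp (half * z) - (cexp (half * z))^-1.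
  by rewrite /D0 subrK mulNr cexpN.
rewrite e /pole2; have c0 := cexp_neq0 (half * z).
have -> : cexp z = cexp (half * z) ^+ 2.
  by rewrite expr2 -cexpD; congr cexp; rewrite /half; field.
move: c0; set c := cexp _ => c0.
have -> : c - c^-1 = - (1 - c ^+ 2) / c by field.
have [->|n1] := eqVneq (1 - c ^+ 2) 0.
  by rewrite oppr0 mul0r !expr0n /= invr0 mulr0.
by field; rewrite c0 n1.
Qed.

(** Here 2 sinh(z/2) = z + [D0 z] with a cubic correction, so the difference of the inverse squares
    is O(z^3) O(z) / z^4, that is, bounded. *)
Lemma pole2_expand : exists2 r, 0 < r & exists2 M, 0 <= M &
  forall z, 0 < cabs z < r -> cabs (pole2 z - (z ^+ 2)^-1) <= M.
Proof.
have K0 : 0 < K by exact: expR_gt0.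
(* This radius forces 8 K |z|^2 <= 1/2, hence |D0 z| <= |z|/2, so the denominator keeps at least
   half the size of z. *)
pose r : R := (16 * K + 1)^-1.
have r1 : r < 1 by rewrite /r invf_lt1 //; lra.
have r0 : 0 < r by rewrite /r invr_gt0; lra.
exists r => //; exists (80 * K) => [|z /andP[z0 zr]]; first by rewrite mulr_ge0 // ltW.
have z1 := lt_trans zr r1.
have bd := bD0 z1; set x := cabs z in z0 zr z1 bd *.
have x2 : 8 * K * x ^+ 2 <= 1 / 2.
  have : 16 * K * x <= 1.
    rewrite (@le_trans _ _ ((16 * K + 1) * x)) //; first by rewrite ler_wpM2r ?(ltW z0) //; lra.
    by rewrite mulrC -ler_pdivlMr; [rewrite div1r ltW|lra].
  rewrite expr2; nra.
have b3 : cabs (D0 z) <= 1 / 2 * x.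
  by rewrite (le_trans bd) // exprSr mulrA ler_wpM2r // ltW.
have lo : x / 2 <= cabs (D0 z + z).
  have := cabsD (D0 z + z) (- D0 z); rewrite cabsN.
  by rewrite (_ : D0 z + z - D0 z = z); [rewrite -/x; lra|ring].
have hi : cabs (- (D0 z + z + z)) <= 5 / 2 * x.
  have h1 := cabsD z z; have h2 := cabsD (D0 z) (z + z); rewrite -/x in h1.
  by rewrite cabsN (_ : D0 z + z + z = D0 z + (z + z)); [lra|ring].
have zn : z != 0 by rewrite -cabs_gt0.
have Dn : D0 z + z != 0 by rewrite -cabs_gt0 (lt_le_trans _ lo) // divr_gt0.
rewrite pole2E.
have -> : ((D0 z + z) ^+ 2)^-1 - (z ^+ 2)^-1 =
  D0 z * (- (D0 z + z + z)) / ((D0 z + z) ^+ 2 * z ^+ 2).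
  by field; rewrite zn Dn.
rewrite cabsM cabsV [cabs (D0 z * _)]cabsM [cabs (_ ^+ 2 * _)]cabsM !cabsX -/x.
have den : 0 < cabs (D0 z + z) ^+ 2 * x ^+ 2.
  by rewrite mulr_gt0 ?exprn_gt0 // cabs_gt0.
rewrite ler_pdivrMr // (@le_trans _ _ ((8 * K * x ^+ 3) * (5 / 2 * x))) //.
  by rewrite ler_pM ?cabs_ge0.
have -> : 8 * K * x ^+ 3 * (5 / 2 * x) = 80 * K * ((x / 2) ^+ 2 * x ^+ 2).
  by field.
rewrite ler_wpM2l ?mulr_ge0 ?(ltW K0) // ler_wpM2r ?exprn_ge0 ?(ltW z0) //.
by rewrite lerXn2r ?nnegrE ?cabs_ge0 // divr_ge0 // ltW.
Qed.

(* Laurent expansion of a function with a double pole at 0. *)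
Lemma sing_expand (N : C -> C) (r0 : R) d : 0 < r0 ->
  hol 2 [set z | cabs z < r0] N -> hder N 0 d ->
  exists2 r, 0 < r & exists2 M, 0 <= M & forall z, 0 < cabs z < r ->
    cabs (pole2 z * N z - (N 0 / z ^+ 2 + d / z)) <= M.
Proof.
move=> r00 [_ [N1 hN [_ [N2 hN1 [cN2 _]]]]] hd.
have z00 : cabs (0 : C) < r0 by rewrite cabs0.
have Ed : N1 0 = d by exact: hder_unique (hN 0 z00) hd.
have /continuousCP /(_ 1 ltr01) /nbhsCP [r1 r10 Hr1] := cN2 0 z00.
have [r2 r20 [M2 M20 HM2]] := pole2_expand.
pose r := Num.min (Num.min r0 r1) r2.
have rr : 0 < r by rewrite !lt_min r00 r10 r20.
pose K2 : R := cabs (N2 0) + 1.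
have K20 : 0 <= K2 by rewrite addr_ge0 ?cabs_ge0.
have sm z : cabs z < r -> [/\ cabs z < r0, cabs z < r1 & cabs z < r2].
  by rewrite !lt_min => /andP[/andP[]].
have b2 z : cabs z < r -> cabs (N2 z) <= K2 * cabs z ^+ 0.
  move=> /sm[_ z1 _]; rewrite expr0 mulr1.
  have -> : N2 z = N2 0 + (N2 z - N2 0) by ring.
  rewrite (le_trans (cabsD _ _)) // lerD2l ltW //.
  by apply: Hr1; rewrite subr0.
have b1 z : cabs z < r -> cabs (N1 z - N1 0) <= 2 * K2 * cabs z ^+ 1.
  apply: (hder_growth (f' := N2)) => // w /sm[w0 _ _]; exact: hN1.
have K4 : 0 <= 2 * K2 by rewrite mulr_ge0.
have b0 z : cabs z < r -> cabs (N z - N 0 - N1 0 * z) <= 2 * (2 * K2) * cabs z ^+ 2.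
  move=> zr; have hG w : cabs w < r -> hder (fun w => N w - N1 0 * w) w (N1 w - N1 0).
    move=> /sm[w0 _ _]; have := hderD (hN w w0) (hderN (hZ (N1 0) (hder_id w))).
    by rewrite mulr1.
  have := hder_growth K4 hG b1 zr.
  by rewrite mulr0 subr0; congr (_ <= _); congr (cabs _); ring.
pose B := cabs (N 0) + cabs (N1 0) * r + 2 * (2 * K2) * r ^+ 2.
have B0 : 0 <= B.
  by rewrite !addr_ge0 ?mulr_ge0 ?cabs_ge0 ?exprn_ge0 // ?addr_ge0 ?cabs_ge0 // ltW.
exists r => //; exists (M2 * B + 2 * (2 * K2)) => [|z /andP[z0 zr]].
  by rewrite addr_ge0 ?mulr_ge0 // addr_ge0 ?cabs_ge0.
have [zr0 zr1 zr2] := sm z zr.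
have zn : z != 0 by rewrite -cabs_gt0.
have e0 := b0 z zr.
rewrite -Ed.
have -> : pole2 z * N z - (N 0 / z ^+ 2 + N1 0 / z) =
  (pole2 z - (z ^+ 2)^-1) * N z + (N z - N 0 - N1 0 * z) / z ^+ 2 by field.
rewrite (le_trans (cabsD _ _)) // !cabsM lerD //.
  rewrite ler_pM ?cabs_ge0 //; first by apply: HM2; rewrite z0.
  have -> : N z = N 0 + N1 0 * z + (N z - N 0 - N1 0 * z) by ring.
  rewrite (le_trans (cabsD _ _)) // lerD //.
    by rewrite (le_trans (cabsD _ _)) // lerD2l cabsM ler_wpM2l ?cabs_ge0 // ltW.
  rewrite (le_trans e0) // ler_wpM2l ?mulr_ge0 // lerXn2r ?nnegrE ?cabs_ge0 ?(ltW rr) //.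
  exact: ltW.
rewrite cabsV cabsX ler_pdivrMr //.
by rewrite exprn_gt0.
Qed.

(** Differentiating f(-z) = f(z) at 0 gives d = -d. Consequently an even regular factor does not
    change the ratio of residue to leading coefficient at a double pole. *)
Lemma hder_even f d : (forall z, f (- z) = f z) -> hder f 0 d -> d = 0.
Proof.
move=> ev hf.
have h1 : hder (fun z => f (0 - z)) 0 (- d).
  have := hderD (hder_cst (0 : C) 0) (hderN (hder_id 0)); rewrite add0r => hg.
  have hf' : hder f (0 - 0) d by rewrite subrr.
  by have := hder_comp (f := f) (g := fun w => 0 - w) hf' hg; rewrite mulrN1.
have h2 : hder f 0 (- d) by apply: hder_ext h1 => z; rewrite sub0r ev.
have E := hder_unique hf h2.
have : d + d = 0 by rewrite {1}E addNr.
move=> /eqP; rewrite -mulr2n -mulr_natl mulf_eq0 => /orP[|/eqP //].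
by rewrite pnatr_eq0.
Qed.

End Expansion.

(** * The Weierstrass data *)

Section Theta.
Variable R : realType.
Local Notation C := R[i].
Local Notation Ct := (R[i]^o).
Implicit Types (z w v : C) (r : R).

Lemma cexp_real (x : R) : cexp (x%:C) = (expR x)%:C.
Proof. by apply: eqC; rewrite ?Re_cexp ?Im_cexp /= ?cos0 ?sin0 ?mulr1 ?mulr0. Qed.

Definition tpi : C := 0 +i* (2 * pi).

Lemma cexp_tpi z : cexp (z + tpi) = cexp z.
Proof.
rewrite cexpD (_ : cexp tpi = 1) ?mulr1 //.
have E : 2 * pi = pi *+ 2 :> R by rewrite mulr2n mulrDl mul1r.
by apply: eqC; rewrite ?Re_cexp ?Im_cexp /= expR0 E ?cos2pi ?sin2pi mul1r.
Qed.

Lemma cexp_tpiN z : cexp (z - tpi) = cexp z.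
Proof. by rewrite -(cexp_tpi (z - tpi)); congr cexp; ring. Qed.

Variables L al : R.
Hypothesis L0 : 0 < L.
Hypothesis al0 : 0 < al.
Hypothesis alpi : al < pi.

Local Notation a := (- (2 * L)).

Definition ial : C := 0 +i* al.

Definition th_L : C := L%:C.
Local Notation LC := th_L.

(* [p] stands for the product of the 1 - e^(z - 2jL), j >= 1, and [p1], [p2]
   for its derivatives. *)
Variables p p1 p2 : C -> C.
Hypothesis pstep : forall z, p z = (1 - cexp (z + a%:C)) * p (z + a%:C).
Hypothesis p_conj : forall z, p (conjc z) = conjc (p z).
Hypothesis p1_conj : forall z, p1 (conjc z) = conjc (p1 z).
Hypothesis p2_conj : forall z, p2 (conjc z) = conjc (p2 z).
Hypothesis p00 : p 0 != 0.
Hypothesis p_per : forall z w, cexp z = cexp w -> p z = p w.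
Hypothesis hder_p : forall z, hder p z (p1 z).
Hypothesis hder_p1 : forall z, hder p1 z (p2 z).
Hypothesis hol_p : forall k D, hol k D p.
Hypothesis p_neq0 : forall z,
  (forall j : int, cexp z != (expR (2 * L * j%:~R))%:C) -> p z != 0.

(** A theta function of [p], with zeros at the odd multiples of L modulo 2 pi i: one factor carries
    the positive ones, the other the negative ones. [th_t1] and [th_t2] are its derivatives. *)
Definition th_t z : C := p (z + LC) * p (LC - z).
Definition th_t1 z : C := p1 (z + LC) * p (LC - z) - p (z + LC) * p1 (LC - z).
Definition th_t2 z : C := p2 (z + LC) * p (LC - z) - 2 * (p1 (z + LC) * p1 (LC - z))
  + p (z + LC) * p2 (LC - z).
Local Notation t := th_t.
Local Notation t1 := th_t1.
Local Notation t2 := th_t2.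
(** The theta function [th] with its zeros on Re z = 0 divided out; it is even and nonzero at 0. *)
Definition th_m z : C := p z * p (- z).
Local Notation m := th_m.
Definition th z : C := (1 - cexp z) * m z.
(** The spinors of the surface: up to the common factor [chi] the Weierstrass forms are their
    squares and product, and the Gauss map is sp1/sp2 in stereographic projection. *)
Definition sp1 z : C := t (z - ial).
Definition sp2 z : C := t (z + ial).
(** The factor e^z makes the function even, since th(-z) = -e^(-z) th(z). *)
Definition chi z : C := cexp z / th z ^+ 2.

Let aE : a%:C = - (LC + LC).
Proof. by rewrite /LC realCN -realCD; congr (- _%:C); ring. Qed.

Lemma p_tpi z : p (z + tpi) = p z.
Proof. exact/p_per/cexp_tpi. Qed.

Lemma p_tpiN z : p (z - tpi) = p z.
Proof. exact/p_per/cexp_tpiN. Qed.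

Lemma conj_L : conjc LC = LC.
Proof. exact: conjc_real. Qed.

Lemma cexp_L : cexp LC = (expR L)%:C.
Proof. exact: cexp_real. Qed.

Opaque th_L.

Lemma t_even z : t (- z) = t z.
Proof. by rewrite /t opprK (addrC LC z) (addrC (- z) LC); exact: mulrC. Qed.

Lemma t1_odd z : t1 (- z) = - t1 z.
Proof. by rewrite /t1 opprK (addrC LC z) (addrC (- z) LC); ring. Qed.

Lemma t2_even z : t2 (- z) = t2 z.
Proof. by rewrite /t2 opprK (addrC LC z) (addrC (- z) LC); ring. Qed.

Lemma t_conj z : t (conjc z) = conjc (t z).
Proof.
have E1 : conjc z + LC = conjc (z + LC) by rewrite conjD conj_L.
have E2 : LC - conjc z = conjc (LC - z) by rewrite conjB conj_L.
by rewrite /t E1 E2 !p_conj -conjM.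
Qed.

Lemma t_tpi z : t (z + tpi) = t z.
Proof. by rewrite /t addrAC p_tpi opprD addrA p_tpiN. Qed.

(** The translation adds the factor 1 - e^(L - z) on one side of the product and removes 1 - e^(z -
    L) on the other; their quotient is -e^(L - z). *)
Lemma t_shift z : t (z + a%:C) = - cexp (LC - z) * t z.
Proof.
rewrite /t (pstep (z + LC)) (pstep (LC - (z + a%:C))).
have -> : LC - (z + a%:C) + a%:C = LC - z by ring.
have -> : z + LC + a%:C = z + a%:C + LC by ring.
have E : cexp (LC - z) * cexp (z + a%:C + LC) = 1.
  by rewrite -cexpD aE (_ : _ + _ = 0) ?cexp0 //; ring.
have -> : - cexp (LC - z) * ((1 - cexp (z + a%:C + LC)) * p (z + a%:C + LC) * p (LC - z))
  = (cexp (LC - z) * cexp (z + a%:C + LC) - cexp (LC - z)) * (p (z + a%:C + LC) * p (LC - z)) by ring.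
by rewrite E; ring.
Qed.

Lemma hder_refl (f : C -> C) (b : C) z d : hder f (b - z) d ->
  hder (fun w => f (b - w)) z (- d).
Proof.
move=> hf; have := hderD (hder_cst b z) (hderN (hder_id z)); rewrite add0r => hg.
by have := hder_comp (f := f) (g := fun w => b - w) hf hg; rewrite mulrN1.
Qed.

Lemma hder_t z : hder t z (t1 z).
Proof.
rewrite /t1 -mulrN; apply: hderM; first by apply: hder_shift; exact: hder_p.
by apply: hder_refl; exact: hder_p.
Qed.

Lemma hder_t1 z : hder t1 z (t2 z).
Proof.
rewrite (_ : t2 z = (p2 (z + LC) * p (LC - z) + p1 (z + LC) * - p1 (LC - z)) +
  - (p1 (z + LC) * p1 (LC - z) + p (z + LC) * - p2 (LC - z))); last by rewrite /t2; ring.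
apply: hderD; last apply: hderN; apply: hderM.
- by apply: hder_shift; exact: hder_p1.
- by apply: hder_refl; exact: hder_p.
- by apply: hder_shift; exact: hder_p.
- by apply: hder_refl; exact: hder_p1.
Qed.

(** In terms of t'/t the translation subtracts the constant 1, which comes from differentiating the
    multiplier. This constant produces the difference equation of [wf]. *)
Lemma t1_shift z : t1 (z + a%:C) = - cexp (LC - z) * (t1 z - t z).
Proof.
have h1 : hder (fun w => t (w + a%:C)) z (t1 (z + a%:C)).
  by apply: hder_shift; exact: hder_t.
have h2 := hderM (hderN (hder_refl (hder_cexp (LC - z)))) (hder_t z).
apply: (hder_unique h1); apply: hder_ext (fun w => esym (t_shift w)) _.
by apply: hder_eq; [exact: h2|ring].
Qed.

Let hol_aff k D (f : C -> C) (b : C) : (forall k D, hol k D f) -> hol k D (fun z => f (z + b)).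
Proof.
move=> hf; apply: (@hol_comp R k D setT f (fun z => z + b)) => //.
by apply: holD; [exact: hol_id|exact: hol_cst].
Qed.

Let hol_ref k D (f : C -> C) (b : C) : (forall k D, hol k D f) -> hol k D (fun z => f (b - z)).
Proof.
move=> hf; apply: (@hol_comp R k D setT f (fun z => b - z)) => //.
by apply: holD; [exact: hol_cst|apply: holN; exact: hol_id].
Qed.

Lemma hol_t k D : hol k D t.
Proof. by apply: holM; [exact/hol_aff/hol_p|exact/hol_ref/hol_p]. Qed.

Lemma hol_t1 k D : hol k D t1.
Proof.
have : hol k.+1 setT t by exact: hol_t.
move=> [_ [f' hf Hf]]; apply: (@hol_sub _ _ setT) => //.
rewrite (_ : t1 = f') //; apply/funext => z.
by apply: (hder_unique (hder_t z)); exact: hf.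
Qed.

Lemma hol_sp1 k D : hol k D sp1. Proof. exact/hol_aff/hol_t. Qed.
Lemma hol_sp2 k D : hol k D sp2. Proof. exact/hol_aff/hol_t. Qed.

Lemma hol_m k D : hol k D m.
Proof.
apply: holM; first exact: hol_p.
apply: (@hol_comp R k D setT p (fun z => - z)) => //.
by apply: holN; exact: hol_id.
Qed.

Lemma m_even z : m (- z) = m z.
Proof. by rewrite /m opprK mulrC. Qed.

Lemma hol_th k D : hol k D th.
Proof.
apply: holM; last exact: hol_m.
by apply: holD; [exact: hol_cst|apply: holN; exact: hol_cexp].
Qed.

Lemma th_neg z : th (- z) = - cexp (- z) * th z.
Proof.
rewrite /th m_even.
have E : cexp (- z) * cexp z = 1 by rewrite -cexpD addrC subrr cexp0.
have -> : - cexp (- z) * ((1 - cexp z) * m z) = (cexp (- z) * cexp z - cexp (- z)) * m z by ring.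
by rewrite E.
Qed.

Lemma th_shift z : th (z + a%:C) = - cexp (- z) * th z.
Proof.
rewrite /th /m (pstep z) (pstep (- (z + a%:C))).
have -> : - (z + a%:C) + a%:C = - z by ring.
have E : cexp (- z) * cexp z = 1 by rewrite -cexpD addrC subrr cexp0.
have -> : - cexp (- z) * ((1 - cexp z) * ((1 - cexp (z + a%:C)) * p (z + a%:C) * p (- z))) =
   (cexp (- z) * cexp z - cexp (- z)) * ((1 - cexp (z + a%:C)) * p (z + a%:C) * p (- z)) by ring.
by rewrite E; ring.
Qed.

Lemma th_conj z : th (conjc z) = conjc (th z).
Proof. by rewrite /th /m [RHS]conjM [conjc (_ * p _)]conjM -!p_conj conjB conjc1 cexp_conj conjN. Qed.

Lemma th_tpi z : th (z + tpi) = th z.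
Proof. by rewrite /th /m cexp_tpi p_tpi opprD p_tpiN. Qed.

(* The punctures, in the coordinate z of the universal cover. *)
Definition lat z := exists j : int, cexp z = (expR (2 * L * j%:~R))%:C.

Lemma th_neq0 z : ~ lat z -> th z != 0.
Proof.
move=> nl; have H j : cexp z != (expR (2 * L * j%:~R))%:C.
  by apply/eqP => E; apply: nl; exists j.
rewrite mulf_neq0 //.
  rewrite subr_eq0 eq_sym; have := H 0; by rewrite mulr0 expR0.
rewrite mulf_neq0 ?p_neq0 // => j; apply/eqP => E.
have := H (- j); rewrite -[z]opprK cexpN E -realCV -expRN.
by rewrite mulrNz mulrN eqxx.
Qed.

(** The exact location of the zeros is not recorded, only that e^z is positive there; this is enough
    to separate the zeros of [sp1] and [sp2]. *)
Lemma t_eq0 z : t z = 0 -> exists2 x, 0 < x & cexp z = x%:C.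
Proof.
move=> /eqP; rewrite mulf_eq0 => /orP[] /eqP E.
- have [//|N] := pselect (exists2 x, 0 < x & cexp z = x%:C).
  suff : p (z + LC) != 0 by rewrite E eqxx.
  apply: p_neq0 => j; apply/eqP => F; apply: N.
  exists (expR (2 * L * j%:~R) / expR L); first by rewrite divr_gt0 ?expR_gt0.
  rewrite realCM realCV -F cexpD cexp_L mulfK //.
  by rewrite -cabs_eq0 cabs_real normr_eq0 gt_eqF ?expR_gt0.
- have [//|N] := pselect (exists2 x, 0 < x & cexp z = x%:C).
  suff : p (LC - z) != 0 by rewrite E eqxx.
  apply: p_neq0 => j; apply/eqP => F; apply: N.
  exists (expR L / expR (2 * L * j%:~R)); first by rewrite divr_gt0 ?expR_gt0.
  by rewrite realCM realCV -F -cexp_L -cexpN -cexpD; congr cexp; ring.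
Qed.

Lemma cos_lt1 (x : R) : 0 < x < 2 * pi -> cos x < 1.
Proof.
move=> /andP[x0 xp]; have -> : x = (x / 2) *+ 2 by rewrite mulr2n; field.
rewrite cos_mulr2n cos2sin2.
have : 0 < sin (x / 2) by apply: sin_gt0_pi; apply/andP; split; lra.
by rewrite mulr2n => H; have := exprn_gt0 2 H; lra.
Qed.

(** At a common zero both e^(z - i al) and e^(z + i al) would be positive, hence also e^(2 i al),
    which is impossible for 0 < 2 al < 2 pi. This makes the surface immersed. *)
Lemma sp_neq0 z : ~ (sp1 z = 0 /\ sp2 z = 0).
Proof.
move=> [/t_eq0[x x0 Ex] /t_eq0[y y0 Ey]].
have E : cexp (ial + ial) = (y / x)%:C.
  rewrite realCM realCV -Ex -Ey -cexpN -cexpD; congr cexp; ring.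
have y1 : y / x = 1.
  have := congr1 (fun z => cabs z) E.
  rewrite cabs_cexp /= addr0 expR0 expr0n addr0 sqrtr_sqr ger0_norm => [-> //|].
  by rewrite divr_ge0 // ltW.
have := congr1 (fun z => Re z) E; rewrite y1 Re_cexp /= addr0 expR0 mul1r => F.
have := @cos_lt1 (al + al); rewrite F ltxx => H.
by move: L0 al0 alpi => ? ? ?; suff : false by []; apply: H; apply/andP; split; lra.
Qed.

Lemma sin_al : 0 < sin al.
Proof. by apply: sin_gt0_pi; apply/andP. Qed.

Lemma t_ial_neq0 : t ial != 0.
Proof.
apply/eqP => /t_eq0[x x0 /(congr1 (fun z => Im z))].
rewrite Im_cexp /= expR0 mul1r => /eqP.
by rewrite gt_eqF ?sin_al.
Qed.

Definition wA z : C := chi z * sp1 z ^+ 2.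
Definition wB z : C := chi z * sp2 z ^+ 2.
Definition wC z : C := chi z * (sp1 z * sp2 z).
(** The form [wC] with t replaced by its derivative in the first spinor: an auxiliary form whose
    variation under translation is [wC], used to compute the vertical period of [wC]. *)
Definition wf z : C := chi z * (t1 (z - ial) * sp2 z).

Lemma chi_neq0 z : ~ lat z -> chi z != 0.
Proof. by move=> nl; rewrite mulf_neq0 ?cexp_neq0 // invr_eq0 expf_neq0 // th_neq0. Qed.

Lemma hol_chi k D : (forall z, D z -> ~ lat z) -> hol k D chi.
Proof.
move=> nl; apply: holM; first exact: hol_cexp.
apply: holV; first by move=> z /nl nz; rewrite expf_neq0 // th_neq0.
by apply: holX; exact: hol_th.
Qed.

Lemma hol_wf k D : (forall z, D z -> ~ lat z) -> hol k D wf.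
Proof.
move=> nl; apply: holM; first exact: hol_chi.
by apply: holM; [exact/hol_aff/hol_t1|exact: hol_sp2].
Qed.

Lemma chi_conj z : chi (conjc z) = conjc (chi z).
Proof. by rewrite /chi cexp_conj th_conj [RHS]conjM conjV conjX. Qed.

Lemma chi_even z : chi (- z) = chi z.
Proof.
rewrite /chi th_neg exprMn sqrrN cexpN.
have c0 := cexp_neq0 z; have [->|h0] := eqVneq (th z) 0; first by rewrite expr0n /= mulr0 invr0 !mulr0.
by field; rewrite c0 h0.
Qed.

Lemma chi_tpi z : chi (z + tpi) = chi z.
Proof. by rewrite /chi cexp_tpi th_tpi. Qed.

Lemma cexp_a : cexp (a%:C) * (cexp LC * cexp LC) = 1.
Proof. by rewrite -!cexpD aE (_ : _ + _ = 0) ?cexp0 //; ring. Qed.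

Lemma chi_shift z : chi (z + a%:C) * (cexp LC * cexp LC) = cexp z ^+ 2 * chi z.
Proof.
rewrite /chi th_shift exprMn sqrrN cexpD cexpN.
rewrite -[RHS]mul1r -cexp_a.
have c0 := cexp_neq0 z; have [->|h0] := eqVneq (th z) 0.
  by rewrite expr0n /= mulr0 invr0 !mulr0 mul0r.
by field; rewrite c0 h0.
Qed.

Lemma chi_shift' z w : chi (z + a%:C) * (cexp (LC - z) ^+ 2 * w) = chi z * w.
Proof.
rewrite cexpD cexpN.
have c0 := cexp_neq0 z.
rewrite (_ : chi (z + a%:C) * _ = (chi (z + a%:C) * (cexp LC * cexp LC)) * w / cexp z ^+ 2).
  by rewrite chi_shift; field.
by field.
Qed.

Lemma sp1_shift z : sp1 (z + a%:C) = - cexp (LC - z) * (cexp ial * sp1 z).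
Proof.
rewrite /sp1 addrAC t_shift (_ : LC - (z - ial) = LC - z + ial); last by ring.
by rewrite cexpD; ring.
Qed.

Lemma sp2_shift z : sp2 (z + a%:C) = - cexp (LC - z) * (cexp (- ial) * sp2 z).
Proof.
rewrite /sp2 addrAC t_shift (_ : LC - (z + ial) = LC - z - ial); last by ring.
by rewrite cexpD; ring.
Qed.

Let eial : cexp ial * cexp (- ial) = 1.
Proof. by rewrite -cexpD subrr cexp0. Qed.

(** The multipliers e^(i al) and e^(-i al) of the two spinors cancel, and -e^(L - z) is absorbed by
    [chi]. *)
Lemma wC_shift z : wC (z + a%:C) = wC z.
Proof.
rewrite /wC sp1_shift sp2_shift.
rewrite (_ : _ * (- cexp (LC - z) * _) =
  cexp (LC - z) ^+ 2 * ((cexp ial * cexp (- ial)) * (sp1 z * sp2 z))); last by ring.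
by rewrite chi_shift' eial mul1r.
Qed.

(** Direct consequence of t'/t dropping by 1. A period of [wC] becomes a difference of two periods
    of [wf], hence a residue. *)
Lemma wf_shift z : wf (z + a%:C) = wf z - wC z.
Proof.
rewrite /wf /wC sp2_shift addrAC t1_shift (_ : LC - (z - ial) = LC - z + ial); last by ring.
rewrite cexpD.
rewrite (_ : _ * (- cexp (LC - z) * _) =
  cexp (LC - z) ^+ 2 * ((cexp ial * cexp (- ial)) * ((t1 (z - ial) - t (z - ial)) * sp2 z))); last by ring.
by rewrite chi_shift' eial mul1r -/(sp1 z); ring.
Qed.

Lemma conj_ial : conjc ial = - ial.
Proof. by apply: eqC; rewrite /= ?oppr0. Qed.

Lemma sp1_conj z : sp1 (conjc z) = conjc (sp2 z).
Proof. by rewrite /sp1 /sp2 -t_conj conjD conj_ial. Qed.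
Lemma sp2_conj z : sp2 (conjc z) = conjc (sp1 z).
Proof. by rewrite /sp1 /sp2 -t_conj conjB conj_ial opprK. Qed.
Lemma sp1_neg z : sp1 (- z) = sp2 z.
Proof. by rewrite /sp1 /sp2 -opprD t_even. Qed.
Lemma wA_conj z : wA (conjc z) = conjc (wB z).
Proof. by rewrite /wA chi_conj sp1_conj [RHS]conjM conjX. Qed.
Lemma wB_conj z : wB (conjc z) = conjc (wA z).
Proof. by rewrite /wB chi_conj sp2_conj [RHS]conjM conjX. Qed.
Lemma sp1_tpi z : sp1 (z + tpi) = sp1 z.
Proof. by rewrite /sp1 addrAC t_tpi. Qed.
Lemma sp2_tpi z : sp2 (z + tpi) = sp2 z.
Proof. by rewrite /sp2 addrAC t_tpi. Qed.
Lemma t1_tpi z : t1 (z + tpi) = t1 z.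
Proof.
have E : (fun w => t (w + tpi)) =1 t by move=> w; rewrite t_tpi.
apply: (@hder_unique _ t z) (hder_t z); apply: hder_ext E _.
by apply: hder_shift; exact: hder_t.
Qed.
Lemma wA_tpi z : wA (z + tpi) = wA z.
Proof. by rewrite /wA chi_tpi sp1_tpi. Qed.
Lemma wB_tpi z : wB (z + tpi) = wB z.
Proof. by rewrite /wB chi_tpi sp2_tpi. Qed.
Lemma wC_tpi z : wC (z + tpi) = wC z.
Proof. by rewrite /wC chi_tpi sp1_tpi sp2_tpi. Qed.
Lemma wf_tpi z : wf (z + tpi) = wf z.
Proof. by rewrite /wf chi_tpi sp2_tpi addrAC t1_tpi. Qed.

(** The even factor, regular near 0, that is left of [chi] once the model pole [pole2] is taken
    out. *)
Definition im2 z : C := (m z ^+ 2)^-1.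

Lemma chi_pole z : chi z = pole2 z * im2 z.
Proof. by rewrite /chi /pole2 /im2 /th exprMn invfM mulrA. Qed.

Lemma m0_neq0 : m 0 != 0.
Proof. by rewrite /m oppr0 mulf_neq0. Qed.

Lemma m_neq0_near : exists2 r, 0 < r & forall z, cabs z < r -> m z != 0.
Proof.
have c0 : 0 < cabs (m 0) by rewrite cabs_gt0 m0_neq0.
have /continuousCP /(_ _ c0) /nbhsCP [r r0 Hr] := hol_continuous (hol_m 0 setT) (Logic.I : setT 0).
exists r => // z zr; apply/eqP => E.
have := Hr z; rewrite subr0 => /(_ zr); rewrite /= E sub0r cabsN ltxx.
by [].
Qed.

Lemma sp1_0 : sp1 0 = t ial.
Proof. by rewrite /sp1 sub0r t_even. Qed.

Lemma sp2_0 : sp2 0 = t ial.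
Proof. by rewrite /sp2 add0r. Qed.

Lemma hder_sp1 z : hder sp1 z (t1 (z - ial)).
Proof. by apply: (@hder_shift R t (- ial)); exact: hder_t. Qed.

Lemma hder_sp2 z : hder sp2 z (t1 (z + ial)).
Proof. by apply: (@hder_shift R t ial); exact: hder_t. Qed.

Lemma im2_der0 : hder im2 0 0.
Proof.
have [r r0 Hr] := m_neq0_near.
have H : hol 1 [set z | cabs z < r] im2.
  apply: holV; first by move=> z /Hr mz; rewrite expf_neq0.
  by apply: holX; exact: hol_m.
have [_ [im2' Hd _]] := H.
have z0r : cabs (0 : C) < r by rewrite cabs0.
have h0 : hder im2 0 (im2' 0) by exact: Hd.
have E : im2' 0 = 0.
  by apply: (hder_even _ h0) => z; rewrite /im2 m_even.
by rewrite E in h0.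
Qed.

Lemma weier_expand (N : C -> C) d : (forall k D, hol k D N) -> hder N 0 d ->
  exists2 r, 0 < r & exists2 M, 0 <= M & forall z, 0 < cabs z < r ->
    cabs (chi z * N z - (N 0 * im2 0 / z ^+ 2 + d * im2 0 / z)) <= M.
Proof.
move=> hN dN; have [r r0 Hr] := m_neq0_near.
have H : hol 2 [set z | cabs z < r] (fun z => N z * im2 z).
  apply: holM; first exact: hN.
  apply: holV; first by move=> z /Hr mz; rewrite expf_neq0.
  by apply: holX; exact: hol_m.
have hd : hder (fun z => N z * im2 z) 0 (d * im2 0).
  by have := hderM dN im2_der0; rewrite mulr0 addr0.
have [r1 r10 [M M0 HM]] := sing_expand r0 H hd.
exists r1 => //; exists M => // z zr.
have -> : chi z * N z = pole2 z * (N z * im2 z) by rewrite chi_pole; ring.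
exact: HM.
Qed.

(** [kappa] is the coefficient of z^-2 shared by the three forms at 0. [gres] is the residue of [wB]
    and minus that of [wA]; it becomes the logarithmic growth of the end. *)
Definition kappa : C := t ial ^+ 2 * im2 0.
Definition gres : C := 2 * (t ial * t1 ial) * im2 0.

Let hX2 (f : C -> C) z d : hder f z d -> hder (fun w => f w ^+ 2) z (2 * f z * d).
Proof.
move=> hf; have := hderM hf hf; rewrite (_ : d * f z + f z * d = 2 * f z * d); last by ring.
by apply: hder_ext => w; rewrite expr2.
Qed.

Let common (f g h : C -> C) : (exists2 r, 0 < r & exists2 M, 0 <= M & forall z, 0 < cabs z < r -> cabs (f z) <= M) ->
  (exists2 r, 0 < r & exists2 M, 0 <= M & forall z, 0 < cabs z < r -> cabs (g z) <= M) ->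
  (exists2 r, 0 < r & exists2 M, 0 <= M & forall z, 0 < cabs z < r -> cabs (h z) <= M) ->
  exists2 r, 0 < r & exists2 M, 0 <= M & forall z, 0 < cabs z < r ->
    [/\ cabs (f z) <= M, cabs (g z) <= M & cabs (h z) <= M].
Proof.
move=> [r1 r10 [M1 M10 H1]] [r2 r20 [M2 M20 H2]] [r3 r30 [M3 M30 H3]].
exists (Num.min r1 (Num.min r2 r3)); first by rewrite !lt_min r10 r20 r30.
exists (M1 + M2 + M3) => [|z /andP[z0]]; first by rewrite !addr_ge0.
rewrite !lt_min => /and3P[zr1 zr2 zr3]; split.
- by rewrite (le_trans (H1 z _)) ?z0 // -addrA lerDl addr_ge0.
- by rewrite (le_trans (H2 z _)) ?z0 // addrAC lerDr addr_ge0.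
- by rewrite (le_trans (H3 z _)) ?z0 // lerDr addr_ge0.
Qed.

Lemma wABC_expand : exists2 r, 0 < r & exists2 M, 0 <= M & forall z, 0 < cabs z < r ->
  [/\ cabs (wA z - (kappa / z ^+ 2 - gres / z)) <= M,
      cabs (wB z - (kappa / z ^+ 2 + gres / z)) <= M
    & cabs (wC z - kappa / z ^+ 2) <= M].
Proof.
apply: common.
- have [||r r0 [M M0 H]] := @weier_expand (fun z => sp1 z ^+ 2) (2 * sp1 0 * t1 (0 - ial)).
  + by move=> k D; apply: holX; exact: hol_sp1.
  + by apply: hX2; exact: hder_sp1.
  exists r => //; exists M => // z /H.
  rewrite sp1_0 sub0r t1_odd; congr (cabs (_ - _) <= _); rewrite /kappa /gres; ring.
- have [||r r0 [M M0 H]] := @weier_expand (fun z => sp2 z ^+ 2) (2 * sp2 0 * t1 (0 + ial)).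
  + by move=> k D; apply: holX; exact: hol_sp2.
  + by apply: hX2; exact: hder_sp2.
  exists r => //; exists M => // z /H.
  rewrite sp2_0 add0r; congr (cabs (_ - _) <= _); rewrite /kappa /gres; ring.
- have [||r r0 [M M0 H]] := @weier_expand (fun z => sp1 z * sp2 z)
    (t1 (0 - ial) * sp2 0 + sp1 0 * t1 (0 + ial)).
  + by move=> k D; apply: holM; [exact: hol_sp1|exact: hol_sp2].
  + by apply: hderM; [exact: hder_sp1|exact: hder_sp2].
  exists r => //; exists M => // z /H.
  rewrite sp1_0 sp2_0 (add0r ial) (sub0r ial) t1_odd; congr (cabs (_ - _) <= _); rewrite /kappa; ring.
Qed.

(** The hypothesis is the vanishing of the numerator of (log t)'' at i al, which up to the factor
    [im2 0] is the residue of [wf] at 0. *)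
Lemma wf_expand : t2 ial * t ial - t1 ial ^+ 2 = 0 -> exists k : C,
  exists2 r, 0 < r & exists2 M, 0 <= M & forall z, 0 < cabs z < r ->
    cabs (wf z - k / z ^+ 2) <= M.
Proof.
move=> E; have [||r r0 [M M0 H]] := @weier_expand (fun z => t1 (z - ial) * sp2 z)
    (t2 (0 - ial) * sp2 0 + t1 (0 - ial) * t1 (0 + ial)).
- by move=> k D; apply: holM; [exact/hol_aff/hol_t1|exact: hol_sp2].
- apply: hderM; last exact: hder_sp2.
  by apply: (@hder_shift R t1 (- ial)); exact: hder_t1.
exists (t1 (0 - ial) * sp2 0 * im2 0), r => //; exists M => // z /H.
rewrite (_ : t2 (0 - ial) * sp2 0 + t1 (0 - ial) * t1 (0 + ial) = 0) ?mul0r ?addr0 //.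
by rewrite sp2_0 (sub0r ial) (add0r ial) t2_even t1_odd -E; ring.
Qed.

Lemma conj_fixed z : conjc z = z -> z = (Re z)%:C.
Proof.
move=> E; apply: eqC => //=; have := congr1 (fun z => Im z) E; rewrite Im_conj.
by move: (Im z) => y; lra.
Qed.

(** It is the square of t(i al)/m(0), which is real: t is even and commutes with conjugation, and
    conjugation sends i al to -i al. *)
Lemma kappaE : exists2 k : R, 0 < k & kappa = k%:C.
Proof.
pose x := t ial / m 0.
have xr : x = (Re x)%:C.
  have c0 : conjc (0 : C) = 0 by exact: conjc0.
  have m0 : conjc (m 0) = m 0 by rewrite /m conjM -!p_conj conjN c0.
  by apply: conj_fixed; rewrite /x conjM conjV m0 -t_conj conj_ial t_even.
have xn : x != 0 by rewrite mulf_neq0 ?t_ial_neq0 // invr_eq0 m0_neq0.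
exists (Re x ^+ 2).
  rewrite lt_def sqr_ge0 andbT expf_neq0 //.
  by apply: contraNneq xn => E; rewrite xr E.
by rewrite realCX -xr /x exprMn exprVn.
Qed.

Local Notation w0 := (ial + LC).

Let w0c : LC - ial = conjc w0.
Proof. by rewrite conjD conj_ial conj_L addrC. Qed.

(** At i al the two factors of t are the values of [p] at the conjugate points w0 and conj w0. Hence
    t' is a difference of conjugates and the numerator of (log t)'' a sum of conjugates. *)
Lemma t1_w : t1 ial = p1 w0 * conjc (p w0) - conjc (p1 w0 * conjc (p w0)).
Proof. by rewrite /t1 w0c p_conj p1_conj [conjc (_ * _)]conjM conjcK; ring. Qed.

Lemma t2_w : t2 ial * t ial - t1 ial ^+ 2 =
  (p2 w0 * p w0 - p1 w0 ^+ 2) * conjc (p w0) ^+ 2 +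
  conjc ((p2 w0 * p w0 - p1 w0 ^+ 2) * conjc (p w0) ^+ 2).
Proof.
rewrite /t2 /t1 /t w0c p_conj p1_conj p2_conj.
by rewrite conjM conjX conjcK conjB conjM conjX; ring.
Qed.

(** t(i al) is real and t'(i al) is 2i times the imaginary part of p'(w0) conj(p(w0)). The
    nonvanishing of that imaginary part is what gives the ends a nonzero logarithmic growth. *)
Lemma gresE : Im (p1 w0 / p w0) != 0 -> p w0 != 0 ->
  exists2 y : R, y != 0 & gres = I * y%:C.
Proof.
move=> n1 n0; have t0 := t_ial_neq0.
have pp : p w0 * conjc (p w0) = (cabs (p w0) ^+ 2)%:C.
  rewrite cabs_sqr; apply: eqC; rewrite ?(ReM, ImM, Re_conj, Im_conj) /=; ring.
have E1 : t1 ial = I * (2 * cabs (p w0) ^+ 2 * Im (p1 w0 / p w0))%:C.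
  have e : p1 w0 * conjc (p w0) = (cabs (p w0) ^+ 2)%:C * (p1 w0 / p w0).
    by rewrite -pp; field.
  rewrite t1_w e conjM conjc_real; apply: eqC.
    by rewrite !(ReD, ReN, ReM, ImM, Re_conj, Im_conj) /=; ring.
  by rewrite !(ImD, ImN, ReM, ImM, Re_conj, Im_conj) /=; ring.
pose x := t ial / m 0.
have [k k0 kE] := kappaE.
have tr : t ial = (Re (t ial))%:C by apply: conj_fixed; rewrite -t_conj conj_ial t_even.
pose y0 := 2 * cabs (p w0) ^+ 2 * Im (p1 w0 / p w0).
have y00 : y0 != 0.
  by rewrite !mulf_neq0 ?pnatr_eq0 ?cabs_eq0.
rewrite -/y0 in E1; clearbody y0.
have Rt : Re (t ial) != 0 by apply: contraNneq t0 => E; rewrite tr E.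
exists (2 * y0 * k / Re (t ial)).
  by rewrite mulf_neq0 ?invr_eq0 // mulf_neq0 ?(gt_eqF k0) // mulf_neq0 ?pnatr_eq0.
rewrite realCM realCV -tr !realCM -kE /gres /kappa E1.
have -> : (2 : R)%:C = 2 :> C by rewrite rmorph_nat.
by field.
Qed.

(** (log t)''(i al) is twice the real part of (log p)''(w0); this is why a single real parameter
    suffices to close the surface. *)
Lemma t2_zero : Re ((p2 w0 * p w0 - p1 w0 ^+ 2) / p w0 ^+ 2) = 0 -> p w0 != 0 ->
  t2 ial * t ial - t1 ial ^+ 2 = 0.
Proof.
move=> E n0.
have pp : p w0 * conjc (p w0) = (cabs (p w0) ^+ 2)%:C.
  rewrite cabs_sqr; apply: eqC; rewrite ?(ReM, ImM, Re_conj, Im_conj) /=; ring.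
have e : (p2 w0 * p w0 - p1 w0 ^+ 2) * conjc (p w0) ^+ 2 =
   (cabs (p w0) ^+ 2)%:C ^+ 2 * ((p2 w0 * p w0 - p1 w0 ^+ 2) / p w0 ^+ 2).
  by rewrite -pp exprMn; field.
rewrite t2_w e -realCX; move: E; set u := (_ / _) => E.
apply: eqC; last by rewrite ImD Im_conj subrr.
by rewrite ReD Re_conj ReZ E mulr0 addr0.
Qed.

End Theta.

Section Nome.
Variable R : realType.
Local Notation C := R[i].
Variable L : R.
Hypothesis L0 : 0 < L.
Implicit Types z : C.

Definition nome : R := expR (- (2 * L)).
Local Notation q := nome.
Local Notation a := (- (2 * L)).

Lemma nome01 : 0 < q < 1.
Proof. by rewrite /nome expR_gt0 /= expR_lt1 oppr_lt0 mulr_gt0 // ltr0n. Qed.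

Local Notation p := (qp q).

Lemma qp_neq0 z : (forall j : int, cexp z != (expR (2 * L * j%:~R))%:C) -> p z != 0.
Proof.
move=> H; apply: (regular_qp nome01) => j; rewrite subr_eq0 eq_sym.
apply: contraNneq (H j.+1%:Z) => E.
have qj : (q%:C : C) ^+ j.+1 = (expR (- (2 * L * j.+1%:~R)))%:C.
  rewrite -realCX /nome -expRM_natl; congr (expR _)%:C.
  by rewrite -mulrN mulrC -pmulrn; ring.
have qn : (q%:C : C) ^+ j.+1 != 0.
  by rewrite qj -cabs_eq0 cabs_real normr_eq0 gt_eqF ?expR_gt0.
apply/eqP/(mulfI qn); rewrite E qj -realCM -expRD addNr expR0.
by [].
Qed.

End Nome.

(** * Strips covering the complement of the lattice *)

Section Periods.
Variable R : realType.
Local Notation C := R[i].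
Local Notation Ct := (R[i]^o).
Local Notation tpi := (tpi R).
Implicit Types (z w : C) (F G E : C -> R) (f g : C -> C).
Variable L : R.
Hypothesis L0 : 0 < L.
Local Notation a := (- (2 * L)).

Definition vstrip (j : int) : set C := [set z | 2 * L * j%:~R < Re z < 2 * L * (j + 1)%:~R].
Definition hstrip (k : int) : set C := [set z | 2 * pi * k%:~R < Im z < 2 * pi * (k + 1)%:~R].

Lemma pi2_gt0 : (0 : R) < 2 * pi.
Proof. by rewrite mulr_gt0 // pi_gt0. Qed.

Let convex_lt (u v t : R) : 0 < u -> 0 < v -> 0 <= t <= 1 -> 0 < (1 - t) * u + t * v.
Proof.
move=> u0 v0 /andP[t0 t1]; have [->|tn] := eqVneq t 0.
  by rewrite subr0 mul1r mul0r addr0.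
by rewrite ltr_wpDl // ?mulr_gt0 ?mulr_ge0 // ?subr_ge0 ?(ltW u0) // lt_def tn.
Qed.

Let convex_itv (x y p q t : R) : x < p < y -> x < q < y -> 0 <= t <= 1 ->
  x < p + t * (q - p) < y.
Proof.
move=> /andP[px py] /andP[qx qy] tt.
have H1 : 0 < (1 - t) * (p - x) + t * (q - x) by apply: convex_lt; rewrite ?subr_gt0.
have H2 : 0 < (1 - t) * (y - p) + t * (y - q) by apply: convex_lt; rewrite ?subr_gt0.
have E1 : p + t * (q - p) - x = (1 - t) * (p - x) + t * (q - x) by ring.
have E2 : y - (p + t * (q - p)) = (1 - t) * (y - p) + t * (y - q) by ring.
by rewrite -subr_gt0 E1 H1 -subr_gt0 E2 H2.
Qed.

Lemma convex_Re (x y : R) : convexC [set z : C | x < Re z < y].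
Proof.
by move=> z w t /= zz ww tt; rewrite ReD ReZ ReD ReN; exact: convex_itv.
Qed.

Lemma convex_Im (x y : R) : convexC [set z : C | x < Im z < y].
Proof.
by move=> z w t /= zz ww tt; rewrite ImD ImZ ImD ImN; exact: convex_itv.
Qed.

Lemma convexI (A B : set C) : convexC A -> convexC B -> convexC (A `&` B).
Proof. by move=> cA cB z w t [Az Bz] [Aw Bw] tt; split; [exact: cA|exact: cB]. Qed.

Lemma open_itvC (f : Ct -> R) (x y : R) : continuous f -> open [set z : Ct | x < f z < y].
Proof.
move=> cf; rewrite (_ : mkset _ = f @^-1` [set t | x < t] `&` f @^-1` [set t | t < y]); last first.
  by apply/seteqP; split => z /=; [move/andP|move=> ?; apply/andP].
have oc (A : set R) : open A -> open (f @^-1` A) by apply: open_comp => z _; exact: cf.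
by apply: openI; apply: oc; [exact: open_gt|exact: open_lt].
Qed.

Lemma open_vstrip j : open (vstrip j : set Ct).
Proof. exact/open_itvC/continuous_Re. Qed.
Lemma open_hstrip j : open (hstrip j : set Ct).
Proof. exact/open_itvC/continuous_Im. Qed.
Lemma convex_vstrip j : convexC (vstrip j). Proof. exact: convex_Re. Qed.
Lemma convex_hstrip j : convexC (hstrip j). Proof. exact: convex_Im. Qed.

Lemma cexp_Re z w : cexp z = cexp w -> Re z = Re w.
Proof. by move=> /(congr1 (fun v => cabs v)); rewrite !cabs_cexp => /expR_inj. Qed.

Lemma cexp_tpin z (n : nat) : cexp (z + tpi *+ n) = cexp z.
Proof.
elim: n => [|n IH]; first by rewrite mulr0n addr0.
by rewrite mulrSr addrA cexp_tpi.
Qed.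

Lemma cexp_tpiz z (k : int) : cexp (z + tpi *~ k) = cexp z.
Proof.
case: k => n; first by rewrite -pmulrn cexp_tpin.
rewrite NegzE mulrNz -pmulrn -(cexp_tpin (z - tpi *+ n.+1) n.+1); congr cexp.
by rewrite addrNK.
Qed.

Lemma Re_tpi : Re tpi = 0. Proof. by []. Qed.
Lemma Im_tpi : Im tpi = 2 * pi. Proof. by []. Qed.

Lemma tpiz (k : int) : tpi *~ k = 0 +i* (2 * pi * k%:~R).
Proof.
have H (n : nat) : tpi *+ n = 0 +i* (2 * pi * n%:R).
  elim: n => [|n IH]; first by rewrite mulr0n mulr0.
  rewrite mulrSr IH; apply: eqC.
      by rewrite ReD Re_tpi /= addr0.
    by rewrite ImD Im_tpi /= -(natr1 n); ring.
case: k => n; first by rewrite -pmulrn H.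
rewrite NegzE mulrNz -pmulrn H; apply: eqC; rewrite ?ReN ?ImN /= ?oppr0 //.
by rewrite mulrNz mulrN.
Qed.

Let intrS (k : int) : (k + 1)%:~R = k%:~R + 1 :> R.
Proof. by rewrite intrD. Qed.

Lemma vstrip_nlat j z : vstrip j z -> ~ lat L z.
Proof.
move=> /andP[jz zj] [j' E].
have Rz : Re z = 2 * L * j'%:~R.
  by rewrite (@cexp_Re z (2 * L * j'%:~R)%:C) // E cexp_real.
have L2 : 0 < 2 * L by rewrite mulr_gt0.
move: jz zj; rewrite Rz !ltr_pM2l // !ltr_int.
by move=> j1; rewrite ltzD1 leNgt j1.
Qed.

Lemma hstrip_nlat k z : hstrip k z -> ~ lat L z.
Proof.
move=> /andP[kz zk] [j E].
pose w := z + tpi *~ (- k).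
have Ew : cexp w = (expR (2 * L * j%:~R))%:C by rewrite /w cexp_tpiz.
have := congr1 (fun v => Re v) Ew; rewrite Re_cexp /=.
have -> : Re w = 2 * L * j%:~R.
  by rewrite (@cexp_Re w (2 * L * j%:~R)%:C) // Ew cexp_real.
have e0 := expR_gt0 (2 * L * j%:~R).
move=> /(canRL (mulKf (lt0r_neq0 e0))); rewrite mulVf ?gt_eqF // => c1.
have := @cos_lt1 _ (Im w); rewrite c1 ltxx.
have -> : Im w = Im z - 2 * pi * k%:~R.
  by rewrite /w ImD tpiz /= mulrNz mulrN.
move=> H; suff : false by []; apply: H.
have ES : 2 * pi * (k + 1)%:~R = 2 * pi * k%:~R + 2 * pi :> R by rewrite intrS; ring.
move: kz zk; rewrite ES; move: (2 * pi * k%:~R) => u ? ?.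
by apply/andP; split; lra.
Qed.

(** If Im z is not a multiple of 2 pi then z lies in a horizontal strip; otherwise Re z is not a
    multiple of 2L. Both families consist of convex open sets, on which potentials exist and are
    unique up to a constant. *)
Lemma nlat_cover z : ~ lat L z -> (exists j, vstrip j z) \/ (exists k, hstrip k z).
Proof.
move=> nl; pose k := Num.floor (Im z / (2 * pi)); have p2 := pi2_gt0.
have /andP[k1 k2] := floor_itv (Im z / (2 * pi)).
rewrite -/k ler_pdivlMr // in k1; rewrite -/k ltr_pdivrMr // in k2.
have [E|ne] := eqVneq (2 * pi * k%:~R) (Im z); last first.
  by right; exists k; rewrite /hstrip /= lt_def eq_sym ne /= mulrC k1 mulrC.
left; pose j := Num.floor (Re z / (2 * L)); have L2 : 0 < 2 * L by rewrite mulr_gt0.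
have /andP[j1 j2] := floor_itv (Re z / (2 * L)).
rewrite -/j ler_pdivlMr // in j1; rewrite -/j ltr_pdivrMr // in j2.
suff nj : 2 * L * j%:~R != Re z.
  by exists j; rewrite /vstrip /= lt_def eq_sym nj /= mulrC j1 mulrC.
apply/eqP => F; apply: nl; exists j; rewrite -(cexp_tpiz z (- k)).
have -> : z + tpi *~ (- k) = (Re z)%:C.
  rewrite tpiz; apply: eqC; first by rewrite ReD /= addr0.
  by rewrite ImD /= mulrNz mulrN -E subrr.
by rewrite cexp_real F.
Qed.

Lemma pot_near (D : set Ct) F G f z : open D -> D z -> (forall w, D w -> F w = G w) ->
  pot D G f -> forall w, is_derive (0 : R) (1 : R) (fun t => F (z + t%:C * w)) (Re (w * f z)).
Proof.
move=> oD Dz FG hG w; have [r r0 Hr] := nbhs_ball_sub oD Dz.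
apply: (near_eq_is_derive _ (hG z Dz w)).
have w0 : 0 < cabs w + 1 by rewrite ltr_wpDl // cabs_ge0.
have d0 : 0 < r / (cabs w + 1) by rewrite divr_gt0.
apply: filterS (near_ball_R 0 d0) => t; rewrite subr0 ltr_pdivlMr // => tr.
apply/esym/FG/Hr; rewrite (_ : _ - z = t%:C * w); last by ring.
rewrite cabsM cabs_real (le_lt_trans _ tr) // ler_wpM2l // lerDl.
by [].
Qed.

(** Two moves along segments inside strips reach the base point L + i pi: to height pi in a vertical
    strip, to abscissa L in a horizontal one. *)
Lemma pot_nlat_const F : pot [set z | ~ lat L z] F (fun=> 0) ->
  forall z w, ~ lat L z -> ~ lat L w -> F z = F w.
Proof.
move=> hF.
pose z0 : C := L +i* pi.
have vs z j : vstrip j z -> F z = F (Re z +i* pi).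
  move=> zj; apply: (@pot_const _ (vstrip j) F (Re z +i* pi) z) => //.
  - exact: convex_vstrip.
  - by apply: pot_sub hF => v; exact: vstrip_nlat.
have hs z k : hstrip k z -> F z = F (L +i* Im z).
  move=> zk; apply: (@pot_const _ (hstrip k) F (L +i* Im z) z) => //.
  - exact: convex_hstrip.
  - by apply: pot_sub hF => v; exact: hstrip_nlat.
suff H z : ~ lat L z -> F z = F z0 by move=> z w nz nw; rewrite (H z) // (H w).
move=> /nlat_cover[[j zj]|[k zk]].
- rewrite (vs z j) // (hs _ 0) // /hstrip /= mulr0 add0r mulr1 pi_gt0 /=.
  by rewrite ltr_pMl ?pi_gt0 // ltr1n.
- rewrite (hs z k) // (vs _ 0) // /vstrip /= mulr0 add0r mulr1 L0 /=.
  by rewrite ltr_pMl // ltr1n.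
Qed.

Lemma pot_nlat_unique F G f : pot [set z | ~ lat L z] F f -> pot [set z | ~ lat L z] G f ->
  exists c, forall z, ~ lat L z -> F z = G z + c.
Proof.
move=> hF hG; pose z0 : C := L +i* pi.
have n0 : ~ lat L z0.
  apply: (@vstrip_nlat 0); rewrite /vstrip /= mulr0 add0r mulr1 L0 /=.
  by rewrite ltr_pMl // ltr1n.
exists (F z0 - G z0) => z nz.
have h0 : pot [set z | ~ lat L z] (fun z => F z - G z) (fun=> 0).
  by apply: pot_eq (potB hF hG) => v _; rewrite subrr.
by rewrite -(pot_nlat_const h0 nz n0) addrC subrK.
Qed.

End Periods.

(** * Gluing potentials, symmetric periods and residues *)

Section Global.
Variable R : realType.
Local Notation C := R[i].
Local Notation Ct := (R[i]^o).
Local Notation tpi := (tpi R).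
Implicit Types (z w : C) (F G E : C -> R) (f g : C -> C).
Variable L : R.
Hypothesis L0 : 0 < L.
Local Notation a := (- (2 * L)).
Local Notation lat := (lat L).
Local Notation vstrip := (vstrip L).
Local Notation hstrip := (@hstrip R).
Local Notation nlat := [set z : C | ~ lat z].

Let L20 : 0 < 2 * L. Proof. by rewrite mulr_gt0. Qed.
Let intrS (k : int) : (k + 1)%:~R = k%:~R + 1 :> R.
Proof. by rewrite intrD. Qed.

Let p20 : (0 : R) < 2 * pi. Proof. exact: pi2_gt0. Qed.

Definition holo_off f := forall k D, (forall z, D z -> ~ lat z) -> hol k D f.
Definition tper f := forall z, f (z + tpi) = f z.

Lemma ReC (x y : R) : Re (x +i* y) = x. Proof. by []. Qed.
Lemma ImC (x y : R) : Im (x +i* y) = y. Proof. by []. Qed.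

Lemma hstripP k z : hstrip k z <-> 2 * pi * k%:~R < Im z < 2 * pi * k%:~R + 2 * pi.
Proof. by rewrite /hstrip [mkset _ _]/mkset intrS (_ : 2 * pi * (k%:~R + 1) = 2 * pi * k%:~R + 2 * pi :> R) //; ring. Qed.

Lemma vstripP j z : vstrip j z <-> 2 * L * j%:~R < Re z < 2 * L * j%:~R + 2 * L.
Proof. by rewrite /vstrip [mkset _ _]/mkset intrS (_ : 2 * L * (j%:~R + 1) = 2 * L * j%:~R + 2 * L :> R) //; ring. Qed.

Lemma pot_exists (D : set Ct) f z0 : open D -> convexC D -> D z0 -> hol 1 D f ->
  exists F, pot D F f.
Proof.
move=> oD cD Dz [_ [f' hf [cf' _]]]; exists (potential f z0).
exact: (@pot_potential R D f f' z0 oD cD Dz hf cf').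
Qed.

Lemma lat_tpi z : lat (z + tpi) <-> lat z.
Proof. by split=> -[j E]; exists j; move: E; rewrite cexp_tpi. Qed.

Lemma vstrip_tpi j z : vstrip j (z + tpi) <-> vstrip j z.
Proof. by rewrite /vstrip /= ReD Re_tpi addr0. Qed.

Lemma vstrip_tpiz j z k : vstrip j (z + tpi *~ k) <-> vstrip j z.
Proof. by rewrite /vstrip /= tpiz ReD /= addr0. Qed.

Lemma per_int (T : Type) (E : C -> T) (P : set C) (h : C) :
  (forall z, P (z + h) <-> P z) -> (forall z, P z -> E (z + h) = E z) ->
  forall z k, P z -> E (z + h *~ k) = E z.
Proof.
move=> PP EE.
have Pn z n : P (z + h *+ n) <-> P z.
  by elim: n => [|n IH]; rewrite ?mulr0n ?addr0 // mulrSr addrA PP.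
have En z n : P z -> E (z + h *+ n) = E z.
  move=> Pz; elim: n => [|n IH]; rewrite ?mulr0n ?addr0 // mulrSr addrA EE //.
  exact/Pn.
move=> z [] n Pz; first by rewrite -pmulrn En.
have Ez : z = z - h *+ n.+1 + h *+ n.+1 by rewrite addrNK.
rewrite NegzE mulrNz -pmulrn [in RHS]Ez En //.
by apply/(Pn _ n.+1); rewrite -Ez.
Qed.

Lemma vstrip_floor j z : vstrip j z -> Num.floor (Re z / (2 * L)) = j.
Proof.
move=> /andP[j1 j2]; apply: floor_def.
by rewrite ler_pdivlMr // ltr_pdivrMr // mulrC ltW //= mulrC.
Qed.

Lemma hstrip_floor k z : hstrip k z -> Num.floor (Im z / (2 * pi)) = k.
Proof.
move=> /andP[j1 j2]; apply: floor_def.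
by rewrite ler_pdivlMr // ltr_pdivrMr // mulrC ltW //= mulrC.
Qed.

Let vmid j : C := (2 * L * j%:~R + L) +i* pi.

Let vmid_v j : vstrip j (vmid j).
Proof.
rewrite /vstrip /= intrD ltrDl L0 /= mulrDr ltrD2l mulr1.
by rewrite ltr_pMl // ltr1n.
Qed.

Let vmid_h j : hstrip 0 (vmid j).
Proof. by rewrite /hstrip /= mulr0 add0r mulr1 pi_gt0 /= ltr_pMl ?pi_gt0 // ltr1n. Qed.

(** The potentials on the vertical strips are adjusted by constants to agree with a potential [G] on
    the strip 0 < Im z < 2 pi; [G] is then carried to the other horizontal strips by multiples of
    [tpi]. Periodicity on the vertical strips makes the pieces agree on all overlaps. *)
Lemma global_pot f : holo_off f -> tper f ->
  (forall j, exists E, pot (vstrip j) E f /\ forall z, vstrip j z -> E (z + tpi) = E z) ->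
  exists F, pot nlat F f /\ forall z, ~ lat z -> F (z + tpi) = F z.
Proof.
move=> hf pf /choice[E0 HE0].
have [G hG] : exists G, pot (hstrip 0) G f.
  apply: (@pot_exists _ _ (vmid 0)); [exact: open_hstrip|exact: convex_hstrip|exact: vmid_h|].
  by apply: hf; exact: hstrip_nlat.
pose E j z := E0 j z + (G (vmid j) - E0 j (vmid j)).
have hE j : pot (vstrip j) (E j) f.
  have := potD (HE0 j).1 (@pot_cst R (vstrip j) (G (vmid j) - E0 j (vmid j))).
  by apply: pot_eq => z _; rewrite addr0.
have pE j z k : vstrip j z -> E j (z + tpi *~ k) = E j z.
  by apply: (per_int (vstrip_tpi j)) => v vj; rewrite /E (HE0 j).2.
have EG j z : vstrip j z -> hstrip 0 z -> E j z = G z.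
  move=> vz hz.
  have h1 : pot (vstrip j `&` hstrip 0) (E j) f by apply: pot_sub (hE j) => v [].
  have h2 : pot (vstrip j `&` hstrip 0) G f by apply: pot_sub hG => v [].
  have cc : convexC (vstrip j `&` hstrip 0).
    by apply: convexI; [exact: convex_vstrip|exact: convex_hstrip].
  have m0 : (vstrip j `&` hstrip 0) (vmid j) by split; [exact: vmid_v|exact: vmid_h].
  have := pot_unique cc m0 (conj vz hz) h1 h2; rewrite /E; move: (E0 j z) (E0 j (vmid j)) => x y; lra.
pose fl z := Num.floor (Re z / (2 * L)).
(* The integer parts select the strips. The second branch is needed only when Re z is a multiple of
   2L. *)
pose F z := if `[< vstrip (fl z) z >] then E (fl z) z
  else G (z + tpi *~ (- Num.floor (Im z / (2 * pi)))).
have F1 j z : vstrip j z -> F z = E j z.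
  move=> vz; have fz : fl z = j by exact: vstrip_floor.
  by rewrite /F fz asboolT.
have hsh k z : hstrip k z -> hstrip 0 (z + tpi *~ (- k)).
  move=> /hstripP hk; apply/hstripP; rewrite tpiz ImD mulrNz mulrN mulr0z mulr0 add0r.
  case/andP: hk => h1 h2; apply/andP; split; move: h1 h2; rewrite ImC; lra.
have F2 k z : hstrip k z -> F z = G (z + tpi *~ (- k)).
  move=> hz; have fk := hstrip_floor hz.
  rewrite /F fk; case: asboolP => [vz|//].
  rewrite -(EG (fl z)) //; first by rewrite pE.
    exact/vstrip_tpiz.
  exact: hsh.
have fz0 z k : f (z + tpi *~ k) = f z.
  by apply: (per_int (P := setT)) => // v _; rewrite pf.
exists F; split.
  move=> z /(nlat_cover L0)[[j vz]|[k hz]].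
    by apply: (pot_near (@open_vstrip R L (j)) vz (F1 j) (hE j)).
  apply: (pot_near (@open_hstrip R (k)) hz (F2 k)).
  have := pot_shift (h := tpi *~ (- k)) hG.
  move=> H; apply: pot_eq (pot_sub _ H); first by move=> v _; exact: fz0.
  by move=> v /=; exact: hsh.
move=> z /(nlat_cover L0)[[j vz]|[k hz]].
  rewrite (F1 j) ?(F1 j z) //; last exact/vstrip_tpi.
  by have := pE j z 1 vz; rewrite mulr1z.
have hz' : hstrip (k + 1) (z + tpi).
  move: hz => /hstripP /andP[z1 z2]; apply/hstripP; rewrite ImD Im_tpi intrS.
  by apply/andP; split; lra.
rewrite (F2 _ _ hz') (F2 _ _ hz); congr G.
by rewrite opprD mulrzDr mulrN1z -addrA; congr (_ + _); rewrite addrCA subrr addr0.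
Qed.

(** E(conj z) is a potential of the same form, and equals E on the real axis, so E is invariant
    under conjugation on the strip. Evaluated at two conjugate points that differ by [tpi], this
    gives period 0. *)
Lemma sym_period f j : holo_off f -> tper f -> (forall z, f (conjc z) = conjc (f z)) ->
  exists E, pot (vstrip j) E f /\ forall z, vstrip j z -> E (z + tpi) = E z.
Proof.
move=> hf pf cf.
have oV := @open_vstrip R L (j); have cV := @convex_vstrip R L (j).
have [E hE] : exists E, pot (vstrip j) E f.
  apply: (pot_exists oV cV (vmid_v j)).
  by apply: hf => z; exact: vstrip_nlat.
exists E; split=> // z vz.
have hc : pot (vstrip j) (fun z => E (conjc z)) f.
  have H := pot_conj hE; apply: pot_eq (pot_sub _ H).
    by move=> v _; rewrite cf conjcK.
  by move=> v; rewrite /vstrip /= Re_conj.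
have hs : pot (vstrip j) (fun z => E (z + tpi)) f.
  have H := pot_shift (h := tpi) hE; apply: pot_eq (pot_sub _ H).
    by move=> v _; exact: pf.
  by move=> v vv; apply/vstrip_tpi.
pose x : C := (2 * L * j%:~R + L) +i* 0.
have vx : vstrip j x by have := vmid_v j.
(* The point of height -pi, whose conjugate is y + [tpi]. *)
pose y : C := (2 * L * j%:~R + L) +i* (- pi).
have vy : vstrip j y by have := vmid_v j.
have e1 := pot_unique cV vx vy hc hE.
have e2 := pot_unique cV vy vz hs hE.
have xx : conjc x = x by apply: eqC; rewrite /= ?oppr0.
have yy : conjc y = y + tpi.
  by apply: eqC; rewrite ?ReD ?ImD ?Re_tpi ?Im_tpi /= ?addr0 // opprK; ring.
move: e1 e2; rewrite xx yy subrr => -> /eqP.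
by rewrite subr_eq0 => /eqP.
Qed.

(** The elementary form of a removable singularity: the vertical loops on the two sides of 0 are
    joined through the horizontal strip, at the cost of short segments around 0 and [tpi], where g
    is bounded. *)
Lemma residue_period g (M d : R) E1 E2 : holo_off g -> tper g -> 0 < d -> 0 <= M ->
  (forall z, 0 < cabs z < d -> cabs (g z) <= M) ->
  pot (vstrip 0) E1 g -> pot (vstrip (-1)) E2 g ->
  forall z w, vstrip 0 z -> vstrip (-1) w -> E1 (z + tpi) - E1 z = E2 (w + tpi) - E2 w.
Proof.
move=> hg pg d0 M0 bg h1 h2 z w vz vw.
have [H hH] : exists H, pot (hstrip 0) H g.
  apply: (@pot_exists _ _ (vmid 0)); [exact: open_hstrip|exact: convex_hstrip|exact: vmid_h|].
  by apply: hg; exact: hstrip_nlat.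
have shift_pot j E : pot (vstrip j) E g -> pot (vstrip j) (fun z => E (z + tpi)) g.
  move=> hE; have K := pot_shift (h := tpi) hE; apply: pot_eq (pot_sub _ K).
    by move=> v _; exact: pg.
  by move=> v vv; apply/vstrip_tpi.
have per j E u v : pot (vstrip j) E g -> vstrip j u -> vstrip j v ->
    E (u + tpi) - E u = E (v + tpi) - E v.
  by move=> hE vu vv; exact: (pot_unique (@convex_vstrip R L (j)) vv vu (shift_pot j E hE) hE).
have EH j E u v : pot (vstrip j) E g -> vstrip j u -> hstrip 0 u -> vstrip j v -> hstrip 0 v ->
    E v - E u = H v - H u.
  move=> hE vu hu vv hv.
  have k1 : pot (vstrip j `&` hstrip 0) E g by apply: pot_sub hE => x [].
  have k2 : pot (vstrip j `&` hstrip 0) H g by apply: pot_sub hH => x [].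
  have cc : convexC (vstrip j `&` hstrip 0).
    by apply: convexI; [exact: convex_vstrip|exact: convex_hstrip].
  have := pot_unique cc (conj vu hu) (conj vv hv) k1 k2; move: (E v) (E u) (H v) (H u) => *; lra.
have seg (u v : C) (K : set C) (F : C -> R) (b : C) : pot K F g -> convexC K ->
    K u -> K v -> (forall x, g (b + x) = g x) -> (forall x, K x -> x - b != 0) ->
    cabs (u - b) < d -> cabs (v - b) < d -> `|F v - F u| <= M * cabs (v - u).
  move=> hF cK Ku Kv gb Kb ud vd.
  have sg t : 0 <= t <= 1 -> K (u + t%:C * (v - u)) by move=> tt; exact: cK.
  apply: (pot_lip sg hF) => t tt.
  have := convex_ball ud vd tt => /= sd.
  rewrite (_ : u + t%:C * (v - u) = b + (u + t%:C * (v - u) - b)); last by ring.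
  rewrite gb; apply: bg; rewrite sd andbT cabs_gt0.
  exact/Kb/sg.
have g0 x : g (0 + x) = g x by rewrite add0r.
have gt x : g (tpi + x) = g x by rewrite addrC pg.
have main (e : R) : 0 < e -> e < d / 2 -> e < L -> e < pi ->
    `|(E1 (z + tpi) - E1 z) - (E2 (w + tpi) - E2 w)| <= 8 * M * e.
  move=> e0 ed eL ep.
  (* Corners of squares of half-side e centred at 0 and at [tpi]. Four segments of length 2e are
     crossed, each contributing at most 2 M e, whence 8 M e. *)
  pose p1 : C := e +i* e; pose p1' : C := e +i* (- e); pose p2 : C := e +i* (2 * pi - e).
  pose m1 : C := (- e) +i* e; pose m1' : C := (- e) +i* (- e); pose m2 : C := (- e) +i* (2 * pi - e).
  have e2L : e < 2 * L by rewrite (lt_trans eL) // ltr_pMl // ltr1n.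
  have e2p : e < 2 * pi by rewrite (lt_trans ep) // ltr_pMl ?pi_gt0 // ltr1n.
  have vp y : vstrip 0 (e +i* y) by rewrite /vstrip /= mulr0 e0 add0r mulr1.
  have vm y : vstrip (-1) ((- e) +i* y).
    by rewrite /vstrip /= mulrN1 ltrN2 e2L addNr mulr0 oppr_lt0.
  have hs x y : 0 < y < 2 * pi -> hstrip 0 (x +i* y) by rewrite /hstrip /= mulr0 add0r mulr1.
  have y1 : 0 < e < 2 * pi by rewrite e0.
  have y2 : 0 < 2 * pi - e < 2 * pi by rewrite subr_gt0 e2p /= gtrBl.
  have small x y : `|x| = e -> `|y| = e -> cabs (x +i* y) < d.
    move=> xe ye; rewrite (le_lt_trans (cabs_le_ReIm _)) //= xe ye; lra.
  have ne : `|- e| = e by rewrite normrN gtr0_norm.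
  have pe : `|e| = e by rewrite gtr0_norm.
  have z1 : p1' + tpi = p2 by apply: eqC; rewrite ?ReD ?ImD ?Re_tpi ?Im_tpi /= ?addr0 // addrC.
  have z2 : m1' + tpi = m2 by apply: eqC; rewrite ?ReD ?ImD ?Re_tpi ?Im_tpi /= ?addr0 // addrC.
  have s (u v b : C) x y : u - b = x +i* y -> `|x| = e -> `|y| = e -> cabs (u - b) < d.
    by move=> -> ; exact: small.
  have sub0 (u : C) : u - 0 = u by rewrite subr0.
  have pt : p2 - tpi = e +i* (- e) by rewrite -z1 addrK.
  have mt : m2 - tpi = (- e) +i* (- e) by rewrite -z2 addrK.
  have nv0 x : vstrip 0 x -> x - 0 != 0.
    by move=> /andP[]; rewrite mulr0 subr0 => x0 _; apply: contraTneq x0 => ->; rewrite ltxx.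
  have nv1 x : vstrip (-1) x -> x - 0 != 0.
    move=> /andP[_]; rewrite addNr mulr0 subr0 => x0; apply: contraTneq x0 => ->; by rewrite ltxx.
  have nh0 x : hstrip 0 x -> x - 0 != 0.
    by move=> /andP[]; rewrite mulr0 subr0 => x0 _; apply: contraTneq x0 => ->; rewrite ltxx.
  have nht x : hstrip 0 x -> x - tpi != 0.
    move=> /andP[_]; rewrite add0r mulr1 => x0; apply: contraTneq x0 => /eqP.
    by rewrite subr_eq0 => /eqP ->; rewrite Im_tpi ltxx.
  have q1 := seg p1' p1 (vstrip 0) E1 0 h1 (@convex_vstrip R L (0)) (vp _) (vp _) g0 nv0.
  have q2 := seg m1' m1 (vstrip (-1)) E2 0 h2 (@convex_vstrip R L (-1)) (vm _) (vm _) g0 nv1.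
  have q3 := seg m1 p1 (hstrip 0) H 0 hH (@convex_hstrip R (0)) (hs _ _ y1) (hs _ _ y1) g0 nh0.
  have q4 := seg m2 p2 (hstrip 0) H tpi hH (@convex_hstrip R (0)) (hs _ _ y2) (hs _ _ y2) gt nht.
  have dist (u v : C) : cabs (u - v) = 2 * e -> M * cabs (u - v) = 2 * M * e by move=> ->; ring.
  have e20 : 0 <= 2 * e by rewrite mulr_ge0 // ltW.
  have d1 : cabs (p1 - p1') = 2 * e.
    have -> : p1 - p1' = I * (2 * e)%:C by apply: eqC; rewrite ?ReD ?ImD ?ReN ?ImN ?ReM ?ImM /=; ring.
    by rewrite cabsM cabs_I mul1r cabs_real ger0_norm.
  have d2 : cabs (m1 - m1') = 2 * e.
    have -> : m1 - m1' = I * (2 * e)%:C by apply: eqC; rewrite ?ReD ?ImD ?ReN ?ImN ?ReM ?ImM /=; ring.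
    by rewrite cabsM cabs_I mul1r cabs_real ger0_norm.
  have d3 : cabs (p1 - m1) = 2 * e.
    have -> : p1 - m1 = (2 * e)%:C by apply: eqC; rewrite ?ReD ?ImD ?ReN ?ImN /=; ring.
    by rewrite cabs_real ger0_norm.
  have d4 : cabs (p2 - m2) = 2 * e.
    have -> : p2 - m2 = (2 * e)%:C by apply: eqC; rewrite ?ReD ?ImD ?ReN ?ImN /=; ring.
    by rewrite cabs_real ger0_norm.
  have {}q1 : `|E1 p1 - E1 p1'| <= 2 * M * e.
    by rewrite -(dist _ _ d1); apply: q1; rewrite subr0; apply: small.
  have {}q2 : `|E2 m1 - E2 m1'| <= 2 * M * e.
    by rewrite -(dist _ _ d2); apply: q2; rewrite subr0; apply: small.
  have {}q3 : `|H p1 - H m1| <= 2 * M * e.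
    by rewrite -(dist _ _ d3); apply: q3; rewrite subr0; apply: small.
  have {}q4 : `|H p2 - H m2| <= 2 * M * e.
    by rewrite -(dist _ _ d4); apply: q4; rewrite ?pt ?mt; apply: small.
  rewrite (per 0 E1 z p1' h1 vz (vp _)) (per (-1) E2 w m1' h2 vw (vm _)) z1 z2.
  have r1 := EH 0 E1 p1 p2 h1 (vp _) (hs _ _ y1) (vp _) (hs _ _ y2).
  have r2 := EH (-1) E2 m1 m2 h2 (vm _) (hs _ _ y1) (vm _) (hs _ _ y2).
  have -> : E1 p2 - E1 p1' - (E2 m2 - E2 m1') =
     (H p2 - H m2) - (H p1 - H m1) + (E1 p1 - E1 p1') - (E2 m1 - E2 m1').
    by move: r1 r2; move: (E1 p2) (E1 p1) (E2 m2) (E2 m1) (H p2) (H p1) (H m2) (H m1) => *; lra.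
  have -> : 8 * M * e = 2 * M * e + 2 * M * e + 2 * M * e + 2 * M * e by ring.
  rewrite (le_trans (ler_normB _ _)) // lerD // (le_trans (ler_normD _ _)) // lerD //.
  by rewrite (le_trans (ler_normB _ _)) // lerD.
apply/eqP; rewrite -subr_eq0 -normr_eq0 eq_le normr_ge0 andbT leNgt; apply/negP => P0.
set X := `| _ | in P0 main.
pose e := Num.min (Num.min (d / 4) (L / 2)) (Num.min (pi / 2) (X / (16 * (M + 1)))).
have M1 : 0 < 16 * (M + 1) by rewrite mulr_gt0 // ltr_wpDl.
have e0 : 0 < e by rewrite !lt_min !divr_gt0 // pi_gt0.
have pi0 := pi_gt0 R.
have [l1 l2 l3 l4] : [/\ e <= d / 4, e <= L / 2, e <= pi / 2 & e <= X / (16 * (M + 1))].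
  by split; rewrite /e !ge_min lexx ?orbT.
have b1 : e < d / 2 by apply: (le_lt_trans l1); lra.
have b2 : e < L by apply: (le_lt_trans l2); move: L0 => ?; lra.
have b3 : e < pi by apply: (le_lt_trans l3); lra.
have := main e e0 b1 b2 b3.
have : e * (16 * (M + 1)) <= X by rewrite -ler_pdivlMr.
nra.
Qed.

End Global.

(** The interface between theta functions and geometry: the geometric part uses only these
    properties. The multiplier in [w_shift] is left unspecified because it cancels in the three
    products forming the Weierstrass data. *)
Record weier (R : realType) (al : R) := Weier {
  wl : R;
  wchi : R[i] -> R[i];
  w1 : R[i] -> R[i];
  w2 : R[i] -> R[i];
  wl_gt0 : 0 < wl;
  w1_hol : forall k D, hol k D w1;
  w2_hol : forall k D, hol k D w2;
  wchi_hol : forall k (D : set R[i]), (forall z, D z -> ~ lat wl z) -> hol k D wchi;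
  wchi_neq0 : forall z, ~ lat wl z -> wchi z != 0;
  w12_neq0 : forall z, ~ (w1 z = 0 /\ w2 z = 0);
  wchi_conj : forall z, wchi (conjc z) = conjc (wchi z);
  wchi_neg : forall z, wchi (- z) = wchi z;
  wchi_tpi : forall z, wchi (z + tpi R) = wchi z;
  w1_conj : forall z, w1 (conjc z) = conjc (w2 z);
  w1_neg : forall z, w1 (- z) = w2 z;
  w1_tpi : forall z, w1 (z + tpi R) = w1 z;
  w2_tpi : forall z, w2 (z + tpi R) = w2 z;
  w_shift : exists m : R[i] -> R[i], forall z,
    [/\ wchi (z + (- (2 * wl))%:C) * m z ^+ 2 = wchi z,
        w1 (z + (- (2 * wl))%:C) = m z * (cexp (ial al) * w1 z)
      & w2 (z + (- (2 * wl))%:C) = m z * (cexp (- ial al) * w2 z)];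
  w_expand : exists k y r M : R, [/\ 0 < k, y != 0, 0 < r, 0 <= M &
    forall z, 0 < cabs z < r ->
    [/\ cabs (wchi z * w1 z ^+ 2 - (k%:C / z ^+ 2 - I * y%:C / z)) <= M,
        cabs (wchi z * w2 z ^+ 2 - (k%:C / z ^+ 2 + I * y%:C / z)) <= M
      & cabs (wchi z * (w1 z * w2 z) - k%:C / z ^+ 2) <= M]];
  w_pot : exists F1 F2 F3 : R[i] -> R,
    [/\ pot [set z | ~ lat wl z] F1 (fun z => I / 2 * (wchi z * w2 z ^+ 2 - wchi z * w1 z ^+ 2)),
        pot [set z | ~ lat wl z] F2 (fun z => - ((wchi z * w1 z ^+ 2 + wchi z * w2 z ^+ 2) / 2)),
        pot [set z | ~ lat wl z] F3 (fun z => I * (wchi z * (w1 z * w2 z)))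
      & forall z, ~ lat wl z ->
        [/\ F1 (z + tpi R) = F1 z, F2 (z + tpi R) = F2 z & F3 (z + tpi R) = F3 z]]
}.

(** * Construction of the Weierstrass data and of their potentials *)

Section Existence.
Variable R : realType.
Local Notation C := R[i].
Local Notation Ct := (R[i]^o).
Local Notation tpi := (tpi R).
Implicit Types (z w : C) (F G E : C -> R) (f g : C -> C).
Variable n : nat.
Hypothesis hn : (3 <= n)%N.
(** Half the angle of the rotational symmetry: translation multiplies the spinors by e^(i al) and
    e^(-i al), up to a common factor, and the forms A and B by the squares. *)
Definition oid_angle : R := pi / n%:R.
Local Notation al := oid_angle.

Let n0 : 0 < n%:R :> R. Proof. by rewrite ltr0n (leq_trans _ hn). Qed.

Lemma oid_angle_gt0 : 0 < al.
Proof. by rewrite divr_gt0 // pi_gt0. Qed.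

Lemma oid_angle_le : al <= pi / 3.
Proof. by rewrite ler_pM2l ?pi_gt0 // lef_pV2 ?posrE // ler_nat. Qed.

Lemma oid_angle_lt : al < pi.
Proof. by rewrite (le_lt_trans oid_angle_le) // ltr_pdivrMr // ltr_pMr ?pi_gt0 // ltr1n. Qed.

Lemma cos_pi3 : cos (pi / 3) = 1 / 2 :> R.
Proof.
have p0 := pi_gt0 R.
have e : cos (pi / 3 *+ 2) = - cos (pi / 3) :> R.
  rewrite -[in RHS]cosN -cosDpi; congr cos.
  by rewrite mulr2n; field.
have c0 : 0 < cos (pi / 3) :> R.
  apply: cos_gt0_pihalf; apply/andP; split; lra.
move: e; rewrite mulr2n cosD -!expr2 sin2cos2; move: c0; set c := cos _; rewrite !expr2 => c0 e; nra.
Qed.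

Let k0 : 1 / 2 <= cos al.
Proof.
rewrite -cos_pi3 leNgt; apply/negP; rewrite ltr_cos ?in_itv /=.
- by rewrite ltNge oid_angle_le.
- by have p0 := pi_gt0 R; apply/andP; split; lra.
- by rewrite (ltW oid_angle_gt0) (ltW oid_angle_lt).
Qed.

Let k1 : cos al < 1.
Proof.
apply: cos_lt1; rewrite oid_angle_gt0 /= (lt_trans oid_angle_lt) //.
by rewrite ltr_pMl ?pi_gt0 // ltr1n.
Qed.

Let u : C := cexp (ial al).
Let uR : Re u = cos al. Proof. by rewrite Re_cexp /= expR0 mul1r. Qed.
Let uI : Im u = sin al. Proof. by rewrite Im_cexp /= expR0 mul1r. Qed.
Let u1 : cabs u = 1. Proof. by rewrite cabs_cexp /= expR0. Qed.

Section WithQ.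
Variable Q : R.
Hypothesis Q01 : 0 < Q < 1.
Hypothesis QH : Hpart u ^~ Q @ \oo --> (0 : R).
Let Q0 : 0 < Q. Proof. by case/andP: Q01. Qed.
Let Q1 : Q < 1. Proof. by case/andP: Q01. Qed.
Let L : R := - ln Q.
Let L0 : 0 < L. Proof. by rewrite oppr_gt0 ln_lt0. Qed.
Let eL : expR (- L) = Q. Proof. by rewrite opprK lnK. Qed.
Let q := nome L.
Let q01 : 0 < q < 1. Proof. exact: nome01. Qed.
Let qE : q = expR (- (2 * L)). Proof. by []. Qed.
Let qQ : q = Q ^+ 2.
Proof. by rewrite qE -[in RHS]eL -expRM_natl (mulrN 2 L). Qed.
Let w0 : C := ial al + th_L L.

(** Since q = Q^2 and e^L = 1/Q, the terms of the iterated second logarithmic derivative at w0 are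
    those of the Lambert series: odd powers of Q times [u]. *)
Let ew0 j : q%:C ^+ j.+1 * cexp w0 = (Q ^+ (2 * j + 1))%:C * u.
Proof.
rewrite cexpD cexp_real mulrCA mulrC; congr (_ * _).
rewrite -realCX -realCM qQ; congr _%:C.
have -> : expR L = Q^-1 by rewrite -eL expRN invrK.
have -> : Q ^+ 2 ^+ j.+1 = Q ^+ (2 * j + 1) * Q by rewrite -exprM -exprSr; congr (_ ^+ _); lia.
by rewrite mulfK // gt_eqF.
Qed.

Let kk0 : 1 / 2 <= Re u. Proof. by rewrite uR. Qed.
Let kk1 : Re u < 1. Proof. by rewrite uR. Qed.

Let reg0 : regular q w0.
Proof. by move=> j; rewrite ew0; exact: (one_sub_neq0 u1 kk0 kk1). Qed.

Let p_w0 : qp q w0 != 0. Proof. exact: (regular_qp q01 reg0). Qed.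

(** Both the partial sums, by the choice of Q, and the remainder of [ql2_iter] tend to 0. This is
    the period condition. *)
Let re_ql2 : Re (ql2 q w0) = 0.
Proof.
pose a := - (2 * L).
have E j : Re (ql2 q w0) + Hpart u j Q = Re (ql2 q (w0 + (a *+ j)%:C)).
  rewrite {1}(ql2_iter q01 qE j reg0) ReD ReN addrAC -[RHS]add0r; congr (_ + _).
  rewrite /Hpart; elim: j => [|j IH]; first by rewrite !big_ord0 /= oppr0 addr0.
  by rewrite !big_ord_recr /= ReD opprD addrACA IH add0r ew0 addNr.
have c1 : (fun j => Re (ql2 q w0) + Hpart u j Q) @ \oo --> Re (ql2 q w0) + 0.
  by apply: cvgD => //; exact: cvg_cst.
have c2 : (fun j => Re (ql2 q (w0 + (a *+ j)%:C))) @ \oo --> Re (0 : C).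
  exact: (cvg_comp _ _ (@cvg_ql2 _ q q01 a qE w0) (continuous_Re (0 : C))).
rewrite (_ : (fun j => _) = (fun j => Re (ql2 q (w0 + (a *+ j)%:C)))) in c1; last exact/funext.
by have := cvg_unique (@Rhausdorff R) c1 c2; rewrite (addr0 (Re _)); apply.
Qed.

(** Every term Im(w/(1 - w)) equals x sin al / |1 - x u|^2 > 0, so all terms of the series have one
    sign and the first one, [b Q], already keeps the sum away from 0. *)
Let im_ql1 : Im (ql1 q w0) != 0.
Proof.
pose a := - (2 * L).
pose b x := Im (x%:C * u / (1 - x%:C * u)).
have bE x : b x = x * sin al / den u x.
  rewrite /b.
  have n1 := one_sub_neq0 u1 kk0 kk1 x.
  have -> : x%:C * u / (1 - x%:C * u) = (den u x)^-1%:C * (x%:C * u * conjc (1 - x%:C * u)).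
    rewrite realCV (den_conj u1).
    have n2 : conjc (1 - x%:C * u) != 0 by rewrite conjc_eq0.
    move: n1 n2; move: (1 - x%:C * u) => v; move: (conjc v) => v' n1 n2.
    by field; apply/andP.
  rewrite ImZ mulrC; congr (_ * _).
  rewrite ImM Re_conj Im_conj ImD ReD ImN ReN ReZ ImZ uR uI /=; ring.
have s0 : 0 < sin al by apply: sin_gt0_pi; rewrite oid_angle_gt0 oid_angle_lt.
have b0 x : 0 < x -> 0 < b x.
  by move=> x0; rewrite bE; apply: divr_gt0; [exact: mulr_gt0|exact: (den_gt0 kk0 kk1)].
have E j : Im (ql1 q w0) = - (\sum_(i < j) b (Q ^+ (2 * i + 1))) + Im (ql1 q (w0 + (a *+ j)%:C)).
  rewrite {1}(ql1_iter q01 qE j reg0) ImD ImN; congr (- _ + _).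
  elim: j => [|j IH]; first by rewrite !big_ord0.
  by rewrite !big_ord_recr /= ImD IH ew0.
have c2 : (fun j => Im (ql1 q (w0 + (a *+ j)%:C))) @ \oo --> Im (0 : C).
  exact: (cvg_comp _ _ (@cvg_ql1 _ q q01 a qE w0) (continuous_Im (0 : C))).
have bQ : 0 < b Q by exact: b0.
have : b Q + Im (ql1 q w0) <= Im (0 : C).
  apply: (cvgr_to_ge c2); exists 1%N => // j /= j1.
  have gen (x y s c : R) : c <= s -> x = - s + y -> c + x <= y by lra.
  apply: gen (E j); case: j j1 => // j _; rewrite big_ord_recl /= expr1 lerDl.
  by apply: sumr_ge0 => i _; rewrite ltW // b0 // exprn_gt0.
rewrite [Im 0]/= => h; rewrite lt_eqF //; move: h bQ; lra.
Qed.

Local Notation a := (- (2 * L)).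
Local Notation p := (qp q).
Local Notation p1 := (qp1 q).
Local Notation p2 := (qp2 q).
Let pstep : forall z, p z = (1 - cexp (z + a%:C)) * p (z + a%:C).
Proof. exact: (qp_step q01 qE). Qed.
Let pcj : forall z, p (conjc z) = conjc (p z).
Proof. exact: qp_conj. Qed.
Let p1cj : forall z, p1 (conjc z) = conjc (p1 z).
Proof. exact: qp1_conj. Qed.
Let p2cj : forall z, p2 (conjc z) = conjc (p2 z).
Proof. exact: qp2_conj. Qed.
Let pper : forall z w, cexp z = cexp w -> p z = p w.
Proof. exact: qp_per. Qed.
Let hp : forall z, hder p z (p1 z).
Proof. exact: hder_qp. Qed.
Let hp1 : forall z, hder p1 z (p2 z).
Proof. exact: hder_qp1. Qed.
Let hlp : forall k D, hol k D p.
Proof. exact: hol_qp. Qed.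
Let pn0 : forall z, (forall j : int, cexp z != (expR (2 * L * j%:~R))%:C) -> p z != 0.
Proof. exact: qp_neq0. Qed.
Let p00 : p 0 != 0.
Proof.
apply: (regular_qp q01) => j; rewrite cexp0 mulr1 -realCX -realC1 -realCN -realCD.
rewrite -cabs_eq0 cabs_real normr_eq0 subr_eq0 eq_sym lt_eqF // exprn_ilt1 //.
  by case/andP: q01 => /ltW.
by case/andP: q01.
Qed.

Local Notation lat := (lat L).
Local Notation vstrip := (vstrip L).
Local Notation nlat := [set z : C | ~ lat z].
Local Notation chi := (chi p).
Local Notation s1 := (sp1 L al p).
Local Notation s2 := (sp2 L al p).
Local Notation wA := (wA L al p).
Local Notation wB := (wB L al p).
Local Notation wC := (wC L al p).
Local Notation wf := (wf L al p p1).
Let al0 := oid_angle_gt0.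
Let alpi := oid_angle_lt.

(** By the choice of Q the form [wf] has no residue at 0. After subtraction of a multiple of [pole2]
    it is bounded there, and [residue_period] equates its periods on the strips 0 and -1; their
    difference is the period of [wC]. *)
Let iwC_period : exists E, pot (vstrip 0) E (fun z => I * wC z) /\
  forall z, vstrip 0 z -> E (z + tpi) = E z.
Proof.
have tz : th_t2 L p p1 p2 (ial al) * th_t L p (ial al) - th_t1 L p p1 (ial al) ^+ 2 = 0.
  exact: (t2_zero pcj p1cj p2cj re_ql2 p_w0).
have [k [r r0 [M M0 hf]]] : exists k : C, exists2 r, 0 < r & exists2 M, 0 <= M &
    forall z, 0 < cabs z < r -> cabs (wf z - k / z ^+ 2) <= M.
  by apply: wf_expand.
have [r' r'0 [M' M'0 hp2]] := pole2_expand R.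
(* The function 1/(1 - e^z) is a primitive of [pole2] with period [tpi], so removing the double pole
   does not change the period. *)
pose G z := Re (I * k * (1 - cexp z)^-1).
have n1 z : ~ lat z -> 1 - cexp z != 0.
  move=> nz; apply: contra_notN nz; rewrite subr_eq0 => /eqP e.
  by exists 0; rewrite -e mulr0z mulr0 expR0.
have hG : pot nlat G (fun z => I * k * pole2 z).
  apply: pot_hder => z nz.
  have h1 : hder (fun w => 1 - cexp w) z (0 - cexp z).
    by apply: hderD; [exact: hder_cst|apply: hderN; exact: hder_cexp].
  have := hderM (hder_cst (I * k) z) (hderV (f := fun w => 1 - cexp w) (n1 z nz) h1).
  by rewrite mul0r add0r sub0r opprK.
have tG z : G (z + tpi) = G z by rewrite /G cexp_tpi.
have wfh m D : (forall z, D z -> ~ lat z) -> hol m D wf by move=> nD; apply: hol_wf.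
have wft z : wf (z + tpi) = wf z by apply: wf_tpi.
have hIf : holo_off L (fun z => I * wf z).
  by move=> m D nD; apply: holM; [exact: hol_cst|exact: wfh].
pose g z := I * wf z - I * k * pole2 z.
have hg : holo_off L g.
  move=> m D nD; apply: holD; first exact: hIf.
  apply: holN; apply: holM; first exact: hol_cst.
  apply: holM; first exact: hol_cexp.
  apply: holV => [z Dz|]; first by rewrite expf_eq0 /= n1 //; exact: nD.
  by apply: holX; apply: holD; [exact: hol_cst|apply: holN; exact: hol_cexp].
have tg : tper g by move=> z; rewrite /g wft /pole2 cexp_tpi.
have bg z : 0 < cabs z < Num.min r r' -> cabs (g z) <= M + cabs k * M'.
  rewrite lt_min => /and3P[z0 zr zr'].
  have -> : g z = I * ((wf z - k / z ^+ 2) - k * (pole2 z - (z ^+ 2)^-1)).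
    by rewrite /g; ring.
  rewrite cabsM cabs_I mul1r (le_trans (cabsD _ _)) // cabsN cabsM lerD //.
    by apply: hf; rewrite z0.
  by rewrite ler_wpM2l ?cabs_ge0 //; apply: hp2; rewrite z0.
have pe j (z0 : C) : vstrip j z0 -> exists E, pot (vstrip j) E (fun z => I * wf z).
  move=> vz; apply: (pot_exists (@open_vstrip R L j) (@convex_vstrip R L j) vz).
  by apply: hIf => z; exact: vstrip_nlat.
have v0 : vstrip 0 (L +i* 0).
  by apply/vstripP; rewrite ReC mulr0z mulr0 add0r L0 ltr_pMl // ltr1n.
have v1 z : vstrip 0 z -> vstrip (-1) (z + a%:C).
  move=> /vstripP + ; rewrite mulr0z mulr0 add0r => /andP[h1 h2].
  by apply/vstripP; rewrite ReD ReC mulrN1z; apply/andP; split; lra.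
have [E1 hE1] := pe 0 _ v0; have [E2 hE2] := pe (-1) _ (v1 _ v0).
have sub j E : pot (vstrip j) E (fun z => I * wf z) -> pot (vstrip j) (fun z => E z - G z) g.
  by move=> hE; apply: potB => //; apply: pot_sub hG => z; exact: vstrip_nlat.
have rp := @residue_period R L L0 g (M + cabs k * M') (Num.min r r') _ _ hg tg.
have d0 : 0 < Num.min r r' by rewrite lt_min r0.
have M00 : 0 <= M + cabs k * M' by rewrite addr_ge0 // mulr_ge0 // cabs_ge0.
have per := rp _ _ d0 M00 bg (sub 0 _ hE1) (sub (-1) _ hE2).
(* A potential of i (wf(z) - wf(z - 2L)) = i wC(z). *)
exists (fun z => E1 z - E2 (z + a%:C)); split.
  have h2 := pot_sub v1 (pot_shift (h := a%:C) hE2).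
  apply: pot_eq (potB hE1 h2) => z _; rewrite wf_shift //; ring.
move=> z vz.
have arr (x1 x2 y1 y2 g1 g2 : R) : (x1 - g1) - (x2 - g1) = (y1 - g2) - (y2 - g2) ->
    x1 - y1 = x2 - y2 by lra.
have := per z (z + a%:C) vz (v1 _ vz); rewrite !tG (addrAC z a%:C).
exact: arr.
Qed.

Let wAt z : wA (z + tpi) = wA z. Proof. exact: wA_tpi. Qed.
Let wBt z : wB (z + tpi) = wB z. Proof. exact: wB_tpi. Qed.
Let wCt z : wC (z + tpi) = wC z. Proof. exact: wC_tpi. Qed.
Let wAc z : wA (conjc z) = conjc (wB z). Proof. exact: wA_conj. Qed.
Let wBc z : wB (conjc z) = conjc (wA z). Proof. exact: wB_conj. Qed.
Let chi_h k D : (forall z, D z -> ~ lat z) -> hol k D chi.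
Proof. by move=> nD; apply: (@hol_chi R L). Qed.
Let s1_h k D : hol k D s1. Proof. exact: hol_sp1. Qed.
Let s2_h k D : hol k D s2. Proof. exact: hol_sp2. Qed.
Let wA_h : holo_off L wA. Proof. by move=> k D nD; apply: holM; [exact: chi_h|exact/holX/s1_h]. Qed.
Let wB_h : holo_off L wB. Proof. by move=> k D nD; apply: holM; [exact: chi_h|exact/holX/s2_h]. Qed.
Let wC_h : holo_off L wC.
Proof. by move=> k D nD; apply: holM; [exact: chi_h|apply: holM; [exact: s1_h|exact: s2_h]]. Qed.

(** The invariance of [wC] under translation by 2L carries the closed period from the strip 0 to
    every other vertical strip. *)
Let pot3 : exists F, pot nlat F (fun z => I * wC z) /\ forall z, ~ lat z -> F (z + tpi) = F z.
Proof.
apply: (global_pot L0).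
- by move=> k D nD; apply: holM; [exact: hol_cst|exact: wC_h].
- by move=> z; rewrite wCt.
have [E [hE tE]] := iwC_period.
move=> j; pose h : C := a%:C *~ j.
have hhE : h = (a * j%:~R)%:C by rewrite /h realCM rmorph_int mulrzr.
have wCh z : wC (z + h) = wC z.
  have sh v : setT v -> wC (v + a%:C) = wC v by move=> _; exact: wC_shift.
  have st (v : C) : setT (v + a%:C) <-> setT v by [].
  exact: (per_int st sh).
have vj z : vstrip j z -> vstrip 0 (z + h).
  move=> /vstripP + ; rewrite hhE => /andP[h1 h2].
  apply/vstripP; rewrite ReD ReC mulr0z mulr0 add0r.
  by move: h1 h2; move: (j%:~R : R) => x h1 h2; apply/andP; split; lra.
exists (fun z => E (z + h)); split.
  apply: pot_eq (pot_sub vj (pot_shift (h := h) hE)) => z _.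
  by rewrite wCh.
by move=> z vz; rewrite addrAC tE //; exact: vj.
Qed.

Let half : conjc (1 / 2) = 1 / 2 :> C.
Proof. by rewrite conjM conjV -realC1 !conjc_real conjc_nat. Qed.

(** Conjugation exchanges [wA] and [wB] and changes the sign of i, so this form commutes with
    conjugation and [sym_period] applies. *)
Let pot1 : exists F, pot nlat F (fun z => I / 2 * (wB z - wA z)) /\
  forall z, ~ lat z -> F (z + tpi) = F z.
Proof.
apply: (global_pot L0).
- move=> k D nD; apply: holM; first exact: hol_cst.
  by apply: holD; [exact: wB_h|apply: holN; exact: wA_h].
- by move=> z; rewrite wAt wBt.
move=> j; apply: (sym_period L0).
- move=> k D nD; apply: holM; first exact: hol_cst.
  by apply: holD; [exact: wB_h|apply: holN; exact: wA_h].
- by move=> z; rewrite wAt wBt.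
- move=> z; rewrite wAc wBc [RHS]conjM conjB.
  have -> : conjc (I / 2) = - (I / 2) :> C.
    by rewrite (_ : I / 2 = I * (1 / 2)); [rewrite conjM half; rewrite (_ : conjc I = - I) ?mulNr //; apply: eqC; rewrite /= ?oppr0|ring].
  by rewrite mulNr -mulrN opprB.
Qed.

Let cj2 (A B : C) : - ((conjc B + conjc A) / 2) = conjc (- ((A + B) / 2)).
Proof. by rewrite [RHS]conjN conjM conjD conjV conjc_nat [X in X / _]addrC. Qed.

Let pot2 : exists F, pot nlat F (fun z => - ((wA z + wB z) / 2)) /\
  forall z, ~ lat z -> F (z + tpi) = F z.
Proof.
have h : holo_off L (fun z => - ((wA z + wB z) / 2)).
  move=> k D nD; apply: holN; apply: holM; last exact: hol_cst.
  by apply: holD; [exact: wA_h|exact: wB_h].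
apply: (global_pot L0 h) => [z|j]; first by rewrite wAt wBt.
apply: (sym_period L0 _ h) => [z|z]; first by rewrite wAt wBt.
by rewrite wAc wBc; exact: cj2.
Qed.

Lemma weier_Q : exists W : weier al, True.
Proof.
have n1 : Im (p1 w0 / p w0) != 0 by [].
have [y y0 gE] := gresE al0 alpi pcj p1cj p00 pn0 n1 p_w0.
have [k k_gt0 kE] := kappaE al0 alpi pcj p00 pn0.
have [r r0 [M M0 ex]] : exists2 r, 0 < r & exists2 M, 0 <= M & forall z, 0 < cabs z < r ->
  [/\ cabs (wA z - (k%:C / z ^+ 2 - I * y%:C / z)) <= M,
      cabs (wB z - (k%:C / z ^+ 2 + I * y%:C / z)) <= M
    & cabs (wC z - k%:C / z ^+ 2) <= M].
  by rewrite -gE -kE; apply: wABC_expand.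
have [F1 [hF1 tF1]] := pot1; have [F2 [hF2 tF2]] := pot2; have [F3 [hF3 tF3]] := pot3.
have c1 z : ~ lat z -> chi z != 0 by move=> nz; apply: (@chi_neq0 R L).
have c2 z : ~ (s1 z = 0 /\ s2 z = 0) by exact: (sp_neq0 L0 al0 alpi pn0).
have c3 z : chi (conjc z) = conjc (chi z) by exact: chi_conj.
have c4 z : chi (- z) = chi z by exact: chi_even.
have c5 z : chi (z + tpi) = chi z by exact: chi_tpi.
have c6 z : s1 (conjc z) = conjc (s2 z) by exact: sp1_conj.
have c7 z : s1 (- z) = s2 z by exact: sp1_neg.
have c8 z : s1 (z + tpi) = s1 z by exact: sp1_tpi.
have c9 z : s2 (z + tpi) = s2 z by exact: sp2_tpi.
have d1 z : chi (z + a%:C) * (- cexp (th_L L - z)) ^+ 2 = chi z.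
  have gen (x v c : C) : x * (c ^+ 2 * 1) = v * 1 -> x * (- c) ^+ 2 = v by rewrite sqrrN !mulr1.
  exact: gen (chi_shift' pstep z 1).
have d2 z : s1 (z + a%:C) = - cexp (th_L L - z) * (cexp (ial al) * s1 z) by exact: sp1_shift.
have d3 z : s2 (z + a%:C) = - cexp (th_L L - z) * (cexp (- ial al) * s2 z) by exact: sp2_shift.
have dd : exists m : C -> C, forall z, [/\ chi (z + a%:C) * m z ^+ 2 = chi z,
    s1 (z + a%:C) = m z * (cexp (ial al) * s1 z) & s2 (z + a%:C) = m z * (cexp (- ial al) * s2 z)].
  exists (fun z => - cexp (th_L L - z)) => z; split; [exact: d1|exact: d2|exact: d3].
have ee : exists k y r M : R, [/\ 0 < k, y != 0, 0 < r, 0 <= M &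
    forall z, 0 < cabs z < r ->
    [/\ cabs (wA z - (k%:C / z ^+ 2 - I * y%:C / z)) <= M,
        cabs (wB z - (k%:C / z ^+ 2 + I * y%:C / z)) <= M
      & cabs (wC z - k%:C / z ^+ 2) <= M]].
  by exists k, y, r, M; split.
have pp : exists F1 F2 F3 : C -> R,
    [/\ pot nlat F1 (fun z => I / 2 * (wB z - wA z)),
        pot nlat F2 (fun z => - ((wA z + wB z) / 2)), pot nlat F3 (fun z => I * wC z)
      & forall z, ~ lat z -> [/\ F1 (z + tpi) = F1 z, F2 (z + tpi) = F2 z & F3 (z + tpi) = F3 z]].
  by exists F1, F2, F3; split=> // z nz; split; [exact: tF1|exact: tF2|exact: tF3].
exact (ex_intro _ (@Weier R al L chi s1 s2 L0 s1_h s2_h chi_h c1 c2 c3 c4 c5 c6 c7 c8 c9 dd ee pp) Logic.I).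
Qed.

End WithQ.

Lemma weier_exists : exists W : weier al, True.
Proof. by have [Q Q01 QH] := Hsum_zero u1 ltac:(by rewrite uR) ltac:(by rewrite uR); exact: weier_Q QH. Qed.

End Existence.

(** * Normalised coordinate functions and their symmetries *)

Section Symmetries.
Variable R : realType.
Local Notation C := R[i].
Local Notation tpi := (tpi R).
Implicit Types (z w : C) (F G E : C -> R).

Section Lat.
Variable L : R.
Local Notation a := (- (2 * L)).
Local Notation lat := (lat L).

Lemma lat_conj z : lat (conjc z) <-> lat z.
Proof.
have h v : lat v -> lat (conjc v).
  by move=> [j e]; exists j; rewrite cexp_conj e conjc_real.
by split=> /h //; rewrite conjcK.
Qed.

Lemma lat_neg z : lat (- z) <-> lat z.
Proof.
have h v : lat v -> lat (- v).
  move=> [j e]; exists (- j); rewrite cexpN e -realCV; congr _%:C.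
  by rewrite mulrNz mulrN expRN.
by split=> /h //; rewrite opprK.
Qed.

Lemma lat_shift z : lat (z + a%:C) <-> lat z.
Proof.
have h (b : int) v : lat v -> lat (v + (2 * L * b%:~R)%:C).
  move=> [j e]; exists (j + b); rewrite cexpD e cexp_real -realCM -expRD.
  by congr (expR _)%:C; rewrite intrD; ring.
split=> [/(h 1)|/(h (-1))].
  by rewrite mulr1 -addrA -realCD addNr addr0.
by rewrite mulrN1z mulrN1.
Qed.

End Lat.

Variable n : nat.
Hypothesis hn : (3 <= n)%N.
Local Notation al := (oid_angle R n).
Variable W : weier al.
Local Notation L := (wl W).
Local Notation a := (- (2 * L)).
Local Notation lat := (lat L).
Local Notation nlat := [set z : C | ~ lat z].

Definition wqA z := wchi W z * w1 W z ^+ 2.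
Definition wqB z := wchi W z * w2 W z ^+ 2.
Definition wqC z := wchi W z * (w1 W z * w2 W z).
Definition phi1 z := I / 2 * (wqB z - wqA z).
Definition phi2 z := - ((wqA z + wqB z) / 2).
Definition phi3 z := I * wqC z.

Let co := cos (al + al).
Let si := sin (al + al).

Lemma two_al : 0 < al + al < pi.
Proof.
have := oid_angle_gt0 R hn; have := oid_angle_le R hn; have := pi_gt0 R.
by move=> *; apply/andP; split; lra.
Qed.

Let cs : co ^+ 2 + si ^+ 2 = 1. Proof. exact: cos2Dsin2. Qed.
Let c1 : co < 1.
Proof.
apply: cos_lt1; have /andP[h1 h2] := two_al; rewrite h1 (lt_trans h2) //.
by rewrite ltr_pMl ?pi_gt0 // ltr1n.
Qed.

Let w2_conj z : w2 W (conjc z) = conjc (w1 W z).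
Proof. by have := w1_conj W (conjc z); rewrite conjcK => ->; rewrite conjcK. Qed.

Lemma wqA_conj z : wqA (conjc z) = conjc (wqB z).
Proof. by rewrite /wqA w1_conj wchi_conj [RHS]conjM conjX. Qed.
Lemma wqB_conj z : wqB (conjc z) = conjc (wqA z).
Proof. by rewrite /wqB w2_conj wchi_conj [RHS]conjM conjX. Qed.
Lemma wqC_conj z : wqC (conjc z) = conjc (wqC z).
Proof. by rewrite /wqC w1_conj w2_conj wchi_conj [RHS]conjM conjM [X in _ * X]mulrC. Qed.

Let w2_neg z : w2 W (- z) = w1 W z.
Proof. by rewrite -w1_neg opprK. Qed.

Let wqA_neg z : wqA (- z) = wqB z.
Proof. by rewrite /wqA w1_neg wchi_neg. Qed.
Let wqB_neg z : wqB (- z) = wqA z.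
Proof. by rewrite /wqB w2_neg wchi_neg. Qed.
Let wqC_neg z : wqC (- z) = wqC z.
Proof. by rewrite /wqC w1_neg w2_neg wchi_neg [X in _ * X]mulrC. Qed.

Let e1 : cexp (ial al) ^+ 2 = co +i* si.
Proof.
rewrite expr2 -cexpD; apply: eqC; rewrite ?Re_cexp ?Im_cexp /= ?addr0 expR0 mul1r //.
Qed.
Let e2 : cexp (- ial al) ^+ 2 = co +i* (- si).
Proof.
by rewrite -conj_ial cexp_conj -conjX e1.
Qed.

Lemma wq_shift z : [/\ wqA (z + a%:C) = (co +i* si) * wqA z,
  wqB (z + a%:C) = (co +i* (- si)) * wqB z & wqC (z + a%:C) = wqC z].
Proof.
have [m /(_ z)[m1 m2 m3]] := w_shift W; rewrite /wqA /wqB /wqC -e1 -e2 m2 m3 -m1.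
have e : cexp (ial al) * cexp (- ial al) = 1 :> C by rewrite -cexpD subrr cexp0.
move: (wchi _ _) (m z) (cexp _) (cexp _) (w1 _ _) (w2 _ _) e => x y u v p q e.
by split; [ring|ring|rewrite -[RHS]mulr1 -e; ring].
Qed.

Let rotI (c s : R) (A B : C) :
  I / 2 * ((c +i* (- s)) * B - (c +i* s) * A) =
  c%:C * (I / 2 * (B - A)) - s%:C * (- ((A + B) / 2)).
Proof.
have -> : (c +i* (- s)) = c%:C - I * s%:C.
  by apply: eqC; rewrite !(ReD, ImD, ReN, ImN, ReM, ImM) /=; ring.
have -> : (c +i* s) = c%:C + I * s%:C.
  by apply: eqC; rewrite !(ReD, ImD, ReN, ImN, ReM, ImM) /=; ring.
have II : I * I = -1 :> C by apply: eqC; rewrite !(ReM, ImM, ReN, ImN) /=; ring.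
have -> : I / 2 * ((c%:C - I * s%:C) * B - (c%:C + I * s%:C) * A) =
  c%:C * (I / 2 * (B - A)) - (I * I) * s%:C * ((A + B) / 2) by ring.
by rewrite II; ring.
Qed.

Let rotJ (c s : R) (A B : C) :
  - (((c +i* s) * A + (c +i* (- s)) * B) / 2) =
  s%:C * (I / 2 * (B - A)) + c%:C * (- ((A + B) / 2)).
Proof.
have -> : (c +i* (- s)) = c%:C - I * s%:C.
  by apply: eqC; rewrite !(ReD, ImD, ReN, ImN, ReM, ImM) /=; ring.
have -> : (c +i* s) = c%:C + I * s%:C.
  by apply: eqC; rewrite !(ReD, ImD, ReN, ImN, ReM, ImM) /=; ring.
by ring.
Qed.

Lemma phi_shift z : [/\ phi1 (z + a%:C) = co%:C * phi1 z - si%:C * phi2 z,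
  phi2 (z + a%:C) = si%:C * phi1 z + co%:C * phi2 z & phi3 (z + a%:C) = phi3 z].
Proof.
by rewrite /phi1 /phi2 /phi3; have [-> -> ->] := wq_shift z; rewrite rotI rotJ.
Qed.

Let conjI : conjc I = - I :> C.
Proof. by apply: eqC; rewrite /= ?oppr0. Qed.

Lemma phi_conj z : [/\ conjc (phi1 (conjc z)) = phi1 z, conjc (phi2 (conjc z)) = phi2 z
  & conjc (phi3 (conjc z)) = - phi3 z].
Proof.
rewrite /phi1 /phi2 /phi3 wqA_conj wqB_conj wqC_conj.
move: (wqA z) (wqB z) (wqC z) => A B D; split.
- by rewrite conjM conjM conjV conjc_nat conjB !conjcK conjI; ring.
- by rewrite conjN conjM conjV conjc_nat conjD !conjcK; ring.
- by rewrite conjM conjcK conjI mulNr.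
Qed.

Lemma phi_neg z : [/\ phi1 (- z) = - phi1 z, phi2 (- z) = phi2 z & phi3 (- z) = phi3 z].
Proof.
rewrite /phi1 /phi2 /phi3 wqA_neg wqB_neg wqC_neg.
by split=> //; [rewrite -[RHS]mulrN opprB|rewrite [X in X / _]addrC].
Qed.

(** A rotation by an angle of cosine less than 1 has 0 as its only fixed vector. This eliminates the
    additive constants in the horizontal symmetries. *)
Let det (x y : R) : x = co * x - si * y -> y = si * x + co * y -> x = 0 /\ y = 0.
Proof.
move=> h1 h2; have : (x ^+ 2 + y ^+ 2) * (1 - co) = 0.
  have : x * (x - (co * x - si * y)) + y * (y - (si * x + co * y)) = 0 by rewrite -h1 -h2 !subrr !mulr0 addr0.
  by rewrite !expr2; lra.
move/eqP; rewrite mulf_eq0 subr_eq0 (gt_eqF c1) orbF.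
by rewrite paddr_eq0 ?sqr_ge0 // !sqrf_eq0 => /andP[/eqP -> /eqP ->].
Qed.

(** The identities carry no additive constants: the common axis of the symmetries passes through the
    origin. Conjugation is the reflection in the horizontal plane, and z -> - conj z the one in a
    vertical plane. *)
Record oid_pot (X1 X2 X3 : C -> R) := OidPot {
  op1 : pot nlat X1 phi1;
  op2 : pot nlat X2 phi2;
  op3 : pot nlat X3 phi3;
  op_tpi : forall z, ~ lat z -> [/\ X1 (z + tpi) = X1 z, X2 (z + tpi) = X2 z & X3 (z + tpi) = X3 z];
  op_shift : forall z, ~ lat z -> [/\ X1 (z + a%:C) = co * X1 z - si * X2 z,
    X2 (z + a%:C) = si * X1 z + co * X2 z & X3 (z + a%:C) = X3 z];
  op_conj : forall z, ~ lat z -> [/\ X1 (conjc z) = X1 z, X2 (conjc z) = X2 z & X3 (conjc z) = - X3 z];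
  op_refl : forall z, ~ lat z -> [/\ X1 (- conjc z) = X1 z, X2 (- conjc z) = - X2 z & X3 (- conjc z) = X3 z]
}.

(** Uniqueness of potentials gives every symmetry up to a constant. The constants are removed by
    moving the origin to the centre of symmetry and by using the relations between the
    symmetries. *)
Lemma oid_pot_exists : exists X1 X2 X3, oid_pot X1 X2 X3.
Proof.
have L0 := wl_gt0 W.
have [F1 [F2 [F3 [h1 h2 h3 ht]]]] := w_pot W.
have {}h1 : pot nlat F1 phi1 by [].
have {}h2 : pot nlat F2 phi2 by [].
have {}h3 : pot nlat F3 phi3 by [].
have nS z : nlat z -> nlat (z + a%:C) by move=> nz /lat_shift.
have nC z : nlat z -> nlat (conjc z) by move=> nz /lat_conj.
have nN z : nlat z -> nlat (- z) by move=> nz /lat_neg.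
have sh F f : pot nlat F f -> pot nlat (fun z => F (z + a%:C)) (fun z => f (z + a%:C)).
  by move=> hF; apply: (pot_sub nS); exact: pot_shift.
have cj F f : pot nlat F f -> pot nlat (fun z => F (conjc z)) (fun z => conjc (f (conjc z))).
  by move=> hF; apply: (pot_sub nC); exact: pot_conj.
have ng F f : pot nlat F f -> pot nlat (fun z => F (- z)) (fun z => - f (- z)).
  by move=> hF; apply: (pot_sub nN); exact: pot_neg.
have [d1 E1] : exists d, forall z, ~ lat z -> F1 (z + a%:C) = (co * F1 z - si * F2 z) + d.
  apply: (pot_nlat_unique L0 (sh _ _ h1)).
  by apply: pot_eq (potB (potZ co h1) (potZ si h2)) => z _; have [-> _ _] := phi_shift z.
have [d2 E2] : exists d, forall z, ~ lat z -> F2 (z + a%:C) = (si * F1 z + co * F2 z) + d.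
  apply: (pot_nlat_unique L0 (sh _ _ h2)).
  by apply: pot_eq (potD (potZ si h1) (potZ co h2)) => z _; have [_ -> _] := phi_shift z.
have [d3 E3] : exists d, forall z, ~ lat z -> F3 (z + a%:C) = F3 z + d.
  apply: (pot_nlat_unique L0 (sh _ _ h3)).
  by apply: pot_eq h3 => z _; have [_ _ ->] := phi_shift z.
have [b3 B3] : exists d, forall z, ~ lat z -> F3 (conjc z) = - F3 z + d.
  apply: (pot_nlat_unique L0 (cj _ _ h3)).
  by apply: pot_eq (potN h3) => z _; have [_ _ ->] := phi_conj z.
(* The determinant of the identity minus the rotation; (t1, t2) translates the fixed point of the
   affine rotation to the origin. *)
pose D := (1 - co) ^+ 2 + si ^+ 2.
have D0 : D != 0 by rewrite gt_eqF // ltr_wpDr ?sqr_ge0 // exprn_gt0 // subr_gt0.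
pose t1 := (si * d2 - (1 - co) * d1) / D.
pose t2 := (- (1 - co) * d2 - si * d1) / D.
have T1 : d1 + t1 = co * t1 - si * t2 by move: D0; rewrite /t1 /t2 /D => D0; field.
have T2 : d2 + t2 = si * t1 + co * t2 by move: D0; rewrite /t1 /t2 /D => D0; field.
pose X1 z := F1 z + t1; pose X2 z := F2 z + t2; pose X3 z := F3 z - b3 / 2.
have addc F f c : pot nlat F f -> pot nlat (fun z => F z + c) f.
  by move=> hF; apply: pot_eq (potD hF (@pot_cst R nlat c)) => z _; rewrite addr0.
have p1 : pot nlat X1 phi1 by exact: addc.
have p2 : pot nlat X2 phi2 by exact: addc.
have p3 : pot nlat X3 phi3 by exact: addc.
have S1 z : ~ lat z -> X1 (z + a%:C) = co * X1 z - si * X2 z.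
  by move=> nz; rewrite /X1 /X2 E1 //; move: T1; lra.
have S2 z : ~ lat z -> X2 (z + a%:C) = si * X1 z + co * X2 z.
  by move=> nz; rewrite /X1 /X2 E2 //; move: T2; lra.
have C3 z : ~ lat z -> X3 (conjc z) = - X3 z.
  by move=> nz; rewrite /X3 B3 //; lra.
have cS z : conjc (z + a%:C) = conjc z + a%:C by rewrite conjD conjc_real.
(* Conjugation commutes with the translation and changes the sign of [X3], so the constant [d3]
   equals its opposite. *)
have S3 z : ~ lat z -> X3 (z + a%:C) = X3 z.
  move=> nz; have e v : ~ lat v -> X3 (v + a%:C) = X3 v + d3.
    by move=> nv; rewrite /X3 E3 //; ring.
  have := e _ (nC _ nz); rewrite -cS (C3 _ (nS _ nz)) (C3 _ nz) !e //; lra.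
have [b1 B1] : exists d, forall z, ~ lat z -> X1 (conjc z) = X1 z + d.
  apply: (pot_nlat_unique L0 (cj _ _ p1)).
  by apply: pot_eq p1 => z _; have [-> _ _] := phi_conj z.
have [b2 B2] : exists d, forall z, ~ lat z -> X2 (conjc z) = X2 z + d.
  apply: (pot_nlat_unique L0 (cj _ _ p2)).
  by apply: pot_eq p2 => z _; have [_ -> _] := phi_conj z.
(* A fixed point of z -> - conj z off the lattice; it settles [r3] below. *)
pose z0 : C := 0 +i* pi.
have n0 : ~ lat z0.
  apply: (@hstrip_nlat R L 0); apply/hstripP; rewrite ImC mulr0z mulr0 add0r pi_gt0 /=.
  by rewrite ltr_pMl ?pi_gt0 // ltr1n.
(* As conjugation commutes with the translation, (b1, b2) is fixed by the rotation. *)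
have [b10 b20] : b1 = 0 /\ b2 = 0.
  have nc := nC _ n0; have u1 := S1 _ nc; have u2 := S2 _ nc.
  move: u1 u2; rewrite -!cS !B1 ?B2 ?S1 ?S2 //; try exact: nS.
  by move=> u1 u2; apply: det; lra.
have rr F f : pot nlat F f -> pot nlat (fun z => F (- conjc z)) (fun z => - conjc (f (- conjc z))).
  move=> /ng/cj H; apply: pot_eq H => z _.
  by rewrite conjN.
have nR z : ~ lat z -> ~ lat (- conjc z) by move=> nz; exact/nN/nC.
have pr z : [/\ - conjc (phi1 (- conjc z)) = phi1 z, - conjc (phi2 (- conjc z)) = - phi2 z
    & - conjc (phi3 (- conjc z)) = phi3 z].
  have [-> -> ->] := phi_neg (conjc z); have [e1' e2' e3'] := phi_conj z.
  by rewrite conjN e1' e2' e3' !opprK.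
have [r1 R1] : exists d, forall z, ~ lat z -> X1 (- conjc z) = X1 z + d.
  apply: (pot_nlat_unique L0 (rr _ _ p1)).
  by apply: pot_eq p1 => z _; have [-> _ _] := pr z.
have [r2 R2] : exists d, forall z, ~ lat z -> X2 (- conjc z) = - X2 z + d.
  apply: (pot_nlat_unique L0 (rr _ _ p2)).
  by apply: pot_eq (potN p2) => z _; have [_ -> _] := pr z.
have [r3 R3] : exists d, forall z, ~ lat z -> X3 (- conjc z) = X3 z + d.
  apply: (pot_nlat_unique L0 (rr _ _ p3)).
  by apply: pot_eq p3 => z _; have [_ _ ->] := pr z.
have rz0 : - conjc z0 = z0 by apply: eqC; rewrite /= ?oppr0 ?opprK.
have r30 : r3 = 0 by have := R3 _ n0; rewrite rz0; lra.
(* Writing T for the translation and S for z -> - conj z, the relation T S T = S shows that (r1, r2)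
   is fixed by the rotation. *)
have [r10 r20] : r1 = 0 /\ r2 = 0.
  have rS z : - conjc (z + a%:C) + a%:C = - conjc z by rewrite cS opprD addrNK.
  have nv := nR _ (nS _ n0); have u1 := S1 _ nv; have u2 := S2 _ nv.
  move: u1 u2; rewrite !rS !R1 ?R2 ?S1 ?S2 //; try exact: nS.
  move=> u1 u2.
  have h : forall p q : R, co * (co * p - si * q) + si * (si * p + co * q) = p.
    by move=> p q; rewrite -[RHS]mul1r -cs; ring.
  have h' : forall p q : R, si * (co * p - si * q) - co * (si * p + co * q) = - q.
    by move=> p q; rewrite -[RHS]mul1r -cs; ring.
  have := h (X1 z0) (X2 z0); have := h' (X1 z0) (X2 z0).
  by move=> k1 k2; apply: det; lra.
exists X1, X2, X3; split=> //.
- by move=> z /ht[t1' t2' t3']; rewrite /X1 /X2 /X3 t1' t2' t3'.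
- by move=> z nz; rewrite S1 // S2 // S3.
- by move=> z nz; rewrite B1 // B2 // C3 // b10 b20 !addr0.
- by move=> z nz; rewrite R1 // R2 // R3 // r10 r20 r30 !addr0.
Qed.

End Symmetries.

(** * Vectors of R^3, reflections and rotations in coordinates *)

Section Rows.
Variable R : realType.
Implicit Types (x y : 'rV[R]_3) (a b c : R).

Definition rv3 a b c : 'rV[R]_3 := \row_(i < 3) nth 0 [:: a; b; c] i.

Let i0 : 'I_3 := 0.
Let i1 : 'I_3 := 1.
Let i2 : 'I_3 := 2.

Lemma ord3P (P : 'I_3 -> Prop) : P 0 -> P 1 -> P 2 -> forall i, P i.
Proof.
move=> p0 p1 p2 [[|[|[|//]]] Hi].
- by rewrite (_ : Ordinal Hi = 0) //; exact: val_inj.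
- by rewrite (_ : Ordinal Hi = 1) //; exact: val_inj.
- by rewrite (_ : Ordinal Hi = 2) //; exact: val_inj.
Qed.

Lemma rv3_0 a b c : rv3 a b c 0 0 = a. Proof. by rewrite mxE. Qed.
Lemma rv3_1 a b c : rv3 a b c 0 1 = b. Proof. by rewrite mxE. Qed.
Lemma rv3_2 a b c : rv3 a b c 0 2 = c. Proof. by rewrite mxE. Qed.
Definition rv3E := (rv3_0, rv3_1, rv3_2).

Lemma row3P x y : x 0 0 = y 0 0 -> x 0 1 = y 0 1 -> x 0 2 = y 0 2 -> x = y.
Proof. by move=> e0 e1 e2; apply/rowP; apply: ord3P. Qed.

Lemma rv3K x : rv3 (x 0 0) (x 0 1) (x 0 2) = x.
Proof. by apply: row3P; rewrite rv3E. Qed.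

Lemma sum3 (T : nmodType) (F : 'I_3 -> T) : \sum_(i < 3) F i = F 0 + F 1 + F 2.
Proof.
rewrite !big_ord_recr big_ord0 /= add0r.
by congr (_ + _ + _); congr F; exact: val_inj.
Qed.

Lemma dotE x y : dot x y = x 0 0 * y 0 0 + x 0 1 * y 0 1 + x 0 2 * y 0 2.
Proof. by rewrite /dot mxE sum3 !mxE. Qed.

Lemma dotC x y : dot x y = dot y x.
Proof. by rewrite !dotE; ring. Qed.

Lemma enormE x : enorm x = Num.sqrt (x 0 0 ^+ 2 + x 0 1 ^+ 2 + x 0 2 ^+ 2).
Proof. by rewrite /enorm dotE !expr2. Qed.

Lemma enorm_ge0 x : 0 <= enorm x. Proof. exact: sqrtr_ge0. Qed.

Lemma le_enorm x (i : 'I_3) : `|x 0 i| <= enorm x.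
Proof.
rewrite enormE -sqrtr_sqr; apply: ler_wsqrtr.
have := sqr_ge0 (x 0 0); have := sqr_ge0 (x 0 1); have := sqr_ge0 (x 0 2).
by elim/ord3P: i => h2 h1 h0; move: h0 h1 h2; lra.
Qed.

Lemma enorm_le x : enorm x <= `|x 0 0| + `|x 0 1| + `|x 0 2|.
Proof.
rewrite enormE -[leRHS]ger0_norm ?addr_ge0 // -sqrtr_sqr; apply: ler_wsqrtr.
rewrite -(real_normK (num_real (x 0 0))) -(real_normK (num_real (x 0 1))) -(real_normK (num_real (x 0 2))).
have := normr_ge0 (x 0 0); have := normr_ge0 (x 0 1); have := normr_ge0 (x 0 2).
by move: `|x 0 0| `|x 0 1| `|x 0 2| => p q r p0 q0 r0; rewrite !expr2; nra.
Qed.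

Lemma crossE x y : cross x y = rv3 (x 0 1 * y 0 2 - x 0 2 * y 0 1)
  (x 0 2 * y 0 0 - x 0 0 * y 0 2) (x 0 0 * y 0 1 - x 0 1 * y 0 0).
Proof.
by apply: row3P; rewrite rv3E mxE; congr (x 0 _ * y 0 _ - x 0 _ * y 0 _); exact: val_inj.
Qed.

Lemma enormZ a x : 0 <= a -> enorm (a *: x) = a * enorm x.
Proof.
move=> a0; rewrite !enormE !mxE.
have -> : (a * x 0 0) ^+ 2 + (a * x 0 1) ^+ 2 + (a * x 0 2) ^+ 2 =
   a ^+ 2 * (x 0 0 ^+ 2 + x 0 1 ^+ 2 + x 0 2 ^+ 2) by ring.
by rewrite sqrtrM ?sqr_ge0 // sqrtr_sqr ger0_norm.
Qed.

Lemma enorm0 : enorm (0 : 'rV[R]_3) = 0.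
Proof. by rewrite enormE !mxE !expr0n !addr0 sqrtr0. Qed.

Lemma mulmx3 x (A : 'M[R]_3) i : (x *m A) 0 i = x 0 0 * A 0 i + x 0 1 * A 1 i + x 0 2 * A 2 i.
Proof. by rewrite mxE sum3. Qed.

Definition axis3 : 'rV[R]_3 := rv3 0 0 1.
Definition axis2 : 'rV[R]_3 := rv3 0 1 0.

Lemma mul_reflection x e : x *m reflection_mx e = x - (2 * dot x e) *: e.
Proof.
apply: row3P; rewrite mulmx3 dotE !mxE !big_ord1 !mxE /=; ring.
Qed.

Lemma mul_refl3 a b c : rv3 a b c *m reflection_mx axis3 = rv3 a b (- c).
Proof. by rewrite mul_reflection dotE; apply: row3P; rewrite !mxE /=; ring. Qed.

Lemma mul_refl2 a b c : rv3 a b c *m reflection_mx axis2 = rv3 a (- b) c.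
Proof. by rewrite mul_reflection dotE; apply: row3P; rewrite !mxE /=; ring. Qed.

Lemma cross_lin1 x e : x *m lin1_mx (cross e) = cross e x.
Proof.
have L i j : lin1_mx (cross e) i j = cross e (delta_mx 0 i) 0 j by rewrite mxE.
by apply: row3P; rewrite mulmx3 !L !crossE !rv3E !mxE /=; ring.
Qed.

Lemma mul_rotation x e t : x *m rotation_mx e t =
  cos t *: x + sin t *: cross e x + ((1 - cos t) * dot x e) *: e.
Proof.
rewrite /rotation_mx !mulmxDr -!scalemxAr mulmx1 cross_lin1; congr (_ + _).
by rewrite -scalerA; congr (_ *: _); apply: row3P; rewrite mulmx3 dotE !mxE !big_ord1 !mxE; ring.
Qed.

Lemma mul_rot3 a b c t : rv3 a b c *m rotation_mx axis3 t =
  rv3 (cos t * a - sin t * b) (sin t * a + cos t * b) c.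
Proof.
by rewrite mul_rotation dotE crossE; apply: row3P; rewrite !mxE /=; ring.
Qed.

Lemma cvg_rv3 (T : Type) (F : set_system T) (FF : Filter F) (f g h : T -> R) a b c :
  f @ F --> a -> g @ F --> b -> h @ F --> c ->
  (fun t => rv3 (f t) (g t) (h t)) @ F --> rv3 a b c.
Proof.
move=> /cvgrPdist_lt fa /cvgrPdist_lt gb /cvgrPdist_lt hc.
apply/cvgrPdist_lt => e e0.
apply: filterS3 (fa e e0) (gb e e0) (hc e e0) => t h1 h2 h3.
rewrite [ltLHS]/Num.Def.normr/= mx_normrE; apply: bigmax_lt => //= -[i j] _ /=.
rewrite (ord1 i) {i} !mxE; move: j; exact: ord3P.
Qed.

Lemma cvg_entry (T : Type) (F : set_system T) (FF : Filter F) (f : T -> 'rV[R]_3) (v : 'rV[R]_3) (i : 'I_3) :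
  f @ F --> v -> (fun t => f t 0 i) @ F --> v 0 i.
Proof.
move=> /cvgrPdist_lt fv; apply/cvgrPdist_lt => e e0; apply: filterS (fv e e0) => t.
apply: le_lt_trans; rewrite [leRHS]/Num.Def.normr/= mx_normrE.
by have := @le_bigmax _ _ _ 0 (fun ij : 'I_1 * 'I_3 => `|(v - f t) ij.1 ij.2|) (0, i); rewrite /= !mxE.
Qed.

Lemma derive_rv3 (f g h : R^o -> R^o) (t : R^o) (a b c : R) : is_derive t (1 : R^o) f a ->
  is_derive t (1 : R^o) g b -> is_derive t (1 : R^o) h c ->
  is_derive t (1 : R^o) (fun s => rv3 (f s) (g s) (h s)) (rv3 a b c).
Proof.
move=> [df ef] [dg eg] [dh eh].
have e0 : (fun s => rv3 (f s) (g s) (h s) 0 0) = f by apply/funext => s; exact: rv3_0.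
have e1 : (fun s => rv3 (f s) (g s) (h s) 0 1) = g by apply/funext => s; exact: rv3_1.
have e2 : (fun s => rv3 (f s) (g s) (h s) 0 2) = h by apply/funext => s; exact: rv3_2.
have D : derivable (fun s : R^o => rv3 (f s) (g s) (h s)) t 1.
  apply/derivable_mxP => i j; rewrite (ord1 i) {i}; elim/ord3P: j.
  - exact: (eq_ind_r (fun k : R^o -> R^o => derivable k t 1) df e0).
  - exact: (eq_ind_r (fun k : R^o -> R^o => derivable k t 1) dg e1).
  - exact: (eq_ind_r (fun k : R^o -> R^o => derivable k t 1) dh e2).
apply: DeriveDef => //; rewrite derive_mx //; apply: row3P; rewrite rv3E mxE.
- exact: (eq_ind_r (fun k : R^o -> R^o => derive k t 1 = a) ef e0).
- exact: (eq_ind_r (fun k : R^o -> R^o => derive k t 1 = b) eg e1).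
- exact: (eq_ind_r (fun k : R^o -> R^o => derive k t 1 = c) eh e2).
Qed.

Lemma derive_entry (f : R^o -> 'rV[R]_3) (t : R^o) (v : 'rV[R]_3) (i : 'I_3) : is_derive t (1 : R^o) f v ->
  is_derive t (1 : R^o) (fun s => f s 0 i : R^o) (v 0 i).
Proof.
move=> [df ef]; apply: DeriveDef; first by move/derivable_mxP: df.
by rewrite -ef derive_mx // mxE.
Qed.

End Rows.

(** * Smoothness of potentials and of locally affine functions *)

Section ClassC.
Variable R : realType.
Local Notation C := R[i].
Local Notation Ct := (R[i]^o).
Implicit Types (z w : C) (D : set Ct).

Lemma near_line D z w : open D -> D z -> \forall t \near (0 : R), D (z + t%:C * w).
Proof.
move=> oD Dz; have [r r0 Hr] := nbhs_ball_sub oD Dz.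
have w0 : 0 < cabs w + 1 by rewrite ltr_wpDl // cabs_ge0.
have d0 : 0 < r / (cabs w + 1) by rewrite divr_gt0.
apply: filterS (near_ball_R 0 d0) => t; rewrite subr0 ltr_pdivlMr // => tr.
apply: Hr; rewrite (_ : _ - z = t%:C * w); last by ring.
by rewrite cabsM cabs_real (le_lt_trans _ tr) // ler_wpM2l // lerDl.
Qed.

Lemma continuous_open_eq (T U : topologicalType) (D : set T) (F G : T -> U) (z : T) : open D -> D z ->
  (forall v, D v -> F v = G v) -> {for z, continuous F} -> {for z, continuous G}.
Proof.
move=> oD Dz FG c; change (G @ z --> G z); rewrite -(FG z Dz); apply: cvg_trans c.
by apply: near_eq_cvg; apply: filterS (open_nbhs_nbhs (conj oD Dz)) => w /FG.
Qed.

Lemma partial_local (V : normedModType R) D w (F G : Ct -> V) z : open D -> D z ->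
  (forall v, D v -> F v = G v) -> has_partial w F z -> has_partial w G z /\ partial w F z = partial w G z.
Proof.
move=> oD Dz FG hF.
have N : {near (0 : R^o), (fun t : R^o => F (z + t%:C * w)) =1 (fun t : R^o => G (z + t%:C * w))}.
  by apply: filterS (near_line w oD Dz) => t; exact: FG.
split; first exact: (near_eq_derivable N hF).
exact: near_eq_derive.
Qed.

Lemma class_C_ext (V : normedModType R) k D (F G : Ct -> V) : open D ->
  (forall v, D v -> F v = G v) -> class_C k D F -> class_C k D G.
Proof.
move=> oD; elim: k F G => [|k IH] F G FG [cF Hk]; split.
- by move=> z Dz; apply: (continuous_open_eq oD Dz FG); exact: cF.
- by [].
- by move=> z Dz; apply: (continuous_open_eq oD Dz FG); exact: cF.
move=> w ww; have [hp hc] := Hk w ww; split.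
  by move=> z Dz; have [] := partial_local oD Dz FG (hp z Dz).
by apply: IH hc => z Dz; have [] := partial_local oD Dz FG (hp z Dz).
Qed.

Lemma partial_pot D (X1 X2 X3 : C -> R) (f1 f2 f3 : C -> C) w z : D z ->
  pot D X1 f1 -> pot D X2 f2 -> pot D X3 f3 ->
  let F := (fun z => rv3 (X1 z) (X2 z) (X3 z)) : Ct -> 'rV[R]_3 in
  has_partial w F z /\ partial w F z = rv3 (Re (w * f1 z)) (Re (w * f2 z)) (Re (w * f3 z)).
Proof.
move=> Dz h1 h2 h3 F.
by have [] := derive_rv3 (h1 z Dz w) (h2 z Dz w) (h3 z Dz w).
Qed.

Lemma cont_pot D (X1 X2 X3 : C -> R) (f1 f2 f3 : C -> C) z : open D -> D z ->
  pot D X1 f1 -> pot D X2 f2 -> pot D X3 f3 -> cont f1 z -> cont f2 z -> cont f3 z ->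
  {for (z : Ct), continuous ((fun z => rv3 (X1 z) (X2 z) (X3 z)) : Ct -> 'rV[R]_3)}.
Proof.
move=> oD Dz h1 h2 h3 c1 c2 c3; apply: (cvg_rv3 (nbhs_filter (z : Ct))).
- exact: (pot_continuous oD Dz h1 c1).
- exact: (pot_continuous oD Dz h2 c2).
- exact: (pot_continuous oD Dz h3 c3).
Qed.

(** The derivative of Re f in the direction w is Re(w f'), again the real part of a holomorphic
    function, so the induction on k closes. *)
Lemma class_Re k D (f1 f2 f3 : C -> C) : open D -> hol k D f1 -> hol k D f2 -> hol k D f3 ->
  class_C k D ((fun z => rv3 (Re (f1 z)) (Re (f2 z)) (Re (f3 z))) : Ct -> 'rV[R]_3).
Proof.
move=> oD; elim: k f1 f2 f3 => [|k IH] f1 f2 f3 hf1 hf2 hf3.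
  split=> // z Dz; apply: (cvg_rv3 (nbhs_filter (z : Ct))).
  - exact: (cvg_comp _ _ (hol_continuous hf1 Dz) (continuous_Re (f1 z))).
  - exact: (cvg_comp _ _ (hol_continuous hf2 Dz) (continuous_Re (f2 z))).
  - exact: (cvg_comp _ _ (hol_continuous hf3 Dz) (continuous_Re (f3 z))).
split.
  move=> z Dz; apply: (cvg_rv3 (nbhs_filter (z : Ct))).
  - exact: (cvg_comp _ _ (hol_continuous hf1 Dz) (continuous_Re (f1 z))).
  - exact: (cvg_comp _ _ (hol_continuous hf2 Dz) (continuous_Re (f2 z))).
  - exact: (cvg_comp _ _ (hol_continuous hf3 Dz) (continuous_Re (f3 z))).
move: hf1 hf2 hf3 => [_ [g1 d1 e1]] [_ [g2 d2 e2]] [_ [g3 d3 e3]] w _.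
have P z : D z -> has_partial w ((fun z => rv3 (Re (f1 z)) (Re (f2 z)) (Re (f3 z))) : Ct -> 'rV[R]_3) z /\
    partial w ((fun z => rv3 (Re (f1 z)) (Re (f2 z)) (Re (f3 z))) : Ct -> 'rV[R]_3) z =
    rv3 (Re (w * g1 z)) (Re (w * g2 z)) (Re (w * g3 z)).
  by move=> Dz; apply: (partial_pot w Dz); apply: pot_hder.
split=> [z /P[]//|].
apply: (@class_C_ext _ _ _ (fun z => rv3 (Re (w * g1 z)) (Re (w * g2 z)) (Re (w * g3 z)))) => //.
  by move=> z /P[].
by apply: IH; (apply: holM => //; exact: hol_cst).
Qed.

Lemma class_pot k D (X1 X2 X3 : C -> R) (f1 f2 f3 : C -> C) : open D ->
  pot D X1 f1 -> pot D X2 f2 -> pot D X3 f3 -> hol k D f1 -> hol k D f2 -> hol k D f3 ->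
  class_C k.+1 D ((fun z => rv3 (X1 z) (X2 z) (X3 z)) : Ct -> 'rV[R]_3).
Proof.
move=> oD p1 p2 p3 h1 h2 h3; split.
  move=> z Dz; exact: (cont_pot oD Dz p1 p2 p3 (hol_continuous h1 Dz) (hol_continuous h2 Dz) (hol_continuous h3 Dz)).
move=> w _; split; first by move=> z Dz; have [] := partial_pot w Dz p1 p2 p3.
apply: (@class_C_ext _ _ _ (fun z => rv3 (Re (w * f1 z)) (Re (w * f2 z)) (Re (w * f3 z)))) => //.
  by move=> z Dz; have [] := partial_pot w Dz p1 p2 p3.
by apply: class_Re => //; (apply: holM => //; exact: hol_cst).
Qed.

Lemma class_C_le (V : normedModType R) k D (F : Ct -> V) : class_C k.+1 D F -> class_C k D F.
Proof.
elim: k F => [|k IH] F [cF Hk]; split=> // w ww.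
by have [hp hc] := Hk w ww; split=> //; exact: IH.
Qed.

Lemma open_cball z r : open [set v : Ct | cabs (v - z) < r].
Proof.
rewrite openE => u /= ur; have s0 : 0 < r - cabs (u - z) by rewrite subr_gt0.
apply: filterS (near_ball_C u s0) => x; rewrite ltrBrDr; apply: le_lt_trans.
by rewrite (_ : x - z = (x - u) + (u - z)) ?cabsD //; ring.
Qed.

(** Made for the symmetries read in charts, which are affine near each point; the constant may
    change from one connected piece of the domain to another, hence the local formulation. *)
Lemma class_affine k D (F : Ct -> R^o) : open D ->
  (forall z, D z -> exists r p q c : R, 0 < r /\
    forall v, cabs (v - z) < r -> F v = p * Re v + q * Im v + c) -> class_C k D F.
Proof.
move=> oD.
have cF F' : (forall z, D z -> exists r p q c : R, 0 < r /\
    forall v, cabs (v - z) < r -> F' v = p * Re v + q * Im v + c) ->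
    forall z, D z -> {for z, continuous (F' : Ct -> R^o)}.
  move=> HF z /HF[r [p [q [c [r0 E]]]]].
  have zz : [set v : Ct | cabs (v - z) < r] z by rewrite /= subrr cabs0.
  apply: (@continuous_open_eq Ct R^o _ (fun v => p * Re v + q * Im v + c) F' z (@open_cball z r) zz (fun v vr => esym (E v vr))).
  apply: (@continuousD R R^o Ct (fun v => p * Re v + q * Im v) (fun=> c)); last exact: cst_continuous.
  apply: (@continuousD R R^o Ct (fun v => p * Re v) (fun v => q * Im v)).
    by apply: (@continuousM R Ct (fun=> p) Re); [exact: cst_continuous|exact: continuous_Re].
  by apply: (@continuousM R Ct (fun=> q) Im); [exact: cst_continuous|exact: continuous_Im].
elim: k F => [|k IH] F HF; first by split=> //; exact: cF.
split; first exact: cF.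
move=> w _.
have P z : D z -> exists r p q c : R, [/\ 0 < r,
    (forall v, cabs (v - z) < r -> F v = p * Re v + q * Im v + c) &
    (forall v, cabs (v - z) < r -> has_partial w F v /\ partial w F v = p * Re w + q * Im w)].
  move=> /HF[r [p [q [c [r0 E]]]]]; exists r, p, q, c; split=> // v vr.
  have oB := @open_cball z r.
  have d : is_derive (0 : R^o) (1 : R^o) (fun t : R^o => p * Re (v + t%:C * w) + q * Im (v + t%:C * w) + c)
      (p * Re w + q * Im w).
    rewrite (_ : (fun t => _) = (fun t : R^o => (p * Re v + q * Im v + c) + t * (p * Re w + q * Im w))); last first.
      by apply/funext => t; rewrite ReD ImD ReZ ImZ; ring.
    apply/rderP => e e0; exists 1 => // h _; rewrite add0r.
    rewrite (_ : _ - _ = 0); last by ring.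
    by rewrite normr0 mulr_ge0 // ltW.
  have N : {near (0 : R^o), (fun t : R^o => p * Re (v + t%:C * w) + q * Im (v + t%:C * w) + c)
      =1 (fun t : R^o => F (v + t%:C * w))}.
    by apply: filterS (near_line w oB vr) => t /E.
  by have [] := near_eq_is_derive N d.
split=> [z Dz|].
  have [r [p [q [c [r0 E H]]]]] := P z Dz.
  by have [] := H z; rewrite ?subrr ?cabs0.
apply: IH => z Dz; have [r [p [q [c [r0 E H]]]]] := P z Dz.
exists r, 0, 0, (p * Re w + q * Im w); split=> // v /H[_ ->].
by rewrite !mul0r !add0r.
Qed.

End ClassC.

(** * Geometry of the surface *)

Section Spinor.
Variable R : realType.
Local Notation C := R[i].
Implicit Types (c p q : C).

(** The spinor parametrisation of the null vectors of C^3: sv1^2 + sv2^2 + sv3^2 = 0. The vector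
    [snum1], [snum2], [snum3], divided by [snrm], is the inverse stereographic image of p/q. *)
Definition sv1 c p q : C := I / 2 * (c * q ^+ 2 - c * p ^+ 2).
Definition sv2 c p q : C := - ((c * p ^+ 2 + c * q ^+ 2) / 2).
Definition sv3 c p q : C := I * (c * (p * q)).
Definition snrm p q : R := cabs p ^+ 2 + cabs q ^+ 2.
Definition snum1 p q : R := 2 * Re (p * conjc q).
Definition snum2 p q : R := 2 * Im (p * conjc q).
Definition snum3 p q : R := cabs p ^+ 2 - cabs q ^+ 2.

Let half (z : C) : z / 2 = (1 / 2 : R)%:C * z.
Proof. by rewrite mulrC realCM realCV realC1 mul1r (_ : (2 : R)%:C = 2) // rmorph_nat. Qed.

Let ReIm := (ReD, ImD, ReN, ImN, ReM, ImM, @ReC R, @ImC R, Re_conj, Im_conj).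

(** The real parts will be F_u and the opposites of the imaginary parts F_v. The first block of
    identities is conformality, the second gives the cross product and hence the normal. Naming the
    six real numbers keeps later rewriting away from the complex expressions. *)
Lemma sv_ReIm c p q : exists x1 x2 x3 y1 y2 y3 : R,
  [/\ [/\ Re (sv1 c p q) = x1, Re (sv2 c p q) = x2 & Re (sv3 c p q) = x3],
      [/\ Im (sv1 c p q) = y1, Im (sv2 c p q) = y2 & Im (sv3 c p q) = y3],
      let E := cabs c ^+ 2 * snrm p q ^+ 2 / 4 in
      [/\ x1 ^+ 2 + x2 ^+ 2 + x3 ^+ 2 = E, y1 ^+ 2 + y2 ^+ 2 + y3 ^+ 2 = E
        & x1 * y1 + x2 * y2 + x3 * y3 = 0] &
      let k := cabs c ^+ 2 * snrm p q / 4 in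
      [/\ x3 * y2 - x2 * y3 = k * snum1 p q, x1 * y3 - x3 * y1 = k * snum2 p q
        & x2 * y1 - x1 * y2 = k * snum3 p q]].
Proof.
exists (Re (sv1 c p q)), (Re (sv2 c p q)), (Re (sv3 c p q)).
exists (Im (sv1 c p q)), (Im (sv2 c p q)), (Im (sv3 c p q)).
rewrite /sv1 /sv2 /sv3 /snrm /snum1 /snum2 /snum3 !half !cabs_sqr.
case: c => a b; case: p => p1 p2; case: q => q1 q2.
rewrite !expr2 !ReIm.
by split=> //; split; field.
Qed.

Lemma snrm_gt0 p q : ~ (p = 0 /\ q = 0) -> 0 < snrm p q.
Proof.
move=> pq; rewrite lt_def addr_ge0 ?sqr_ge0 // andbT paddr_eq0 ?sqr_ge0 //.
by rewrite !sqrf_eq0 !cabs_eq0; apply/negP => /andP[/eqP p0 /eqP q0]; exact: pq.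
Qed.

Lemma snum_norm p q : snum1 p q ^+ 2 + snum2 p q ^+ 2 + snum3 p q ^+ 2 = snrm p q ^+ 2.
Proof.
rewrite /snrm /snum1 /snum2 /snum3 !cabs_sqr.
case: p => p1 p2; case: q => q1 q2; rewrite !ReIm; ring.
Qed.

Lemma snum_sv c p q : (snum1 p q)%:C * sv1 c p q + (snum2 p q)%:C * sv2 c p q
  + (snum3 p q)%:C * sv3 c p q = 0.
Proof.
rewrite /sv1 /sv2 /sv3 /snum1 /snum2 /snum3 !half !cabs_sqr.
by case: c => a b; case: p => p1 p2; case: q => q1 q2; apply: eqC; rewrite !expr2 !ReIm; field.
Qed.

Lemma row_free_orth (x y : 'rV[R]_3) (E : R) : 0 < E -> dot x x = E -> dot y y = E ->
  dot x y = 0 -> row_free (col_mx x y).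
Proof.
move=> E0 ex ey exy; apply/row_freeP; exists (E^-1 *: row_mx x^T y^T).
have D (u v : 'rV[R]_3) : u *m v^T = (dot u v)%:M.
  by apply/matrixP => i j; rewrite !ord1 /dot [RHS]mxE.
rewrite -scalemxAr mul_col_row !D (dotC y x) ex ey exy.
rewrite (_ : 0%:M = 0); last by apply/matrixP => i j; rewrite !mxE mul0rn.
rewrite -scalar_mx_block scale_scalar_mx mulVf ?gt_eqF //.
Qed.

Definition spin_normal p q : 'rV[R]_3 :=
  rv3 (snum1 p q / snrm p q) (snum2 p q / snrm p q) (snum3 p q / snrm p q).

End Spinor.

(** * Metric, normal and curvature of the surface *)

Section Local.
Variable R : realType.
Local Notation C := R[i].
Local Notation Ct := (R[i]^o).
Implicit Types (z w : C).
Variable n : nat.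
Variable W : weier (oid_angle R n).
Local Notation L := (wl W).
Local Notation lat := (lat L).
Local Notation nlat := [set z : C | ~ lat z].
Variables X1 X2 X3 : C -> R.
Hypothesis h1 : pot nlat X1 (phi1 W).
Hypothesis h2 : pot nlat X2 (phi2 W).
Hypothesis h3 : pot nlat X3 (phi3 W).

Lemma open_nlat : open (nlat : set Ct).
Proof.
rewrite openE => z /(nlat_cover (wl_gt0 W))[[j vz]|[k hz]].
  by apply: filterS (open_nbhs_nbhs (conj (@open_vstrip R L j) vz)) => w; exact: vstrip_nlat (wl_gt0 W) _ _.
by apply: filterS (open_nbhs_nbhs (conj (@open_hstrip R k) hz)) => w; exact: hstrip_nlat.
Qed.

(** The value 0 on the lattice is fixed by every linear isometry, so the symmetry identities hold at
    all z without case distinction in their statements. *)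
Definition oid z : 'rV[R]_3 := if `[< lat z >] then 0 else rv3 (X1 z) (X2 z) (X3 z).

Lemma oidE z : ~ lat z -> oid z = rv3 (X1 z) (X2 z) (X3 z).
Proof. by move=> nz; rewrite /oid asboolF. Qed.

Let hphi k : [/\ hol k nlat (phi1 W), hol k nlat (phi2 W) & hol k nlat (phi3 W)].
Proof.
have hc : hol k nlat (wchi W) by exact: wchi_hol.
have hA : hol k nlat (wqA W) by apply: holM => //; apply: holX; exact: w1_hol.
have hB : hol k nlat (wqB W) by apply: holM => //; apply: holX; exact: w2_hol.
have hC : hol k nlat (wqC W).
  by apply: holM => //; apply: holM; [exact: w1_hol|exact: w2_hol].
split.
- by apply: holM; [exact: hol_cst|apply: holD => //; exact: holN].
- by apply: holN; apply: holM; [exact: holD|exact: hol_cst].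
- by apply: holM => //; exact: hol_cst.
Qed.

Lemma oid_smooth : smooth (nlat : set Ct) (oid : Ct -> _).
Proof.
move=> k; apply: class_C_le; apply: (class_C_ext open_nlat (fun z nz => esym (oidE nz))).
by have [? ? ?] := hphi k; exact: (class_pot open_nlat h1 h2 h3).
Qed.

Let oid_partial w z : ~ lat z -> has_partial w (oid : Ct -> _) z /\
  partial w (oid : Ct -> _) z = rv3 (Re (w * phi1 W z)) (Re (w * phi2 W z)) (Re (w * phi3 W z)).
Proof.
move=> nz; have [hp e] := partial_pot w (nz : nlat z) h1 h2 h3.
by have [hp' <-] := partial_local open_nlat (nz : nlat z) (fun z nz => esym (oidE nz)) hp.
Qed.

Let oid_partial2 v w z d1 d2 d3 : ~ lat z -> hder (phi1 W) z d1 -> hder (phi2 W) z d2 ->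
  hder (phi3 W) z d3 ->
  partial v (partial w (oid : Ct -> _)) z = rv3 (Re (v * (w * d1))) (Re (v * (w * d2))) (Re (v * (w * d3))).
Proof.
move=> nz e1 e2 e3.
have [[_ [g1 f1 _]] [_ [g2 f2 _]] [_ [g3 f3 _]]] := hphi 1.
have wm (f g : C -> C) : (forall z, nlat z -> hder f z (g z)) -> pot nlat (fun z => Re (w * f z)) (fun z => w * g z).
  move=> fg; apply: pot_hder => u nu; have := hderM (hder_cst w u) (fg u nu).
  by rewrite mul0r add0r.
have [hp e] := partial_pot v (nz : nlat z) (wm _ _ f1) (wm _ _ f2) (wm _ _ f3).
have [_ <-] := partial_local open_nlat (nz : nlat z) (fun z nz => esym (oid_partial w nz).2) hp.
by rewrite e (hder_unique e1 (f1 z nz)) (hder_unique e2 (f2 z nz)) (hder_unique e3 (f3 z nz)).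
Qed.

Local Notation ps z := (w1 W z).
Local Notation qs z := (w2 W z).
Local Notation cs z := (wchi W z).
Local Notation Xo := (oid : Ct -> 'rV[R]_3).

Definition oid_normal z : 'rV[R]_3 := spin_normal (ps z) (qs z).

Let n0 z : 0 < snrm (ps z) (qs z).
Proof. by apply: snrm_gt0; exact: w12_neq0. Qed.

Let ReI' z : Re (I * z) = - Im z. Proof. exact: ReI. Qed.

Let one (z : C) : (1 : C) * z = z. Proof. exact: mul1r. Qed.

Lemma oid_local z : ~ lat z -> exists E : R, [/\ 0 < E,
  E = cabs (cs z) ^+ 2 * snrm (ps z) (qs z) ^+ 2 / 4,
  [/\ ffE Xo z = E, ffG Xo z = E & ffF Xo z = 0] &
  unit_normal Xo z = oid_normal z].
Proof.
move=> nz; have [_ eu] := oid_partial 1 nz; have [_ ev] := oid_partial I nz.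
rewrite !one in eu; rewrite !ReI' in ev.
have [x1 [x2 [x3 [y1 [y2 [y3 [[a1 a2 a3] [b1 b2 b3] [E1 E2 E3] [k1 k2 k3]]]]]]]] :=
  sv_ReIm (cs z) (ps z) (qs z).
have {}eu : Fu Xo z = rv3 x1 x2 x3 by rewrite -a1 -a2 -a3.
have {}ev : Fv Xo z = rv3 (- y1) (- y2) (- y3) by rewrite -b1 -b2 -b3.
have c0 : 0 < cabs (cs z) by rewrite cabs_gt0 wchi_neq0.
have s0 := n0 z.
pose E := cabs (cs z) ^+ 2 * snrm (ps z) (qs z) ^+ 2 / 4.
have E0 : 0 < E by rewrite divr_gt0 // mulr_gt0 // exprn_gt0.
exists E; split=> //.
  rewrite /ffE /ffG /ffF eu ev !dotE !rv3E; split.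
  - by rewrite /E -E1 !expr2.
  - by rewrite /E -E2; ring.
  - by rewrite !mulrN -!opprD E3 oppr0.
have Em : cross (Fu Xo z) (Fv Xo z) = E *: oid_normal z.
  rewrite eu ev crossE !rv3E; apply: row3P; rewrite !mxE /=.
  - by transitivity (x3 * y2 - x2 * y3); [ring|rewrite k1 /E; field; rewrite gt_eqF].
  - by transitivity (x1 * y3 - x3 * y1); [ring|rewrite k2 /E; field; rewrite gt_eqF].
  - by transitivity (x2 * y1 - x1 * y2); [ring|rewrite k3 /E; field; rewrite gt_eqF].
have N1 : enorm (oid_normal z) = 1.
  rewrite enormE !rv3E !expr_div_n -!mulrDl snum_norm divff ?sqrtr1 //.
  by rewrite expf_eq0 gt_eqF.
rewrite /unit_normal Em enormZ ?ltW // N1 mulr1 scalerA mulVf ?gt_eqF // scale1r.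
by [].
Qed.

Lemma oid_conformal z : ~ lat z -> conformal_at Xo z.
Proof. by move=> /oid_local[E [E0 _ [e g f] _]]; rewrite /conformal_at e g f. Qed.

Lemma oid_immersed z : ~ lat z -> immersed_at Xo z.
Proof.
by move=> /oid_local[E [E0 _ [e g f] _]]; exact: row_free_orth E0 e g f.
Qed.

Let psi1 z := sv1 1 (ps z) (qs z).
Let psi2 z := sv2 1 (ps z) (qs z).
Let psi3 z := sv3 1 (ps z) (qs z).

(** The forms are [wchi] times the entire null vector psi, to which the normal is orthogonal. Thus
    [wchi'] drops out of the second fundamental form, which is the real part of one quadratic form,
    so L = -N; and [wchi] cancels from |K| dA, leaving a bound that is continuous also at the
    punctures. *)
Lemma oid_curvature : exists b : C -> R, [/\ forall z, cont (fun z => (b z)%:C) z, forall z, 0 <= b z &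
  forall z, ~ lat z -> mean_curvature Xo z = 0 /\
    `|gauss_curvature Xo z| * area_density Xo z <= b z].
Proof.
have ent (f : C -> C) : (forall k D, hol k D f) -> exists f', (forall z, hder f z (f' z)) /\ (forall z, cont f' z).
  move=> hf; have [_ [f' d [c _]]] := hf 1%N setT; exists f'; split=> z; [exact: d|exact: c].
have hp k D : hol k D (fun z => ps z) by exact: w1_hol.
have hq k D : hol k D (fun z => qs z) by exact: w2_hol.
have H1 k D : hol k D psi1.
  apply: holM; first exact: hol_cst.
  by apply: holD; [apply: holM; [exact: hol_cst|exact: holX]|apply: holN; apply: holM; [exact: hol_cst|exact: holX]].
have H2 k D : hol k D psi2.
  apply: holN; apply: holM; last exact: hol_cst.
  by apply: holD; (apply: holM; [exact: hol_cst|exact: holX]).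
have H3 k D : hol k D psi3.
  by apply: holM; [exact: hol_cst|apply: holM; [exact: hol_cst|exact: holM]].
have [g1 [d1 c1]] := ent _ H1; have [g2 [d2 c2]] := ent _ H2; have [g3 [d3 c3]] := ent _ H3.
pose S z := cabs (g1 z) + cabs (g2 z) + cabs (g3 z).
have S0 z : 0 <= S z by rewrite !addr_ge0 // cabs_ge0.
exists (fun z => 4 * S z ^+ 2 / snrm (ps z) (qs z) ^+ 2); split.
- have rc (f : C -> R) z : {for (z : Ct), continuous (f : Ct -> R)} -> cont (fun z => (f z)%:C) z.
    move=> cf; apply: (@continuous_comp Ct R Ct f (fun x : R => x%:C)) => //.
    exact: continuous_realC.
  have ca (f : C -> C) z : cont f z -> {for (z : Ct), continuous ((fun z => cabs (f z)) : Ct -> R)}.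
    move=> cf; apply: (@continuous_comp Ct Ct R f (cabs : Ct -> R)) => //.
    exact: continuous_cabs.
  move=> z; apply: rc; apply: (@continuousM R Ct).
    apply: (@continuousM R Ct); first exact: cst_continuous.
    have cS : {for (z : Ct), continuous (S : Ct -> R)}.
      apply: (@continuousD R R^o Ct (fun z => cabs (g1 z) + cabs (g2 z)) (fun z => cabs (g3 z))); last exact: ca.
      by apply: (@continuousD R R^o Ct (fun z => cabs (g1 z)) (fun z => cabs (g2 z))); exact: ca.
    exact: (@continuousM R Ct S S z cS cS).
  apply: (@continuousV R Ct); first by rewrite expf_eq0 gt_eqF.
  have cn : {for (z : Ct), continuous ((fun z => snrm (ps z) (qs z)) : Ct -> R)}.
    have c' (f : C -> C) : (forall k D, hol k D f) -> {for (z : Ct), continuous ((fun z => cabs (f z) ^+ 2) : Ct -> R)}.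
      move=> hf; have c := ca f z (hol_continuous (hf 0%N setT) Logic.I).
      exact: (@continuousM R Ct (fun z => cabs (f z)) (fun z => cabs (f z)) z c c).
    by apply: (@continuousD R R^o Ct (fun z => cabs (ps z) ^+ 2) (fun z => cabs (qs z) ^+ 2)); exact: c'.
  exact: (@continuousM R Ct (fun z => snrm (ps z) (qs z)) (fun z => snrm (ps z) (qs z)) z cn cn).
- by move=> z; rewrite divr_ge0 ?exprn_ge0 // ?(ltW (n0 z)) // mulr_ge0 // exprn_ge0.
move=> z nz; have [E [E0 EE [e g f] un]] := oid_local nz.
have [_ [cs' hc _]] := @wchi_hol R _ W 1%N nlat (fun _ h => h).
have pe1 u : phi1 W u = cs u * psi1 u by rewrite /phi1 /wqA /wqB /psi1 /sv1; ring.
have pe2 u : phi2 W u = cs u * psi2 u by rewrite /phi2 /wqA /wqB /psi2 /sv2; ring.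
have pe3 u : phi3 W u = cs u * psi3 u by rewrite /phi3 /wqC /psi3 /sv3; ring.
have D1 : hder (phi1 W) z (cs' z * psi1 z + cs z * g1 z).
  by apply: (hder_ext (fun u => esym (pe1 u))); apply: hderM; [exact: hc|exact: d1].
have D2 : hder (phi2 W) z (cs' z * psi2 z + cs z * g2 z).
  by apply: (hder_ext (fun u => esym (pe2 u))); apply: hderM; [exact: hc|exact: d2].
have D3 : hder (phi3 W) z (cs' z * psi3 z + cs z * g3 z).
  by apply: (hder_ext (fun u => esym (pe3 u))); apply: hderM; [exact: hc|exact: d3].
have e2 v w := oid_partial2 v w nz D1 D2 D3.
have s0 := n0 z; set nn := snrm _ _ in s0.
pose m1 := snum1 (ps z) (qs z) / nn; pose m2 := snum2 (ps z) (qs z) / nn; pose m3 := snum3 (ps z) (qs z) / nn.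
pose V : C := m1%:C * g1 z + m2%:C * g2 z + m3%:C * g3 z.
have gen (a1 a2 a3 : R) (v w u1 u2 u3 : C) :
    Re (v * (w * u1)) * a1 + Re (v * (w * u2)) * a2 + Re (v * (w * u3)) * a3 =
    Re (v * (w * (a1%:C * u1 + a2%:C * u2 + a3%:C * u3))).
  have -> : v * (w * (a1%:C * u1 + a2%:C * u2 + a3%:C * u3)) =
    a1%:C * (v * (w * u1)) + a2%:C * (v * (w * u2)) + a3%:C * (v * (w * u3)) by ring.
  by rewrite !ReD !ReZ; ring.
(* The identity [K] below removes the term containing the derivative of [wchi]. *)
have DV v w : dot (partial v (partial w Xo) z) (oid_normal z) = Re (v * (w * (cs z * V))).
  rewrite e2 dotE !rv3E -/nn -/m1 -/m2 -/m3.
  have K : m1%:C * psi1 z + m2%:C * psi2 z + m3%:C * psi3 z = 0.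
    have k := snum_sv 1 (ps z) (qs z).
    rewrite /m1 /m2 /m3 !(realCM _ nn^-1).
    transitivity (nn^-1%:C * ((snum1 (ps z) (qs z))%:C * psi1 z + (snum2 (ps z) (qs z))%:C * psi2 z + (snum3 (ps z) (qs z))%:C * psi3 z)); first ring.
    by rewrite /psi1 /psi2 /psi3 k mulr0.
  have -> : cs z * V = (m1%:C * (cs' z * psi1 z + cs z * g1 z) + m2%:C * (cs' z * psi2 z + cs z * g2 z)
     + m3%:C * (cs' z * psi3 z + cs z * g3 z)) - cs' z * (m1%:C * psi1 z + m2%:C * psi2 z + m3%:C * psi3 z).
    by rewrite /V; ring.
  by rewrite K mulr0 subr0; exact: gen.
have sL : sfL Xo z = Re (cs z * V) by rewrite /sfL un DV !mul1r.
have sM : sfM Xo z = - Im (cs z * V) by rewrite /sfM un DV mul1r ReI.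
have sN : sfN Xo z = - Re (cs z * V).
  rewrite /sfN un DV mulrA (_ : 'i%C * 'i%C = -1); first by rewrite mulN1r ReN.
  by apply: eqC; rewrite !(ReM, ImM, ReN, ImN) /=; ring.
split; first by rewrite /mean_curvature e f g sL sN mulr0 subr0 mulNr subrr mul0r.
rewrite /gauss_curvature /area_density e f g sL sM sN expr0n subr0 -expr2 sqrtr_sqr.
rewrite (gtr0_norm E0) normrM normfV (ger0_norm (exprn_ge0 2 (ltW E0))).
have -> : `|Re (cs z * V) * - Re (cs z * V) - (- Im (cs z * V)) ^+ 2| = cabs (cs z) ^+ 2 * cabs V ^+ 2.
  have gn (x y : R) : `|x * - x - (- y) ^+ 2| = x ^+ 2 + y ^+ 2.
    have -> : x * - x - (- y) ^+ 2 = - (x ^+ 2 + y ^+ 2) by ring.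
    by rewrite normrN ger0_norm // addr_ge0 ?sqr_ge0.
  by rewrite -exprMn -cabsM cabs_sqr gn.
have cc0 : cabs (cs z) != 0 by rewrite cabs_eq0 wchi_neq0.
(* With E = |chi|^2 nn^2 / 4 the factor |chi|^2 cancels. *)
have -> : cabs (cs z) ^+ 2 * cabs V ^+ 2 / E ^+ 2 * E = 4 * cabs V ^+ 2 / nn ^+ 2.
  have gn (x y m : R) : x != 0 -> 0 < m -> x ^+ 2 * y ^+ 2 / (x ^+ 2 * m ^+ 2 / 4) ^+ 2 * (x ^+ 2 * m ^+ 2 / 4) = 4 * y ^+ 2 / m ^+ 2.
    by move=> x0 m0; field; rewrite x0 gt_eqF.
  by rewrite EE; exact: gn.
rewrite ler_wpM2r ?invr_ge0 ?exprn_ge0 ?(ltW s0) // ler_wpM2l // lerXn2r ?nnegrE ?cabs_ge0 ?S0 //.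
have nns := snum_norm (ps z) (qs z).
have mle' (m : R) (y : C) : m ^+ 2 <= nn ^+ 2 -> cabs ((m / nn)%:C * y) <= cabs y.
  move=> mn; rewrite cabsM cabs_real ler_piMl ?cabs_ge0 // normrM normfV (gtr0_norm s0) ler_pdivrMr // mul1r.
  by rewrite -(ler_pXn2r (ltn0Sn 1)) ?nnegrE ?(ltW s0) // real_normK ?num_real.
have sq := (sqr_ge0 (snum1 (ps z) (qs z)), sqr_ge0 (snum2 (ps z) (qs z)), sqr_ge0 (snum3 (ps z) (qs z))).
rewrite (le_trans (cabsD _ _)) // lerD ?mle' //; last first.
  by rewrite /nn -nns lerDr addr_ge0 // sq.
rewrite (le_trans (cabsD _ _)) // lerD ?mle' //.
  by rewrite /nn -nns -addrA lerDl addr_ge0 // sq.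
by rewrite /nn -nns addrAC lerDr addr_ge0 // sq.
Qed.

End Local.

(** * The unit circle and its arguments *)

Section Angles.
Variable R : realType.
Local Notation C := R[i].
Local Notation Ct := (R[i]^o).
Implicit Types (s t : R) (z w v : C).

Definition ex t : C := cos t +i* sin t.

Lemma exD s t : ex (s + t) = ex s * ex t.
Proof. by apply: eqC; rewrite ?ReM ?ImM /= ?cosD ?sinD //; ring. Qed.

Lemma exN t : ex (- t) = conjc (ex t).
Proof. by rewrite /ex cosN sinN. Qed.

Lemma cabs_ex t : cabs (ex t) = 1.
Proof. by rewrite /= cos2Dsin2 sqrtr1. Qed.

Lemma ex_unit t : ex t * conjc (ex t) = 1.
Proof. by rewrite -exN -exD subrr /ex cos0 sin0. Qed.

Lemma exB s t : ex (s - t) = ex s * conjc (ex t).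
Proof. by rewrite exD exN. Qed.

Lemma ex_div s t : ex s = ex t -> ex (s - t) = 1.
Proof. by move=> e; rewrite exB e ex_unit. Qed.

Lemma ex0 : ex 0 = 1. Proof. by rewrite /ex cos0 sin0. Qed.

Lemma ex_eq1 t : ex t = 1 -> exists k : int, t = 2 * pi * k%:~R.
Proof.
move=> e; pose k := Num.floor (t / (2 * pi)); exists k.
have p0 : 0 < 2 * pi :> R by exact: pi2_gt0.
have /andP[k1 k2] := floor_itv (t / (2 * pi)).
rewrite -/k ler_pdivlMr // in k1; rewrite -/k ltr_pdivrMr // intrD mulrDl in k2.
apply/eqP; apply/negPn/negP => ne.
have c1 : cos (t - 2 * pi * k%:~R) = 1.
  have tw m : ex (2 * pi * m%:~R) = 1.
    by apply: eqC; have := @cexp_tpiz R 0 m; rewrite cexp0 add0r tpiz => /(congr1 (fun v => (Re v, Im v))) []; rewrite Re_cexp Im_cexp /= expR0 !mul1r.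
  by have := exB t (2 * pi * k%:~R); rewrite e tw => /(congr1 (fun v => Re v)) /=; rewrite mul1r mul0r subr0.
have := @cos_lt1 R (t - 2 * pi * k%:~R); rewrite c1 ltxx => H.
suff : false by []; apply: H; rewrite subr_gt0 lt_def ne /= mulrC k1 /=.
by move: k2; rewrite mul1r (mulrC _ (2 * pi)); lra.
Qed.

Lemma continuous_ex (T : topologicalType) (f : T -> R) (x : T) : {for x, continuous f} ->
  {for x, continuous (fun y => ex (f y) : Ct)}.
Proof.
move=> cf; apply: (@cvg_C R T (nbhs x) (nbhs_filter x) (fun y => cos (f y)) (fun y => sin (f y))).
  by apply: (@continuous_comp T R R f cos) => //; exact: continuous_cos.
by apply: (@continuous_comp T R R f sin) => //; exact: continuous_sin.
Qed.

(** On the open right half circle the arcsine of the imaginary part is a continuous argument;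
    rotating the circle beforehand gives the charts of the torus. *)
Lemma asin_angle v : cabs v = 1 -> 0 < Re v ->
  [/\ - (pi / 2) < asin (Im v) < pi / 2, ex (asin (Im v)) = v & -1 < Im v < 1].
Proof.
move=> v1 v0; have e : Re v ^+ 2 + Im v ^+ 2 = 1 by rewrite -cabs_sqr v1 expr1n.
have i1 : Im v ^+ 2 < 1 by rewrite -e ltrDr exprn_gt0.
have i2 : -1 < Im v < 1.
  by rewrite -ltr_norml -(ltr_pXn2r (ltn0Sn 1)) ?nnegrE // expr1n real_normK ?num_real.
have /andP[a1 a2] := i2; split=> //.
  by rewrite asin_gtNpi2 ?a1 ?ltW //= asin_ltpi2 // ltW.
have i3 : -1 <= Im v <= 1 by rewrite !ltW.
apply: eqC; rewrite /= ?asinK ?in_itv //= cos_asin //.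
by rewrite -e addrK sqrtr_sqr gtr0_norm.
Qed.

Lemma angle_asin t : - (pi / 2) < t < pi / 2 -> 0 < Re (ex t) /\ asin (Im (ex t)) = t.
Proof.
move=> /andP[t1 t2]; split; first by apply: cos_gt0_pihalf; rewrite t1.
by rewrite /= sinK // in_itv /= !ltW.
Qed.

Lemma continuous_eval (U : topologicalType) (f : U -> Ct) (x : U) v : {for x, continuous f} ->
  {for x, continuous (fun y => f y * v : Ct)}.
Proof. move=> cf; exact: (@continuousM R[i] U f (fun=> v) x cf (@cst_continuous U Ct v x)). Qed.

End Angles.

(** * The torus *)

Section Torus.
Variable R : realType.
Local Notation C := R[i].
Local Notation Ct := (R[i]^o).
Variable b : R.
Hypothesis b0 : 0 < b.
Implicit Types (z w v : C).

Definition Tr : topologicalType := set_type (torus R).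
Implicit Types x : Tr.

Let ang z : R := pi / b * Re z.

Lemma torus_ex z : (ex (pi / b * Re z), ex (Im z)) \in torus R.
Proof. by rewrite inE; split; rewrite normE cabs_ex. Qed.

(** The covering of the torus by the plane with periods 2b and 2 pi i. *)
Definition cov z : Tr := exist (fun w : Ct * Ct => w \in torus R) _ (torus_ex z).

Lemma cov_eqP z w : cov z = cov w <-> ex (pi / b * Re z) = ex (pi / b * Re w) /\ ex (Im z) = ex (Im w).
Proof.
split=> [e|[e1 e2]].
  exact: (conj (congr1 (fun x : Tr => (\val x).1) e) (congr1 (fun x : Tr => (\val x).2) e)).
by apply: val_inj; rewrite /= e1 e2.
Qed.

Lemma tr1 x : cabs (\val x).1 = 1.
Proof. by case: x => /= w /set_mem[+ _]; rewrite normE => /complexI. Qed.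
Lemma tr2 x : cabs (\val x).2 = 1.
Proof. by case: x => /= w /set_mem[_ +]; rewrite normE => /complexI. Qed.

Lemma tr_inj x y : (\val x).1 = (\val y).1 -> (\val x).2 = (\val y).2 -> x = y.
Proof. by move=> e1 e2; apply: val_inj; move: e1 e2; case: (\val x) (\val y) => [? ?] [? ?] /= -> ->. Qed.

Lemma continuous_val : continuous (\val : Tr -> Ct * Ct).
Proof. exact: initial_continuous. Qed.

Lemma continuous_val1 : continuous (fun x : Tr => (\val x).1 : Ct).
Proof. by move=> x; apply: (@continuous_comp Tr _ Ct \val fst); [exact: continuous_val|exact: cvg_fst]. Qed.
Lemma continuous_val2 : continuous (fun x : Tr => (\val x).2 : Ct).
Proof. by move=> x; apply: (@continuous_comp Tr _ Ct \val snd); [exact: continuous_val|exact: cvg_snd]. Qed.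

Lemma continuous_cov : continuous (cov : Ct -> Tr).
Proof.
apply: continuous_comp_initial => z.
have c1 : {for (z : Ct), continuous ((fun z => ex (pi / b * Re z)) : Ct -> Ct)}.
  apply: continuous_ex; apply: (@continuousM R Ct (fun=> pi / b) Re); [exact: cst_continuous|exact: continuous_Re].
have c2 : {for (z : Ct), continuous ((fun z => ex (Im z)) : Ct -> Ct)}.
  by apply: continuous_ex; exact: continuous_Im.
exact: (cvg_pair c1 c2).
Qed.

(** Half a period in each direction: [cov] is injective there and the arcsine inverts it. *)
Definition box (c : C) : set Ct := [set z | `|Re z - Re c| < b / 2 /\ `|Im z - Im c| < pi / 2].
Definition tdom (c : C) : set Tr :=
  [set x | 0 < Re ((\val x).1 * conjc (ex (ang c))) /\ 0 < Re ((\val x).2 * conjc (ex (Im c)))].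
Definition tcoord (c : C) (x : Tr) : Ct :=
  (Re c + b / pi * asin (Im ((\val x).1 * conjc (ex (ang c))))) +i*
  (Im c + asin (Im ((\val x).2 * conjc (ex (Im c))))).

Let p0 : (0 : R) < pi := pi_gt0 R.
Let gn1 (x y : R) : x != 0 -> y != 0 -> x / 2 / (x / y) = y / 2.
Proof. by move=> x0 y0; field; rewrite x0 y0. Qed.
Let gn2 (x y u v : R) : x != 0 -> y != 0 -> y / x * (u + x / y * v) = y / x * u + v.
Proof. by move=> x0 y0; field; rewrite x0 y0. Qed.
Let gn3 (x y u v : R) : x != 0 -> y != 0 -> u + x / y * (y / x * v - y / x * u) = v.
Proof. by move=> x0 y0; field; rewrite x0 y0. Qed.
Let gn4 (x y k : R) : x != 0 -> y / x * (x / 2 * k) = y / 2 * k.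
Proof. by move=> x0; field. Qed.
Let bn : b != 0. Proof. by rewrite gt_eqF. Qed.
Let pn : pi != 0 :> R. Proof. by rewrite gt_eqF. Qed.

Lemma tdom_coord c x : tdom c x -> box c (tcoord c x) /\ cov (tcoord c x) = x.
Proof.
move=> [d1 d2].
have n1 : cabs ((\val x).1 * conjc (ex (ang c))) = 1 by rewrite cabsM cabs_conj cabs_ex tr1 mulr1.
have n2 : cabs ((\val x).2 * conjc (ex (Im c))) = 1 by rewrite cabsM cabs_conj cabs_ex tr2 mulr1.
have [a1 e1 _] := asin_angle n1 d1; have [a2 e2 _] := asin_angle n2 d2.
split.
  split; rewrite /tcoord ?ReC ?ImC addrAC subrr add0r.
    rewrite normrM gtr0_norm ?divr_gt0 // mulrC -ltr_pdivlMr ?divr_gt0 //.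
    have -> : b / 2 / (b / pi) = pi / 2 by exact: (gn1 bn pn).
    by rewrite ltr_norml.
  by rewrite ltr_norml.
have un t v : v * conjc (ex t) * ex t = v by rewrite -mulrA (mulrC (conjc _)) ex_unit mulr1.
apply: tr_inj; rewrite /= ?ReC ?ImC.
  have -> : pi / b * (Re c + b / pi * asin (Im ((\val x).1 * conjc (ex (ang c))))) =
    ang c + asin (Im ((\val x).1 * conjc (ex (ang c)))).
    by rewrite /ang; exact: (gn2 _ _ bn pn).
  by rewrite exD e1 mulrC un.
by rewrite exD e2 mulrC un.
Qed.

Lemma tcoord_cov c z : box c z -> tdom c (cov z) /\ tcoord c (cov z) = z.
Proof.
move=> [z1 z2].
have a1 : - (pi / 2) < ang z - ang c < pi / 2.
  rewrite -ltr_norml /ang -mulrBr normrM gtr0_norm ?divr_gt0 // mulrC -ltr_pdivlMr ?divr_gt0 //.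
  have -> : pi / 2 / (pi / b) = b / 2 by exact: (gn1 pn bn).
  exact: z1.
have a2 : - (pi / 2) < Im z - Im c < pi / 2 by rewrite -ltr_norml.
have [c1 s1] := angle_asin a1; have [c2 s2] := angle_asin a2.
have v1 : (\val (cov z)).1 = ex (ang z) by [].
have v2 : (\val (cov z)).2 = ex (Im z) by [].
split; first by split; rewrite ?v1 ?v2 -exB.
rewrite /tcoord v1 v2 -!exB s1 s2; apply: eqC; rewrite ?ReC ?ImC.
  by rewrite /ang; exact: (gn3 _ _ bn pn).
by rewrite addrC subrK.
Qed.

Lemma tcoord_image c : tcoord c @` tdom c = box c.
Proof.
apply/seteqP; split=> [_ [x dx <-]|z bz]; first by have [] := tdom_coord dx.
by have [d e] := tcoord_cov bz; exists (cov z).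
Qed.

Lemma open_box c : open (box c).
Proof.
have H (f : Ct -> R) (r y : R) : continuous f -> open [set z | `|f z - y| < r].
  move=> cf; rewrite (_ : mkset _ = [set z | y - r < f z < y + r]); first exact: open_itvC.
  by apply/seteqP; split=> z /=; rewrite ltr_distl.
rewrite (_ : box c = [set z | `|Re z - Re c| < b / 2] `&` [set z | `|Im z - Im c| < pi / 2]) //.
by apply: openI; apply: H; [exact: continuous_Re|exact: continuous_Im].
Qed.

Let cpos (f : Tr -> Ct) : continuous f -> open [set x | 0 < Re (f x)].
Proof.
move=> cf; have -> : [set x | 0 < Re (f x)] = (fun x => Re (f x)) @^-1` [set t | 0 < t] by [].
apply: open_comp; last exact: open_gt.
by move=> x _; apply: (@continuous_comp Tr Ct R f Re); [exact: cf|exact: continuous_Re].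
Qed.

Lemma open_tdom c : open (tdom c).
Proof.
rewrite (_ : tdom c = [set x | 0 < Re ((\val x).1 * conjc (ex (ang c)))] `&`
  [set x | 0 < Re ((\val x).2 * conjc (ex (Im c)))]) //.
by apply: openI; apply: cpos => x; apply: continuous_eval; [exact: continuous_val1|exact: continuous_val2].
Qed.

Lemma tcoord_continuous c x : tdom c x -> {for x, continuous (tcoord c)}.
Proof.
move=> [d1 d2].
have n1 : cabs ((\val x).1 * conjc (ex (ang c))) = 1 by rewrite cabsM cabs_conj cabs_ex tr1 mulr1.
have n2 : cabs ((\val x).2 * conjc (ex (Im c))) = 1 by rewrite cabsM cabs_conj cabs_ex tr2 mulr1.
have [_ _ a1] := asin_angle n1 d1; have [_ _ a2] := asin_angle n2 d2.
have ca (f : Tr -> Ct) v : -1 < Im (f x * v) < 1 -> continuous f ->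
    {for x, continuous (fun y => asin (Im (f y * v)))}.
  move=> fx cf; apply: (@continuous_comp Tr R R (fun y => Im (f y * v)) asin); last exact: continuous_asin.
  apply: (@continuous_comp Tr Ct R (fun y => f y * v) Im); last exact: continuous_Im.
  by apply: continuous_eval; exact: cf.
have c1 := ca _ _ a1 continuous_val1; have c2 := ca _ _ a2 continuous_val2.
apply: (@cvg_C R Tr (nbhs x) (nbhs_filter x)).
  apply: (@continuousD R R^o Tr (fun=> Re c)); first exact: cst_continuous.
  by apply: (@continuousM R Tr (fun=> b / pi)) => //; exact: cst_continuous.
by apply: (@continuousD R R^o Tr (fun=> Im c)) => //; exact: cst_continuous.
Qed.

Definition tchart (c : C) : chart R Tr.
Proof.
apply: (@Chart R Tr (tdom c) (tcoord c) cov (@open_tdom c)).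
- rewrite tcoord_image; exact: (@open_box c).
- by move=> x /tdom_coord[].
- exact: tcoord_continuous.
- by move=> z _; exact: continuous_cov.
Defined.

(** Centres at the quarter periods; four half-period intervals cover each circle, so 16 charts cover
    the torus. *)
Definition center (k l : 'I_4) : C := (b / 2 * k%:R) +i* (pi / 2 * l%:R).
Definition tatlas : set (chart R Tr) := [set c | exists k l, c = tchart (center k l)].

(** Every point of the circle is at an angle less than pi/2 from one of 1, i, -1, -i. *)
Lemma quadrant v : cabs v = 1 -> exists k : 'I_4, 0 < Re (v * conjc (ex (pi / 2 * k%:R))).
Proof.
move=> v1; have nz : Re v != 0 \/ Im v != 0.
  have e : Re v ^+ 2 + Im v ^+ 2 = 1 by rewrite -cabs_sqr v1 expr1n.
  have [r|] := eqVneq (Re v) 0; last by left.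
  by right; apply: contra_eq_neq e => ->; rewrite r !expr0n addr0 eq_sym oner_neq0.
have E0 : ex (pi / 2 * 0%:R) = 1 :> C by rewrite mulr0 ex0.
have E1 : ex (pi / 2 * 1%:R) = I :> C by rewrite mulr1 /ex cos_pihalf sin_pihalf.
have E2 : ex (pi / 2 * 2%:R) = -1 :> C.
  by rewrite divfK ?pnatr_eq0 // /ex cospi sinpi; apply: eqC; rewrite /= ?oppr0.
have E3 : ex (pi / 2 * 3%:R) = - I :> C.
  have -> : pi / 2 * 3%:R = pi / 2 * 1%:R + pi / 2 * 2%:R :> R by ring.
  by rewrite exD E1 E2 mulrN1.
have [r|r|r] := ltrgtP (Re v) 0.
- exists 2; rewrite (_ : (2 : 'I_4) = 2%N :> nat) // E2 conjN rmorph1 mulrN1 ReN oppr_gt0 //.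
- by exists 0; rewrite (_ : (0 : 'I_4) = 0%N :> nat) // E0 rmorph1 mulr1.
have [s|s|s] := ltrgtP (Im v) 0.
- exists 3; rewrite (_ : (3 : 'I_4) = 3%N :> nat) // E3 conjN mulrN ReN ReM Re_conj Im_conj /=.
  by rewrite mulr0 mulrN1 opprK add0r oppr_gt0.
- exists 1; rewrite (_ : (1 : 'I_4) = 1%N :> nat) // E1 ReM Re_conj Im_conj /=.
  by rewrite mulr0 mulrN1 opprK add0r.
by case: nz; rewrite ?r ?s eqxx.
Qed.

Lemma tcover x : exists2 c, tatlas c & dom c x.
Proof.
have [k hk] := quadrant (tr1 x); have [l hl] := quadrant (tr2 x).
exists (tchart (center k l)); first by exists k, l.
split; rewrite /center /ang ?ReC ?ImC //.
by rewrite (_ : pi / b * (b / 2 * k%:R) = pi / 2 * k%:R) //; exact: (gn4 _ _ bn).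
Qed.

Lemma cov_surj x : exists z, cov z = x.
Proof. by have [c [k [l ->]] d] := tcover x; exists (tcoord (center k l) x); have [] := tdom_coord d. Qed.

Lemma cov_translate z w v : cov z = cov w -> cov (v + (w - z)) = cov v.
Proof.
move=> /cov_eqP[e1 e2]; apply/cov_eqP; rewrite !ReD !ImD !ReN !ImN; split.
  by rewrite mulrDr exD mulrBr exB -e1 ex_unit mulr1.
by rewrite exD exB -e2 ex_unit mulr1.
Qed.

(** Coordinates are local inverses of the covering, so they differ from the plane coordinate by a
    translation near each point. Holomorphic chart changes and smooth symmetries follow. *)
Lemma tcoord_local c z : tdom c (cov z) -> exists2 r, 0 < r &
  forall v, cabs (v - z) < r -> tdom c (cov v) /\ tcoord c (cov v) = v + (tcoord c (cov z) - z).
Proof.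
move=> d; have [bx e] := tdom_coord d.
have [r r0 Hr] := nbhs_ball_sub (@open_box c) bx; exists r => // v vr.
have bv : box c (v + (tcoord c (cov z) - z)).
  by apply: Hr; rewrite (_ : _ - _ = v - z) //; ring.
have [] := tcoord_cov bv; rewrite (cov_translate v (esym e)).
by [].
Qed.

Lemma tholomorphic c d : tatlas c -> tatlas d ->
  forall z : R[i]^o, (coord c @` (dom c `&` dom d)) z ->
  derivable (coord d \o param c : R[i]^o -> R[i]^o) z 1.
Proof.
move=> [k [l ->]] [k' [l' ->]] z [x [dx dx'] <-] /=.
have [_ e] := tdom_coord dx; rewrite -e in dx'.
have [r r0 Hr] := tcoord_local dx'.
set z0 := tcoord _ x in Hr *; set h := _ - z0 in Hr.
have [+ _] : hder (fun v => v + h) z0 (1 + 0) by apply: hderD; [exact: hder_id|exact: hder_cst].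
apply: near_eq_derivable.
by apply: filterS (near_ball_C z0 r0) => v /Hr[_ e']; exact: esym e'.
Qed.

Lemma torus_hausdorff : hausdorff_space Tr.
Proof.
have sep (f : Tr -> Ct) (x y : Tr) : continuous f -> f x != f y ->
    exists2 AB : set Tr * set Tr, x \in AB.1 /\ y \in AB.2 & [/\ open AB.1, open AB.2 & AB.1 `&` AB.2 == set0].
  move=> cf ne; pose d := cabs (f x - f y) / 2.
  have d0 : 0 < d by rewrite divr_gt0 // cabs_gt0 subr_eq0.
  exists ([set u | cabs (f u - f x) < d], [set u | cabs (f u - f y) < d]).
    by split; rewrite inE /= subrr cabs0.
  split.
  - by apply: (@open_comp Tr Ct f _ _ (@open_cball R (f x) d)) => u _; exact: cf.
  - by apply: (@open_comp Tr Ct f _ _ (@open_cball R (f y) d)) => u _; exact: cf.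
  apply/eqP/seteqP; split=> // u [/= u1 u2].
  have := cabsD (f x - f u) (f u - f y); rewrite addrA subrK (cabsC (f x) (f u)).
  by move: u1 u2; rewrite /d => u1 u2 u3; lra.
rewrite open_hausdorff => x y ne.
have [e1|n1] := eqVneq (\val x).1 (\val y).1; last exact: (sep _ x y continuous_val1 n1).
have [e2|n2] := eqVneq (\val x).2 (\val y).2; last exact: (sep _ x y continuous_val2 n2).
by move: ne; rewrite (tr_inj e1 e2) eqxx.
Qed.

Lemma continuous_within (T U : topologicalType) (A : set T) (f : T -> U) : continuous f ->
  {within A, continuous f}.
Proof. by move=> cf; apply: continuous_subspaceT. Qed.

Lemma torus_connected : connected [set: Tr].
Proof.
have -> : [set: Tr] = \bigcup_(z in [set: C]) ((fun t : R => cov (t%:C * z)) @` `[0, 1]).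
  apply/seteqP; split=> // x _; have [z <-] := cov_surj x.
  by exists z => //; exists 1; rewrite /= ?in_itv /= ?lexx ?ler01 ?mul1r.
apply: bigcup_connected.
  exists (cov 0) => z _; exists 0; rewrite /= ?in_itv /= ?lexx ?ler01 // mul0r //.
move=> z _; apply: connected_continuous_connected; first exact: segment_connected.
apply: continuous_within => t; apply: (@continuous_comp R Ct Tr (fun t : R => t%:C * z) cov).
  by apply: continuous_eval; exact: continuous_realC.
exact: continuous_cov.
Qed.

Lemma torus_compact : compact [set: Tr].
Proof.
pose B : set (R * R) := `[- (2 * b), 2 * b] `*` `[- (2 * pi), 2 * pi].
have -> : [set: Tr] = (fun w : R * R => cov (w.1 +i* w.2)) @` B.
  apply/seteqP; split=> // x _; have [c [k [l ->]] d] := tcover x.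
  have [[b1 b2] e] := tdom_coord d; set z := tcoord _ x in b1 b2 e.
  exists (Re z, Im z); last by rewrite -[RHS]e; congr cov; case: (z).
  have k4 (m : 'I_4) : 0 <= (m%:R : R) <= 3.
    by rewrite ler0n (ler_nat _ m 3) -ltnS ltn_ord.
  have bd (u v m : R) : 0 < v -> 0 <= m <= 3 -> `|u - v / 2 * m| < v / 2 -> - (2 * v) <= u <= 2 * v.
    by move=> v0 /andP[m0 m3]; rewrite ltr_distl => /andP[u1 u2]; apply/andP; split; nra.
  move: b1 b2; rewrite /center ReC ImC => b1 b2; split; rewrite /= in_itv /=.
    exact: bd b0 (k4 k) b1.
  exact: bd p0 (k4 l) b2.
apply: continuous_compact; last by apply: compact_setX; exact: segment_compact.
apply: continuous_within => w; apply: (@continuous_comp _ Ct Tr (fun w : R * R => w.1 +i* w.2) cov).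
  by apply: (@cvg_C R _ (nbhs w) (nbhs_filter w) fst snd); [exact: cvg_fst|exact: cvg_snd].
exact: continuous_cov.
Qed.

Lemma torus_genus : genus_one R Tr.
Proof.
pose g (w : Ct * Ct) : Tr := insubd (cov 0) w.
have gK (w : Ct * Ct) : torus R w -> \val (g w) = w by move=> tw; rewrite insubdK // inE.
exists \val, g; split.
- exact: continuous_val.
- apply/subspace_continuousP => w tw.
  have cv : (\val \o g) x @[x --> within (torus R) (nbhs w)] --> w.
    apply: cvg_trans (_ : x @[x --> within (torus R) (nbhs w)] --> w); last exact: cvg_within.
    apply: near_eq_cvg; near=> v; rewrite /= gK //; near: v; exact: withinT.
  have gw := gK _ tw.
  move=> A [U [[V oV <-] /= Vg UA]].
  have : nbhs w V by apply: open_nbhs_nbhs; split=> //; rewrite -gw.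
  by move=> /cv; apply: (@filterS _ (within (torus R) (nbhs w)) _) => v Vv; apply: UA.
- apply/seteqP; split=> [_ [x _ <-]|w tw]; first by case: x => w /= /set_mem.
  by exists (g w) => //; exact: gK.
- by move=> x; apply: val_inj; rewrite gK //; case: x => w /= /set_mem.
- by move=> w /set_mem; exact: gK.
Unshelve. all: by end_near. Qed.

Definition Tsurf : riemannSurface R :=
  RiemannSurface torus_hausdorff torus_connected tcover tholomorphic.

End Torus.

(** * Catenoid ends *)

Section Punctured.
Variable R : realType.
Local Notation C := R[i].
Local Notation Ct := (R[i]^o).
Implicit Types (z w : C) (r K M : R).

Definition pdisc r : set C := [set z | 0 < cabs z < r].

(* A segment through 0 is replaced by the two legs through i w. *)
Lemma punctured_lip r M (F : C -> R) (f : C -> C) : 0 <= M -> pot (pdisc r) F f ->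
  (forall z, pdisc r z -> cabs (f z) <= M) ->
  forall z w, pdisc r z -> pdisc r w -> `|F z - F w| <= 3 * M * cabs (z - w).
Proof.
move=> M0 hF fM.
have seg z w : pdisc r z -> pdisc r w -> (forall t, 0 <= t <= 1 -> z + t%:C * (w - z) != 0) ->
    `|F w - F z| <= M * cabs (w - z).
  move=> /andP[z0 zr] /andP[w0 wr] nz.
  have D t : 0 <= t <= 1 -> pdisc r (z + t%:C * (w - z)).
    move=> tt; rewrite /pdisc [mkset _ _]/mkset cabs_gt0 nz //=.
    have := @convex_ball R 0 r z w t; rewrite /= !subr0; exact.
  by apply: (pot_lip D hF) => t /D; exact: fM.
move=> z w Dz Dw; have [z0 zr] := andP Dz; have [w0 wr] := andP Dw.
have [h|h] := pselect (forall t, 0 <= t <= 1 -> w + t%:C * (z - w) != 0).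
  rewrite (le_trans (seg w z Dw Dz h)) // ler_wpM2r ?cabs_ge0 //; lra.
have [t [tt /eqP e]] : exists t, 0 <= t <= 1 /\ w + t%:C * (z - w) == 0.
  apply: contra_notP h => h t tt; apply/negP => e; apply: h; by exists t.
have t1 : 0 < t.
  case/andP: tt; rewrite le_eqVlt => /predU1P[t0 _|//].
  by move: e w0; rewrite -t0 mul0r addr0 => ->; rewrite cabs0 ltxx.
pose s := (1 - t) / t.
have zE : z = - s%:C * w.
  have tn : (t%:C : C) != 0 by rewrite -cabs_eq0 cabs_real normr_eq0 gt_eqF.
  have : t%:C * z = (t%:C - 1) * w.
    by move/eqP: e; rewrite addr_eq0 => /eqP e; rewrite mulrBl mul1r [in X in _ - X]e; ring.
  move=> e'; apply: (mulfI tn); rewrite e' /s realCM realCV realCD realCN realC1.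
  by field.
have s0 : 0 < s.
  have s0 : 0 <= s by rewrite divr_ge0 ?subr_ge0 // ?(ltW t1) //; case/andP: tt.
  rewrite lt_def s0 andbT; apply: contraTneq z0 => s00.
  by rewrite zE s00 oppr0 mul0r cabs0 ltxx.
have Dv : pdisc r (I * w) by rewrite /pdisc [mkset _ _]/mkset cabsM cabs_I mul1r.
have wn : w != 0 by rewrite -cabs_gt0.
have l1 : `|F z - F (I * w)| <= M * cabs (z - I * w).
  apply: (seg (I * w) z Dv Dz) => x /andP[x0 x1].
  have -> : I * w + x%:C * (z - I * w) = ((- (x * s)) +i* (1 - x)) * w.
    have -> : (- (x * s)) +i* (1 - x) = I * (1 - x%:C) - x%:C * s%:C.
      by apply: eqC; rewrite !(ReD, ImD, ReN, ImN, ReM, ImM) /=; ring.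
    by rewrite zE; ring.
  rewrite mulf_neq0 //; apply/negP => /eqP [] e1 e2.
  have x1' : x = 1 by lra.
  by move: e1; rewrite x1' mul1r => e1; move: s0; rewrite (_ : s = 0) ?ltxx //; lra.
have l2 : `|F w - F (I * w)| <= M * cabs (w - I * w).
  apply: (seg (I * w) w Dv Dw) => x /andP[x0 x1].
  have -> : I * w + x%:C * (w - I * w) = (x +i* (1 - x)) * w.
    have -> : x +i* (1 - x) = I * (1 - x%:C) + x%:C.
      by apply: eqC; rewrite !(ReD, ImD, ReN, ImN, ReM, ImM) /=; ring.
    by ring.
  rewrite mulf_neq0 //; apply/negP => /eqP [] e1 e2; lra.
have c1 : cabs (z - I * w) <= cabs z + cabs w.
  by rewrite (le_trans (cabsD _ _)) // cabsN cabsM cabs_I mul1r.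
have c2 : cabs (w - I * w) <= cabs w + cabs w.
  by rewrite (le_trans (cabsD _ _)) // cabsN cabsM cabs_I mul1r.
have c3 : cabs (z - w) = cabs z + cabs w.
  have -> : z - w = - ((s + 1)%:C * w) by rewrite zE realCD realC1; ring.
  rewrite zE !cabsN !cabsM cabsN !cabs_real !gtr0_norm ?addr_gt0 //; ring.
have z00 := cabs_ge0 z; have w00 := cabs_ge0 w.
have -> : F z - F w = (F z - F (I * w)) - (F w - F (I * w)) by ring.
rewrite (le_trans (ler_normB _ _)) // (le_trans (lerD l1 l2)) // -mulrDr c3.
rewrite [3 * M]mulrC -mulrA ler_wpM2l //; lra.
Qed.

(** The limit is the supremum of F z - K |z|; the Lipschitz bound places every F z + K |z| above all
    those numbers. *)
Lemma punctured_limit r K (F : C -> R) : 0 < r -> 0 <= K ->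
  (forall z w, pdisc r z -> pdisc r w -> `|F z - F w| <= K * cabs (z - w)) ->
  exists h, forall z, pdisc r z -> `|F z - h| <= K * cabs z.
Proof.
move=> r0 K0 lip; pose A := [set F z - K * cabs z | z in pdisc r].
have key z w : pdisc r z -> pdisc r w -> F z - K * cabs z <= F w + K * cabs w.
  move=> Dz Dw; have := ler_norm (F z - F w); have := lip z w Dz Dw.
  have : K * cabs (z - w) <= K * (cabs z + cabs w).
    by rewrite ler_wpM2l // (le_trans (cabsD _ _)) ?cabsN.
  by rewrite mulrDr; move: (K * _) (K * _) (K * _) `|_| => *; lra.
have Dr : pdisc r ((r / 2)%:C).
  rewrite /pdisc [mkset _ _]/mkset cabs_real gtr0_norm ?divr_gt0 //.
  by rewrite ltr_pdivrMr // ltr_pMr // ltr1n.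
have A0 : A !=set0 by exists (F (r / 2)%:C - K * cabs (r / 2)%:C), (r / 2)%:C.
have ub w : pdisc r w -> ubound A (F w + K * cabs w).
  by move=> Dw _ [z Dz <-]; exact: key.
have hA : has_sup A by split=> //; exists (F (r / 2)%:C + K * cabs (r / 2)%:C); exact: ub.
exists (sup A) => z Dz; rewrite ler_norml.
have u1 : F z - K * cabs z <= sup A by apply: sup_upper_bound => //; exists z.
have u2 : sup A <= F z + K * cabs z by apply: sup_le_ub => //; exact: ub.
by move: u1 u2; move: (K * _) => *; apply/andP; split; lra.
Qed.

(** Along a line ln|z + t w| is half the logarithm of a quadratic polynomial in t, so only real
    calculus is used. *)
Lemma pot_ln (r : R) : pot (pdisc r) (fun z => ln (cabs z)) (fun z => z^-1).
Proof.
move=> z /andP[z0 _] w.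
have n0 : 0 < cabs z ^+ 2 by rewrite exprn_gt0.
pose P (t : R) := cabs z ^+ 2 + 2 * Re (conjc z * w) * t + cabs w ^+ 2 * t ^+ 2.
have PE t : P t = cabs (z + t%:C * w) ^+ 2.
  by rewrite /P !cabs_sqr ReD ImD ReZ ImZ ReM Re_conj Im_conj; ring.
have dP : is_derive (0 : R) (1 : R) P (2 * Re (conjc z * w)).
  apply/rderP => e e0; exists (e / (cabs w ^+ 2 + 1)).
    by rewrite divr_gt0 // ltr_wpDl // sqr_ge0.
  move=> h hr; rewrite add0r.
  have -> : P h - P 0 - h * (2 * Re (conjc z * w)) = cabs w ^+ 2 * h * h by rewrite /P; ring.
  rewrite normrM ler_wpM2r // normrM (ger0_norm (sqr_ge0 _)).
  have q0 : 0 < cabs w ^+ 2 + 1 by rewrite ltr_wpDl // sqr_ge0.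
  move: hr; rewrite ltr_pdivlMr // => hr; apply: le_trans (ltW hr).
  by rewrite mulrC ler_wpM2l // lerDl.
have P0 : P 0 = cabs z ^+ 2 by rewrite /P; ring.
have dl : is_derive (P 0) (1 : R) (@ln R) (P 0)^-1 by apply: is_derive1_ln; rewrite P0.
have dc := is_derive1_comp dl dP.
have dz := @is_deriveZ R R R (@ln R \o P) (1 / 2) 0 1 _ dc.
have E : Re (w * z^-1) = (1 / 2) *: (2 * Re (conjc z * w) *: (P 0)^-1).
  have zn : z != 0 by rewrite -cabs_gt0.
  have cn : conjc z != 0 by rewrite conjc_eq0.
  have -> : w * z^-1 = ((cabs z ^+ 2)^-1)%:C * (conjc z * w).
    have -> : ((cabs z ^+ 2)^-1)%:C = (z * conjc z)^-1.
      rewrite realCV; congr (_^-1); rewrite cabs_sqr; apply: eqC; rewrite ?ReM ?ImM Re_conj Im_conj /=; ring.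
    by rewrite invfM -mulrA (mulrA (conjc z)^-1) mulVf // mul1r mulrC.
  by rewrite ReZ P0 /GRing.scale /=; field; rewrite gt_eqF.
rewrite (_ : Re _ = (1 / 2) *: (2 * Re (conjc z * w) *: (P 0)^-1)) //.
suff N : {near (0 : R), (1 / 2) *: (@ln R \o P) =1 (fun t => ln (cabs (z + t%:C * w)))}.
  by apply: (is_derive_eq (near_eq_is_derive N dz)); rewrite /GRing.scale /=; ring.
have w0 : 0 < cabs w + 1 by rewrite ltr_wpDl // cabs_ge0.
have d0 : 0 < cabs z / (cabs w + 1) by rewrite divr_gt0.
apply: filterS (near_ball_R 0 d0) => t; rewrite subr0 ltr_pdivlMr // => tr.
rewrite /GRing.scale /= PE lnXn; last first.
  rewrite cabs_gt0; apply/negP => /eqP e.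
  have : cabs z <= `|t| * cabs w.
    by rewrite -(cabs_real t) -cabsM -(cabsN (_ * _)) (_ : - _ = z) //; apply/eqP; rewrite eq_sym -subr_eq0 opprK e.
  by move: tr; have := normr_ge0 t; rewrite mulrDr mulr1; lra.
have g (x : R) : 1 / 2 * (x *+ 2) = x by rewrite -mulr_natr; field.
exact: g.
Qed.

End Punctured.

Section Catenoid.
Variable R : realType.
Implicit Types (a r t : R).

(** With x = e^(t/a) one has 2r/a = x (1 + x^-2), so the error is a ln(1 + x^-2) <= a x^-2, and 1/x
    <= a/r. *)
Lemma catenoid_height a t : 0 < a -> 0 <= t -> let r := a * cosh (t / a) in
  [/\ a <= r, t <= 2 * r & `|a * ln (2 * r / a) - t| <= a ^+ 3 / r ^+ 2].
Proof.
move=> a0 t0 r; pose x := expR (t / a).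
have x1 : 1 <= x by rewrite -expR0 ler_expR divr_ge0 // ltW.
have x0 : 0 < x by exact: expR_gt0.
have rE : r = a * (x + x^-1) / 2 by rewrite /r /cosh expRN mulrA.
have xi : 0 < x^-1 <= 1 by rewrite invr_gt0 x0 invf_le1.
have xx : x * x^-1 = 1 by rewrite mulfV // gt_eqF.
have r0 : 0 < r by rewrite rE divr_gt0 // mulr_gt0 // addr_gt0 // invr_gt0.
case/andP: xi => xi0 xi1.
have s2 : 2 <= x + x^-1 by nra.
have tE : t = a * ln x by rewrite /x expRK mulrC divfK // gt_eqF.
split.
- by rewrite rE ler_pdivlMr // ler_pM2l.
- have : ln x <= x - 1 by have := @le_ln1Dx R (x - 1); rewrite subrKC; apply; lra.
  have g (y : R) : 2 * (a * y / 2) = a * y by field.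
  by rewrite tE rE g => h; rewrite ler_pM2l //; lra.
have -> : 2 * r / a = x * (1 + x^-1 ^+ 2).
  by rewrite rE; field; rewrite !gt_eqF.
have u0 : 0 < 1 + x^-1 ^+ 2 by rewrite ltr_pwDl // sqr_ge0.
rewrite lnM ?posrE // mulrDr tE [X in X - _]addrC addrK normrM gtr0_norm //.
have l0 : 0 <= ln (1 + x^-1 ^+ 2) by rewrite ln_ge0 // lerDl sqr_ge0.
have l1 : ln (1 + x^-1 ^+ 2) <= x^-1 ^+ 2 by apply: le_ln1Dx; apply: lt_le_trans (sqr_ge0 _); lra.
have -> : a ^+ 3 / r ^+ 2 = a * (a / r) ^+ 2 by rewrite expr_div_n mulrA -exprS.
rewrite ger0_norm // ler_pM2l // (le_trans l1) //.
rewrite lerXn2r ?nnegrE ?divr_ge0 ?(ltW xi0) ?(ltW a0) ?(ltW r0) // ler_pdivlMr // rE.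
have : x^-1 * (x + x^-1) <= 2 by rewrite mulrDr (mulrC _ x) xx; nra.
have g (w v : R) : w * (a * v / 2) = a * (w * v / 2) by field.
by rewrite g => h; rewrite ler_piMr ?(ltW a0) //; lra.
Qed.

(** The height is a arcosh(r/a), written with the logarithm and the square root. *)
Lemma catenoid_exists a r : 0 < a -> a <= r -> exists2 t, 0 <= t & r = a * cosh (t / a).
Proof.
move=> a0 ar; pose y := r / a; have y1 : 1 <= y by rewrite ler_pdivlMr // mul1r.
pose s := Num.sqrt (y ^+ 2 - 1).
have s0 : 0 <= s by exact: sqrtr_ge0.
have s2 : s ^+ 2 = y ^+ 2 - 1 by rewrite sqr_sqrtr // subr_ge0 exprn_ege1.
have ys : 0 < y + s by rewrite ltr_pwDl // (lt_le_trans ltr01).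
exists (a * ln (y + s)).
  by rewrite mulr_ge0 ?(ltW a0) // ln_ge0 // ler_wpDr.
rewrite [a * ln _ / a]mulrC mulKf ?gt_eqF // /cosh expRN lnK ?posrE //.
have -> : (y + s)^-1 = y - s.
  apply: (mulfI (lt0r_neq0 ys)); rewrite mulfV ?gt_eqF //.
  by move: s2; rewrite !expr2 => s2; lra.
by rewrite /y; field; rewrite gt_eqF.
Qed.

End Catenoid.

(** * The end at the puncture 0 *)

Section OidEnd.
Variable R : realType.
Local Notation C := R[i].
Local Notation Ct := (R[i]^o).
Local Notation tpi := (tpi R).
Implicit Types (z w : C).
Variable n : nat.
Variable W : weier (oid_angle R n).
Local Notation L := (wl W).
Local Notation lat := (lat L).
Variables X1 X2 X3 : C -> R.
Hypothesis op : oid_pot W X1 X2 X3.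
Local Notation Xo := (oid W X1 X2 X3).

Lemma small_nlat z : pdisc (Num.min (2 * L) (2 * pi)) z -> ~ lat z.
Proof.
have L0 := wl_gt0 W.
rewrite /pdisc [mkset _ _]/mkset lt_min => /and3P[z0 zL zp].
have rl := le_lt_trans (Re_le_cabs z) zL; have il := le_lt_trans (Im_le_cabs z) zp.
move: rl il; rewrite !ltr_norml => /andP[r1 r2] /andP[i1 i2].
have [r|r|r] := ltrgtP (Re z) 0.
- by apply: (vstrip_nlat L0 (j := -1)); apply/vstripP; rewrite mulrN1z; apply/andP; split; lra.
- by apply: (vstrip_nlat L0 (j := 0)); apply/vstripP; rewrite mulr0z; apply/andP; split; lra.
have [i|i|i] := ltrgtP (Im z) 0.
- by apply: (hstrip_nlat (L := L) (k := -1)); apply/hstripP; rewrite mulrN1z; apply/andP; split; lra.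
- by apply: (hstrip_nlat (L := L) (k := 0)); apply/hstripP; rewrite mulr0z; apply/andP; split; lra.
by move: z0; rewrite (eqC (w := 0) r i) cabs0 ltxx.
Qed.

(** The explicit potentials of the polar parts, a multiple of ln|z| and the real and imaginary parts
    of k/z, are subtracted. The remaining forms are bounded, so the remainders are Lipschitz on the
    punctured disc and have limits at 0. *)
Lemma oid_expansion : exists r k y K h1 h2 h3 : R,
  [/\ [/\ 0 < r, 0 < k, y != 0 & 0 <= K], (forall z, pdisc r z -> ~ lat z),
   (forall z, pdisc r z -> [/\ `|X1 z + y * ln (cabs z) - h1| <= K * cabs z,
     `|X2 z - Re (k%:C / z) - h2| <= K * cabs z & `|X3 z - Im (k%:C / z) - h3| <= K * cabs z]) &
   forall z w, pdisc r z -> pdisc r w ->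
     `|(X2 z - Re (k%:C / z)) - (X2 w - Re (k%:C / w))| <= K * cabs (z - w) /\
     `|(X3 z - Im (k%:C / z)) - (X3 w - Im (k%:C / w))| <= K * cabs (z - w)].
Proof.
have [k [y [r0 [M [k0 y0 r00 M0 ex]]]]] := w_expand W.
have L0 := wl_gt0 W.
pose r := Num.min r0 (Num.min (2 * L) (2 * pi)).
have r_gt0 : 0 < r by rewrite !lt_min r00 !mulr_gt0 // pi_gt0.
have nl z : pdisc r z -> ~ lat z.
  move=> /andP[z0]; rewrite lt_min => /andP[_ zr]; apply: small_nlat.
  by rewrite /pdisc [mkset _ _]/mkset z0.
have {}ex z : pdisc r z -> [/\ cabs (wqA W z - (k%:C / z ^+ 2 - I * y%:C / z)) <= M,
    cabs (wqB W z - (k%:C / z ^+ 2 + I * y%:C / z)) <= M & cabs (wqC W z - k%:C / z ^+ 2) <= M].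
  by move=> /andP[z0]; rewrite lt_min => /andP[zr _]; apply: ex; rewrite z0.
have nz z : pdisc r z -> z != 0 by move=> /andP[z0 _]; rewrite -cabs_gt0.
have half (v : C) : cabs (v / 2) = cabs v / 2.
  by rewrite cabsM cabsV (_ : (2 : C) = (2 : R)%:C) ?cabs_real ?ger0_norm // rmorph_nat.
have pinv (c : C) : pot (pdisc r) (fun z => Re (c / z)) (fun z => - (c / z ^+ 2)).
  apply: pot_hder => z /nz z0; have := hderM (hder_cst c z) (hderV (f := id) z0 (hder_id z)).
  by rewrite mul0r add0r mulN1r mulrN.
have sub X f : pot [set z | ~ lat z] X f -> pot (pdisc r) X f by move=> h; apply: pot_sub h => z /nl.
have g1 : pot (pdisc r) (fun z => X1 z + y * ln (cabs z)) (fun z => phi1 W z + y%:C * z^-1).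
  by apply: potD; [exact: sub (op1 op)|apply: potZ; exact: pot_ln].
have g2 : pot (pdisc r) (fun z => X2 z - Re (k%:C / z)) (fun z => phi2 W z - - (k%:C / z ^+ 2)).
  by apply: potB; [exact: sub (op2 op)|exact: pinv].
have g3 : pot (pdisc r) (fun z => X3 z - Im (k%:C / z)) (fun z => phi3 W z - - (- (I * k%:C) / z ^+ 2)).
  have := potB (sub _ _ (op3 op)) (pinv (- (I * k%:C))).
  congr (pot _ _ _); apply/funext => z; congr (_ - _).
  by rewrite mulNr -mulrA ReN ReI opprK.
have b1 z : pdisc r z -> cabs (phi1 W z + y%:C * z^-1) <= M.
  move=> Dz; have [hA hB _] := ex z Dz.
  have II : I * I = -1 :> C by apply: eqC; rewrite !(ReM, ImM, ReN, ImN) /=; ring.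
  have -> : phi1 W z + y%:C * z^-1 = I * ((wqB W z - (k%:C / z ^+ 2 + I * y%:C / z)) -
      (wqA W z - (k%:C / z ^+ 2 - I * y%:C / z))) / 2.
    have -> : y%:C * z^-1 = - (I * I) * y%:C * z^-1 by rewrite II opprK mul1r.
    rewrite /phi1; move: (wqA W z) (wqB W z) (z^-1) => A B v.
    by move: (k%:C / z ^+ 2) => u; move: (y%:C) => y'; field.
  rewrite half cabsM cabs_I mul1r ler_pdivrMr // (le_trans (cabsD _ _)) // cabsN.
  by rewrite mulr_natr mulr2n lerD.
have b2 z : pdisc r z -> cabs (phi2 W z - - (k%:C / z ^+ 2)) <= M.
  move=> Dz; have [hA hB _] := ex z Dz.
  have -> : phi2 W z - - (k%:C / z ^+ 2) = - ((wqB W z - (k%:C / z ^+ 2 + I * y%:C / z)) +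
      (wqA W z - (k%:C / z ^+ 2 - I * y%:C / z))) / 2.
    rewrite /phi2; move: (wqA W z) (wqB W z) (I * y%:C / z) => A B v.
    by move: (k%:C / z ^+ 2) => u; field.
  rewrite half cabsN ler_pdivrMr // (le_trans (cabsD _ _)) //.
  by rewrite mulr_natr mulr2n lerD.
have b3 z : pdisc r z -> cabs (phi3 W z - - (- (I * k%:C) / z ^+ 2)) <= M.
  move=> Dz; have [_ _ hC] := ex z Dz.
  have -> : phi3 W z - - (- (I * k%:C) / z ^+ 2) = I * (wqC W z - k%:C / z ^+ 2).
    by rewrite /phi3; move: (wqC W z) (z ^+ 2) => A v; ring.
  by rewrite cabsM cabs_I mul1r.
have l1 := punctured_lip M0 g1 b1; have l2 := punctured_lip M0 g2 b2; have l3 := punctured_lip M0 g3 b3.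
have K0 : 0 <= 3 * M by rewrite mulr_ge0.
have [h1 e1] := punctured_limit r_gt0 K0 l1.
have [h2 e2] := punctured_limit r_gt0 K0 l2.
have [h3 e3] := punctured_limit r_gt0 K0 l3.
exists r, k, y, (3 * M), h1, h2, h3; split=> //.
- by move=> z Dz; split; [exact: e1|exact: e2|exact: e3].
- by move=> z w Dz Dw; split; [exact: l2|exact: l3].
Qed.

Lemma ln_abs (x : R) : 0 < x -> `|ln x| <= x + x^-1.
Proof.
move=> x0; have xi : 0 < x^-1 by rewrite invr_gt0.
have h (u : R) : 0 < u -> ln u <= u.
  move=> u0; have := @le_ln1Dx R (u - 1); rewrite subrKC => H; have : ln u <= u - 1 by apply: H; lra.
  by move=> H2; lra.
have a := h x x0; have b := h _ xi; rewrite lnV ?posrE // in b.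
by rewrite ler_norml; apply/andP; split; lra.
Qed.

(** The second and third coordinates behave like k/z and the first one like a logarithm, so the end
    is nearly a graph over the plane of the last two coordinates. The expansion estimate |z - w| <=
    |Xo z - Xo w| encodes embeddedness, and the last clause properness. *)
Lemma oid_end : exists rho : R, [/\ 0 < rho, (forall z, pdisc rho z -> ~ lat z),
  (exists2 E, is_catenoid_end E & asymptotic (Xo @` pdisc rho) E),
  (forall z w, pdisc rho z -> pdisc rho w -> cabs (z - w) <= enorm (Xo z - Xo w)) &
  (forall B, exists2 r, 0 < r & forall z, pdisc r z -> B < enorm (Xo z))].
Proof.
have [r [k [y [K [h1 [h2 [h3 [[r0 k0 y0 K0] nl ex lip]]]]]]]] := oid_expansion.
(* For |z| |w| <= m the difference of k/z and k/w is at least (2K + 1)|z - w|, while the remainders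
   vary by at most 2K |z - w|. *)
pose m := k / (2 * K + 1); have m0 : 0 < m by rewrite divr_gt0 // ltr_wpDl // mulr_ge0.
pose rho := Num.min r (Num.min m 1).
have rho0 : 0 < rho by rewrite !lt_min r0 m0 ltr01.
have [rr rm r1] : [/\ rho <= r, rho <= m & rho <= 1] by split; rewrite /rho !ge_min lexx ?orbT.
clearbody rho.
have sr z : pdisc rho z -> pdisc r z by move=> /andP[z0 z1]; rewrite /pdisc [mkset _ _]/mkset z0 (lt_le_trans z1).
have nl' z : pdisc rho z -> ~ lat z by move=> /sr/nl.
have XE z : pdisc rho z -> Xo z = rv3 (X1 z) (X2 z) (X3 z) by move=> /nl' h; rewrite oidE.
have kz z : cabs (k%:C / z) = k / cabs z by rewrite cabsM cabsV cabs_real gtr0_norm.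
pose a := `|y|; have a0 : 0 < a by rewrite normr_gt0.
pose s := y / a.
have s2 : s ^+ 2 = 1 by rewrite expr_div_n real_normK ?num_real // divff // expf_eq0.
have sa : s * a = y by rewrite divfK // gt_eqF.
have s1 : `|s| = 1 by rewrite normrM normfV normr_id divff // gt_eqF.
(* The catenoid of neck [a] has height about a ln(2 rho/a) at radius rho = k/|z|; the constant a
   ln(2k/a) in this height is compensated here. [s] is the sign of y. *)
pose h0 := h1 - y * ln (2 * k / a).
(* The axis of the catenoid is turned from the third to the first coordinate direction, with
   orientation [s], and translated. *)
pose T (v : 'rV[R]_3) := rv3 (h0 + s * v 0 2) (h2 + v 0 0) (h3 + v 0 1).
have isoT : isometry T.
  move=> u v; rewrite !enormE; congr Num.sqrt; rewrite /T !mxE /=.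
  transitivity (s ^+ 2 * (u 0 2 - v 0 2) ^+ 2 + (u 0 0 - v 0 0) ^+ 2 + (u 0 1 - v 0 1) ^+ 2); first by ring.
  by rewrite s2; ring.
(* The surface point of parameter z is compared with the catenoid point that lies over the plane
   point k/z. *)
have est z t : pdisc rho z -> 0 <= t -> k / cabs z = a * cosh (t / a) ->
    let v := rv3 (Re (k%:C / z)) (Im (k%:C / z)) t in
    half_catenoid a v /\ enorm (Xo z - T v) <= 3 * K * cabs z + a ^+ 3 / (k / cabs z) ^+ 2.
  move=> Dz t0 et v; have [e1 e2 e3] := ex z (sr z Dz); have z0 : 0 < cabs z by case/andP: Dz.
  have hc : half_catenoid a v.
    by split; rewrite !rv3E //; rewrite -et -kz -cabs_sqr sqrtr_sqr ger0_norm ?cabs_ge0.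
  split=> //; have [_ _ ct] := catenoid_height a0 t0; rewrite -et in ct.
  rewrite (le_trans (enorm_le _)) // (XE z Dz) /T !mxE /=.
  have c1 : `|X1 z - (h0 + s * t)| <= K * cabs z + a ^+ 3 / (k / cabs z) ^+ 2.
    have -> : X1 z - (h0 + s * t) = (X1 z + y * ln (cabs z) - h1) + s * (a * ln (2 * (k / cabs z) / a) - t).
      have -> : ln (2 * (k / cabs z) / a) = ln (2 * k / a) - ln (cabs z).
        rewrite -lnV ?posrE // -lnM ?posrE ?divr_gt0 ?mulr_gt0 ?invr_gt0 //.
        by congr ln; rewrite !mulrA mulrAC.
      by rewrite /h0 -sa; ring.
    by rewrite (le_trans (ler_normD _ _)) // lerD // normrM s1 mul1r.
  have c2 : `|X2 z - (h2 + Re (k%:C / z))| <= K * cabs z.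
    by rewrite (_ : _ - _ = X2 z - Re (k%:C / z) - h2) //; ring.
  have c3 : `|X3 z - (h3 + Im (k%:C / z))| <= K * cabs z.
    by rewrite (_ : _ - _ = X3 z - Im (k%:C / z) - h3) //; ring.
  have -> : 3 * K * cabs z + a ^+ 3 / (k / cabs z) ^+ 2 =
     K * cabs z + a ^+ 3 / (k / cabs z) ^+ 2 + K * cabs z + K * cabs z by ring.
  by rewrite lerD // lerD.
exists rho; split=> //.
- exists (T @` half_catenoid a); first by exists a, T.
  move=> eps eps0; pose c := 3 * K + a ^+ 3 / k ^+ 2 + 1.
  have ak0 : 0 <= a ^+ 3 / k ^+ 2 by rewrite divr_ge0 // exprn_ge0 // ltW.
  have K30 : 0 <= 3 * K by rewrite mulr_ge0.
  have c0 : 0 < c by rewrite ltr_wpDl // addr_ge0.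
  pose d := Num.min (Num.min rho (k / a)) (eps / c).
  have d0 : 0 < d by rewrite lt_min lt_min rho0 !divr_gt0.
  have [d1 d2 d3] : [/\ d <= rho, d <= k / a & d <= eps / c] by split; rewrite /d !ge_min lexx ?orbT.
  have small z : pdisc d z -> 3 * K * cabs z + a ^+ 3 / (k / cabs z) ^+ 2 < eps.
    move=> /andP[z0 zd]; have z1 : cabs z <= 1 by rewrite ltW // (lt_le_trans zd) // (le_trans d1).
    have -> : a ^+ 3 / (k / cabs z) ^+ 2 = a ^+ 3 / k ^+ 2 * cabs z * cabs z.
      by field; rewrite !gt_eqF.
    have : c * cabs z < eps by rewrite mulrC -ltr_pdivlMr // (lt_le_trans zd).
    have z00 := ltW z0; have az0 := mulr_ge0 ak0 z00; have h := ler_piMr az0 z1.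
    have -> : c * cabs z = 3 * K * cabs z + a ^+ 3 / k ^+ 2 * cabs z + cabs z by rewrite /c; ring.
    apply: le_lt_trans.
    have g (p q u v : R) : q <= u -> 0 <= v -> p + q <= p + u + v by lra.
    exact: g h z00.
  (* Bounds on the norms of the points of the surface, respectively of the catenoid, for parameters
     with |z| >= d; points further away have |z| < d, where the estimate [small] applies. *)
  pose B1 := a * (d^-1 + rho) + `|h1| + `|h2| + `|h3| + 3 * K * rho + 2 * (k / d).
  pose B2 := `|h0| + `|h2| + `|h3| + 4 * (k / d).
  have kd0 : 0 < k / d by rewrite divr_gt0.
  have f1 : 0 <= a * (d^-1 + rho).
    by apply: mulr_ge0; [exact: ltW|apply: addr_ge0; apply: ltW => //; rewrite invr_gt0].
  have f2 : 0 <= 3 * K * rho by apply: mulr_ge0 => //; exact: ltW.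
  have f3 : 0 <= 2 * (k / d) by apply: mulr_ge0 => //; exact: ltW.
  have f4 : 0 <= 4 * (k / d) by apply: mulr_ge0 => //; exact: ltW.
  have [n0 n1 n2 n3] : [/\ 0 <= `|h0|, 0 <= `|h1|, 0 <= `|h2| & 0 <= `|h3|] by split.
  have B10 : 0 <= B1 by rewrite /B1 addr_ge0 // addr_ge0 // addr_ge0 // addr_ge0 // addr_ge0.
  have B20 : 0 <= B2 by rewrite /B2 addr_ge0 // addr_ge0 // addr_ge0.
  exists (B1 + B2); split.
    move=> _ [z Dz <-] far; have z0 : 0 < cabs z by case/andP: Dz.
    have zd : cabs z < d.
      rewrite ltNge; apply/negP => dz; move: far; rewrite ltNge => /negP; apply.
      have zr : cabs z <= rho by case/andP: Dz => _ /ltW.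
      apply: (@le_trans _ _ B1); last by rewrite lerDl.
      rewrite (le_trans (enorm_le _)) // (XE z Dz) !rv3E.
      have [e1 e2 e3] := ex z (sr z Dz).
      have Kz : K * cabs z <= K * rho by rewrite ler_wpM2l.
      have zi : (cabs z)^-1 <= d^-1 by rewrite lef_pV2 ?posrE.
      have kzd : k / cabs z <= k / d by rewrite ler_pM2l.
      have q1 : `|X1 z| <= K * rho + `|h1| + a * (d^-1 + rho).
        rewrite (_ : X1 z = (X1 z + y * ln (cabs z) - h1) + h1 - y * ln (cabs z)); last by ring.
        rewrite (le_trans (ler_normB _ _)) // lerD //.
          by rewrite (le_trans (ler_normD _ _)) // lerD // (le_trans e1).
        rewrite normrM ler_wpM2l // (le_trans (ln_abs z0)) // addrC lerD //.
      have q2 : `|X2 z| <= K * rho + `|h2| + k / d.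
        rewrite (_ : X2 z = (X2 z - Re (k%:C / z) - h2) + h2 + Re (k%:C / z)); last by ring.
        rewrite (le_trans (ler_normD _ _)) // lerD //.
          by rewrite (le_trans (ler_normD _ _)) // lerD // (le_trans e2).
        by rewrite (le_trans (Re_le_cabs _)) // kz.
      have q3 : `|X3 z| <= K * rho + `|h3| + k / d.
        rewrite (_ : X3 z = (X3 z - Im (k%:C / z) - h3) + h3 + Im (k%:C / z)); last by ring.
        rewrite (le_trans (ler_normD _ _)) // lerD //.
          by rewrite (le_trans (ler_normD _ _)) // lerD // (le_trans e3).
        by rewrite (le_trans (Im_le_cabs _)) // kz.
      have -> : B1 = (K * rho + `|h1| + a * (d^-1 + rho)) + (K * rho + `|h2| + k / d) + (K * rho + `|h3| + k / d).
        by rewrite /B1; ring.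
      by rewrite lerD // lerD.
    have ar : a <= k / cabs z by rewrite ler_pdivlMr // mulrC -ler_pdivlMr // ltW // (lt_le_trans zd).
    have [t t0 et] := catenoid_exists a0 ar.
    have [hc le] := est z t Dz t0 et.
    exists (T (rv3 (Re (k%:C / z)) (Im (k%:C / z)) t)); first by exists (rv3 (Re (k%:C / z)) (Im (k%:C / z)) t).
    by apply: (le_lt_trans le); apply: small; rewrite /pdisc [mkset _ _]/mkset z0.
  move=> _ [v [v1 v2] <-] far.
  (* A catenoid point over [ze] corresponds to the surface parameter z = k/ze. *)
  pose ze : C := v 0 0 +i* v 0 1; pose t := v 0 2.
  have zc : cabs ze = a * cosh (t / a) by rewrite -v1.
  have [c1 c2 c3] := catenoid_height a0 v2; rewrite -/t -zc in c1 c2.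
  have ze0 : 0 < cabs ze by rewrite (lt_le_trans a0).
  have zen : ze != 0 by rewrite -cabs_gt0.
  have kn : (k%:C : C) != 0 by rewrite -cabs_gt0 cabs_real normr_gt0 gt_eqF.
  pose z := k%:C / ze.
  have kzE : k%:C / z = ze by rewrite /z invf_div mulrC divfK.
  have zE : cabs z = k / cabs ze by exact: kz.
  have z0 : 0 < cabs z by rewrite zE divr_gt0.
  have zd : cabs z < d.
    rewrite ltNge; apply/negP => dz; move: far; rewrite ltNge => /negP; apply.
    apply: (@le_trans _ _ B2); last by rewrite lerDr.
    have zk : cabs ze <= k / d.
      by move: dz; rewrite zE ler_pdivlMr // mulrC -ler_pdivlMr.
    rewrite (le_trans (enorm_le _)) // /T !rv3E.
    have q1 : `|h0 + s * v 0 2| <= `|h0| + 2 * (k / d).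
      rewrite (le_trans (ler_normD _ _)) // lerD2l normrM s1 mul1r ger0_norm //.
      by rewrite (le_trans c2) // ler_pM2l.
    have q2 : `|h2 + v 0 0| <= `|h2| + k / d.
      by rewrite (le_trans (ler_normD _ _)) // lerD2l (le_trans _ zk) // (Re_le_cabs ze).
    have q3 : `|h3 + v 0 1| <= `|h3| + k / d.
      by rewrite (le_trans (ler_normD _ _)) // lerD2l (le_trans _ zk) // (Im_le_cabs ze).
    have -> : B2 = (`|h0| + 2 * (k / d)) + (`|h2| + k / d) + (`|h3| + k / d) by rewrite /B2; ring.
    by rewrite lerD // lerD.
  have Dz : pdisc rho z by rewrite /pdisc [mkset _ _]/mkset z0 (lt_le_trans zd).
  have et : k / cabs z = a * cosh (t / a) by rewrite -kz kzE.
  have [_] := est z t Dz v2 et; rewrite kzE /ze ReC ImC rv3K => le.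
  exists (Xo z); first by exists z.
  by apply: (le_lt_trans le); apply: small; rewrite /pdisc [mkset _ _]/mkset z0.
- move=> z w Dz Dw; have [l2 l3] := lip z w (sr z Dz) (sr w Dw).
  have [z0 zr] := andP Dz; have [w0 wr] := andP Dw.
  have en (u : 'rV[R]_3) : cabs (u 0 1 +i* u 0 2) <= enorm u.
    by rewrite enormE /= ler_wsqrtr // -addrA lerDr sqr_ge0.
  have d2 : (Xo z - Xo w) 0 1 = X2 z - X2 w by rewrite (XE z Dz) (XE w Dw) !mxE.
  have d3 : (Xo z - Xo w) 0 2 = X3 z - X3 w by rewrite (XE z Dz) (XE w Dw) !mxE.
  apply: le_trans (en _); rewrite d2 d3.
  pose e := ((X2 z - Re (k%:C / z)) - (X2 w - Re (k%:C / w))) +i* ((X3 z - Im (k%:C / z)) - (X3 w - Im (k%:C / w))).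
  have -> : (X2 z - X2 w) +i* (X3 z - X3 w) = (k%:C / z - k%:C / w) - (- e).
    by apply: eqC; rewrite /e !(ReD, ImD, ReN, ImN) ?ReC ?ImC; ring.
  apply: le_trans (ler_cabsB _ _); rewrite cabsN.
  have e2 : cabs e <= 2 * K * cabs (z - w).
    have -> : 2 * K * cabs (z - w) = K * cabs (z - w) + K * cabs (z - w) by ring.
    by rewrite (le_trans (cabs_le_ReIm _)) // /e ReC ImC lerD.
  have zn : z != 0 by rewrite -cabs_gt0.
  have wn : w != 0 by rewrite -cabs_gt0.
  have -> : k%:C / z - k%:C / w = - (k%:C * (z - w) / (z * w)) by field; rewrite zn wn.
  rewrite cabsN !cabsM cabsV cabsM cabs_real gtr0_norm //.
  have zw : cabs z * cabs w <= m.
    apply: le_trans rm; rewrite -[leRHS]mulr1; apply: ler_pM; rewrite ?cabs_ge0 // ltW //.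
    by rewrite (lt_le_trans wr).
  have zw0 : 0 < cabs z * cabs w by rewrite mulr_gt0.
  have : (2 * K + 1) * cabs (z - w) <= k * cabs (z - w) / (cabs z * cabs w).
    rewrite ler_pdivlMr // mulrAC ler_wpM2r ?cabs_ge0 //.
    by rewrite mulrC -ler_pdivlMr // ltr_wpDl // mulr_ge0.
  by move: e2; rewrite mulrDl mul1r; lra.
- move=> B; pose q := `|B| + `|h2| + `|h3| + 2 * K + 1.
  have q0 : 0 < q by rewrite ltr_wpDl // !addr_ge0 // mulr_ge0.
  exists (Num.min rho (k / q)); first by rewrite lt_min rho0 divr_gt0.
  move=> z /andP[z0]; rewrite lt_min => /andP[zr zq].
  have Dz : pdisc rho z by rewrite /pdisc [mkset _ _]/mkset z0.
  have [_ e2 e3] := ex z (sr z Dz).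
  have q1 : q < k / cabs z by rewrite ltr_pdivlMr // mulrC -ltr_pdivlMr.
  have x2 := le_enorm (Xo z) 1; have x3 := le_enorm (Xo z) 2.
  have en (u : 'rV[R]_3) : cabs (u 0 1 +i* u 0 2) <= enorm u.
    by rewrite enormE /= ler_wsqrtr // -addrA lerDr sqr_ge0.
  apply: lt_le_trans (en _); rewrite (XE z Dz) !rv3E.
  pose e := (X2 z - Re (k%:C / z)) +i* (X3 z - Im (k%:C / z)).
  have -> : X2 z +i* X3 z = k%:C / z - (- e).
    by apply: eqC; rewrite /e !(ReD, ImD, ReN, ImN) ?ReC ?ImC; ring.
  apply: lt_le_trans (ler_cabsB _ _); rewrite cabsN kz.
  have : cabs e <= `|h2| + `|h3| + 2 * K.
    rewrite (le_trans (cabs_le_ReIm _)) // /e ReC ImC.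
    have Kz : K * cabs z <= K by rewrite ler_piMr // ltW // (lt_le_trans zr).
    have t2 : `|X2 z - Re (k%:C / z)| <= K + `|h2|.
      rewrite -[X in `|X|](subrK h2) (le_trans (ler_normD _ _)) // lerD // (le_trans e2) //.
    have t3 : `|X3 z - Im (k%:C / z)| <= K + `|h3|.
      rewrite -[X in `|X|](subrK h3) (le_trans (ler_normD _ _)) // lerD // (le_trans e3) //.
    by lra.
  by have := ler_norm B; move: q1; rewrite /q; lra.
Qed.

End OidEnd.

(** * The symmetry group *)

Section Group.
Import extremal.
Variable R : realType.
Variable n : nat.
Hypothesis hn : (3 <= n)%N.
Local Notation beta := (2 * pi / n%:R : R).
Local Notation rot := (rotation_mx (axis3 R)).
Local Notation sg := (reflection_mx (axis3 R)).
Local Notation ta := (reflection_mx (axis2 R)).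

Lemma mx3P (A B : 'M[R]_3) : (forall a b c, rv3 a b c *m A = rv3 a b c *m B) -> A = B.
Proof. by move=> H; apply/row_matrixP => i; rewrite !rowE -(rv3K (delta_mx 0 i)) H. Qed.

Lemma rotD s t : rot s *m rot t = rot (s + t).
Proof.
apply: mx3P => a b c; rewrite mulmxA !mul_rot3 cosD sinD; congr rv3; ring.
Qed.

Lemma rot0 : rot 0 = 1%:M.
Proof. by apply: mx3P => a b c; rewrite mul_rot3 mulmx1 cos0 sin0; congr rv3; ring. Qed.

Lemma rot2pi (k : nat) : rot (2 * pi * k%:R) = 1%:M.
Proof.
have h : rot (2 * pi) = 1%:M.
  apply: mx3P => a b c; rewrite mul_rot3 mulmx1.
  have -> : 2 * pi = pi *+ 2 :> R by rewrite mulr_natl.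
  by rewrite cos2pi sin2pi; congr rv3; ring.
elim: k => [|k IH]; first by rewrite mulr0 rot0.
have -> : 2 * pi * k.+1%:R = 2 * pi * k%:R + 2 * pi :> R by rewrite -[k.+1]addn1 natrD; ring.
by rewrite -rotD IH h mulmx1.
Qed.

Lemma ta2 : ta *m ta = 1%:M.
Proof. by apply: mx3P => a b c; rewrite mulmxA !mul_refl2 mulmx1 opprK. Qed.
Lemma sg2 : sg *m sg = 1%:M.
Proof. by apply: mx3P => a b c; rewrite mulmxA !mul_refl3 mulmx1 opprK. Qed.
Lemma sg_ta : sg *m ta = ta *m sg.
Proof. by apply: mx3P => a b c; rewrite !mulmxA !(mul_refl2, mul_refl3). Qed.
Lemma sg_rot t : sg *m rot t = rot t *m sg.
Proof. by apply: mx3P => a b c; rewrite !mulmxA !(mul_rot3, mul_refl3). Qed.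
Lemma ta_rot t : ta *m rot t = rot (- t) *m ta.
Proof.
by apply: mx3P => a b c; rewrite !mulmxA !(mul_rot3, mul_refl2) cosN sinN; congr rv3; ring.
Qed.

Let betaD (m p : nat) : beta * (m + p)%:R = beta * m%:R + beta * p%:R.
Proof. by rewrite natrD; ring. Qed.

(* The matrix rho^i tau^j sigma^k. *)
Definition sym_mx (i : nat) (j k : bool) : 'M[R]_3 :=
  rot (beta * i%:R) *m (if j then ta else 1%:M) *m (if k then sg else 1%:M).

Lemma sym_mx_rv i j k a b c : rv3 a b c *m sym_mx i j k =
  rv3 (cos (beta * i%:R) * a - sin (beta * i%:R) * b)
      ((-1) ^+ j * (sin (beta * i%:R) * a + cos (beta * i%:R) * b)) ((-1) ^+ k * c).
Proof.
rewrite /sym_mx !mulmxA mul_rot3; case: j; case: k;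
  by rewrite ?mulmx1 ?mul_refl2 ?mul_refl3 ?expr1 ?expr0 ?mulN1r ?mul1r.
Qed.

(** [ta] conjugates a rotation into its inverse, and [sg] commutes with everything. The inverse is
    written as the power n - 1 in order to keep natural exponents. *)
Lemma sym_mxM i j k i' j' k' : sym_mx i j k *m sym_mx i' j' k' =
  sym_mx (i + (if j then n.-1 * i' else i')) (j (+) j') (k (+) k').
Proof.
have n0 : n%:R != 0 :> R by rewrite pnatr_eq0 -lt0n (leq_trans _ hn).
have rN : rot (beta * (n.-1 * i')%:R) = rot (- (beta * i'%:R)).
  rewrite -(mulmx1 (rot (- _))) -(rot2pi i') rotD; congr rot.
  rewrite natrM -subn1 natrB ?(leq_trans _ hn) //; field.
  by [].
pose T (j : bool) : 'M[R]_3 := if j then ta else 1%:M.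
pose S (k : bool) : 'M[R]_3 := if k then sg else 1%:M.
have TT : T j *m T j' = T (j (+) j').
  by rewrite /T; case: (j); case: (j'); rewrite /= ?mulmx1 ?mul1mx ?ta2.
have SS : S k *m S k' = S (k (+) k').
  by rewrite /S; case: (k); case: (k'); rewrite /= ?mulmx1 ?mul1mx ?sg2.
have ST : S k *m T j' = T j' *m S k.
  by rewrite /S /T; case: (k); case: (j'); rewrite ?mulmx1 ?mul1mx ?sg_ta.
have SR t : S k *m rot t = rot t *m S k.
  by rewrite /S; case: (k); rewrite ?mulmx1 ?mul1mx ?sg_rot.
have TR : T j *m rot (beta * i'%:R) = rot (beta * (if j then n.-1 * i' else i')%N%:R) *m T j.
  by rewrite /T; case: (j); rewrite ?mulmx1 ?mul1mx // ta_rot rN.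
rewrite /sym_mx betaD -rotD -/(T j) -/(T j') -/(S k) -/(S k') -/(T (j (+) j')) -/(S (k (+) k')).
rewrite -TT -SS; move: ST SR TR; move: (T j) (T j') (S k) (S k') => t t' s s' ST SR TR.
rewrite !mulmxA -(mulmxA _ s (rot _)) SR !mulmxA -(mulmxA _ s t') ST !mulmxA.
by rewrite -(mulmxA (rot (beta * i%:R)) t) TR !mulmxA.
Qed.

Lemma sym_mx_mod i j k : sym_mx (i %% n) j k = sym_mx i j k.
Proof.
have n0 : n%:R != 0 :> R by rewrite pnatr_eq0 -lt0n (leq_trans _ hn).
rewrite /sym_mx; congr (_ *m _ *m _).
have -> : beta * i%:R = 2 * pi * (i %/ n)%:R + beta * (i %% n)%:R.
  by rewrite [in LHS](divn_eq i n) natrD natrM; field.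
by rewrite -rotD rot2pi mul1mx.
Qed.

(** The third axis detects k. The images of the two horizontal axes give the cosine and sine of the
    rotation angle and the sign j; two angles below 2 pi with the same cosine and sine coincide. *)
Lemma sym_mx_inj i j k i' j' k' : (i < n)%N -> (i' < n)%N ->
  sym_mx i j k = sym_mx i' j' k' -> [/\ i = i', j = j' & k = k'].
Proof.
move=> li li' E.
have n0 : 0 < n%:R :> R by rewrite ltr0n (leq_trans _ hn).
have H a b c : rv3 a b c *m sym_mx i j k = rv3 a b c *m sym_mx i' j' k' by rewrite E.
have h1 := H 1 0 0; have h2 := H 0 1 0; have h3 := H 0 0 1; rewrite !sym_mx_rv in h1 h2 h3.
have e3 := congr1 (fun v : 'rV[R]_3 => v 0 2) h3; rewrite /= !rv3E !mulr1 in e3.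
have kk : k = k' by exact: signr_inj e3.
have e1 := congr1 (fun v : 'rV[R]_3 => v 0 0) h1; rewrite /= !rv3E !mulr0 !mulr1 !subr0 in e1.
have e2 := congr1 (fun v : 'rV[R]_3 => v 0 0) h2; rewrite /= !rv3E !mulr0 !mulr1 !sub0r in e2.
have e4 := congr1 (fun v : 'rV[R]_3 => v 0 1) h2; rewrite /= !rv3E !mulr0 !mulr1 !add0r in e4.
have e5 := congr1 (fun v : 'rV[R]_3 => v 0 1) h1; rewrite /= !rv3E !mulr0 !mulr1 !addr0 in e5.
have {}e2 := oppr_inj e2.
have jj : j = j'.
  have := cos2Dsin2 (beta * i%:R); rewrite e1 e2; rewrite e1 in e4; rewrite e2 in e5.
  move: e4 e5; case: j {E H h1 h2 h3}; case: j' => //=; rewrite ?expr1 ?expr0 ?mulN1r ?mul1r;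
    move: (cos _) (sin _) => x y a b; rewrite !expr2; nra.
split=> //.
wlog le : i i' li li' {E H h1 h2 h3 e4 e5} e1 e2 / (i' <= i)%N.
  by move=> W; have [|/ltnW] := leqP i' i; [exact: W|move=> ?; apply/esym; apply: W].
have c1 : cos (beta * (i - i')%:R) = 1.
  have -> : beta * (i - i')%:R = beta * i%:R - beta * i'%:R by rewrite natrB //; ring.
  rewrite cosB e1 e2 -!expr2; exact: cos2Dsin2.
apply/eqP; rewrite eqn_leq le andbT leqNgt; apply/negP => lt.
have := @cos_lt1 R (beta * (i - i')%:R); rewrite c1 ltxx => K.
suff : false by []; apply: K.
have p0 := pi_gt0 R; have b0 : 0 < beta by rewrite divr_gt0 // mulr_gt0.
rewrite mulr_gt0 ?ltr0n ?subn_gt0 //=.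
have q0 : 0 < 2 * pi :> R by rewrite mulr_gt0.
have -> : beta * (i - i')%:R = 2 * pi * ((i - i')%:R / n%:R) by field; rewrite gt_eqF.
rewrite -[ltRHS]mulr1 (ltr_pM2l q0) ltr_pdivrMr // mul1r ltr_nat.
exact: leq_ltn_trans (leq_subr _ _) li.
Qed.

Local Notation D := (extremal.dihedral_gtype n.*2).

(** The generators come from the presentation of the dihedral group. The elements x^i y^j are closed
    under products, because y moves past x at the cost of inverting it, so they exhaust the
    group. *)
Lemma dihedral_param : exists x y : D,
  [/\ (x ^+ n = 1)%g, (y ^+ 2 = 1)%g, (y * x = x ^+ n.-1 * y)%g &
   (forall g : D, exists (i : 'I_n) (j : bool), g = x ^+ i * y ^+ j)%g].
Proof.
have n1 : (1 < n)%N by rewrite (leq_trans _ hn).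
have n0 : (0 < n)%N by rewrite (leq_trans _ hn).
have := homg_refl [set: D]%G; rewrite (Grp_dihedral n1) => /existsP[[x y] /=].
rewrite !xpair_eqE /= => /and4P[/eqP defG /eqP xn /eqP y2 /eqP xy].
exists x, y.
have yx : (y * x = x ^+ n.-1 * y)%g.
  have yi : (y^-1 = y)%g by apply/eqP; rewrite eq_invg_mul -expg2 -?expgS y2.
  have xi : (x^-1 = x ^+ n.-1)%g by apply/eqP; rewrite eq_invg_mul -expgS prednK // xn.
  by rewrite -xi -xy /conjg yi -!mulgA -expg2 y2 mulg1.
split=> // g.
pose S := [set (x ^+ (nat_of_ord p.1) * y ^+ (nat_of_bool p.2))%g | p : 'I_n * bool].
have Sx i j : (x ^+ i * y ^+ j)%g \in S.
  apply/imsetP; exists (Ordinal (ltn_pmod i n0), odd j) => //=.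
  by rewrite (expg_mod i xn) -modn2 (expg_mod j y2).
have yxi i : (y * x ^+ i = x ^+ (n.-1 * i) * y)%g.
  elim: i => [|i IH]; first by rewrite muln0 !expg0 mulg1 mul1g.
  by rewrite expgSr mulgA IH -mulgA yx mulgA -expgD mulnS addnC.
have Syx j i : exists k, (y ^+ j * x ^+ i = x ^+ k * y ^+ j)%g.
  elim: j i => [|j IH] i; first by exists i; rewrite !expg0 mulg1 mul1g.
  by have [k e] := IH (n.-1 * i)%N; exists k; rewrite expgSr -mulgA yxi mulgA e -mulgA.
have gS : group_set S.
  apply/group_setP; split; first by have := Sx 0%N 0%N; rewrite !expg0 mulg1.
  move=> _ _ /imsetP[[i j] _ ->] /imsetP[[i' j'] _ ->] /=.
  have [k e] := Syx j i'.
  by rewrite mulgA -(mulgA (x ^+ i)%g) e !mulgA -expgD -mulgA -expgD.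
have : g \in (<[x]> <*> <[y]>)%g by rewrite defG inE.
have sub : (<[x]> <*> <[y]> \subset Group gS)%g.
  rewrite join_subG !cycle_subG; apply/andP; split.
    by have := Sx 1%N 0%N; rewrite expg0 mulg1 expg1.
  by have := Sx 0%N 1%N; rewrite expg0 mul1g expg1.
by move=> /(fintype.subsetP sub) /imsetP[[i j] _ ->]; exists i, j.
Qed.

Lemma dihedral_card : #|D| = n.*2.
Proof. by rewrite -cardsT card_dihedral // (leq_trans _ hn). Qed.

(** The map (i, j) -> x^i y^j is onto and both sides have 2n elements, so the exponents are well
    defined. They multiply by the same rule as those of [sym_mx]. *)
Lemma symmetry_group : exists h : (D * 'Z_2)%type -> 'M[R]_3,
  [/\ injective h, forall x y, h (x * y)%g = h x *m h y,
      forall g, exists i j k, h g = sym_mx i j k &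
      forall i j k, exists g, h g = sym_mx i j k].
Proof.
have n0 : (0 < n)%N by rewrite (leq_trans _ hn).
have [x [y [xn y2 yx gen]]] := dihedral_param.
pose K (p : 'I_n * bool) : D := (x ^+ (nat_of_ord p.1) * y ^+ (nat_of_bool p.2))%g.
have Ksurj g : exists p, K p = g by have [i [j ->]] := gen g; exists (i, j).
have [J KJ] := choice Ksurj.
have [K' _ JK'] : bijective J.
  apply: inj_card_bij; first exact: can_inj KJ.
  by rewrite dihedral_card card_prod card_ord card_bool muln2.
have JK p : J (K p) = p by rewrite -[in LHS](JK' p) KJ JK'.
pose h (g : (D * 'Z_2)%type) := sym_mx (J g.1).1 (J g.1).2 (g.2 != 0).
have KM (p q : 'I_n * bool) : (K p * K q)%g =
  K (Ordinal (ltn_pmod (p.1 + (if p.2 then n.-1 * q.1 else q.1))%N n0), p.2 (+) q.2).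
  have yxi i : (y * x ^+ i = x ^+ (n.-1 * i) * y)%g.
    elim: i => [|i IH]; first by rewrite muln0 !expg0 mulg1 mul1g.
    by rewrite expgSr mulgA IH -mulgA yx mulgA -expgD mulnS addnC.
  case: p q => [i j] [i' j']; rewrite /K /= (expg_mod _ xn) expgD.
  case: j; rewrite ?expg1 ?expg0 ?mulg1 /=; last by rewrite !mulgA.
  rewrite mulgA -(mulgA _ y) yxi !mulgA -!mulgA; congr (_ * (_ * _))%g.
  by case: j'; rewrite ?expg1 ?expg0 ?mulg1 // -expg2 y2.
exists h; split.
- move=> [g k] [g' k'] /sym_mx_inj[] //= e1 e2 e3.
  have -> : g = g' by rewrite -(KJ g) -(KJ g'); congr K; apply: injective_projections => //; exact: val_inj.
  congr (_, _); apply: val_inj; move: e3.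
  by case: k => -[|[|//]] ?; case: k' => -[|[|//]] ?.
- move=> [g k] [g' k']; rewrite /h sym_mxM /=.
  have -> : J (g * g')%g = (Ordinal (ltn_pmod ((J g).1 + (if (J g).2 then n.-1 * (J g').1 else (J g').1))%N n0), (J g).2 (+) (J g').2).
    by rewrite -[in LHS](KJ g) -[in LHS](KJ g') KM JK.
  rewrite /= sym_mx_mod; congr (sym_mx _ _ _).
  by case: k => -[|[|//]] ?; case: k' => -[|[|//]] ?.
- by move=> [g k]; exists (J g).1, (J g).2, (k != 0).
move=> i j k; exists (K (Ordinal (ltn_pmod i n0), j), if k then 1 else 0).
by rewrite /h /= JK /= sym_mx_mod; case: k.
Qed.

Lemma sym_mx_gens : [/\ sym_mx 0 false true = sg, sym_mx 1 false false = rot beta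
  & sym_mx 0 true false = ta].
Proof. by rewrite /sym_mx !mulr0 mulr1 rot0 !mulmx1 !mul1mx. Qed.

(** The matrices [sym_mx i j k] already form a group, closure under inverses being read off from the
    abstract group through [h]. *)
Lemma generated_sym_mx (A : 'M[R]_3) :
  matrix_group_generated [set sg; rot beta; ta] A <-> exists i j k, A = sym_mx i j k.
Proof.
have [g1 g2 g3] := sym_mx_gens.
have [h [_ hM h1 h2]] := symmetry_group.
have one : sym_mx 0 false false = 1%:M by rewrite /sym_mx mulr0 rot0 !mulmx1.
split=> [GA|[i [j [k ->]]]].
  have := @smallest_sub _ (@is_matrix_group R) [set sg; rot beta; ta]
    [set A | exists i j k, A = sym_mx i j k].
  apply=> //; first split.
  - by exists 0%N, false, false.
  - move=> _ _ [i [j [k ->]]] [i' [j' [k' ->]]]; rewrite sym_mxM.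
    by do 3!eexists.
  - move=> _ [i [j [k ->]]]; have [g <-] := h2 i j k.
    have e1 : h 1%g = 1%:M.
      have [g0 e0] := h2 0%N false false; rewrite one in e0.
      by have := hM g0 1%g; rewrite mulg1 e0 mul1mx => <-.
    have e : h g *m h (g^-1)%g = 1%:M by rewrite -hM mulgV.
    have [u _] := mulmx1_unit e; split=> //.
    have -> : invmx (h g) = h (g^-1)%g by rewrite -[LHS]mulmx1 -e mulmxA mulVmx // mul1mx.
    by have [i' [j' [k' ->]]] := h1 (g^-1)%g; do 3!eexists.
  - move=> B [[->|->]|->].
    + by exists 0%N, false, true.
    + by exists 1%N, false, false.
    + by exists 0%N, true, false.
move=> M [[M1 MM MV] sub].
have Ms : M sg by apply: sub; left; left.
have Mr : M (rot beta) by apply: sub; left; right.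
have Mt : M ta by apply: sub; right.
have Mi m : M (rot (beta * m%:R)).
  elim: m => [|m IH]; first by rewrite mulr0 rot0.
  have -> : beta * m.+1%:R = beta * m%:R + beta :> R by rewrite -[m.+1]addn1 natrD; ring.
  by rewrite -rotD; exact: MM.
by rewrite /sym_mx; apply: (MM); [apply: (MM) => //; case: j|case: k].
Qed.

End Group.

(** * The n-oid of genus one *)

Section OidSurface.
Variable R : realType.
Local Notation C := R[i].
Local Notation Ct := (R[i]^o).
Local Notation tpi := (tpi R).
Implicit Types (z w v : C).
Variable n : nat.
Hypothesis hn : (3 <= n)%N.
Variable W : weier (oid_angle R n).
Local Notation L := (wl W).
Local Notation lat := (lat L).
Local Notation nlat := [set z : C | ~ lat z].
Variables X1 X2 X3 : C -> R.
Hypothesis op : oid_pot W X1 X2 X3.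
Local Notation Xo := (oid W X1 X2 X3).
Local Notation beta := (2 * pi / n%:R : R).
Local Notation smx := (sym_mx R n).

Let L0 : 0 < L := wl_gt0 W.
Let n0 : 0 < n%:R :> R. Proof. by rewrite ltr0n (leq_trans _ hn). Qed.
Let nn : n%:R != 0 :> R. Proof. by rewrite gt_eqF. Qed.
(** Half of the horizontal period 2nL, as [cov] is parametrised by half its period. *)
Definition half_period : R := n%:R * L.
Local Notation b := half_period.
Lemma half_period_gt0 : 0 < b. Proof. by rewrite mulr_gt0. Qed.
Let b0 := half_period_gt0.
Let bn : b != 0. Proof. by rewrite gt_eqF. Qed.
Local Notation cv := (cov b).
Definition oidM : riemannSurface R := Tsurf half_period_gt0.

Lemma ex_2pi (k : int) : ex (2 * pi * k%:~R) = 1 :> C.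
Proof.
apply: eqC; have := @cexp_tpiz R 0 k; rewrite cexp0 add0r tpiz => /(congr1 (fun v => (Re v, Im v))) [];
  by rewrite Re_cexp Im_cexp /= expR0 !mul1r.
Qed.

Lemma cov_lattice z w : cv z = cv w ->
  exists j k : int, w = z + ((- (2 * L * n%:R))%:C) *~ j + tpi *~ k.
Proof.
move=> /cov_eqP[e1 e2].
have [j hj] := ex_eq1 (ex_div (esym e1)); have [k hk] := ex_eq1 (ex_div (esym e2)).
exists (- j), k; have jE : ((- (2 * L * n%:R))%:C : C) *~ (- j) = ((2 * L * n%:R) * j%:~R)%:C.
  by rewrite realCN mulNrz mulrNz opprK [RHS]realCM rmorph_int mulrzr.
rewrite jE tpiz; apply: eqC; rewrite !(ReD, ImD) /= ?addr0.
  have gn (x u v p m : R) : x != 0 -> p != 0 -> p / x * u - p / x * v = 2 * p * m -> u = v + 2 * (x * m).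
    move=> x0 p0 e; have : p * (u - v) = p * (2 * (x * m)).
      have -> : p * (u - v) = x * (p / x * u - p / x * v) by field.
      by rewrite e; ring.
    by move/(mulfI p0); lra.
  rewrite (gn _ _ _ _ _ bn _ hj) ?gt_eqF ?pi_gt0 // /half_period; ring.
by rewrite -hk; ring.
Qed.

Lemma lat_shift_nat (i : nat) z : lat (z + (- (2 * L * i%:R))%:C) <-> lat z.
Proof.
elim: i => [|i IH]; first by rewrite mulr0 oppr0 addr0.
have -> : z + (- (2 * L * i.+1%:R))%:C = (z + (- (2 * L * i%:R))%:C) + (- (2 * L))%:C.
  by rewrite -addrA -realCD -[i.+1]addn1 natrD; congr (_ + _%:C); ring.
by rewrite lat_shift.
Qed.

Lemma oid_shift1 z : Xo (z + (- (2 * L))%:C) = Xo z *m smx 1 false false.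
Proof.
have [lz|nz] := pselect (lat z).
  by rewrite /oid !asboolT ?mul0mx //; exact/lat_shift.
rewrite !oidE //; last by move=> /lat_shift.
have [-> -> ->] := op_shift op nz; rewrite sym_mx_rv !expr0 !mul1r mulr1.
have -> : oid_angle R n + oid_angle R n = beta by rewrite /oid_angle; field.
by [].
Qed.

Lemma oid_shift_nat (i : nat) z : Xo (z + (- (2 * L * i%:R))%:C) = Xo z *m smx i false false.
Proof.
elim: i => [|i IH].
  rewrite mulr0 oppr0 addr0 (_ : smx 0 false false = 1%:M) ?mulmx1 //.
  by rewrite /sym_mx mulr0 rot0 !mulmx1.
have -> : z + (- (2 * L * i.+1%:R))%:C = (z + (- (2 * L * i%:R))%:C) + (- (2 * L))%:C.
  by rewrite -addrA -realCD -[i.+1]addn1 natrD; congr (_ + _%:C); ring.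
rewrite oid_shift1 IH -mulmxA sym_mxM // addn1 //.
Qed.

Lemma oid_tpi z : Xo (z + tpi) = Xo z.
Proof.
have [lz|nz] := pselect (lat z); first by rewrite /oid !asboolT //; exact/lat_tpi.
rewrite !oidE //; last by move=> /lat_tpi.
by have [-> -> ->] := op_tpi op nz.
Qed.

(** Two points over the same point of the torus differ by multiples of 2nL and of [tpi]; n
    translations by 2L amount to a full turn, so the map descends to the torus. *)
Lemma oid_cov z w : cv z = cv w -> Xo z = Xo w /\ (lat z <-> lat w).
Proof.
move=> /cov_lattice[j [k ->]].
have sn u : Xo (u + (- (2 * L * n%:R))%:C) = Xo u.
  by rewrite oid_shift_nat -sym_mx_mod // modnn /sym_mx mulr0 rot0 !mulmx1.
have ln u : lat (u + (- (2 * L * n%:R))%:C) <-> lat u by exact: lat_shift_nat.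
have tt (h u : C) : setT (u + h) <-> setT u by [].
split.
  rewrite (@per_int R _ Xo setT tpi (tt _) (fun u _ => oid_tpi u)) //.
  by rewrite (@per_int R _ Xo setT _ (tt _) (fun u _ => sn u)).
have pp (h : C) : (forall u, lat (u + h) <-> lat u) -> forall u (m : int), lat (u + h *~ m) <-> lat u.
  move=> H u m; have := @per_int R _ (fun u => `[< lat u >]) setT h (tt _).
  move=> K; have E : `[< lat (u + h *~ m) >] = `[< lat u >].
    by apply: K => // x _; apply/asboolP/asboolP => /H.
  by split=> /asboolP; [rewrite E|rewrite -E] => /asboolP.
by rewrite pp ?pp //; move=> u; exact: lat_tpi.
Qed.

(** An arbitrary choice of preimage; the default 0 is never reached since [cov] is onto. *)
Definition oid_lift (x : oidM) : C := xget 0 [set z | cv z = x].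

Lemma oid_liftK x : cv (oid_lift x) = x.
Proof. by rewrite /oid_lift; case: xgetP => // H; have [z e] := cov_surj b0 x; case: (H z). Qed.

Definition oidX (x : oidM) : 'rV[R]_3 := Xo (oid_lift x).

Lemma oidX_cov z : oidX (cv z) = Xo z.
Proof. by have [] := oid_cov (oid_liftK (cv z)). Qed.

Definition oid_end_pt (i : 'I_n) : oidM := cv (2 * L * i%:R)%:C.
Local Notation P := (range oid_end_pt).

Lemma lat_real (j : int) : lat (2 * L * j%:~R)%:C.
Proof. by exists j; rewrite cexp_real. Qed.

(** The lattice 2L Z + 2 pi i Z contains the periods 2nL and 2 pi i, and the remainder of the index
    modulo n selects one of the n classes. *)
Lemma oid_end_ptP z : P (cv z) <-> lat z.
Proof.
split=> [[i _ e]|[j e]].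
  by have [_ h] := oid_cov e; apply/h; have := lat_real (Posz i).
have rz : Re z = 2 * L * j%:~R by rewrite (@cexp_Re R z (2 * L * j%:~R)%:C) // e cexp_real.
have iz : ex (Im z) = 1.
  have e0 := expR_gt0 (Re z); have := e; rewrite -rz => e'.
  have e1 := congr1 (fun v => Re v) e'; have e2 := congr1 (fun v => Im v) e'.
  rewrite Re_cexp ReC in e1; rewrite Im_cexp ImC in e2.
  apply: eqC.
    by change (cos (Im z) = 1); apply: (mulfI (lt0r_neq0 e0)); rewrite e1 mulr1.
  by change (sin (Im z) = 0); apply: (mulfI (lt0r_neq0 e0)); rewrite e2 mulr0.
pose m := absz (modz j n).
have n1 : (0 < n)%N by rewrite (leq_trans _ hn).
have mn : (m < n)%N.
  by rewrite -ltz_nat /m gez0_abs ?ltz_pmod // modz_ge0 // -lt0n.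
exists (Ordinal mn) => //; apply/cov_eqP; rewrite ReC ImC rz iz ex0 //; split=> //=.
have jE : (j%:~R : R) = (divz j n)%:~R * n%:R + m%:R.
  rewrite [in LHS](divz_eq j n) intrD intrM; congr (_ * _ + _).
  by rewrite -[in RHS](_ : (m%:Z)%:~R = m%:R) // /m gez0_abs // modz_ge0 // -lt0n.
have -> : pi / b * (2 * L * j%:~R) = 2 * pi * (divz j n)%:~R + pi / b * (2 * L * m%:R).
  rewrite jE /half_period; field; rewrite nn gt_eqF //.
by rewrite exD ex_2pi mul1r.
Qed.

Lemma oid_end_pt_inj : injective oid_end_pt.
Proof.
move=> i i' /cov_eqP[+ _]; rewrite !ReC => /ex_div/ex_eq1[k e].
have {}e : (i%:R - i'%:R : R) = k%:~R * n%:R.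
  have p0 : pi != 0 :> R by rewrite gt_eqF // pi_gt0.
  have gn (p l u v m q : R) : p != 0 -> l != 0 -> m != 0 ->
      p / (m * l) * (2 * l * u) - p / (m * l) * (2 * l * v) = 2 * p * q -> u - v = q * m.
    move=> q1 q2 q3 h; have : 2 * p * (u - v) = 2 * p * (q * m).
      have -> : 2 * p * (u - v) = m * (p / (m * l) * (2 * l * u) - p / (m * l) * (2 * l * v)).
        by field; rewrite q2 q3.
      by rewrite h; ring.
    by apply: mulfI; rewrite mulf_neq0 ?pnatr_eq0.
  by apply: gn e => //; rewrite gt_eqF.
have e2 : ((i : int) - (i' : int) = k * (n : int))%R.
  by apply/eqP; rewrite -(eqr_int R) intrB intrM e.
apply: ord_inj; have := ltn_ord i; have := ltn_ord i'; move: e2; clear.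
move: (nat_of_ord i) (nat_of_ord i') => x y; case: k => k e h1 h2; last by exfalso; nia.
by case: k e => [|k] e; [lia|exfalso; nia].
Qed.

(** The lifts to the plane of all the symmetries: a real translation followed by z -> - conj z if j,
    and by conjugation if k. They are isometries of the plane and respect the periods. *)
Definition afs (j k : bool) (c : R) z : C := ((-1) ^+ j * (Re z + c)) +i* ((-1) ^+ k * Im z).

Let sg2 (j : bool) (x : R) : (-1) ^+ j * ((-1) ^+ j * x) = x.
Proof. by rewrite mulrA -expr2 sqrr_sign mul1r. Qed.

Lemma afsK j k c : cancel (afs j k c) (afs j k (- ((-1) ^+ j * c))).
Proof.
move=> z; apply: eqC; rewrite /afs ?ReC ?ImC ?sg2 //.
by rewrite mulrDr sg2 mulrN sg2 addrK.
Qed.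

Lemma afsK' j k c : cancel (afs j k (- ((-1) ^+ j * c))) (afs j k c).
Proof.
have := @afsK j k (- ((-1) ^+ j * c)).
by rewrite mulrN sg2 opprK.
Qed.

Let ex_sign (j : bool) (x y : R) : ex x = ex y -> ex ((-1) ^+ j * x) = ex ((-1) ^+ j * y).
Proof. by case: j => e; rewrite ?expr1 ?expr0 ?mulN1r ?mul1r // !exN e. Qed.

Lemma cov_afs j k c z w : cv z = cv w -> cv (afs j k c z) = cv (afs j k c w).
Proof.
move=> /cov_eqP[e1 e2]; apply/cov_eqP; rewrite /afs ?ReC ?ImC; split; last exact: ex_sign.
rewrite !(mulrCA (pi / b)); apply: ex_sign; rewrite !mulrDr !exD e1 //.
Qed.

Lemma cabs_afs j k c z w : cabs (afs j k c z - afs j k c w) = cabs (z - w).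
Proof.
apply/eqP; rewrite -(eqrXn2 (ltn0Sn 1)) ?cabs_ge0 // !cabs_sqr /afs !(ReD, ImD, ReN, ImN) ?ReC ?ImC.
rewrite -!mulrBr !exprMn !sqrr_sign !mul1r; apply/eqP; ring.
Qed.

Lemma cont_afs j k c : continuous (afs j k c : Ct -> Ct).
Proof.
move=> z; apply/continuousCP => e e0; apply: filterS (near_ball_C z e0) => w.
by rewrite cabs_afs.
Qed.

Definition oid_map j k c (x : oidM) : oidM := cv (afs j k c (oid_lift x)).

Lemma oid_map_cov j k c z : oid_map j k c (cv z) = cv (afs j k c z).
Proof. by apply: cov_afs; exact: oid_liftK. Qed.

Lemma oid_cov_near (x : oidM) : exists2 z, cv z = x & exists2 g : oidM -> Ct,
  {for x, continuous g} & \forall y \near x, cv (g y) = y.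
Proof.
have [c [k [l ->]] d] := tcover b0 x.
exists (tcoord b (center b k l) x); first by have [] := tdom_coord b0 d.
exists (tcoord b (center b k l)); first exact: (tcoord_continuous d).
apply: filterS (open_nbhs_nbhs (conj (@open_tdom R b (center b k l)) d)) => y dy.
by have [] := tdom_coord b0 dy.
Qed.

Lemma oid_map_continuous j k c : continuous (oid_map j k c).
Proof.
move=> x; have [z zx [g cg gy]] := oid_cov_near x.
have cF : {for x, continuous (fun y => cv (afs j k c (g y)) : oidM)}.
  apply: (@continuous_comp oidM Ct oidM (fun y => afs j k c (g y)) cv); last exact: continuous_cov.
  exact: (@continuous_comp oidM Ct Ct g (afs j k c) x cg (@cont_afs j k c (g x))).
have E : \forall y \near x, cv (afs j k c (g y)) = oid_map j k c y.
  by apply: filterS gy => y e; rewrite -[in RHS]e oid_map_cov.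
change (oid_map j k c @ x --> oid_map j k c x); rewrite -(nbhs_singleton E).
move=> A nA; have H : \forall y \near x, A (cv (afs j k c (g y))) := cF A nA.
change (\forall y \near x, A (oid_map j k c y)).
by apply: filterS2 E H => y <-.
Qed.

(** Read in charts the map is [afs] followed by a translation near every point, hence locally
    affine. *)
Lemma oid_map_smooth j k c : smooth_map P (oid_map j k c).
Proof.
split=> [x _|d1 d2 [k1 [l1 ->]] [k2 [l2 ->]] D f]; first exact: oid_map_continuous.
set c1 := center b k1 l1 in D f *; set c2 := center b k2 l2 in D f *.
pose D' : set Ct := box b c1 `&` nlat `&` ((fun z => cv (afs j k c z)) @^-1` tdom b c2).
have DE : D = D'.
  apply/seteqP; split=> [_ [x [d nP d'] <-]|z [[bz nz] dz]].
    have [bx e] := tdom_coord b0 d; split; first split => //.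
      by move=> /oid_end_ptP; rewrite [cv _]e.
    by move: d'; rewrite /= -[in X in X -> _]e oid_map_cov.
  have [d e] := tcoord_cov b0 bz; exists (cv z) => //; split=> //.
    by move=> /oid_end_ptP.
  by rewrite oid_map_cov.
have oD : open D'.
  apply: openI; first by apply: openI; [exact: open_box|exact: open_nlat].
  apply: open_comp; last exact: open_tdom.
  move=> z _; apply: (@continuous_comp Ct Ct (Tr R) (afs j k c) cv); [exact: cont_afs|exact: continuous_cov].
have loc z : D' z -> exists r h, 0 < r /\ forall v, cabs (v - z) < r -> f v = afs j k c v + h.
  move=> [_ dz]; have [r r0 Hr] := tcoord_local b0 dz.
  exists r, (tcoord b c2 (cv (afs j k c z)) - afs j k c z); split=> // v vr.
  have := Hr (afs j k c v); rewrite cabs_afs => /(_ vr)[_ <-].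
  by rewrite /f /= oid_map_cov.
rewrite DE; split=> m; apply: class_affine => // z /loc[r [h [r0 H]]].
  exists r, ((-1) ^+ j), 0, ((-1) ^+ j * c + Re h); split=> // v /H ->.
  by rewrite ReD /afs ReC; ring.
exists r, 0, ((-1) ^+ k), (Im h); split=> // v /H ->.
by rewrite ImD /afs ImC; ring.
Qed.

Lemma oid_invariant j k c A : (forall z, lat (afs j k c z) <-> lat z) ->
  (forall z, Xo (afs j k c z) = Xo z *m A) -> invariant_under P oidX A.
Proof.
move=> la XA; exists (oid_map j k c).
  exists (oid_map j k (- ((-1) ^+ j * c))); split.
  - move=> x; rewrite -(oid_liftK x) oid_map_cov => /oid_end_ptP nx; split.
      by move=> /oid_end_ptP/la.
    by rewrite oid_map_cov afsK.
  - move=> x; rewrite -(oid_liftK x) oid_map_cov => /oid_end_ptP nx; split.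
      by move=> /oid_end_ptP/la; rewrite afsK'.
    by rewrite oid_map_cov afsK'.
  - exact: oid_map_smooth.
  - exact: oid_map_smooth.
by move=> x _; rewrite -(oid_liftK x) oid_map_cov !oidX_cov.
Qed.

Lemma oid_sym (i : nat) (j k : bool) : exists c,
  (forall z, lat (afs j k c z) <-> lat z) /\ (forall z, Xo (afs j k c z) = Xo z *m smx i j k).
Proof.
pose c : R := - (2 * L * i%:R); exists c.
have lc z : lat (z + c%:C) <-> lat z by exact: lat_shift_nat.
have lcj z : lat (conjc z) <-> lat z by exact: lat_conj.
have lrf z : lat (- conjc z) <-> lat z by rewrite lat_neg lat_conj.
have Xr z : Xo (- conjc z) = Xo z *m reflection_mx (axis2 R).
  have [lz|nz] := pselect (lat z).
    by rewrite /oid !asboolT ?mul0mx //; exact/lrf.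
  rewrite !oidE //; last by move=> /lrf.
  by have [-> -> ->] := op_refl op nz; rewrite mul_refl2.
have Xc z : Xo (conjc z) = Xo z *m reflection_mx (axis3 R).
  have [lz|nz] := pselect (lat z).
    by rewrite /oid !asboolT ?mul0mx //; exact/lcj.
  rewrite !oidE //; last by move=> /lcj.
  by have [-> -> ->] := op_conj op nz; rewrite mul_refl3.
have E z : afs j k c z = (if k then conjc else id) ((if j then fun v => - conjc v else id) (z + c%:C)).
  by apply: eqC; rewrite /afs ?ReC ?ImC; case: (j); case: (k);
    rewrite ?expr0 ?expr1 ?mul1r ?mulN1r /= ?Re_conj ?Im_conj ?ReN ?ImN ?Re_conj ?Im_conj ?ReD ?ImD /= ?addr0 ?opprK.
split=> z; rewrite E.
  by case: (j); case: (k); rewrite ?lcj ?lrf ?lc.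
have Xs := oid_shift_nat i z; rewrite -/c in Xs.
have -> : smx i j k = smx i false false *m (if j then reflection_mx (axis2 R) else 1%:M)
    *m (if k then reflection_mx (axis3 R) else 1%:M) by rewrite /sym_mx !mulmx1.
move: Xs; move: (smx i false false) => Y Xs; rewrite !mulmxA -Xs.
by case: (j); case: (k); rewrite ?mulmx1 ?Xc ?Xr.
Qed.

Lemma oid_sym_invariant i j k : invariant_under P oidX (smx i j k).
Proof. by have [c [h1 h2]] := oid_sym i j k; exact: oid_invariant h1 h2. Qed.

Lemma class_C_sub (V : normedModType R) m (D D' : set Ct) (F : Ct -> V) : D' `<=` D ->
  class_C m D F -> class_C m D' F.
Proof.
move=> DD; elim: m F => [|m IH] F [cF Hm]; split=> //; try by move=> z /DD; exact: cF.
move=> w ww; have [h1 h2] := Hm w ww; split; last exact: IH.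
by move=> z /DD; exact: h1.
Qed.

Lemma oidX_param c : oidX \o (@param R oidM (tchart b0 c)) = Xo.
Proof. by apply/funext => z; exact: oidX_cov. Qed.

Lemma oid_chart_nlat c z : (@coord R oidM (tchart b0 c) @` (dom (tchart b0 c) `\` P)) z ->
  box b c z /\ ~ lat z.
Proof.
move=> [x [d nP] <-]; have [bx e] := tdom_coord b0 d; split=> //.
by move=> /oid_end_ptP; rewrite [cv _]e.
Qed.

Lemma oid_minimal : minimal_immersion P oidX.
Proof.
move=> _ [k [l ->]] D F; rewrite /F oidX_param; split.
  move=> m; apply: (class_C_sub (D := nlat)); first by move=> z /oid_chart_nlat[].
  exact: (oid_smooth (op1 op) (op2 op) (op3 op)).
move=> z /oid_chart_nlat[_ nz]; split.
- exact: (oid_immersed (op1 op) (op2 op) (op3 op) nz).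
- exact: (oid_conformal (op1 op) (op2 op) (op3 op) nz).
- by have [bd [_ _ /(_ z nz)[]]] := oid_curvature (op1 op) (op2 op) (op3 op).
Qed.

(** Applied with a period as h, this makes the normal at a point of the torus independent of the
    chosen lift. *)
Lemma unit_normal_translate (F : Ct -> 'rV[R]_3) h z : (forall v, F (v + h) = F v) ->
  unit_normal F (z + h) = unit_normal F z.
Proof.
move=> FF; have pe w : partial w F (z + h) = partial w F z.
  have e : (fun t : R^o => F (z + h + t%:C * w)) = (fun t : R^o => F (z + t%:C * w)).
    by apply/funext => t; rewrite -[in RHS]FF; congr F; ring.
  by rewrite /partial e.
by rewrite /unit_normal /Fu /Fv !pe.
Qed.

Lemma oid_gauss_map : is_gauss_map P oidX (fun x => unit_normal (Xo : Ct -> _) (oid_lift x)).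
Proof.
move=> _ x [k [l ->]] d nP; rewrite oidX_param.
have [_ e] := tdom_coord b0 d; set z := tcoord _ _ x in e.
have e' : cv (oid_lift x) = cv z by rewrite oid_liftK.
rewrite (_ : oid_lift x = z + (oid_lift x - z)); last by ring.
apply: unit_normal_translate => v.
by have [->] := oid_cov (cov_translate v (esym e')).
Qed.

Lemma oid_normal_continuous z : {for (z : Ct), continuous (oid_normal W : Ct -> 'rV[R]_3)}.
Proof.
have c1 := hol_continuous (@w1_hol R _ W 0%N setT) (Logic.I : setT z).
have c2 := hol_continuous (@w2_hol R _ W 0%N setT) (Logic.I : setT z).
have c3 : {for (z : Ct), continuous ((fun v => w1 W v * conjc (w2 W v)) : Ct -> Ct)}.
  apply: (@continuousM R[i] Ct (w1 W) (fun v => conjc (w2 W v)) z c1).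
  exact: (@continuous_comp Ct Ct Ct (w2 W) conjc z c2 (@continuous_conj R _)).
have a1 : {for (z : Ct), continuous ((fun v => cabs (w1 W v)) : Ct -> R)}.
  exact: (@continuous_comp Ct Ct R (w1 W) cabs z c1 (@continuous_cabs R _)).
have a2 : {for (z : Ct), continuous ((fun v => cabs (w2 W v)) : Ct -> R)}.
  exact: (@continuous_comp Ct Ct R (w2 W) cabs z c2 (@continuous_cabs R _)).
have b1 : {for (z : Ct), continuous ((fun v => cabs (w1 W v) ^+ 2) : Ct -> R)}.
  exact: (@continuousM R Ct _ _ z a1 a1).
have b2 : {for (z : Ct), continuous ((fun v => cabs (w2 W v) ^+ 2) : Ct -> R)}.
  exact: (@continuousM R Ct _ _ z a2 a2).
have d0 : {for (z : Ct), continuous ((fun v => (snrm (w1 W v) (w2 W v))^-1) : Ct -> R)}.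
  apply: (@continuousV R Ct (fun v => snrm (w1 W v) (w2 W v)) z).
    by rewrite gt_eqF // snrm_gt0 //; exact: w12_neq0.
  exact: (@continuousD R R^o Ct _ _ z b1 b2).
have e1 : {for (z : Ct), continuous ((fun v => snum1 (w1 W v) (w2 W v)) : Ct -> R)}.
  apply: (@continuousM R Ct (fun=> 2) (fun v => Re (w1 W v * conjc (w2 W v)))); first exact: cst_continuous.
  exact: (@continuous_comp Ct Ct R _ Re z c3 (@continuous_Re R _)).
have e2 : {for (z : Ct), continuous ((fun v => snum2 (w1 W v) (w2 W v)) : Ct -> R)}.
  apply: (@continuousM R Ct (fun=> 2) (fun v => Im (w1 W v * conjc (w2 W v)))); first exact: cst_continuous.
  exact: (@continuous_comp Ct Ct R _ Im z c3 (@continuous_Im R _)).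
have e3 : {for (z : Ct), continuous ((fun v => snum3 (w1 W v) (w2 W v)) : Ct -> R)}.
  exact: (@continuousB R R^o Ct _ _ z b1 b2).
apply: (cvg_rv3 (nbhs_filter (z : Ct))).
- exact: (@continuousM R Ct _ _ z e1 d0).
- exact: (@continuousM R Ct _ _ z e2 d0).
- exact: (@continuousM R Ct _ _ z e3 d0).
Qed.

(** The covering is a local homeomorphism: a chart coordinate translated to z0 is a continuous local
    section, so a disc in the plane tests a neighbourhood in the torus. *)
Lemma near_cov z0 (Q : oidM -> Prop) r : 0 < r ->
  (forall z, cabs (z - z0) < r -> Q (cv z)) -> \forall x \near (cv z0 : oidM), Q x.
Proof.
move=> r0 H; have [c [k [l ->]] d] := tcover b0 (cv z0 : oidM).
set c1 := center b k l in d; have [bx e] := tdom_coord b0 d.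
set h := tcoord b c1 (cv z0 : oidM) - z0.
have ct := tcoord_continuous d.
have : \forall x \near (cv z0 : oidM), cabs (tcoord b c1 x - tcoord b c1 (cv z0 : oidM)) < r.
  exact: (ct _ (near_ball_C (tcoord b c1 (cv z0 : oidM)) r0)).
apply: filterS2 (open_nbhs_nbhs (conj (@open_tdom R b c1) d)) => x dx xr.
have [_ ex'] := tdom_coord b0 dx; rewrite -ex'.
have -> : cv (tcoord b c1 x) = cv (tcoord b c1 x + (z0 - tcoord b c1 (cv z0 : oidM))).
  by rewrite (cov_translate _ e).
by apply: H; rewrite (_ : _ - _ = tcoord b c1 x - tcoord b c1 (cv z0 : oidM)) //; ring.
Qed.

(** Off the lattice the unit normal is [oid_normal], which depends on the two spinors alone and is
    therefore continuous at the lattice points as well. *)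
Lemma oid_limiting_normal (i : 'I_n) :
  limiting_normal P oidX (oid_end_pt i) (oid_normal W (2 * L * i%:R)%:C).
Proof.
eexists; first exact: oid_gauss_map.
set z0 : C := (2 * L * i%:R)%:C.
have E z : ~ lat z -> unit_normal (Xo : Ct -> _) (oid_lift (cv z)) = oid_normal W z.
  move=> nz; have e : cv z = cv (oid_lift (cv z)) by rewrite oid_liftK.
  rewrite (_ : oid_lift (cv z) = z + (oid_lift (cv z) - z)); last by ring.
  rewrite unit_normal_translate; last by move=> v; have [] := oid_cov (cov_translate v e).
  by have [_ [_ _ _ ->]] := oid_local (op1 op) (op2 op) (op3 op) nz.
apply/cvgrPdist_lt => eps eps0.
have /cvgrPdist_lt /(_ eps eps0) := @oid_normal_continuous z0.
move=> /nbhsCP[r r0 Hr].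
have Q : \forall x \near (oid_end_pt i), x <> oid_end_pt i -> ~ P x ->
    `|oid_normal W z0 - unit_normal (Xo : Ct -> _) (oid_lift x)| < eps.
  by apply: (@near_cov z0 _ r r0) => z zr _ nP; rewrite E; [exact: Hr|move/oid_end_ptP].
(* Punctures are isolated, so points near the end and different from it are regular. *)
have PQ : \forall x \near (oid_end_pt i), x <> oid_end_pt i -> ~ P x.
  have [rho [rho0 nl _ _ _]] := oid_end op.
  apply: (@near_cov z0 _ rho rho0) => z zr ne /oid_end_ptP lz.
  have lz' : lat (z - z0).
    by rewrite -realCN; apply/lat_shift_nat.
  apply: (nl (z - z0)) lz'; rewrite /pdisc [mkset _ _]/mkset zr andbT cabs_gt0 subr_eq0.
  by apply/eqP => ez; apply: ne; rewrite ez.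
rewrite near_withinE; apply: filterS2 Q PQ => x q1 q2 /eqP ne.
by apply: q1 => //; exact: q2.
Qed.

End OidSurface.

(** * The n embedded ends and properness *)

Section Ends.
Variable R : realType.
Local Notation C := R[i].
Local Notation Ct := (R[i]^o).
Implicit Types (z w v u : C).
Variable n : nat.
Hypothesis hn : (3 <= n)%N.
Variable W : weier (oid_angle R n).
Local Notation L := (wl W).
Local Notation lat := (lat L).
Variables X1 X2 X3 : C -> R.
Hypothesis op : oid_pot W X1 X2 X3.
Local Notation Xo := (oid W X1 X2 X3).
Local Notation smx := (sym_mx R n).
Local Notation b := (half_period W).
Local Notation cv := (cov b).
Let b0 := half_period_gt0 hn W.
Local Notation M := (oidM hn W).
Local Notation X := (oidX (hn := hn) (W := W) X1 X2 X3).
Local Notation pt := (oid_end_pt hn W).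
Local Notation P := (range pt).

Let zi (i : 'I_n) : C := (2 * L * i%:R)%:C.
(** The exponent (n - 1) i stands for -i modulo n: moving by +2L i undoes the rotations produced by
    the translation by -2L. All ends are thus rotated copies of the end at 0. *)
Let rotA (i : 'I_n) : 'M[R]_3 := smx (n.-1 * i) false false.

Let Xrot (i : 'I_n) u : Xo (u + zi i) = Xo u *m rotA i.
Proof.
have e : Xo u = Xo (u + zi i) *m smx i false false.
  by rewrite -(oid_shift_nat hn op) /zi -addrA -realCD subrr addr0.
rewrite e -mulmxA sym_mxM //= -mulSn prednK ?(leq_trans _ hn) //.
by rewrite -sym_mx_mod // modnMr /sym_mx mulr0 rot0 !mulmx1.
Qed.

Lemma enorm_rot (x : 'rV[R]_3) m : enorm (x *m smx m false false) = enorm x.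
Proof.
rewrite -(rv3K x) sym_mx_rv !expr0 !mul1r !enormE !rv3E; congr Num.sqrt.
have g (c s p q r : R) : c ^+ 2 + s ^+ 2 = 1 ->
    (c * p - s * q) ^+ 2 + (s * p + c * q) ^+ 2 + r ^+ 2 = p ^+ 2 + q ^+ 2 + r ^+ 2.
  move=> e; have -> : (c * p - s * q) ^+ 2 + (s * p + c * q) ^+ 2 + r ^+ 2 =
    (c ^+ 2 + s ^+ 2) * (p ^+ 2 + q ^+ 2) + r ^+ 2 by ring.
  by rewrite e mul1r.
by apply: g; exact: cos2Dsin2.
Qed.

Let latzi (i : 'I_n) u : lat (u + zi i) <-> lat u.
Proof. by rewrite -(lat_shift_nat W i (u + zi i)) /zi -addrA -realCD subrr addr0. Qed.

Lemma oidX_continuous (x : M) : ~ P x -> {for x, continuous X}.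
Proof.
move=> nP; have [c [k [l ->]] d] := tcover b0 x; set c1 := center b k l in d.
have [bx e] := tdom_coord b0 d.
have nl : ~ lat (tcoord b c1 x) by move=> h; apply: nP; rewrite -e; exact/(oid_end_ptP hn op).
have cX : {for (tcoord b c1 x : Ct), continuous (Xo : Ct -> 'rV[R]_3)}.
  by have [h _] := oid_smooth (op1 op) (op2 op) (op3 op) 0; exact: h.
have cF : {for x, continuous (fun y : M => Xo (tcoord b c1 y))}.
  exact: (@continuous_comp M Ct _ (tcoord b c1) Xo x (tcoord_continuous d) cX).
apply: (@continuous_open_eq M _ (tdom b c1) (fun y : M => Xo (tcoord b c1 y)) X x (@open_tdom R b c1) d) cF.
move=> y dy; have [_ e'] := tdom_coord b0 dy.
by rewrite -[in RHS]e' (oidX_cov hn op).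
Qed.

(** Everything is transported from the end at 0 by a rotation, which preserves the Euclidean norm;
    the expansion estimate gives injectivity and the continuity of the inverse. *)
Lemma oid_embedded_end (i : 'I_n) : embedded_catenoid_end P X (pt i).
Proof.
have [rho [rho0 nl [E [a [T [a0 isoT EE]]] asy] lip _]] := oid_end op.
pose U : set M := [set x | exists u, cabs u < rho /\ cv (u + zi i) = x].
have inU u : cabs u < rho -> U (cv (u + zi i)) by exists u.
have nz u : cabs u < rho -> cv (u + zi i) <> pt i -> pdisc rho u.
  move=> ur ne; rewrite /pdisc [mkset _ _]/mkset ur andbT cabs_gt0.
  by apply/eqP => u0; apply: ne; rewrite u0 add0r.
have oU : open U.
  rewrite openE => _ [u [ur <-]]; have r0 : 0 < rho - cabs u by rewrite subr_gt0.
  apply: (@near_cov _ _ hn W (u + zi i) U _ r0) => z zr.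
  rewrite (_ : z = (z - zi i) + zi i); last by ring.
  apply: inU; rewrite (_ : z - zi i = (z - (u + zi i)) + u); last by ring.
  by rewrite (le_lt_trans (cabsD _ _)) // -ltrBrDr.
have Xu u : X (cv (u + zi i)) = Xo u *m rotA i by rewrite (oidX_cov hn op) Xrot.
have Ue x : (U `\ pt i) x -> exists2 u, pdisc rho u & cv (u + zi i) = x.
  by move=> [[u [ur <-]] ne]; exists u => //; exact: nz.
have eU u : pdisc rho u -> (U `\ pt i) (cv (u + zi i)).
  move=> Du; have [u0 ur] := andP Du; split; first exact: inU.
  move=> h; have /(oid_end_ptP hn op) : P (cv (u + zi i)) by rewrite h; exists i.
  by move=> /latzi; exact: nl.
have nP x : (U `\ pt i) x -> ~ P x.
  by move=> /Ue[u Du <-] /(oid_end_ptP hn op) /latzi; exact: nl.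
have dist u w : enorm (X (cv (u + zi i)) - X (cv (w + zi i))) = enorm (Xo u - Xo w).
  by rewrite !Xu -mulmxBl enorm_rot.
exists U; split=> //.
- by exists 0; rewrite cabs0 add0r.
- move=> x [[u [ur <-]] Px]; apply: contrapT => ne.
  by apply: (nP _ _ Px); split=> //; exact: inU.
- split.
  + move=> x y /set_mem /Ue[u Du <-] /set_mem /Ue[w Dw <-] e.
    have := lip u w Du Dw; rewrite -dist e subrr enorm0 => h.
    have : cabs (u - w) = 0 by apply/eqP; rewrite eq_le h cabs_ge0.
    by move/eqP; rewrite cabs_eq0 subr_eq0 => /eqP ->.
  + by move=> x /set_mem Vx; exact/oidX_continuous/nP.
  move=> O oO OV.
  pose good (p : C * R) := [/\ 0 < p.2, pdisc rho p.1 & forall z, cabs (z - p.1) < p.2 -> O (cv (z + zi i))].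
  (* Balls are taken in the sup norm; radius r/3 makes the Euclidean distance, at most the sum of
     three entries, smaller than r. *)
  pose O' := \bigcup_(p in good) ball (X (cv (p.1 + zi i))) (p.2 / 3).
  exists O'.
    by apply: bigcup_open => p [p0 _ _]; apply: ball_open; rewrite divr_gt0.
  apply/seteqP; split=> [_ [x Ox <-]|y0 [[p gp bp] [x Vx xe]]].
    split; last by exists x => //; exact: OV.
    have [u Du ux] := Ue x (OV x Ox).
    have : nbhs ((u + zi i) : Ct) (cv @^-1` O).
      by apply: (@continuous_cov R b (u + zi i)); rewrite ux; apply: open_nbhs_nbhs.
    move=> /nbhsCP[r r0 Hr]; exists (u, r); last by rewrite /= ux; apply: ballxx; rewrite divr_gt0.
    by split=> //= z zr; apply: Hr; rewrite (_ : _ - _ = z - u) //; ring.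
  move: p gp bp => [u r] [/= r0 Du Hr] bb.
  have [w Dw we] := Ue x Vx; exists x => //; rewrite -we; apply: Hr.
  apply: (le_lt_trans (lip w u Dw Du)); rewrite -dist we xe.
  move: bb; rewrite -ball_normE /= => bb.
  have ent (j : 'I_3) : `|(y0 - X (cv (u + zi i))) 0 j| < r / 3.
    have <- : `|(X (cv (u + zi i)) - y0) 0 j| = `|(y0 - X (cv (u + zi i))) 0 j| by rewrite !mxE distrC.
    apply: le_lt_trans bb.
    rewrite [leRHS]/Num.Def.normr/= mx_normrE.
    by have := @le_bigmax _ _ _ 0 (fun ij : 'I_1 * 'I_3 => `|(X (cv (u + zi i)) - y0) ij.1 ij.2|) (0, j).
  apply: (le_lt_trans (enorm_le _)).
  by have := ent 0; have := ent 1; have := ent 2; lra.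
exists ((fun x => x *m rotA i) @` E).
  exists a, (fun x => T x *m rotA i); split=> //.
    by move=> x y; rewrite -mulmxBl enorm_rot.
  by rewrite EE; apply/seteqP; split=> [_ [_ [v hv <-] <-]|_ [v hv <-]]; [exists v|exists (T v) => //; exists v].
move=> eps eps0; have [r [r1 r2]] := asy eps eps0; exists r; split.
  move=> _ [x /Ue[u Du <-] <-]; rewrite Xu enorm_rot => far.
  have [y Ey xy] := r1 (Xo u) (ex_intro2 _ _ u Du erefl) far.
  by exists (y *m rotA i); [exists y|rewrite -mulmxBl enorm_rot].
move=> _ [y Ey <-]; rewrite enorm_rot => far.
have [_ [u Du <-] xy] := r2 y Ey far.
exists (Xo u *m rotA i); last by rewrite -mulmxBl enorm_rot.
by exists (cv (u + zi i)); [exact: eU|exact: Xu].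
Qed.

(** The compact set is the torus without small discs around the punctures, inside which the
    expansion makes the norm exceed [B]. *)
Lemma oidX_proper B : exists K : set M, [/\ compact K, K `<=` ~` P &
  forall x, ~ P x -> ~ K x -> B < enorm (X x)].
Proof.
have [rho [rho0 nl _ _ pr]] := oid_end op.
have [r r0 Hr] := pr B.
pose N (i : 'I_n) : set M := [set x | exists u, cabs u < r /\ cv (u + zi i) = x].
have oN i : open (N i).
  rewrite openE => _ [u [ur <-]]; have s0 : 0 < r - cabs u by rewrite subr_gt0.
  apply: (@near_cov _ _ hn W (u + zi i) (N i) _ s0) => z zr.
  exists (z - zi i); split; last by rewrite subrK.
  rewrite (_ : z - zi i = (z - (u + zi i)) + u); last by ring.
  by rewrite (le_lt_trans (cabsD _ _)) // -ltrBrDr.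
exists (~` (\bigcup_i N i)); split.
- apply: (subclosed_compact _ (torus_compact b0)) => //.
  by apply: open_closedC; apply: bigcup_open.
- move=> x nN [i _ e]; apply: nN; exists i => //; exists 0.
  by rewrite cabs0 add0r.
move=> x nP /contrapT[i _ [u [ur e]]]; rewrite -e (oidX_cov hn op) Xrot enorm_rot.
apply: Hr; rewrite /pdisc [mkset _ _]/mkset ur andbT cabs_gt0; apply/eqP => u0.
by apply: nP; exists i => //; rewrite -e u0 add0r.
Qed.

End Ends.

(** * Completeness, total curvature and limiting normals *)

Section Integrals.
Local Open Scope ereal_scope.

(** The integral of a nonnegative function is a supremum over the simple functions below it, hence
    monotone even when measurability is not known, as for the curvature density on an arbitrary
    piece. *)
Lemma le_integral_ge0 d (T : measurableType d) (R : realType) (mu : {measure set T -> \bar R})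
    (D : set T) (f g : T -> \bar R) : (forall x, D x -> 0 <= f x <= g x) ->
  \int[mu]_(x in D) f x <= \int[mu]_(x in D) g x.
Proof.
move=> fg; rewrite /integral.
have f0 x : 0 <= (f \_ D) x by rewrite patchE; case: ifPn => // /set_mem /fg /andP[].
have g0 x : 0 <= (g \_ D) x.
  by rewrite patchE; case: ifPn => // /set_mem /fg /andP[a b]; exact: le_trans b.
have fn (u : T -> \bar R) : (forall x, 0 <= u x) -> u^\- = cst 0.
  by move=> u0; apply/funext => x; exact: (@ge0_funenegE _ _ setT u (fun y _ => u0 y) x (in_setT x)).
have fp (u : T -> \bar R) : (forall x, 0 <= u x) -> u^\+ = u.
  by move=> u0; apply/funext => x; exact: (@ge0_funeposE _ _ setT u (fun y _ => u0 y) x (in_setT x)).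
rewrite !fn // !fp //; apply: leeD2r; apply: le_ereal_sup => _ [h hf <-]; exists h => // x.
apply: le_trans (hf x) _.
by rewrite !patchE; case: ifPn => // /set_mem /fg /andP[].
Qed.

End Integrals.

Section Complete.
Variable R : realType.

(** The speed dominates the derivative of each coordinate, whose integral over [0, T] is a
    displacement by the fundamental theorem; the length over the half-line is larger still. *)
Lemma path_length (G : R^o -> 'rV[R]_3) (T : R) : (0 < T) ->
  (forall t, derivable G t 1) -> continuous (derive1 G) -> forall i,
  ((`|G T 0 i - G 0 0 i|)%:E <= \int[@lebesgue_measure R]_(t in `[0%R, +oo[) (enorm (derive1 G t))%:E)%E.
Proof.
move=> T0 dG cG i; pose g t := derive1 G t 0 i.
have dg t : is_derive t (1 : R^o) (fun s => G s 0 i : R^o) (g t).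
  by apply: derive_entry; rewrite derive1E; exact: DeriveDef.
have cg : continuous (g : R -> R) by move=> t; apply: cvg_entry; exact: cG.
have ce : continuous ((fun t => enorm (derive1 G t)) : R -> R).
  have c (j : 'I_3) : continuous ((fun t => derive1 G t 0 j) : R -> R) by move=> t; apply: cvg_entry; exact: cG.
  pose q (s : R) : R := derive1 G s 0 0 * derive1 G s 0 0 + derive1 G s 0 1 * derive1 G s 0 1 + derive1 G s 0 2 * derive1 G s 0 2.
  rewrite (_ : (fun t => enorm (derive1 G t)) = (fun t => Num.sqrt (q t))); last first.
    by apply/funext => s; rewrite enormE !expr2.
  move=> t; have cq : {for t, continuous q}.
    apply: (@continuousD R R^o R); last exact: (@continuousM R R _ _ t (c 2 t) (c 2 t)).
    apply: (@continuousD R R^o R); first exact: (@continuousM R R _ _ t (c 0 t) (c 0 t)).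
    exact: (@continuousM R R _ _ t (c 1 t) (c 1 t)).
  exact: (@continuous_comp R R R q (@Num.sqrt R) t cq (@sqrt_continuous R _)).
have mg : measurable_fun setT (g : R -> R) by exact: measurable_realfun.continuous_measurable_fun.
have me : measurable_fun setT ((fun t => enorm (derive1 G t)) : R -> R) by exact: measurable_realfun.continuous_measurable_fun.
have E : (\int[@lebesgue_measure R]_(t in `[0%R, T]) (g t)%:E)%E = ((G T 0 i)%:E - (G 0 0 i)%:E)%E.
  apply: (@continuous_FTC2 R g (fun s => G s 0 i) 0 T T0).
  - exact: continuous_subspaceT.
  - have cF t : {for t, continuous ((fun s => G s 0 i) : R -> R)} by exact: rder_continuous (dg t).
    split.
    + by move=> t _; have [] := dg t.
    + by apply: cvg_at_right_filter; exact: cF.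
    + by apply: cvg_at_left_filter; exact: cF.
  - by move=> t _; rewrite derive1E; have [_ ->] := dg t.
rewrite (_ : (`|_|)%:E = `|\int[@lebesgue_measure R]_(t in `[0%R, T]) (g t)%:E|%E); last by rewrite E.
apply: (le_trans (le_abse_integral _ _ _)) => //.
  by apply/measurable_realfun.measurable_EFinP; apply: measurable_funS mg.
apply: (@le_trans _ _ (\int[@lebesgue_measure R]_(t in `[0%R, T]) (enorm (derive1 G t))%:E)%E).
  by apply: le_integral_ge0 => t _; rewrite abse_ge0 lee_fin le_enorm.
apply: ge0_subset_integral => //.
- by apply/measurable_realfun.measurable_EFinP; apply: measurable_funS me.
- by move=> t _; rewrite lee_fin enorm_ge0.
- by move=> t; rewrite /= !in_itv /= => /andP[-> _].
Qed.

End Complete.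

Section Global.
Variable R : realType.
Local Notation C := R[i].
Local Notation Ct := (R[i]^o).
Variable n : nat.
Hypothesis hn : (3 <= n)%N.
Variable W : weier (oid_angle R n).
Local Notation L := (wl W).
Local Notation lat := (lat L).
Variables X1 X2 X3 : C -> R.
Hypothesis op : oid_pot W X1 X2 X3.
Local Notation Xo := (oid W X1 X2 X3).
Local Notation b := (half_period W).
Local Notation cv := (cov b).
Let b0 := half_period_gt0 hn W.
Local Notation M := (oidM hn W).
Local Notation X := (oidX (hn := hn) (W := W) X1 X2 X3).
Local Notation pt := (oid_end_pt hn W).
Local Notation P := (range pt).

(** A divergent path leaves every compact set, so by properness it reaches points of arbitrarily
    large norm; some coordinate then moves by an arbitrarily large amount. *)
Lemma oid_complete : complete_immersion P X.
Proof.
move=> g cg gP dg cdg div; apply/eqyP => A A0.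
(* If each of the three coordinates moved by less than [A], the norm at time T would be less than
   [B]. *)
pose B := 3 * A + `|X (g 0) 0 0| + `|X (g 0) 0 1| + `|X (g 0) 0 2|.
have [K [cK KP far]] := oidX_proper hn op B.
have [T0 [_ HT]] := div K cK KP.
pose T := Num.max (T0 + 1) 1.
have T1 : 0 < T by rewrite lt_max ltr01 orbT.
have TT : T0 < T by rewrite lt_max ltrDl ltr01.
have fT := far (g T) (gP T) (HT T TT).
have PL := path_length T1 dg cdg.
have [i hi] : exists i : 'I_3, A <= `|X (g T) 0 i - X (g 0) 0 i|.
  apply: contrapT => no.
  have lt (i : 'I_3) : `|X (g T) 0 i| < A + `|X (g 0) 0 i|.
    have : `|X (g T) 0 i - X (g 0) 0 i| < A by rewrite ltNge; apply/negP => h; apply: no; exists i.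
    have := ler_normD (X (g T) 0 i - X (g 0) 0 i) (X (g 0) 0 i); rewrite subrK; lra.
  have := enorm_le (X (g T)); have := lt 0; have := lt 1; have := lt 2.
  by move: fT; rewrite /B; lra.
by apply: le_trans (PL i); rewrite lee_fin.
Qed.

Lemma oid_density_bound (c : C) : exists2 N : R, 0 <= N & forall z, box b c z -> ~ lat z ->
  `|gauss_curvature (Xo : Ct -> _) z| * area_density (Xo : Ct -> _) z <= N.
Proof.
have [bd [cb bd0 Hb]] := oid_curvature (op1 op) (op2 op) (op3 op).
pose r : R := pi.
pose Q : set (R * R) := `[Re c - b, Re c + b] `*` `[Im c - pi, Im c + pi].
have hb : 0 < b := b0; have hp := pi_gt0 R.
have cQ : compact Q by apply: compact_setX; exact: segment_compact.
have Q0 : Q !=set0.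
  by exists (Re c, Im c); split; rewrite /= in_itv /= ?lerDl ?gerDl ?oppr_le0 ?(ltW hb) ?(ltW hp).
have cf : {within Q, continuous (fun w : R * R => bd (w.1 +i* w.2))}.
  apply: continuous_within => w.
  have cw : {for w, continuous (fun w : R * R => (w.1 +i* w.2) : Ct)}.
    by apply: (@cvg_C R _ (nbhs w) (nbhs_filter w) fst snd); [exact: cvg_fst|exact: cvg_snd].
  have ccb := @continuous_comp _ Ct Ct (fun w : R * R => w.1 +i* w.2) (fun z => (bd z)%:C) w cw (cb _).
  exact: (@continuous_comp _ Ct R _ Re w ccb (@continuous_Re R _)).
have [m _ Hm] := compact_EVT_max Q0 cQ cf.
exists (bd (m.1 +i* m.2)) => // z [z1 z2] nz.
have [_ h] := Hb z nz; apply: (le_trans h).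
have := Hm (Re z, Im z); rewrite /= (_ : Re z +i* Im z = z); last by case: (z).
apply; rewrite inE; move: z1 z2; rewrite !ltr_distl => /andP[a1 a2] /andP[a3 a4].
by split; rewrite /= in_itv /=; apply/andP; split; lra.
Qed.

(** In each of the 16 charts the density is bounded by a constant; disjoint pieces read in one chart
    have total measure at most that of a rectangle, whatever their number. *)
Lemma oid_finite_curvature : finite_total_curvature P X.
Proof.
have dbx (kl : 'I_4 * 'I_4) : exists m : R, 0 <= m /\ forall z, box b (center b kl.1 kl.2) z -> ~ lat z ->
   `|gauss_curvature (Xo : Ct -> _) z| * area_density (Xo : Ct -> _) z <= m.
  by have [m m0 h] := oid_density_bound (center b kl.1 kl.2); exists m.
have [N HN] := choice dbx.
pose mu := (@lebesgue_measure R \x @lebesgue_measure R)%E.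
pose I1 (kl : 'I_4 * 'I_4) : set R := `[Re (center b kl.1 kl.2) - b, Re (center b kl.1 kl.2) + b]%classic.
pose I2 (kl : 'I_4 * 'I_4) : set R := `[Im (center b kl.1 kl.2) - pi, Im (center b kl.1 kl.2) + pi]%classic.
pose B kl := I1 kl `*` I2 kl.
have hb : 0 < b := b0; have hp := pi_gt0 R.
have mB kl : measurable (B kl) by apply: measurableX; exact: measurable_itv.
have muB kl : (mu (B kl) < +oo)%E.
  have li (x y : R) : (@lebesgue_measure R (`[x, y]%classic : set R) < +oo)%E.
    by rewrite lebesgue_measure_itv /=; case: ifP => _; rewrite -?EFinB ltry.
  have -> : mu (B kl) = (@lebesgue_measure R (I1 kl) * @lebesgue_measure R (I2 kl))%E.
    by apply: product_measure1E; exact: measurable_itv.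
  have l1 := li (Re (center b kl.1 kl.2) - b) (Re (center b kl.1 kl.2) + b).
  have l2 := li (Im (center b kl.1 kl.2) - pi) (Im (center b kl.1 kl.2) + pi).
  by rewrite lte_mul_pinfty // ?measure_ge0 // ge0_fin_numE ?measure_ge0.
apply: (@le_lt_trans _ _ (\sum_(kl : 'I_4 * 'I_4) (N kl)%:E * mu (B kl))%E); last first.
  apply: lte_sum_pinfty => kl _; have [Nk _] := HN kl.
  rewrite lte_mul_pinfty //.
apply: ge_ereal_sup => _ [m [c [A [ac mA Ac tA ->]]]].
have ac' k : exists p : 'I_4 * 'I_4, c k = tchart b0 (center b p.1 p.2).
  by have [p [q e]] := ac k; exists (p, q).
have [ka hka] := choice ac'.
have inb k w : A k w -> box b (center b (ka k).1 (ka k).2) (plane_point w) /\ ~ lat (plane_point w).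
  move=> Aw; have : (@plane_point R @` A k) (plane_point w) by exists w.
  by move=> /Ac; rewrite hka => /(oid_chart_nlat op).
have mi (x y z : R) : y <= x -> x <= z -> (`[y, z]%classic : set R) x.
  by move=> yx xz; rewrite /= in_itv /= yx xz.
have AB k : A k `<=` B (ka k).
  move=> w /inb[[]]; rewrite /plane_point ReC ImC !ltr_distl => /andP[a1 a2] /andP[a3 a4] _.
  by split; apply: mi; lra.
have step k : (\int[mu]_(w in A k) (`| gauss_curvature (X \o param (c k)) (plane_point w) |
    * area_density (X \o param (c k)) (plane_point w))%:E <= (N (ka k))%:E * mu (A k))%E.
  rewrite hka (oidX_param hn op) -(integral_cst mu (mA k)).
  apply: le_integral_ge0 => w /inb[bw nw]; rewrite !lee_fin.
  have [_ h] := HN (ka k); rewrite h // andbT mulr_ge0 // /area_density sqrtr_ge0 //.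
apply: (@le_trans _ _ (\sum_(k < m) (N (ka k))%:E * mu (A k))%E); first by apply: lee_sum => k _; exact: step.
(* The pieces are grouped by chart. Within one group the parametrisation is the same, so
   disjointness on the surface gives disjointness in the plane. *)
rewrite (partition_big ka predT) //=; apply: lee_sum => kl _.
rewrite (eq_bigr (fun k => (N kl)%:E * mu (A k))%E); last by move=> k /eqP ->.
have [Nk _] := HN kl.
rewrite -ge0_sume_distrr; last by move=> k _; exact: measure_ge0.
apply: lee_wpmul2l; first by rewrite lee_fin.
rewrite -(@measure_bigsetU_ord_cond _ _ _ mu m (fun k => ka k == kl) A) //.
  apply: le_measure; rewrite ?inE //.
    by apply: bigsetU_measurable => k _; exact: mA.
    exact: mB.
  by apply: (big_ind (fun S => S `<=` B kl)) => [//|x y hx hy w [/hx|/hy]|k /eqP <-] //; exact: AB.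
  by move=> k _; exact: mA.
move=> k k' /eqP e /eqP e' [w [Aw Aw']].
apply: (tA k k') => //; exists (cv (plane_point w)); split; exists w => //=; by rewrite hka.
Qed.

(** On the real axis the spinors are conjugate, so the normals are horizontal and the rank is at
    most 2. The first two normals differ by a rotation of angle 2 pi/n in (0, pi), hence are
    independent. *)
Lemma oid_normal_rank (nu : 'M[R]_(n, 3)) :
  (forall i, row i nu = oid_normal W (2 * L * (nat_of_ord i)%:R)%:C) ->
  \rank nu = 2%N /\ nu *m (axis3 R)^T = 0.
Proof.
move=> Hnu; have sreal (x : R) : cabs (w1 W x%:C) = cabs (w2 W x%:C).
  by have := w1_conj W x%:C; rewrite conjc_real => ->; rewrite cabs_conj.
have third (x : R) : oid_normal W x%:C 0 2 = 0.
  by rewrite /oid_normal /spin_normal rv3_2 /snum3 sreal subrr mul0r.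
have n0 : nu *m (axis3 R)^T = 0.
  apply/row_matrixP => i; rewrite row_mul Hnu row0; apply/matrixP => x y; rewrite !ord1.
  by rewrite mxE sum3 third ![(axis3 R)^T _ _]mxE [in RHS]mxE /axis3 !rv3E; ring.
split=> //.
have w00 : w1 W 0 = w2 W 0 by rewrite -w1_neg oppr0.
have wn : w1 W 0 != 0.
  by apply/eqP => h; apply: (@w12_neq0 _ _ W 0); rewrite -w00 h.
have wr : conjc (w1 W 0) = w1 W 0.
  by have := w1_conj W 0; rewrite (_ : conjc 0 = 0) ?w00 //; apply: eqC; rewrite /= ?oppr0.
pose i0 : 'I_n := Ordinal (leq_trans (isT : 0 < 3)%N hn).
pose i1 : 'I_n := Ordinal (leq_trans (isT : 1 < 3)%N hn).
pose N0 := row i0 nu; pose N1 := row i1 nu.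
have S0 : 0 < cabs (w1 W 0) ^+ 2 by rewrite exprn_gt0 // cabs_gt0.
have wp : w1 W 0 * conjc (w1 W 0) = (cabs (w1 W 0) ^+ 2)%:C.
  rewrite cabs_sqr; apply: eqC; rewrite ?ReM ?ImM Re_conj Im_conj /=; ring.
have N0E : N0 = rv3 1 0 0.
  rewrite /N0 Hnu /= mulr0 /oid_normal /spin_normal /snum1 /snum2 /snum3 /snrm -w00 wp ReC ImC.
  move: S0; move: (cabs (w1 W 0) ^+ 2) => a a0.
  have e : 2 * a = a + a by ring.
  by rewrite e subrr mulr0 !mul0r divff // gt_eqF // addr_gt0.
have N1y : N1 0 1 != 0.
  rewrite /N1 Hnu /oid_normal /spin_normal rv3_1; apply: mulf_neq0; last first.
    by rewrite invr_eq0 gt_eqF // snrm_gt0 //; exact: w12_neq0.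
  apply: mulf_neq0; first by rewrite pnatr_eq0.
  rewrite /= mulr1.
  (* The product w1 conj(w2) at 0 is positive and equals e^(2 i al) |m|^2 times the same product at
     2L. If the latter were real, sin(2 al) > 0 would force it to vanish after scaling by |m|^2, a
     contradiction. *)
  have [m /(_ (2 * L)%:C)[_ m2 m3]] := w_shift W.
  rewrite -realCD subrr in m2 m3.
  have {}m2 : w1 W 0 = _ := m2; have {}m3 : w2 W 0 = _ := m3.
  move: m2 m3; set p := w1 W (2 * L)%:C; set q := w2 W (2 * L)%:C => m2 m3.
  apply/eqP => Ipq.
  have e : cabs (w1 W 0) ^+ 2 = Re (cexp (ial (oid_angle R n)) * cexp (ial (oid_angle R n)) * (p * conjc q)) * cabs (m (2 * L)%:C) ^+ 2
     /\ 0 = Im (cexp (ial (oid_angle R n)) * cexp (ial (oid_angle R n)) * (p * conjc q)) * cabs (m (2 * L)%:C) ^+ 2.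
    have : (cabs (w1 W 0) ^+ 2)%:C = (cexp (ial (oid_angle R n)) * cexp (ial (oid_angle R n)) * (p * conjc q)) * (cabs (m (2 * L)%:C) ^+ 2)%:C.
      have mm (v : C) : (cabs v ^+ 2)%:C = v * conjc v.
        by rewrite cabs_sqr; apply: eqC; rewrite ?ReM ?ImM Re_conj Im_conj /=; ring.
      rewrite -wp {2}w00 m3 m2 mm conjM conjM -cexp_conj conjN conj_ial opprK; ring.
    move=> h; split.
      by have := congr1 (fun v => Re v) h; rewrite ReC mulrC ReZ mulrC.
    by have := congr1 (fun v => Im v) h; rewrite ImC mulrC ImZ mulrC.
  have [e1 e2] := e.
  have ce : cexp (ial (oid_angle R n)) * cexp (ial (oid_angle R n)) = cos (oid_angle R n + oid_angle R n) +i* sin (oid_angle R n + oid_angle R n).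
    by rewrite -cexpD; apply: eqC; rewrite ?Re_cexp ?Im_cexp /= ?addr0 expR0 mul1r.
  rewrite ce ReM ReC ImC Ipq mulr0 subr0 in e1; rewrite ce ImM ReC ImC Ipq mulr0 add0r in e2.
  have s0 : 0 < sin (oid_angle R n + oid_angle R n) by apply: sin_gt0_pi; exact: two_al.
  move: e1 e2 S0; move: (cabs (m _) ^+ 2) => m0 e1 e2 S0.
  have z : Re (p * conjc q) * m0 = 0.
    by apply: (mulfI (lt0r_neq0 s0)); rewrite mulr0 mulrA -e2.
  by move: S0; rewrite e1 -mulrA z mulr0 ltxx.
apply/eqP; rewrite eqn_leq; apply/andP; split.
  have := mulmx0_rank_max n0; rewrite mxrank_tr.
  have -> : \rank (axis3 R) = 1%N.
    apply/eqP; rewrite eqn_leq rank_leq_row lt0n mxrank_eq0.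
    by apply/eqP => /matrixP /(_ 0 2); rewrite !mxE /= => /eqP; rewrite oner_eq0.
  by rewrite addn1 ltnS.
have sub : (col_mx N0 N1 <= nu)%MS by rewrite col_mx_sub !row_sub.
apply: leq_trans (mxrankS sub).
have /eqP -> // : row_free (col_mx N0 N1).
apply/row_freeP.
pose x := N1 0 0; pose y := N1 0 1.
exists (\matrix_(i < 3, j < 2) nth 0 (nth [::] [:: [:: 1; 0]; [:: - x / y; y^-1]; [:: 0; 0]] i) j).
have c0 (v : 'rV[R]_3) j : (v *m (\matrix_(i < 3, j < 2) nth 0 (nth [::] [:: [:: 1; 0]; [:: - x / y; y^-1]; [:: 0; 0]] i) j)) 0 j =
   v 0 0 * nth 0 [:: 1; 0] j + v 0 1 * nth 0 [:: - x / y; y^-1] j + v 0 2 * nth 0 [:: 0; 0] j.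
  by rewrite mxE sum3 !mxE.
rewrite mul_col_mx; apply/matrixP => i j.
rewrite mxE; case: splitP => k ik; rewrite (ord1 k) {k} in ik *; rewrite c0 ?N0E ?rv3E.
- have -> : i = 0 by apply: val_inj.
  by case: j => -[|[|//]] Hj; rewrite !mxE /=; ring.
have -> : i = 1 by apply: val_inj; rewrite /= ik.
case: j => -[|[|//]] Hj; rewrite [in RHS]mxE /= -/x -/y; field; exact: N1y.
Qed.

End Global.

Theorem theorem3p1 (R : realType) (n : nat) (hn : (3 <= n)%N) :
  exists (M : riemannSurface R) (p : 'I_n -> M) (X : M -> 'rV[R]_3),
    let P := range p in
    [/\ compact [set: M] /\ genus_one R M,
        injective p,
        minimal_immersion P X,
        complete_immersion P X
      & finite_total_curvature P X] /\
    (forall i, embedded_catenoid_end P X (p i)) /\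
    (* the plane is the row space of nu; e is a unit normal of it, and f is a
       unit normal of a plane containing the axis R e *)
    exists (nu : 'M[R]_(n, 3)) (e f : 'rV[R]_3),
      [/\ forall i, limiting_normal P X (p i) (row i nu),
          \rank nu = 2%N,
          enorm e = 1 /\ nu *m e^T = 0
        & enorm f = 1 /\ dot f e = 0] /\
      let sigma := reflection_mx e in
      let rho := rotation_mx e (2 * pi / n%:R) in
      let tau := reflection_mx f in
      [/\ invariant_under P X sigma,
          invariant_under P X rho
        & invariant_under P X tau] /\
      let G := matrix_group_generated [set sigma; rho; tau] in
      (forall A, G A -> invariant_under P X A) /\
      (* the library's dihedral group of index m has order m *)
      exists h : (extremal.dihedral_gtype n.*2 * 'Z_2)%type -> 'M[R]_3,
        [/\ injective h,
            forall x y, h (x * y)%g = h x *m h y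
          & range h = G].
Proof.
have [W _] := weier_exists R hn.
have [X1 [X2 [X3 op]]] := oid_pot_exists hn W.
exists (oidM hn W), (oid_end_pt hn W), (oidX (hn := hn) (W := W) X1 X2 X3) => P.
pose nu : 'M[R]_(n, 3) := \matrix_(i, j) oid_normal W (2 * wl W * (nat_of_ord i)%:R)%:C 0 j.
have Hnu i : row i nu = oid_normal W (2 * wl W * (nat_of_ord i)%:R)%:C.
  by apply/rowP => j; rewrite !mxE.
have [rk nue] := oid_normal_rank hn Hnu.
have [g1 g2 g3] := sym_mx_gens R n.
have inv i j k := oid_sym_invariant hn op i j k.
have [h [hi hM h1 h2]] := symmetry_group R hn.
split; first split.
- by split; [exact: torus_compact (half_period_gt0 hn W)|exact: (@torus_genus R 0)].
- exact: oid_end_pt_inj.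
- exact: oid_minimal.
- exact: oid_complete.
- exact: oid_finite_curvature.
split; first exact: oid_embedded_end.
(* The limiting normals span the plane x3 = 0, the mirror of conjugation; [axis2] is the unit normal
   of the mirror of z -> - conj z. *)
exists nu, (axis3 R), (axis2 R); split.
  split=> //.
  - by move=> i; rewrite Hnu; exact: oid_limiting_normal.
  - by split=> //; rewrite enormE !rv3E !expr0n !add0r expr1n sqrtr1.
  - split; first by rewrite enormE !rv3E !expr0n !add0r addr0 expr1n sqrtr1.
    by rewrite dotE !rv3E; ring.
split; first by split; [rewrite -g1|rewrite -g2|rewrite -g3]; exact: inv.
split.
  by move=> A /(generated_sym_mx hn)[i [j [k ->]]]; exact: inv.
exists h; split=> //.
apply/seteqP; split=> [_ [g _ <-]|A /(generated_sym_mx hn)[i [j [k ->]]]].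
  by have [i [j [k ->]]] := h1 g; apply/(generated_sym_mx hn); exists i, j, k.
by have [g <-] := h2 i j k; exists g.
Qed.
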